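(* For every $0<\epsilon<1/2$ there is a constant $C_\epsilon>0$, depending only on $\epsilon$, such that for every positive squarefree integer $q$, every cusp $\mathfrak{a}$ of $X_0(q)=\Gamma_0(q)\backslash SL_2(\mathbb{R})$, every $n\in 2\mathbb{Z}$, every $t\in\mathbb{R}$, and every $g\in SL_2(\mathbb{R})$ with Iwasawa coordinates $(x,y,\theta)$, $$|E_{\mathfrak{a},n}(g,1/2+it)|\le C_\epsilon\, q^{\epsilon}\left(1+|n|^{1/2+\epsilon}+|t|^{1/2+\epsilon}\right)\sqrt{y+y^{-1}},$$ where $E_{\mathfrak{a},n}(\cdot,1/2+it)$ is the Eisenstein series of the cusp $\mathfrak{a}$ and weight $n$ with spectral parameter $1/2+it$, normalized by the constant term.
   Context: Iwasawa coordinates: every $g\in SL_2(\mathbb{R})$ is uniquely $g=\begin{pmatrix}1&x\\0&1\end{pmatrix}\begin{pmatrix}y^{1/2}&0\\0&y^{-1/2}\end{pmatrix}\begin{pmatrix}\cos\theta&-\sin\theta\\ \sin\theta&\cos\theta\end{pmatrix}$ with $x\in\mathbb{R}$, $y>0$, $\theta\in\mathbb{R}/2\pi\mathbb{Z}$; write $x(g),y(g),\theta(g)$. For a cusp $\mathfrak{a}$ of $\Gamma_0(q)$ with stabilizer $\Gamma_{\mathfrak{a}}\subset\Gamma_0(q)$, the scaling matrix $\sigma_{\mathfrak{a}}\in SL_2(\mathbb{R})$ satisfies $\sigma_{\mathfrak{a}}\infty=\mathfrak{a}$ and $\sigma_{\mathfrak{a}}^{-1}\Gamma_{\mathfrak{a}}\sigma_{\mathfrak{a}}=\{\pm\begin{pmatrix}1&m\\0&1\end{pmatrix}:m\in\mathbb{Z}\}$.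 For $n\in2\mathbb{Z}$ the weight $n$ Eisenstein series of $\mathfrak{a}$ is $E_{\mathfrak{a},n}(g,s)=\sum_{\gamma\in\Gamma_{\mathfrak{a}}\backslash\Gamma_0(q)}y(\sigma_{\mathfrak{a}}^{-1}\gamma g)^s e^{in\theta(\sigma_{\mathfrak{a}}^{-1}\gamma g)}$ for $\mathrm{Re}(s)>1$, continued meromorphically in $s$ (it is regular on $\mathrm{Re}(s)=1/2$). It is left $\Gamma_0(q)$-invariant and is viewed as a function on $X_0(q)$ or on $SL_2(\mathbb{R})$. ''Normalized by the constant term'' means that the constant Fourier coefficient in $x$ of $E_{\mathfrak{a},n}(\sigma_{\mathfrak{b}}g,1/2+it)$ is $e^{in\theta}(\delta_{\mathfrak{a}=\mathfrak{b}}y^{1/2+it}+\phi_{\mathfrak{a},\mathfrak{b}}(1/2+it)\alpha(n,1/2+it)y^{1/2-it})$, where $(\phi_{\mathfrak{a},\mathfrak{b}})$ is the (weight $0$) scattering matrix of $\Gamma_0(q)$ and $\alpha(n,s)=\frac{\Gamma(1-s+|n/2|)\Gamma(s)}{\Gamma(1-s)\Gamma(s+|n/2|)}$. *)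

(* Defs.v *)
From mathcomp Require Import all_boot all_order all_algebra.
From mathcomp Require Import all_classical all_reals all_analysis.
From mathcomp Require Import complex.

Set Implicit Arguments.
Unset Strict Implicit.
Unset Printing Implicit Defensive.

Import Order.TTheory GRing.Theory Num.Theory.
Import numFieldNormedType.Exports.

Local Open Scope classical_set_scope.
Local Open Scope ring_scope.

Definition squarefree (q : nat) : Prop :=
  (0 < q)%N /\ forall d : nat, (d ^ 2 %| q)%N -> d = 1%N.

Definition mx2 (K : Type) (a b c d : K) : 'M[K]_2 :=
  \matrix_(i < 2, j < 2)
    if i == 0 then (if j == 0 then a else b) else (if j == 0 then c else d).

(* Action on the projective line K u {oo}, with oo encoded by None. *)
Definition mobius (K : fieldType) (g : 'M[K]_2) (z : option K) : option K :=
  let num := if z is Some x then g 0 0 * x + g 0 1 else g 0 0 in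
  let den := if z is Some x then g 1 0 * x + g 1 1 else g 1 0 in
  if den == 0 then None else Some (num / den).

Definition Gamma0 (q : nat) : set 'M[int]_2 :=
  [set h | \det h = 1 /\ (q%:Z %| h 1%R 0%R)%Z].

Definition cusp_stabilizer (q : nat) (a : option rat) : set 'M[int]_2 :=
  [set h | Gamma0 q h /\ mobius (map_mx intr h) a = a].

Definition right_cosets (q : nat) (a : option rat) : set (set 'M[int]_2) :=
  [set [set h *m gamma | h in cusp_stabilizer q a] | gamma in Gamma0 q].

Section Eisenstein.
Variable R : realType.
Local Notation C := (R[i]).

(* The bound on theta selects the representative of its class mod 2 pi. *)
Definition iwasawa_coords (g : 'M[R]_2) (x y theta : R) : Prop :=
  [/\ 0 < y, 0 <= theta < 2 * pi &
      g = mx2 1 x 0 1 *m mx2 (Num.sqrt y) 0 0 (Num.sqrt y)^-1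
          *m mx2 (cos theta) (- sin theta) (sin theta) (cos theta)].

Definition iwasawa (g : 'M[R]_2) : R * R * R :=
  xget (0, 1, 0) [set p | iwasawa_coords g p.1.1 p.1.2 p.2].

Definition iwasawa_y (g : 'M[R]_2) : R := (iwasawa g).1.2.
Definition iwasawa_theta (g : 'M[R]_2) : R := (iwasawa g).2.

Definition is_scaling_matrix (q : nat) (a : option rat) (sigma : 'M[R]_2) :
    Prop :=
  [/\ \det sigma = 1,
      mobius sigma None = omap ratr a &
      [set invmx sigma *m map_mx intr h *m sigma | h in cusp_stabilizer q a] =
      [set A | exists m : int,
         A = mx2 1 m%:~R 0 1 \/ A = - mx2 1 m%:~R 0 1]].

Definition cexp (z : C) : C :=
  (expR (complex.Re z))%:C%C * (cos (complex.Im z) +i* sin (complex.Im z))%C.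

(* y ^ s, for y > 0 *)
Definition cpow (y : R) (s : C) : C := cexp (s * (ln y)%:C%C).

Definition eisenstein_term (sigma : 'M[R]_2) (n : int) (g : 'M[R]_2) (s : C)
    (gamma : 'M[int]_2) : C :=
  let h := invmx sigma *m map_mx intr gamma *m g in
  cpow (iwasawa_y h) s * cexp (0 +i* (n%:~R * iwasawa_theta h))%C.

(* Unconditional convergence of the sum of f over A to v. *)
Definition has_sum (I : choiceType) (A : set I) (f : I -> C) (v : C) : Prop :=
  forall e : R, 0 < e -> exists2 F0 : set I, fsets A F0 &
    forall F : set I, fsets A F -> F0 `<=` F ->
      `|\sum_(i \in F) f i - v| < e%:C%C.

(* The summand depends only on the coset K, for n even; it is computed at a
   chosen representative of K. *)
Definition eisenstein_series (q : nat) (a : option rat) (sigma : 'M[R]_2)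
    (n : int) (g : 'M[R]_2) (s v : C) : Prop :=
  has_sum (right_cosets q a)
    (fun K => eisenstein_term sigma n g s (xget 1%:M K)) v.

Definition holomorphic_at (f : C -> C) (p : C) : Prop :=
  \forall z \near (p : C^o), derivable (f : C^o -> C^o) z 1.

(* At a pole the value of f is unconstrained; a point where f has a removable
   singularity is a regular point in the sense of holomorphic_at only if f
   takes the limit value there. *)
Definition meromorphic (f : C -> C) : Prop :=
  forall p : C, exists (k : nat) (h : C -> C),
    holomorphic_at h p /\
    \forall z \near (p : C^o)^', (z - p) ^+ k * f z = h z.

(* The value at s of the meromorphic continuation of the Eisenstein series,
   which by the identity theorem does not depend on the choice of f
   (0 if s is a pole). *)
Definition eisenstein (q : nat) (a : option rat) (sigma : 'M[R]_2) (n : int)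
    (g : 'M[R]_2) (s : C) : C :=
  xget 0 [set v | exists f : C -> C,
    [/\ meromorphic f,
        forall z : C, 1 < complex.Re z -> eisenstein_series q a sigma n g z (f z),
        holomorphic_at f s &
        f s = v]].

End Eisenstein.

(* Main.v *)
Require Import Defs.
From mathcomp Require Import all_boot all_order all_algebra.
From mathcomp Require Import all_classical all_reals all_analysis.
From mathcomp Require Import complex ring lra zify.
Set Implicit Arguments.
Unset Strict Implicit.
Unset Printing Implicit Defensive.
Import Order.TTheory GRing.Theory Num.Theory.
Import numFieldNormedType.Exports.
Local Open Scope classical_set_scope.
Local Open Scope ring_scope.

(** For Re s > 1, unfolding the cosets turns E_{a,n}(g,s) into a sum of the character
    u |-> |u|^(-2s) (u/|u|)^n over lattice vectors c w1 + d w2, where (c,d) runs through the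
    coprime pairs with a prescribed gcd(c,q).  Multiplying by zeta(2s) prod_(p | q) (1 - p^(-2s))
    removes the coprimality, so that, q being squarefree, what is left is a combination of
    2^omega(q) full lattice sums.  The factor 4 * 2^(-2s) - 1, which does not vanish near
    Re s = 1/2, turns a full lattice sum into three sums twisted by (-1)^c, (-1)^d, (-1)^(c+d),
    and these converge for Re s > 1/2.  For a reduced lattice the shells beyond the conductor
    A = |n| + 2|t| are controlled by partial summation along alternating lines, and those below
    by van der Corput differencing; the result is A^(1/2) up to logarithms plus a multiple of
    1/|2s - 1|, uniformly as Re s tends to 1/2.  Dividing by zeta(2s) costs a power of
    log(2 + |t|), by the 3-4-1 inequality, and the pole of zeta absorbs the term 1/|2s - 1|.
    Any meromorphic continuation agrees with this one on Re s > 1/2 by the identity theorem, and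
    the bound extends to the critical line by continuity.  Finally 4^omega(q) << q^eps. *)

(** * The modulus as a real number; inequalities for the exponential and the circle *)

Section Modulus.
Variable R : realType.
Local Notation C := (R[i]).
Implicit Types (z w : C) (x y : R).

(** The statement evaluates an arbitrary meromorphic [f] that agrees with the series on Re s > 1, so
    no formula on the critical line is at hand. None is constructed: limits [K] and [A] of entire
    functions, locally uniform on Re s > 1/2, satisfy [f K = A] where the series converges; the
    identity spreads to Re s > 1/2, and all estimates are made strictly to the right of the line,
    with constants that survive the limit. The identity theorem is proved for uniform limits: these
    are integrated twice, and a maximum principle takes the place of Cauchy's formula.

    The exponent 1/2 is square-root cancellation: the shell at |c| about P, |d| about P y has about
    P^2 y terms of size 1/(P y), hence the trivial bound P, with P up to A; one differencing step
    turns this into A^(1/2). The factor sqrt(y + 1/y) is homogeneity: scaling out the shortest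
    lattice vector costs the inverse of its length at Re s = 1/2, and no nonzero row (c, d) g is
    shorter than (y + 1/y)^(-1/2). *)

Definition cmod z : R := Num.sqrt (complex.Re z ^+ 2 + complex.Im z ^+ 2).

(** The norm of [R[i]] takes its values in [R[i]]; [cmod] is its real-valued form, which turns
    estimates into inequalities of [R]. The rules of the norm are transported along this
    identity. *)
Lemma normc_cmod z : `|z| = (cmod z)%:C%C.
Proof. by rewrite normc_def. Qed.

Lemma cmod_ge0 z : 0 <= cmod z.
Proof. exact: sqrtr_ge0. Qed.
Hint Resolve cmod_ge0 : core.

Lemma cmod_sqr z : cmod z ^+ 2 = complex.Re z ^+ 2 + complex.Im z ^+ 2.
Proof. by rewrite sqr_sqrtr // addr_ge0 ?sqr_ge0. Qed.

Lemma cmod_inj_real x y : x%:C%C = y%:C%C :> C -> x = y.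
Proof. by case. Qed.

Lemma cmod0 : cmod 0 = 0.
Proof. by apply: cmod_inj_real; rewrite -normc_cmod normr0. Qed.

Lemma cmod1 : cmod 1 = 1.
Proof. by apply: cmod_inj_real; rewrite -normc_cmod normr1. Qed.

Lemma cmodM z w : cmod (z * w) = cmod z * cmod w.
Proof. by apply: cmod_inj_real; rewrite rmorphM /= -!normc_cmod normrM. Qed.

Lemma cmodV z : cmod z^-1 = (cmod z)^-1.
Proof. by apply: cmod_inj_real; rewrite fmorphV /= -!normc_cmod normfV. Qed.

Lemma cmodX z n : cmod (z ^+ n) = cmod z ^+ n.
Proof. by apply: cmod_inj_real; rewrite rmorphXn /= -!normc_cmod normrX. Qed.

Lemma cmodN z : cmod (- z) = cmod z.
Proof. by apply: cmod_inj_real; rewrite -!normc_cmod normrN. Qed.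

Lemma cmodB z w : cmod (z - w) = cmod (w - z).
Proof. by rewrite -cmodN opprB. Qed.

Lemma cmod_eq0 z : (cmod z == 0) = (z == 0).
Proof. by rewrite -(normr_eq0 z) normc_cmod eq_complex /= eqxx andbT. Qed.

Lemma cmod_gt0 z : (0 < cmod z) = (z != 0).
Proof. by rewrite lt_def cmod_ge0 andbT cmod_eq0. Qed.

Lemma ler_cmodD z w : cmod (z + w) <= cmod z + cmod w.
Proof. by rewrite -lecR rmorphD /= -!normc_cmod ler_normD. Qed.

Lemma ler_cmodB z w : cmod (z - w) <= cmod z + cmod w.
Proof. by rewrite (le_trans (ler_cmodD _ _)) // cmodN. Qed.

Lemma ler_cmod_dist z w : cmod z - cmod w <= cmod (z - w).
Proof. by rewrite lerBlDr; have := ler_cmodD (z - w) w; rewrite subrK. Qed.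

Lemma cmod_real x : cmod x%:C%C = `|x|.
Proof. by rewrite /cmod /= expr0n addr0 sqrtr_sqr. Qed.

Lemma cmod_nat n : cmod n%:R = n%:R.
Proof. by rewrite -(rmorph_nat (real_complex R)) cmod_real normr_nat. Qed.

Lemma ler_Re_cmod z : `|complex.Re z| <= cmod z.
Proof. by rewrite -sqrtr_sqr ler_sqrt ?addr_ge0 ?sqr_ge0 // lerDl sqr_ge0. Qed.

Lemma ler_Im_cmod z : `|complex.Im z| <= cmod z.
Proof. by rewrite -sqrtr_sqr ler_sqrt ?addr_ge0 ?sqr_ge0 // lerDr sqr_ge0. Qed.

Lemma ler_cmod_ReIm z : cmod z <= `|complex.Re z| + `|complex.Im z|.
Proof.
rewrite -(ler_pXn2r (n := 2)) ?nnegrE ?addr_ge0 //.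
rewrite cmod_sqr sqrrD !real_normK ?num_real // addrAC lerDl.
by rewrite mulrn_wge0 // mulr_ge0.
Qed.

Lemma ler_cmod_sum I (r : seq I) (P : pred I) (F : I -> C) :
  cmod (\sum_(i <- r | P i) F i) <= \sum_(i <- r | P i) cmod (F i).
Proof.
elim/big_rec2 : _ => [|i y z _ H]; first by rewrite cmod0.
by rewrite (le_trans (ler_cmodD _ _)) // lerD2l.
Qed.

Lemma cmodJ z : cmod z^*%C = cmod z.
Proof. by case: z => a b; rewrite /cmod /= sqrrN. Qed.

Lemma mulcJ_cmod z : z * z^*%C = (cmod z ^+ 2)%:C%C.
Proof. by case: z => a b; rewrite cmod_sqr; apply/eqP; rewrite eq_complex /=; apply/andP; split; apply/eqP; ring. Qed.

Definition cis x : C := (cos x +i* sin x)%C.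

Lemma cis0 : cis 0 = 1.
Proof. by rewrite /cis cos0 sin0. Qed.

Lemma cisD x y : cis (x + y) = cis x * cis y.
Proof.
apply/eqP; rewrite eq_complex /= cosD sinD eqxx /=; apply/eqP; ring.
Qed.

Lemma cmod_cis x : cmod (cis x) = 1.
Proof. by rewrite /cmod /= cos2Dsin2 sqrtr1. Qed.

(** Mean value theorem on [[0, x]]. The inequalities for sine, cosine and arctangent are obtained by
    integrating an inequality between derivatives. *)
Lemma ge0_derive_le (f df : R -> R) :
  (forall x, is_derive x 1 f (df x)) -> (forall x, 0 <= x -> 0 <= df x) ->
  forall x, 0 <= x -> f 0 <= f x.
Proof.
move=> fd df0 x x0.
have [c] : exists2 c, c \in `[0, x] & f x - f 0 = df c * (x - 0).
  apply: MVT_segment => //; apply: continuous_subspaceT => y.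
  by apply: differentiable_continuous; apply/derivable1_diffP; case: (fd y).
rewrite subr0 in_itv /= => /andP[c0 _] E.
by rewrite -subr_ge0 E mulr_ge0 // df0.
Qed.

Lemma sin_le_id x : 0 <= x -> sin x <= x.
Proof.
move=> x0; have := @ge0_derive_le (fun x => x - sin x) (fun x => 1 - cos x) _ _ x x0.
rewrite sin0 subr0 subr_ge0; apply => y _.
by rewrite subr_ge0 cos_le1.
Qed.

Lemma cos_ge_1Bsqr x : 1 - x ^+ 2 / 2 <= cos x.
Proof.
wlog x0 : x / 0 <= x.
  by move=> W; case: (leP 0 x) => [/W//|/ltW x0]; have := W (- x); rewrite cosN sqrrN; apply; rewrite oppr_ge0.
have D y : is_derive y 1 (fun x => cos x + x ^+ 2 / 2) (y - sin y).
  by apply: is_derive_eq; rewrite /GRing.scale /=; field.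
have := ge0_derive_le D _ x0.
rewrite cos0 expr0n /= mul0r addr0 => H.
by rewrite lerBlDr H // => y y0; rewrite subr_ge0 sin_le_id.
Qed.

Lemma ler_sin_id x : `|x - sin x| <= x ^+ 2 / 2.
Proof.
wlog x0 : x / 0 <= x.
  move=> W; case: (leP 0 x) => [/W//|/ltW x0]; have := W (- x).
  by rewrite sinN sqrrN -opprB normrN opprK oppr_ge0 addrC; apply.
rewrite ger0_norm ?subr_ge0 ?sin_le_id //.
have D y : is_derive y 1 (fun x => x ^+ 2 / 2 - (x - sin x)) (y - (1 - cos y)).
  by apply: is_derive_eq; rewrite /GRing.scale /=; field.
have := ge0_derive_le D _ x0.
rewrite sin0 expr0n /= mul0r !subr0 subr_ge0; apply => y y0.
(* Up to 2 the quadratic lower bound of the cosine suffices, beyond 2 the bound [-1 <= cos y]. *)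
have := cos_ge_1Bsqr y; have := cos_geN1 y; case: (leP y 2) => ? ? ?; nra.
Qed.

Lemma ler_cis_sub1 x : cmod (cis x - 1) <= `|x|.
Proof.
rewrite -(ler_pXn2r (n := 2)) ?nnegrE // cmod_sqr /= real_normK ?num_real //.
have := cos2Dsin2 x; have := cos_ge_1Bsqr x; nra.
Qed.

Lemma ler_norm_sqr x y : `|x| <= y -> x ^+ 2 <= y ^+ 2.
Proof.
by move=> xy; rewrite -real_normK ?num_real // ler_pXn2r ?nnegrE // (le_trans _ xy).
Qed.

Lemma ler_cis_sub1_id x : cmod (cis x - 1 - (0 +i* x)%C) <= x ^+ 2.
Proof.
rewrite -(ler_pXn2r (n := 2)) ?nnegrE ?sqr_ge0 // cmod_sqr /= oppr0 !addr0.
have c2 : (cos x - 1) ^+ 2 <= (x ^+ 2 / 2) ^+ 2.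
  apply: ler_norm_sqr; rewrite ler0_norm ?opprB ?subr_le0 ?cos_le1 //.
  by have := cos_ge_1Bsqr x; lra.
have s2 : (sin x - x) ^+ 2 <= (x ^+ 2 / 2) ^+ 2.
  by apply: ler_norm_sqr; rewrite distrC ler_sin_id.
apply: le_trans (lerD c2 s2) _; rewrite exprMn.
have := sqr_ge0 (x ^+ 2); lra.
Qed.

Lemma expR_sub1_id_ge0 x : 0 <= expR x - 1 - x.
Proof. by have := expR_ge1Dx x; lra. Qed.

(** From [1 - x <= exp (- x)] one gets [exp x (1 - x) <= 1]; after multiplication by [1 - x > 0] the
    claim becomes [0 <= x^2 (1 - 2 x)]. *)
Lemma ler_expR_sub1_id x : x <= 2^-1 -> expR x - 1 - x <= 2 * x ^+ 2.
Proof.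
move=> x2; have e1 := expR_ge1Dx (- x).
have e0 := expR_gt0 x; have eN : expR x * expR (- x) = 1 by rewrite -expRD subrr expR0.
have {eN} : expR x * (1 - x) <= 1 by rewrite -[leRHS]eN ler_pM2l.
case: (leP 0 x) => x0 e2.
  suff : (expR x - 1 - x - 2 * x ^+ 2) * (1 - x) <= 0 by rewrite pmulr_lle0; lra.
  have : 0 <= x ^+ 2 * (1 - 2 * x) by rewrite mulr_ge0 ?sqr_ge0; lra.
  lra.
suff : (expR x - 1 - x - 2 * x ^+ 2) * (1 - x) <= 0 by rewrite pmulr_lle0; lra.
have : 0 <= x ^+ 2 * (1 - 2 * x) by rewrite mulr_ge0 ?sqr_ge0; lra.
lra.
Qed.

Lemma cexpD z w : cexp (z + w) = cexp z * cexp w :> C.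
Proof.
case: z => a b; case: w => c d; rewrite /cexp /= expRD rmorphM /=.
by rewrite -!/(cis _) cisD; ring.
Qed.

Lemma cexp0 : cexp 0 = 1 :> C.
Proof. by rewrite /cexp /= expR0 -/(cis _) cis0 mulr1. Qed.

Lemma cmod_cexp z : cmod (cexp z) = expR (complex.Re z).
Proof.
by rewrite /cexp cmodM -/(cis _) cmod_cis mulr1 cmod_real ger0_norm // expR_ge0.
Qed.

Lemma cexp_im x : cexp (0 +i* x)%C = cis x.
Proof. by rewrite /cexp /= expR0 mul1r. Qed.

Lemma ler_cexp_sub1_id z : complex.Re z <= 2^-1 ->
  cmod (cexp z - 1 - z) <= 4 * cmod z ^+ 2.
Proof.
case: z => x y /= x2.
have -> : cexp (x +i* y)%C - 1 - (x +i* y)%C =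
    (expR x - 1 - x)%:C%C * cis y + (cis y - 1 - (0 +i* y)%C) + x%:C%C * (cis y - 1).
  by rewrite /cexp /=; apply/eqP; rewrite eq_complex /=; apply/andP; split; apply/eqP; ring.
apply: le_trans (ler_cmodD _ _) _; apply: le_trans (lerD (ler_cmodD _ _) (lexx _)) _.
rewrite !cmodM cmod_cis mulr1 !cmod_real cmod_sqr /= ger0_norm ?expR_sub1_id_ge0 //.
have a := ler_expR_sub1_id x2; have b := ler_cis_sub1_id y.
have c : `|x| * cmod (cis y - 1) <= `|x| * `|y| by rewrite ler_wpM2l // ler_cis_sub1.
have d : 0 <= (`|x| - `|y|) ^+ 2 by rewrite sqr_ge0.
rewrite sqrrB !real_normK ?num_real // in d.
have y2 := sqr_ge0 y; have x2' := sqr_ge0 x.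
lra.
Qed.

Lemma ler_cexp_sub1 z : complex.Re z <= 2^-1 -> cmod z <= 1 ->
  cmod (cexp z - 1) <= 5 * cmod z.
Proof.
move=> z2 z1; have := ler_cexp_sub1_id z2.
have := ler_cmodD (cexp z - 1 - z) z; rewrite subrK.
have : cmod z ^+ 2 <= cmod z by rewrite expr2 ler_piMl.
lra.
Qed.

Lemma ler_norm_sqr_norm x y : `|x| <= `|y| -> x ^+ 2 <= y ^+ 2.
Proof. by move=> /ler_norm_sqr; rewrite real_normK ?num_real. Qed.

End Modulus.
#[global] Hint Extern 0 (is_true (_ <= cmod _)) => exact: cmod_ge0 : core.

(** * Real derivatives, mean values and antiderivatives *)

Section RealDerivative.
Variable R : realType.

Lemma eps_is_derive (f : R -> R) (t d : R) :
  (forall e, 0 < e -> exists2 r, 0 < r &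
    forall h, `|h| < r -> `|f (t + h) - f t - d * h| <= e * `|h|) ->
  is_derive t 1 f d.
Proof.
move=> H.
have L : (fun h => h^-1 *: (f (h *: (1 : R) + t) - f t)) @ (0 : R)^' --> d.
  apply/cvgrPdist_le => e e0; have [r r0 {}H] := H e e0.
  rewrite near_withinE; apply/nbhs_ballP; exists r => // h.
  rewrite /ball /= sub0r normrN => hr h0.
  have -> : d - h^-1 *: (f (h *: (1 : R) + t) - f t)
      = - (h^-1 * (f (t + h) - f t - d * h)).
    by rewrite /GRing.scale /= mulr1 (addrC h t); field.
  rewrite normrN normrM normfV mulrC ler_pdivrMr ?normr_gt0 //; exact: H.
by apply: DeriveDef; [exact: cvgP L | exact: cvg_lim L].
Qed.

Lemma is_derive_continuous (f : R -> R) (t d : R) : is_derive t 1 f d -> {for t, continuous f}.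
Proof. by case=> fd _; apply: differentiable_continuous; apply/derivable1_diffP. Qed.

Lemma mean_value_bound (f df : R -> R) (M a b : R) : a <= b ->
  (forall x, a <= x <= b -> is_derive x 1 f (df x)) ->
  (forall x, a <= x <= b -> `|df x| <= M) -> `|f b - f a| <= M * (b - a).
Proof.
move=> ab fd fM.
have [c cab ->] : exists2 c, c \in `[a, b] & f b - f a = df c * (b - a).
  apply: MVT_segment => // [x|].
    by rewrite in_itv /= => /andP[ax xb]; apply: fd; rewrite (ltW ax) (ltW xb).
  apply: continuous_in_subspaceT => x; rewrite inE /= in_itv /= => xab.
  exact: is_derive_continuous (fd x xab).
rewrite in_itv /= in cab.
by rewrite normrM (ger0_norm (x := b - a)) ?subr_ge0 // ler_wpM2r ?subr_ge0 // fM.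
Qed.

(** The integral from [a] is differentiated only to the right of [a]; this is why primitives below
    start at a point left of the square on which they are used. *)
Lemma exists_antiderivative (g : R -> R) (a : R) : continuous g ->
  exists G : R -> R, forall x, a < x -> is_derive x 1 G (g x).
Proof.
move=> cg; exists (fun x => \int[lebesgue_measure]_(t in [set` `[a, x]]) g t)%R => x ax.
have [||d1 d2] := @continuous_FTC1_closed R g a x (x + 1) _ _ ax (cg x).
- by rewrite ltrDl.
- apply: continuous_compact_integrable; first exact: segment_compact.
  exact: continuous_subspaceT.
by rewrite derive1E in d2; exact: DeriveDef d1 d2.
Qed.

End RealDerivative.

(** * Complex derivatives with explicit radii *)

Section ComplexDerivative.
Variable R : realType.
Local Notation C := (R[i]).
Implicit Types (f g : C -> C) (z d h : C).

(** Complex differentiability with radii and tolerances in [R], the form in which all estimates are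
    made; [derivable_cder] is the passage from the derivative of the statement. *)
Definition cder f z d := forall e : R, 0 < e -> exists2 r : R, 0 < r &
  forall h, cmod h < r -> cmod (f (z + h) - f z - d * h) <= e * cmod h.

Definition ccont f z := forall e : R, 0 < e -> exists2 r : R, 0 < r &
  forall h, cmod h < r -> cmod (f (z + h) - f z) <= e.

Lemma cder_cont f z d : cder f z d -> ccont f z.
Proof.
move=> fd e e0; have [r r0 H] := fd 1 ltr01.
pose K := 1 + cmod d; have K0 : 0 < K by rewrite /K ltr_pwDl // cmod_ge0.
exists (Num.min r (e / K)); first by rewrite lt_min r0 divr_gt0 //.
move=> h; rewrite lt_min => /andP[hr he].
rewrite -(subrK (d * h) (f (z + h) - f z)); apply: le_trans (ler_cmodD _ _) _.
rewrite ltr_pdivlMr // in he; rewrite cmodM.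
by have := H h hr; rewrite /K in he; lra.
Qed.

Lemma cder_cst (c : C) z : cder (fun _ => c) z 0.
Proof.
by move=> e e0; exists 1 => // h _; rewrite subrr mul0r subr0 cmod0 mulr_ge0 // ltW.
Qed.

Lemma cder_id z : cder id z 1.
Proof.
move=> e e0; exists 1 => // h _.
by rewrite mul1r (addrC z) addrK subrr cmod0 mulr_ge0 // ltW.
Qed.

Lemma cderD f g z d d' : cder f z d -> cder g z d' ->
  cder (fun w => f w + g w) z (d + d').
Proof.
move=> fd gd e e0; have e2 : 0 < e / 2 by rewrite divr_gt0.
have [r r0 H] := fd _ e2; have [r' r'0 H'] := gd _ e2.
exists (Num.min r r'); first by rewrite lt_min r0.
move=> h; rewrite lt_min => /andP[hr hr'].
have -> : f (z + h) + g (z + h) - (f z + g z) - (d + d') * h =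
  (f (z + h) - f z - d * h) + (g (z + h) - g z - d' * h) by ring.
apply: le_trans (ler_cmodD _ _) _.
by have := H h hr; have := H' h hr'; lra.
Qed.

Lemma cderM f g z d d' : cder f z d -> cder g z d' ->
  cder (fun w => f w * g w) z (d * g z + f z * d').
Proof.
move=> fd gd e e0.
pose K := 1 + cmod (f z) + cmod (g z) + cmod d.
have K0 : 0 < K by rewrite /K -!addrA ltr_pwDl // !addr_ge0.
have e3 : 0 < e / (3 * K) by rewrite divr_gt0 // mulr_gt0.
have [r r0 H] := fd _ e3; have [r' r'0 H'] := gd _ e3.
have [|r1 r10 C1] := cder_cont gd (e := Num.min 1 (e / (3 * K))); first by rewrite lt_min ltr01.
exists (Num.min r (Num.min r' r1)); first by rewrite !lt_min r0 r'0.
move=> h; rewrite !lt_min => /and3P[hr hr' hr1].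
have -> : f (z + h) * g (z + h) - f z * g z - (d * g z + f z * d') * h =
  (f (z + h) - f z - d * h) * (g (z + h) - g z) + (f (z + h) - f z - d * h) * g z
  + f z * (g (z + h) - g z - d' * h) + d * h * (g (z + h) - g z) by ring.
apply: le_trans (ler_cmodD _ _) _; apply: le_trans (lerD (ler_cmodD _ _) (lexx _)) _.
apply: le_trans (lerD (lerD (ler_cmodD _ _) (lexx _)) (lexx _)) _.
rewrite !cmodM; have := C1 h hr1; rewrite le_min => /andP[g1 g2].
have {}H := H h hr; have {}H' := H' h hr'.
set X := cmod h in H H' *; have X0 : 0 <= X by exact: cmod_ge0.
set E := e / (3 * K) in H H' g2.
have EK : E * K = e / 3 by rewrite /E; field; rewrite gt_eqF.
have E0 : 0 < E by [].
have a1 : cmod (f (z + h) - f z - d * h) * cmod (g (z + h) - g z) <= E * X * 1 by rewrite ler_pM.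
have a2 : cmod (f (z + h) - f z - d * h) * cmod (g z) <= E * X * cmod (g z) by rewrite ler_wpM2r.
have a3 : cmod (f z) * cmod (g (z + h) - g z - d' * h) <= cmod (f z) * (E * X) by rewrite ler_wpM2l.
have a4 : cmod d * X * cmod (g (z + h) - g z) <= cmod d * X * E by rewrite ler_wpM2l // mulr_ge0.
have eX : 0 <= e * X by rewrite mulr_ge0 // ltW.
have : E * X * 1 + E * X * cmod (g z) + cmod (f z) * (E * X) + cmod d * X * E = E * K * X.
  by rewrite /K; ring.
rewrite EK; lra.
Qed.

Lemma cderV z : z != 0 -> cder (fun w => w^-1) z (- z ^- 2).
Proof.
move=> z0 e e0; have mz : 0 < cmod z by rewrite cmod_gt0.
pose m := cmod z.
exists (Num.min (m / 2) (e * m ^+ 3 / 2)).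
  by rewrite lt_min !divr_gt0 // mulr_gt0 // exprn_gt0.
move=> h; rewrite lt_min => /andP[h1 h2].
have zh : m / 2 <= cmod (z + h).
  have := ler_cmod_dist z (- h); rewrite opprK cmodN -/m; lra.
have zh0 : z + h != 0 by rewrite -cmod_gt0 (lt_le_trans _ zh) // divr_gt0.
have -> : (z + h)^-1 - z^-1 - - z ^- 2 * h = h ^+ 2 * (z ^+ 2 * (z + h))^-1.
  by field; rewrite z0 zh0.
rewrite cmodM cmodV cmodX cmodM cmodX -/m expr2 -mulrA mulrC ler_wpM2r //.
rewrite ler_pdivrMr ?mulr_gt0 ?exprn_gt0 ?cmod_gt0 //.
apply: le_trans (ltW h2) _.
have -> : e * m ^+ 3 / 2 = e * (m ^+ 2 * (m / 2)) by field.
by rewrite ler_wpM2l ?(ltW e0) // ler_wpM2l ?sqr_ge0.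
Qed.

Lemma cder_ext f g z d (r : R) : 0 < r ->
  (forall h, cmod h < r -> f (z + h) = g (z + h)) -> cder f z d -> cder g z d.
Proof.
move=> r0 fg fd e e0; have [r' r'0 H] := fd _ e0.
exists (Num.min r r'); first by rewrite lt_min r0.
move=> h; rewrite lt_min => /andP[hr hr'].
by have := fg 0; rewrite addr0 cmod0 => /(_ r0) <-; rewrite -fg // H.
Qed.

Lemma cder_unique f z d d' : cder f z d -> cder f z d' -> d = d'.
Proof.
move=> fd fd'; apply/eqP; rewrite -subr_eq0 -cmod_eq0 eq_le cmod_ge0 andbT.
apply/ler_addgt0Pl => e e0; rewrite addr0.
have e2 : 0 < e / 2 by rewrite divr_gt0.
have [r r0 H] := fd _ e2; have [r' r'0 H'] := fd' _ e2.
pose m := Num.min r r' / 2; have m0 : 0 < m by rewrite divr_gt0 // lt_min r0.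
have mr : m < Num.min r r' by rewrite /m ltr_pdivrMr // ltr_pMr ?lt_min ?r0 // ltr1n.
move: mr; rewrite lt_min => /andP[mr mr'].
have hm : cmod (m%:C)%C = m by rewrite cmod_real gtr0_norm.
have := H (m%:C)%C; rewrite hm => /(_ mr) {}H.
have := H' (m%:C)%C; rewrite hm => /(_ mr') {}H'.
rewrite -(ler_pM2r m0) -[X in _ * X]hm -cmodM.
have -> : (d - d') * m%:C%C = (f (z + m%:C%C) - f z - d' * m%:C%C) - (f (z + m%:C%C) - f z - d * m%:C%C) by ring.
apply: le_trans (ler_cmodB _ _) _; lra.
Qed.

Lemma derivable_cder f z : derivable (f : C^o -> C^o) z 1 -> exists d, cder f z d.
Proof.
move=> /cvg_ex[d] /= fd; exists d => e e0.
have e0' : 0 < (e%:C)%C :> C by rewrite ltcR.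
move/cvgrPdist_le : fd => /(_ _ e0'); rewrite near_withinE => /nbhs_ballP[r /= r0 H].
(* A positive element of [R[i]] is real, so the radius of the ball comes from [R]. *)
have [r1 rE] : exists r1 : R, r = (r1%:C)%C.
  by apply/complex_realP; rewrite realE ltW.
exists r1; first by rewrite -ltcR -rE.
move=> h hr; have [->|h0] := eqVneq h 0.
  by rewrite addr0 subrr mulr0 subrr cmod0 mulr0.
have := H h; rewrite /ball /= sub0r normrN normc_cmod rE ltcR => /(_ hr h0).
rewrite normc_cmod lecR => {}H.
have -> : f (z + h) - f z - d * h = - ((d - h^-1 *: ((f (h *: (1:C) + z) : C) - f z)) * h).
  by rewrite /GRing.scale /= mulr1 (addrC h z); field.
by rewrite cmodN cmodM ler_wpM2r.
Qed.

(** Along a line the real and imaginary parts become real functions of one variable, to which the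
    real mean value theorem applies. *)
Lemma cder_is_derive f z h d (t : R) : cder f (z + t%:C%C * h) d ->
  is_derive t 1 (fun t => complex.Re (f (z + t%:C%C * h))) (complex.Re (d * h)) /\
  is_derive t 1 (fun t => complex.Im (f (z + t%:C%C * h))) (complex.Im (d * h)).
Proof.
move=> fd.
have K0 : 0 < 1 + cmod h by rewrite ltr_pwDl // cmod_ge0.
have H e : 0 < e -> exists2 r : R, 0 < r & forall k : R, `|k| < r ->
    cmod (f (z + (t + k)%:C%C * h) - f (z + t%:C%C * h) - d * h * k%:C%C) <= e * `|k|.
  move=> e0; have [|r r0 H] := fd (e / (1 + cmod h)); first by rewrite divr_gt0.
  exists (r / (1 + cmod h)); first by rewrite divr_gt0.
  move=> k; rewrite ltr_pdivlMr // => kr.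
  have kh : cmod (k%:C%C * h) = `|k| * cmod h by rewrite cmodM cmod_real.
  have := H (k%:C%C * h); rewrite kh => /(_ _)/le_trans H2.
  have -> : z + (t + k)%:C%C * h = z + t%:C%C * h + k%:C%C * h by rewrite rmorphD /=; ring.
  rewrite -mulrA (mulrC h); apply: H2.
    by apply: le_lt_trans kr; rewrite ler_wpM2l // lerDr.
  rewrite -mulrA ler_wpM2l ?(ltW e0) // mulrC -mulrA ler_piMr //.
  by rewrite ler_pdivrMr // mul1r lerDr.
split; apply: eps_is_derive => e e0; have [r r0 {}H] := H e e0; exists r => // k kr;
  apply: le_trans (H k kr).
- apply: le_trans (ler_Re_cmod _); rewrite le_eqVlt; apply/orP; left; apply/eqP; congr `|_|.
  by rewrite !raddfB /=; congr (_ - _); case: (d * h) => x y /=; ring.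
- apply: le_trans (ler_Im_cmod _); rewrite le_eqVlt; apply/orP; left; apply/eqP; congr `|_|.
  by rewrite !raddfB /=; congr (_ - _); case: (d * h) => x y /=; ring.
Qed.

(* The factor 2 comes from treating real and imaginary parts separately. *)
Lemma cder_segment_bound f f1 z h (M : R) :
  (forall t : R, 0 <= t <= 1 -> cder f (z + t%:C%C * h) (f1 (z + t%:C%C * h))) ->
  (forall t : R, 0 <= t <= 1 -> cmod (f1 (z + t%:C%C * h)) <= M) ->
  cmod (f (z + h) - f z) <= 2 * (M * cmod h).
Proof.
move=> fd fM.
have B (t : R) : 0 <= t <= 1 -> cmod (f1 (z + t%:C%C * h) * h) <= M * cmod h.
  by move=> t01; rewrite cmodM ler_wpM2r // fM.
have a1 := @mean_value_bound R (fun t => complex.Re (f (z + t%:C%C * h)))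
  (fun t => complex.Re (f1 (z + t%:C%C * h) * h)) (M * cmod h) 0 1 ler01
  (fun t t01 => (cder_is_derive (fd t t01)).1)
  (fun t t01 => le_trans (ler_Re_cmod _) (B t t01)).
have a2 := @mean_value_bound R (fun t => complex.Im (f (z + t%:C%C * h)))
  (fun t => complex.Im (f1 (z + t%:C%C * h) * h)) (M * cmod h) 0 1 ler01
  (fun t t01 => (cder_is_derive (fd t t01)).2)
  (fun t t01 => le_trans (ler_Im_cmod _) (B t t01)).
move: a1 a2; rewrite mul1r mul0r addr0 subr0 mulr1 => a1 a2.
by apply: le_trans (ler_cmod_ReIm _) _; rewrite !raddfB /=; lra.
Qed.

End ComplexDerivative.

(** * Goursat's theorem and the identity theorem *)

Section Primitive.
Variable R : realType.
Local Notation C := (R[i]).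
Implicit Types (f g : C -> C) (z w : C) (x y r : R).

(** Increments of such a primitive play the part of line integrals throughout Goursat's argument. *)
Definition cprim (a : R) (phi Phi : R -> C) := forall x, a < x ->
  is_derive x 1 (fun t => complex.Re (Phi t)) (complex.Re (phi x)) /\
  is_derive x 1 (fun t => complex.Im (Phi t)) (complex.Im (phi x)).

Definition rcont (phi : R -> C) := forall t e : R, 0 < e ->
  exists2 r, 0 < r & forall k, `|k| < r -> cmod (phi (t + k) - phi t) <= e.

Lemma rcont_continuous (phi : R -> C) : rcont phi ->
  continuous (fun t => complex.Re (phi t)) /\ continuous (fun t => complex.Im (phi t)).
Proof.
move=> c; split=> t; apply/cvgrPdist_le => e e0; have [r r0 H] := c t e e0;
  apply/nbhs_ballP; exists r => // s; rewrite /ball /= distrC => st;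
  have := H (s - t) st; rewrite (addrC t) subrK distrC => /(le_trans _); apply.
- by rewrite -raddfB ler_Re_cmod.
- by rewrite -raddfB ler_Im_cmod.
Qed.

Lemma exists_cprim a (phi : R -> C) : rcont phi -> exists Phi, cprim a phi Phi.
Proof.
move=> /rcont_continuous[c1 c2].
have [G1 H1] := exists_antiderivative a c1; have [G2 H2] := exists_antiderivative a c2.
by exists (fun t => (G1 t +i* G2 t)%C) => x ax; split; [exact: H1|exact: H2].
Qed.

(** The estimate of an integral by length times maximum, in terms of primitives: the mean value
    theorem is applied to the real and to the imaginary part, whence the factor 2. *)
Lemma cprim_bound a (phi Phi psi Psi : R -> C) x y (M : R) :
  cprim a phi Phi -> cprim a psi Psi -> a < x -> x <= y ->
  (forall t, x <= t <= y -> cmod (phi t - psi t) <= M) ->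
  cmod ((Phi y - Phi x) - (Psi y - Psi x)) <= 2 * M * (y - x).
Proof.
move=> H1 H2 ax xy HM.
have at_ t : x <= t <= y -> a < t by move=> /andP[xt _]; exact: lt_le_trans xt.
have b1 : `|(complex.Re (Phi y) - complex.Re (Psi y)) - (complex.Re (Phi x) - complex.Re (Psi x))| <= M * (y - x).
  apply: (@mean_value_bound R (fun t => complex.Re (Phi t) - complex.Re (Psi t))
    (fun t => complex.Re (phi t) - complex.Re (psi t))) => // t txy.
    by apply: is_deriveB; [case: (H1 t (at_ t txy))|case: (H2 t (at_ t txy))].
  by apply: le_trans (HM t txy); rewrite -raddfB ler_Re_cmod.
have b2 : `|(complex.Im (Phi y) - complex.Im (Psi y)) - (complex.Im (Phi x) - complex.Im (Psi x))| <= M * (y - x).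
  apply: (@mean_value_bound R (fun t => complex.Im (Phi t) - complex.Im (Psi t))
    (fun t => complex.Im (phi t) - complex.Im (psi t))) => // t txy.
    by apply: is_deriveB; [case: (H1 t (at_ t txy))|case: (H2 t (at_ t txy))].
  by apply: le_trans (HM t txy); rewrite -raddfB ler_Im_cmod.
apply: le_trans (ler_cmod_ReIm _) _; rewrite !raddfB /=.
have -> : 2 * M * (y - x) = M * (y - x) + M * (y - x) by ring.
by apply: lerD; [apply: le_trans b1|apply: le_trans b2]; rewrite le_eqVlt; apply/orP; left; apply/eqP; congr `|_|; ring.
Qed.

Lemma cprim_affine a (P Q : C) :
  cprim a (fun x => P + Q * x%:C%C) (fun x => P * x%:C%C + Q * (x ^+ 2 / 2)%:C%C).
Proof.
case: P => P1 P2; case: Q => Q1 Q2 x _; split => /=.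
- have -> : (fun t : R => P1 * t - P2 * 0 + (Q1 * (t ^+ 2 / 2) - Q2 * 0)) =
    (fun t => P1 * t + Q1 / 2 * t ^+ 2) by apply/funext => t; field.
  by apply: is_derive_eq; rewrite /GRing.scale /=; field.
- have -> : (fun t : R => P1 * 0 + P2 * t + (Q1 * 0 + Q2 * (t ^+ 2 / 2))) =
    (fun t => P2 * t + Q2 / 2 * t ^+ 2) by apply/funext => t; field.
  by apply: is_derive_eq; rewrite /GRing.scale /=; field.
Qed.

(** Retraction of the line onto [[-r, r]]. Composing with it extends a function continuous on the
    square to all coordinates, so that its antiderivatives exist globally. *)
Definition clamp r x := Num.max (- r) (Num.min r x).

Lemma clamp_in r x : 0 <= r -> `|clamp r x| <= r.
Proof.
by move=> r0; rewrite ler_norml /clamp maxEle minEle; do 2 case: ifPn; rewrite -?ltNge => *; lra.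
Qed.

Lemma clamp_id r x : `|x| <= r -> clamp r x = x.
Proof.
rewrite ler_norml /clamp maxEle minEle => /andP[? ?].
by do 2 case: ifPn; rewrite -?ltNge => *; lra.
Qed.

Lemma clamp_lip r x y : `|clamp r x - clamp r y| <= `|x - y|.
Proof.
have := ler_norm (x - y); have := ler_norm (y - x); rewrite (distrC y) ler_norml /clamp !maxEle !minEle.
by do 4 case: ifPn; rewrite -?ltNge => *; lra.
Qed.

Definition insq r z := `|complex.Re z| <= r /\ `|complex.Im z| <= r.
Definition insqo r z := `|complex.Re z| < r /\ `|complex.Im z| < r.

Definition contsq r f := forall z, insq r z -> forall e : R, 0 < e ->
  exists2 d : R, 0 < d & forall w, insq r w -> cmod (w - z) < d -> cmod (f w - f z) <= e.

Section RectangleIntegral.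
Variable r : R.
Hypothesis r0 : 0 <= r.

Local Notation cl x := (clamp r x).

(** A primitive along the horizontal line at height [c], and below it one along the vertical line at
    abscissa [c]. The starting point [- r - 1] lies strictly left of [-r], so the derivative is also
    available at the edge of the square. *)
Definition hprim f c := xget (fun=> 0)
  [set Phi | cprim (- r - 1) (fun x => f (cl x +i* cl c)%C) Phi].
Definition vprim f c := xget (fun=> 0)
  [set Phi | cprim (- r - 1) (fun y => f (cl c +i* cl y)%C) Phi].

Lemma hprimP f c : contsq r f -> cprim (- r - 1) (fun x => f (cl x +i* cl c)%C) (hprim f c).
Proof.
move=> cf; rewrite /hprim; case: xgetP => [// _ -> //|] /=.
have [|Phi H /(_ Phi H)//] := @exists_cprim (- r - 1) (fun x => f (cl x +i* cl c)%C).
move=> t e e0; have [//|d d0 H] := cf (cl t +i* cl c)%C _ e e0; first by split; exact: clamp_in.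
exists d => // k kd; apply: H; first by split; exact: clamp_in.
apply: le_lt_trans kd; apply: le_trans (ler_cmod_ReIm _) _; rewrite /= subrr normr0 addr0.
by apply: le_trans (clamp_lip _ _ _) _; rewrite addrC addKr.
Qed.

Lemma vprimP f c : contsq r f -> cprim (- r - 1) (fun y => f (cl c +i* cl y)%C) (vprim f c).
Proof.
move=> cf; rewrite /vprim; case: xgetP => [// _ -> //|] /=.
have [|Phi H /(_ Phi H)//] := @exists_cprim (- r - 1) (fun y => f (cl c +i* cl y)%C).
move=> t e e0; have [//|d d0 H] := cf (cl c +i* cl t)%C _ e e0; first by split; exact: clamp_in.
exists d => // k kd; apply: H; first by split; exact: clamp_in.
apply: le_lt_trans kd; apply: le_trans (ler_cmod_ReIm _) _; rewrite /= subrr normr0 add0r.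
by apply: le_trans (clamp_lip _ _ _) _; rewrite addrC addKr.
Qed.

(** The counterclockwise integral of [f] along the boundary of the rectangle: bottom minus top, plus
    [i] times right minus left. *)
Definition rect f x1 x2 y1 y2 : C :=
  (hprim f y1 x2 - hprim f y1 x1) - (hprim f y2 x2 - hprim f y2 x1)
  + 'i%C * ((vprim f x2 y2 - vprim f x2 y1) - (vprim f x1 y2 - vprim f x1 y1)).

Lemma rect_split f x1 xm x2 y1 ym y2 : rect f x1 x2 y1 y2 =
  rect f x1 xm y1 ym + rect f xm x2 y1 ym + rect f x1 xm ym y2 + rect f xm x2 ym y2.
Proof. by rewrite /rect; ring. Qed.

Lemma cmod_i : cmod ('i%C : C) = 1.
Proof. by rewrite /cmod /= expr0n add0r expr1n sqrtr1. Qed.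

Lemma cmod4 (a b c d : C) (M : R) (x y : R) :
  cmod a <= M * x -> cmod b <= M * x -> cmod c <= M * y -> cmod d <= M * y ->
  cmod (a - b + 'i%C * (c - d)) <= 2 * M * (x + y).
Proof.
move=> H1 H2 H3 H4; apply: le_trans (ler_cmodD _ _) _; rewrite cmodM cmod_i mul1r.
by apply: le_trans (lerD (ler_cmodB _ _) (ler_cmodB _ _)) _; lra.
Qed.

Lemma rect_compare f g x1 x2 y1 y2 (M : R) : contsq r f -> contsq r g ->
  - r <= x1 -> x1 <= x2 -> x2 <= r -> - r <= y1 -> y1 <= y2 -> y2 <= r ->
  (forall x y, x1 <= x <= x2 -> y1 <= y <= y2 -> cmod (f (x +i* y)%C - g (x +i* y)%C) <= M) ->
  cmod (rect f x1 x2 y1 y2 - rect g x1 x2 y1 y2) <= 4 * M * (x2 - x1 + (y2 - y1)).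
Proof.
move=> cf cg a1 a2 a3 b1 b2 b3 HM.
have cx x : x1 <= x <= x2 -> cl x = x by move=> ?; rewrite clamp_id // ler_norml; lra.
have cy y : y1 <= y <= y2 -> cl y = y by move=> ?; rewrite clamp_id // ler_norml; lra.
have hb c : y1 <= c <= y2 -> cmod ((hprim f c x2 - hprim f c x1) - (hprim g c x2 - hprim g c x1)) <= 2 * M * (x2 - x1).
  move=> cc; apply: cprim_bound (hprimP c cf) (hprimP c cg) _ a2 _; first by lra.
  by move=> t tx; rewrite /= (cx t tx) (cy c cc); apply: HM.
have vb c : x1 <= c <= x2 -> cmod ((vprim f c y2 - vprim f c y1) - (vprim g c y2 - vprim g c y1)) <= 2 * M * (y2 - y1).
  move=> cc; apply: cprim_bound (vprimP c cf) (vprimP c cg) _ b2 _; first by lra.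
  by move=> t tx; rewrite /= (cy t tx) (cx c cc); apply: HM.
have -> : rect f x1 x2 y1 y2 - rect g x1 x2 y1 y2 =
  ((hprim f y1 x2 - hprim f y1 x1) - (hprim g y1 x2 - hprim g y1 x1)) - ((hprim f y2 x2 - hprim f y2 x1) - (hprim g y2 x2 - hprim g y2 x1))
  + 'i%C * (((vprim f x2 y2 - vprim f x2 y1) - (vprim g x2 y2 - vprim g x2 y1)) - ((vprim f x1 y2 - vprim f x1 y1) - (vprim g x1 y2 - vprim g x1 y1))).
  by rewrite /rect; ring.
have -> : 4 * M * (x2 - x1 + (y2 - y1)) = 2 * (2 * M) * (x2 - x1 + (y2 - y1)) by ring.
by apply: cmod4; [apply: hb|apply: hb|apply: vb|apply: vb]; lra.
Qed.

Lemma contsq_affine (A B : C) : contsq r (fun z => A + B * z).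
Proof.
move=> z _ e e0; have K0 : 0 < 1 + cmod B by rewrite ltr_pwDl.
exists (e / (1 + cmod B)); first by rewrite divr_gt0.
move=> w _; rewrite ltr_pdivlMr // => H.
have -> : A + B * w - (A + B * z) = B * (w - z) by ring.
rewrite cmodM; have := cmod_ge0 (w - z); lra.
Qed.

Lemma rect_affine (A B : C) x1 x2 y1 y2 :
  - r <= x1 -> x1 <= x2 -> x2 <= r -> - r <= y1 -> y1 <= y2 -> y2 <= r ->
  rect (fun z => A + B * z) x1 x2 y1 y2 = 0.
Proof.
move=> a1 a2 a3 b1 b2 b3.
have cx x : x1 <= x <= x2 -> cl x = x by move=> ?; rewrite clamp_id // ler_norml; lra.
have cy y : y1 <= y <= y2 -> cl y = y by move=> ?; rewrite clamp_id // ler_norml; lra.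
pose f z := A + B * z; have cf : contsq r f by exact: contsq_affine.
have E (u v : C) (M : R) : cmod (u - v) <= 2 * 0 * M -> u = v.
  by rewrite mulr0 mul0r => H; apply/eqP; rewrite -subr_eq0 -cmod_eq0 eq_le H cmod_ge0.
have hE c : y1 <= c <= y2 -> hprim f c x2 - hprim f c x1 =
    ((A + B * (0 +i* c)%C) * x2%:C%C + B * (x2 ^+ 2 / 2)%:C%C) - ((A + B * (0 +i* c)%C) * x1%:C%C + B * (x1 ^+ 2 / 2)%:C%C).
  move=> cc; apply: E; apply: cprim_bound (hprimP c cf) (@cprim_affine _ _ _) _ a2 _; first by lra.
  move=> t tx; rewrite /= (cx t tx) (cy c cc) /f.
  have -> : (t +i* c)%C = (0 +i* c)%C + t%:C%C by apply/eqP; rewrite eq_complex /= add0r addr0 !eqxx.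
  by rewrite mulrDr addrA subrr cmod0.
have vE c : x1 <= c <= x2 -> vprim f c y2 - vprim f c y1 =
    ((A + B * c%:C%C) * y2%:C%C + (B * 'i%C) * (y2 ^+ 2 / 2)%:C%C) - ((A + B * c%:C%C) * y1%:C%C + (B * 'i%C) * (y1 ^+ 2 / 2)%:C%C).
  move=> cc; apply: E; apply: cprim_bound (vprimP c cf) (@cprim_affine _ _ _) _ b2 _; first by lra.
  move=> t tx; rewrite /= (cy t tx) (cx c cc) /f.
  have -> : (c +i* t)%C = c%:C%C + 'i%C * t%:C%C by apply/eqP; rewrite eq_complex /=; apply/andP; split; apply/eqP; ring.
  by rewrite mulrDr -mulrA addrA subrr cmod0.
have -> : rect f x1 x2 y1 y2 = 0; last by [].
have y1i : y1 <= y1 <= y2 by lra.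
have y2i : y1 <= y2 <= y2 by lra.
have x1i : x1 <= x1 <= x2 by lra.
have x2i : x1 <= x2 <= x2 by lra.
rewrite /rect (hE _ y1i) (hE _ y2i) (vE _ x1i) (vE _ x2i).
by case: (A) => A1 A2; case: (B) => B1 B2; apply/eqP; rewrite eq_complex /=; apply/andP; split; apply/eqP; field.
Qed.

Lemma cder_contsq f : (forall z, insq r z -> exists d, cder f z d) -> contsq r f.
Proof.
move=> fd z zr e e0; have [d /cder_cont c] := fd z zr; have [s s0 H] := c e e0.
by exists s => // w _ wz; have := H (w - z) wz; rewrite (addrC z) subrK.
Qed.

(** The supremum of the left ends lies in every interval of the nested halving sequence. *)
Lemma nested_point (u : nat -> R) (W : R) : 0 <= W ->
  (forall n, u n <= u n.+1) ->
  (forall n, u n.+1 + W / 2 ^+ n.+1 <= u n + W / 2 ^+ n) ->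
  exists x, forall n, u n <= x <= u n + W / 2 ^+ n.
Proof.
move=> W0 ui vi.
have W2 n : 0 <= W / 2 ^+ n by rewrite divr_ge0 // exprn_ge0.
have um n k : u n <= u (n + k)%N by elim: k => [|k IH]; rewrite ?addn0 // addnS (le_trans IH).
have vm n k : u (n + k)%N + W / 2 ^+ (n + k) <= u n + W / 2 ^+ n.
  by elim: k => [|k IH]; rewrite ?addn0 // addnS (le_trans _ IH).
have uv n m : u m <= u n + W / 2 ^+ n.
  case: (leqP n m) => [nm|/ltnW mn].
    by have := vm n (m - n)%N; rewrite subnKC // => H; have := W2 m; lra.
  by have := um m (n - m)%N; rewrite subnKC // => H; have := W2 n; lra.
exists (sup (range u)) => n; apply/andP; split.
  apply: ub_le_sup; last by exists n.
  by exists (u n + W / 2 ^+ n) => _ [m _ <-]; exact: uv.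
by apply: ge_sup; [exists (u n), n|move=> _ [m _ <-]; exact: uv].
Qed.

(** Goursat's subdivision. One of the four quarters carries at least a quarter of the integral; the
    nested quarters meet in a point, near which [f] is within [e] times the distance of an affine
    function, and affine functions have integral zero by explicit primitives. *)
Lemma goursat f x1 x2 y1 y2 : (forall z, insq r z -> exists d, cder f z d) ->
  - r <= x1 -> x1 <= x2 -> x2 <= r -> - r <= y1 -> y1 <= y2 -> y2 <= r ->
  rect f x1 x2 y1 y2 = 0.
Proof.
move=> fd a1 a2 a3 b1 b2 b3; have cf := cder_contsq fd.
pose W := x2 - x1; pose H := y2 - y1.
have W0 : 0 <= W by rewrite subr_ge0.
have H0 : 0 <= H by rewrite subr_ge0.
pose w n := W / 2 ^+ n; pose h n := H / 2 ^+ n.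
have ww n : w n = w n.+1 + w n.+1 by rewrite /w exprS; field; rewrite expf_neq0.
have hh n : h n = h n.+1 + h n.+1 by rewrite /h exprS; field; rewrite expf_neq0.
have w0 n : 0 <= w n by rewrite divr_ge0 // exprn_ge0.
have h0 n : 0 <= h n by rewrite divr_ge0 // exprn_ge0.
pose Rn n (p : R * R) := rect f p.1 (p.1 + w n) p.2 (p.2 + h n).
have step (np : nat * (R * R)) : exists p' : R * R,
   [/\ p'.1 = np.2.1 \/ p'.1 = np.2.1 + w np.1.+1,
       p'.2 = np.2.2 \/ p'.2 = np.2.2 + h np.1.+1 &
       cmod (Rn np.1 np.2) <= 4 * cmod (Rn np.1.+1 p')].
  case: np => n [x y] /=; rewrite {1}/Rn /= (rect_split f x (x + w n.+1) _ y (y + h n.+1)).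
  have -> : x + w n = x + w n.+1 + w n.+1 by rewrite ww addrA.
  have -> : y + h n = y + h n.+1 + h n.+1 by rewrite hh addrA.
  set A1 := rect f x _ y _; set A2 := rect f _ _ y _; set A3 := rect f x _ _ _; set A4 := rect f _ _ _ _.
  have T : cmod (A1 + A2 + A3 + A4) <= cmod A1 + cmod A2 + cmod A3 + cmod A4.
    apply: le_trans (ler_cmodD _ _) _; rewrite lerD2r.
    by apply: le_trans (ler_cmodD _ _) _; rewrite lerD2r ler_cmodD.
  set S := cmod (_ + _ + _ + _) in T *.
  case: (leP S (4 * cmod A1)) => [|l1]; first by exists (x, y); split => //; left.
  case: (leP S (4 * cmod A2)) => [|l2]; first by exists (x + w n.+1, y); split => //; [right|left].
  case: (leP S (4 * cmod A3)) => [|l3]; first by exists (x, y + h n.+1); split => //; [left|right].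
  case: (leP S (4 * cmod A4)) => [|l4]; first by exists (x + w n.+1, y + h n.+1); split => //; right.
  by exfalso; lra.
have [nx nxP] := choice step.
pose p := fix p n := if n is m.+1 then nx (m, p m) else (x1, y1).
have pS n : [/\ (p n.+1).1 = (p n).1 \/ (p n.+1).1 = (p n).1 + w n.+1,
       (p n.+1).2 = (p n).2 \/ (p n.+1).2 = (p n).2 + h n.+1 &
       cmod (Rn n (p n)) <= 4 * cmod (Rn n.+1 (p n.+1))] by exact: (nxP (n, p n)).
have pR n : cmod (rect f x1 x2 y1 y2) <= 4 ^+ n * cmod (Rn n (p n)).
  elim: n => [|n IH].
    by rewrite expr0 mul1r /Rn /= /w /h expr0 !divr1 /W /H !(addrC _ (_ - _)) !subrK.
  case: (pS n) => _ _ H1; apply: le_trans IH _; rewrite exprSr -mulrA.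
  by rewrite ler_pM2l ?exprn_gt0.
have [xs xsP] : exists x, forall n, (p n).1 <= x <= (p n).1 + W / 2 ^+ n.
  apply: nested_point => // n; case: (pS n) => H1 _ _.
    by have := w0 n.+1; case: H1 => ->; lra.
  by have := ww n; have := w0 n.+1; rewrite /w in H1 *; case: H1 => ->; lra.
have [ys ysP] : exists x, forall n, (p n).2 <= x <= (p n).2 + H / 2 ^+ n.
  apply: nested_point => // n; case: (pS n) => _ H1 _.
    by have := h0 n.+1; case: H1 => ->; lra.
  by have := hh n; have := h0 n.+1; rewrite /h in H1 *; case: H1 => ->; lra.
have pin n : [/\ x1 <= (p n).1, (p n).1 + w n <= x2, y1 <= (p n).2 & (p n).2 + h n <= y2].
  elim: n => [|n [q1 q2 q3 q4]].
    by rewrite /= /w /h expr0 !divr1 /W /H; split => //; lra.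
  by case: (pS n) => H1 H2 _; have := ww n; have := hh n; have := w0 n.+1; have := h0 n.+1;
    case: H1 => ->; case: H2 => ->; move: q1 q2 q3 q4; move: (w n) (w n.+1) (h n) (h n.+1) (p n).1 (p n).2;
    clear=> *; split; lra.
have xsr : insq r (xs +i* ys)%C.
  have /andP[e1 e2] := xsP 0%N; have /andP[e3 e4] := ysP 0%N.
  have [] := pin 0%N; rewrite /w /h => e5 e6 e7 e8.
  by split; rewrite /= ler_norml; lra.
have [d fdz] := fd _ xsr.
apply/eqP; rewrite -cmod_eq0 eq_le cmod_ge0 andbT.
apply/ler_addgt0Pl => e e0; rewrite addr0.
(* At level [n] the quantity [K / 2^n] is the half-perimeter of the rectangle and also bounds the
   distance of its points to the limit point; its square cancels the factor [4^n]. *)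
pose K := W + H.
have K0 : 0 <= K by rewrite addr_ge0.
have K1 : 0 < 4 * K ^+ 2 + 1 by rewrite ltr_wpDl // mulr_ge0 // sqr_ge0.
have [|s s0 fs] := fdz (e / (4 * K ^+ 2 + 1)); first by rewrite divr_gt0.
set e' := e / _ in fs.
have e'0 : 0 < e' by rewrite divr_gt0.
have [n Kn] : exists n, K / 2 ^+ n < s.
  have [n] : exists n : nat, K / s < n%:R by exists (Num.truncn (K / s)).+1; rewrite truncnS_gt.
  rewrite ltr_pdivrMr // => Kn; exists n; rewrite ltr_pdivrMr ?exprn_gt0 //.
  apply: lt_le_trans Kn _; rewrite mulrC ler_pM2l // -natrX ler_nat.
  exact: ltnW (ltn_expl _ _).
case: (pin n) => q1 q2 q3 q4.
set z0 := (xs +i* ys)%C in fs.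
have B : cmod (Rn n (p n)) <= 4 * (e' * (K / 2 ^+ n)) * (K / 2 ^+ n).
  have wn := w0 n; have hn := h0 n.
  have c1 : - r <= (p n).1 by apply: le_trans q1.
  have c2 : (p n).1 <= (p n).1 + w n by rewrite lerDl.
  have c3 : (p n).1 + w n <= r by apply: le_trans a3.
  have c4 : - r <= (p n).2 by apply: le_trans q3.
  have c5 : (p n).2 <= (p n).2 + h n by rewrite lerDl.
  have c6 : (p n).2 + h n <= r by apply: le_trans b3.
  have := @rect_compare f (fun z => (f z0 - d * z0) + d * z) (p n).1 ((p n).1 + w n) (p n).2 ((p n).2 + h n)
    (e' * (K / 2 ^+ n)) cf (contsq_affine _ _) c1 c2 c3 c4 c5 c6.
  rewrite rect_affine // subr0 => RC; apply: le_trans (RC _) _.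
    move=> x y xin yin.
    have xy : cmod ((x +i* y)%C - z0) <= K / 2 ^+ n.
      apply: le_trans (ler_cmod_ReIm _) _; rewrite /= mulrDl.
      by apply: lerD; rewrite ler_norml; [have := xsP n|have := ysP n]; move: xin yin; rewrite /w /h; clear; lra.
    have := fs ((x +i* y)%C - z0) (le_lt_trans xy Kn); rewrite (addrC z0) subrK => F.
    have -> : f (x +i* y)%C - (f z0 - d * z0 + d * (x +i* y)%C) = f (x +i* y)%C - f z0 - d * ((x +i* y)%C - z0) by ring.
    by apply: le_trans F _; rewrite ler_wpM2l // ltW.
  by rewrite (addrC (p n).1) addrK (addrC (p n).2) addrK /w /h /K (mulrDl W H).
apply: le_trans (pR n) _; apply: le_trans (_ : 4 ^+ n * (4 * (e' * (K / 2 ^+ n)) * (K / 2 ^+ n)) <= _).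
  by rewrite ler_wpM2l // exprn_ge0.
have -> : 4 ^+ n * (4 * (e' * (K / 2 ^+ n)) * (K / 2 ^+ n)) = e' * (4 * K ^+ 2).
  have -> : (4 : R) ^+ n = 2 ^+ n * 2 ^+ n by rewrite -exprMn; congr (_ ^+ _); ring.
  by field; rewrite expf_neq0.
rewrite /e' -mulrA ler_piMr ?(ltW e0) // mulrC ler_pdivrMr // mul1r lerDl //.
Qed.

(** Continuity and vanishing rectangle integrals both pass to uniform limits. This is the only form
    in which holomorphy of a limit is used, and it is what Morera's construction needs. *)
Lemma rect_ulim (f_ : nat -> C -> C) f x1 x2 y1 y2 :
  (forall k z, insq r z -> exists d, cder (f_ k) z d) ->
  (forall e : R, 0 < e -> exists k, forall z, insq r z -> cmod (f_ k z - f z) <= e) ->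
  contsq r f /\
  (- r <= x1 -> x1 <= x2 -> x2 <= r -> - r <= y1 -> y1 <= y2 -> y2 <= r ->
  rect f x1 x2 y1 y2 = 0).
Proof.
move=> fd fu.
have cf : contsq r f.
  move=> z zr e e0; have e3 : 0 < e / 3 by rewrite divr_gt0.
  have [k kP] := fu _ e3; have [d d0 H] := cder_contsq (fd k) zr e3.
  exists d => // w wr wz; have := H w wr wz => {}H.
  have -> : f w - f z = (f_ k w - f_ k z) - (f_ k w - f w) + (f_ k z - f z) by ring.
  apply: le_trans (ler_cmodD _ _) _; apply: le_trans (lerD (ler_cmodB _ _) (lexx _)) _.
  by have := kP w wr; have := kP z zr; lra.
split => // a1 a2 a3 b1 b2 b3.
apply/eqP; rewrite -cmod_eq0 eq_le cmod_ge0 andbT.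
apply/ler_addgt0Pl => e e0; rewrite addr0.
pose K := x2 - x1 + (y2 - y1); have K0 : 0 <= K by rewrite addr_ge0 // subr_ge0.
have K1 : 0 < 4 * K + 1 by rewrite ltr_wpDl // mulr_ge0.
have [|k kP] := fu (e / (4 * K + 1)); first by rewrite divr_gt0.
have := @rect_compare (f_ k) f x1 x2 y1 y2 (e / (4 * K + 1)) (cder_contsq (fd k)) cf a1 a2 a3 b1 b2 b3.
rewrite (goursat (fd k)) // sub0r cmodN => H; apply: le_trans (H _) _.
  by move=> x y xin yin; apply: kP; split; rewrite /= ler_norml; lra.
rewrite -/K (_ : _ * K = e * (4 * K / (4 * K + 1))); last by field; rewrite gt_eqF.
by rewrite ler_piMr ?(ltW e0) // ler_pdivrMr // mul1r lerDl.
Qed.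

End RectangleIntegral.
End Primitive.

(** * Morera's primitive and the maximum principle *)

Section Holomorphy.
Variable R : realType.
Local Notation C := (R[i]).
Implicit Types (f g : C -> C) (z w h : C) (x y r : R).

Lemma cprim_segment_cst r (phi Phi : R -> C) (c : C) (e x y : R) :
  cprim (- r - 1) phi Phi -> `|x| <= r -> `|y| <= r ->
  (forall t, `|t| <= r -> `|t - x| <= `|y - x| -> cmod (phi t - c) <= e) ->
  cmod (Phi y - Phi x - c * (y - x)%:C%C) <= 2 * e * `|y - x|.
Proof.
move=> HP xr yr He.
have := @cprim_affine R (- r - 1) c 0; set psi := (fun _ => _ + _); set Psi := (fun _ => _ + _) => Hc.
have PsiE u v : Psi u - Psi v = c * (u - v)%:C%C by rewrite /Psi rmorphB /=; ring.
have psiE t : psi t = c by rewrite /psi mul0r addr0.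
move: xr yr; rewrite !ler_norml => /andP[x1 x2] /andP[y1 y2].
case: (leP x y) => xy.
  rewrite ger0_norm ?subr_ge0 // -PsiE; apply: cprim_bound HP Hc _ xy _; first by lra.
  by move=> t /andP[t1 t2]; rewrite psiE He // ?ler_norml; [lra|rewrite !ger0_norm; lra].
have -> : Phi y - Phi x - c * (y - x)%:C%C = - (Phi x - Phi y - (Psi x - Psi y)).
  by rewrite PsiE !rmorphB /=; ring.
rewrite cmodN distrC ger0_norm ?subr_ge0 ?(ltW xy) //.
apply: cprim_bound HP Hc _ (ltW xy) _; first by lra.
by move=> t /andP[t1 t2]; rewrite psiE He // ?ler_norml; [lra|rewrite !ler0_norm; lra].
Qed.

(** Morera: the primitive integrates from 0 along the real axis and then vertically. Vanishing of
    the rectangle integrals, first extended to unordered corners, makes the other route to a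
    neighbouring point equivalent. *)
Lemma exists_primitive r f : 0 < r -> contsq r f ->
  (forall x1 x2 y1 y2, - r <= x1 -> x1 <= x2 -> x2 <= r -> - r <= y1 -> y1 <= y2 -> y2 <= r ->
    rect r f x1 x2 y1 y2 = 0) ->
  exists F, forall z, insqo r z -> cder F z (f z).
Proof.
move=> r0 cf f0.
have swapx x1 x2 y1 y2 : rect r f x2 x1 y1 y2 = - rect r f x1 x2 y1 y2 by rewrite /rect; ring.
have swapy x1 x2 y1 y2 : rect r f x1 x2 y2 y1 = - rect r f x1 x2 y1 y2 by rewrite /rect; ring.
have f0' x1 x2 y1 y2 : `|x1| <= r -> `|x2| <= r -> `|y1| <= r -> `|y2| <= r -> rect r f x1 x2 y1 y2 = 0.
  move=> X1 X2; wlog x12 : x1 x2 X1 X2 / x1 <= x2.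
    by move=> W Y1 Y2; case: (leP x1 x2) => [/W->//|/ltW /W H]; rewrite swapx H // oppr0.
  move=> Y1 Y2; wlog y12 : y1 y2 Y1 Y2 / y1 <= y2.
    by move=> W; case: (leP y1 y2) => [/W->//|/ltW /W H]; rewrite swapy H // oppr0.
  by apply: f0; move: X1 X2 Y1 Y2; rewrite !ler_norml => /andP[? ?] /andP[? ?] /andP[? ?] /andP[? ?].
exists (fun z => (hprim r f 0 (complex.Re z) - hprim r f 0 0) +
  'i%C * (vprim r f (complex.Re z) (complex.Im z) - vprim r f (complex.Re z) 0)).
move=> [x y] [/= xr yr] e e0.
have e4 : 0 < e / 4 by rewrite divr_gt0.
have zr : insq r (x +i* y)%C by split; exact: ltW.
have [d d0 cd] := cf _ zr _ e4.
exists (Num.min d (Num.min (r - `|x|) (r - `|y|))); first by rewrite !lt_min d0 !subr_gt0 xr.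
move=> [h1 h2]; rewrite !lt_min /= => /and3P[hd hx hy].
have h1h := ler_Re_cmod (h1 +i* h2)%C; have h2h := ler_Im_cmod (h1 +i* h2)%C.
rewrite /= in h1h h2h.
have x'r : `|x + h1| <= r by apply: le_trans (ler_normD _ _) _; lra.
have y'r : `|y + h2| <= r by apply: le_trans (ler_normD _ _) _; lra.
(* This rectangle trades the horizontal step on the real axis for the same step at height [y], next
   to the point where the derivative is taken. *)
have := f0' x (x + h1) 0 y (ltW xr) x'r _ (ltW yr); rewrite normr0 => /(_ (ltW r0)).
rewrite /rect => RE.
set a := hprim r f 0 x; set b := hprim r f 0 (x + h1).
set F1 := hprim r f y (x + h1) - hprim r f y x - f (x +i* y)%C * (x + h1 - x)%:C%C.
set F2 := vprim r f (x + h1) (y + h2) - vprim r f (x + h1) y - f (x +i* y)%C * (y + h2 - y)%:C%C.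
have -> : b - hprim r f 0 0 + 'i%C * (vprim r f (x + h1) (y + h2) - vprim r f (x + h1) 0)
   - (a - hprim r f 0 0 + 'i%C * (vprim r f x y - vprim r f x 0)) - f (x +i* y)%C * (h1 +i* h2)%C
   = F1 + 'i%C * F2.
  have -> : (h1 +i* h2)%C = (x + h1 - x)%:C%C + 'i%C * (y + h2 - y)%:C%C :> C.
    by apply/eqP; rewrite eq_complex /=; apply/andP; split; apply/eqP; ring.
  apply/eqP; rewrite -subr_eq0; rewrite -/a -/b in RE.
  rewrite -[X in _ == X]RE /F1 /F2; apply/eqP; ring.
have B1 : cmod F1 <= 2 * (e / 4) * `|x + h1 - x|.
  rewrite /F1; apply: cprim_segment_cst (hprimP (ltW r0) y cf) (ltW xr) x'r _.
  move=> t tr tx; rewrite !clamp_id // ?(ltW yr) //; apply: cd; first by split => //; exact: ltW.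
  apply: le_lt_trans hd; apply: le_trans (ler_cmod_ReIm _) _.
  rewrite /= subrr normr0 addr0; apply: le_trans tx _.
  by rewrite (addrC x) addrK.
have B2 : cmod F2 <= 2 * (e / 4) * `|y + h2 - y|.
  rewrite /F2; apply: cprim_segment_cst (vprimP (ltW r0) (x + h1) cf) (ltW yr) y'r _.
  move=> t tr tx; rewrite !clamp_id //; apply: cd; first by split.
  apply: le_lt_trans hd; rewrite (addrC y) addrK in tx.
  rewrite -(ler_pXn2r (n := 2)) ?nnegrE // !cmod_sqr /= (addrC x) addrK lerD2l.
  exact: ler_norm_sqr_norm.
apply: le_trans (ler_cmodD _ _) _; rewrite cmodM cmod_i mul1r.
move: B1 B2; rewrite (addrC x) addrK (addrC y) addrK => B1 B2.
have : (e / 4) * `|h1| <= (e / 4) * cmod (h1 +i* h2)%C by rewrite ler_wpM2l // ltW.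
have : (e / 4) * `|h2| <= (e / 4) * cmod (h1 +i* h2)%C by rewrite ler_wpM2l // ltW.
lra.
Qed.

Lemma exists_primitive_ulim r (f_ : nat -> C -> C) f : 0 < r ->
  (forall k z, insq r z -> exists d, cder (f_ k) z d) ->
  (forall e : R, 0 < e -> exists k, forall z, insq r z -> cmod (f_ k z - f z) <= e) ->
  exists F, forall z, insqo r z -> cder F z (f z).
Proof.
move=> r0 fd fu; apply: exists_primitive => //.
  by case: (rect_ulim (ltW r0) 0 0 0 0 fd fu).
by move=> x1 x2 y1 y2 *; case: (rect_ulim (ltW r0) x1 x2 y1 y2 fd fu) => _; apply.
Qed.

Definition contsqR r (u : C -> R) := forall z, insq r z -> forall e : R, 0 < e ->
  exists2 d : R, 0 < d & forall w, insq r w -> cmod (w - z) < d -> `|u w - u z| <= e.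

Lemma contsqR_cmod_sqr r f : contsq r f -> contsqR r (fun z => cmod (f z) ^+ 2).
Proof.
move=> cf z zr e e0; pose K := 2 * cmod (f z) + 1.
have K0 : 0 < K by rewrite ltr_wpDl // mulr_ge0.
have [|d d0 H] := cf z zr (Num.min 1 (e / K)); first by rewrite lt_min ltr01 divr_gt0.
exists d => // w wr wz; have := H w wr wz; rewrite le_min ler_pdivlMr // => /andP[a1 aK].
rewrite subr_sqr normrM.
have b1 : `|cmod (f w) - cmod (f z)| <= cmod (f w - f z).
  by rewrite ler_norml ler_cmod_dist lerNl opprB cmodB ler_cmod_dist.
apply: le_trans aK; apply: ler_pM => //; rewrite ger0_norm ?addr_ge0 // /K.
by have := le_trans (ler_norm _) b1; lra.
Qed.

Lemma contsqRD r (u v : C -> R) : contsqR r u -> contsqR r v -> contsqR r (fun z => u z + v z).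
Proof.
move=> cu cv z zr e e0; have e2 : 0 < e / 2 by rewrite divr_gt0.
have [d d0 H] := cu z zr _ e2; have [d' d'0 H'] := cv z zr _ e2.
exists (Num.min d d'); first by rewrite lt_min d0.
move=> w wr; rewrite lt_min => /andP[w1 w2].
rewrite opprD addrACA; apply: le_trans (ler_normD _ _) _.
by have := H w wr w1; have := H' w wr w2; lra.
Qed.

Lemma contsqRZ r (c : R) (u : C -> R) : contsqR r u -> contsqR r (fun z => c * u z).
Proof.
move=> cu z zr e e0; have K0 : 0 < `|c| + 1 by rewrite ltr_wpDl.
have [|d d0 H] := cu z zr (e / (`|c| + 1)); first by rewrite divr_gt0.
exists d => // w wr wz; rewrite -mulrBr normrM; have := H w wr wz.
rewrite ler_pdivlMr // mulrC => He; apply: le_trans He.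
by rewrite ler_wpM2r // lerDl.
Qed.

(** Clamped coordinates turn [u] into a continuous function on the plane, to which the extreme value
    theorem on a product of two segments applies. *)
Lemma contsqR_max r (u : C -> R) : 0 <= r -> contsqR r u ->
  exists2 z, insq r z & forall w, insq r w -> u w <= u z.
Proof.
move=> r0 cu.
pose U (p : R * R) := u (clamp r p.1 +i* clamp r p.2)%C.
have cU : continuous U.
  move=> p; apply/cvgrPdist_le => e e0.
  have cr q : insq r (clamp r q.1 +i* clamp r q.2)%C by split; exact: clamp_in.
  have [d d0 H] := cu _ (cr p) _ e0.
  exists (ball p.1 (d / 2), ball p.2 (d / 2)).
    by split; apply: nbhsx_ballx; rewrite divr_gt0.
  move=> q [/= q1 q2]; rewrite /U distrC; apply: H => //.
  apply: le_lt_trans (ler_cmod_ReIm _) _ => /=.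
  have := clamp_lip r q.1 p.1; have := clamp_lip r q.2 p.2.
  by rewrite /ball /= distrC in q1; rewrite /ball /= distrC in q2; lra.
have cK : compact ([set` `[- r, r]] `*` [set` `[- r, r]] : set (R * R)).
  by apply: compact_setX; exact: segment_compact.
have [||p pK pmax] := @compact_EVT_max (R * R)%type R U _ _ cK.
- by exists (0, 0); split; rewrite /= in_itv /= oppr_le0 r0.
- exact: continuous_subspaceT.
move: pK; rewrite inE => -[]; rewrite /= !in_itv /= => p1 p2.
have p1' : `|p.1| <= r by rewrite ler_norml.
have p2' : `|p.2| <= r by rewrite ler_norml.
exists (p.1 +i* p.2)%C; first by split.
move=> [a b] [/= ar br]; have := pmax (a, b); rewrite inE /U /= !clamp_id //; apply.
by split; rewrite /= in_itv /= -ler_norml.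
Qed.

(** Two complex derivatives are postulated instead of being derived from one. They come for free for
    a primitive of a primitive, and the maximum principle needs no more. *)
Definition C2on r f f1 f2 := forall z, insqo r z -> cder f z (f1 z) /\ cder f1 z (f2 z).

Lemma insqo_nbhs r z : insqo r z -> exists2 d : R, 0 < d & forall h, cmod h < d -> insqo r (z + h).
Proof.
case: z => x y [/= xr yr]; exists (Num.min (r - `|x|) (r - `|y|)); first by rewrite lt_min !subr_gt0 xr.
move=> h; rewrite lt_min => /andP[hx hy].
have := ler_Re_cmod h; have := ler_Im_cmod h; case: h hx hy => a b /= hx hy ia ib.
by split; rewrite /=; apply: le_lt_trans (ler_normD _ _) _; lra.
Qed.

Lemma cder_shift f z w d : cder f (z + w) d -> cder (fun v => f (z + v)) w d.
Proof.
by move=> fd e e0; have [r r0 H] := fd e e0; exists r => // h hr; rewrite addrA; exact: H.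
Qed.

(** The segment bound is applied to [f] minus its second order Taylor polynomial; the derivative of
    this difference is the first order error of [f1], at most [e / 2 |h|] on the segment. *)
Lemma taylor2 r f f1 f2 z : C2on r f f1 f2 -> insqo r z -> forall e : R, 0 < e ->
  exists2 d : R, 0 < d & forall h, cmod h < d ->
    cmod (f (z + h) - f z - f1 z * h - f2 z / 2 * h ^+ 2) <= e * cmod h ^+ 2.
Proof.
move=> fC zr e e0; have [d1 d10 H1] := insqo_nbhs zr.
have e2 : 0 < e / 2 by rewrite divr_gt0.
have [d2 d20 H2] := (fC z zr).2 _ e2.
exists (Num.min d1 d2); first by rewrite lt_min d10.
move=> h; rewrite lt_min => /andP[hd1 hd2].
pose T v := f (z + v) + ((- f z) + (- f1 z) * v + (- (f2 z / 2)) * (v * v)).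
have th (t : R) : 0 <= t <= 1 -> cmod (t%:C%C * h) <= cmod h.
  by move=> /andP[t0 t1]; rewrite cmodM cmod_real ger0_norm // ler_piMl.
have Td (t : R) : 0 <= t <= 1 -> cder T (0 + t%:C%C * h) (f1 (z + (0 + t%:C%C * h)) - f1 z - f2 z * (0 + t%:C%C * h)).
  move=> t01; rewrite add0r; set v := t%:C%C * h.
  have -> : f1 (z + v) - f1 z - f2 z * v = f1 (z + v) + (0 + (0 * v + (- f1 z) * 1) + (0 * (v * v) + (- (f2 z / 2)) * (1 * v + v * 1))) by field.
  apply: cderD.
    by apply: cder_shift; apply: (fC _ _).1; apply: H1; apply: le_lt_trans (th t t01) _.
  apply: cderD; [apply: cderD; [exact: cder_cst|]|].
    by apply: cderM; [exact: cder_cst|exact: cder_id].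
  by apply: cderM; [exact: cder_cst|apply: cderM; exact: cder_id].
have := @cder_segment_bound R T (fun v => f1 (z + v) - f1 z - f2 z * v) 0 h (e / 2 * cmod h) Td.
rewrite add0r => B.
have -> : f (z + h) - f z - f1 z * h - f2 z / 2 * h ^+ 2 = T h - T 0.
  by rewrite /T addr0; ring.
apply: le_trans (B _) _.
- by move=> t t01; rewrite add0r; apply: le_trans (H2 _ (le_lt_trans (th t t01) hd2)) _; rewrite ler_wpM2l ?th // ltW.
- by rewrite expr2; lra.
Qed.

(** Orthogonality of [1, w, w^2] on the fourth roots of unity: the left side sums
    [|a + b w + c w^2|^2] over them. *)
Lemma parallelogram4 (a b c : C) :
  cmod (a + b + c) ^+ 2 + cmod (a + 'i%C * b - c) ^+ 2 + cmod (a - b + c) ^+ 2 + cmod (a - 'i%C * b - c) ^+ 2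
  = 4 * (cmod a ^+ 2 + cmod b ^+ 2 + cmod c ^+ 2).
Proof. by case: a => a1 a2; case: b => b1 b2; case: c => c1 c2; rewrite !cmod_sqr /=; ring. Qed.

Lemma cmod_sqr_perturb (w v : C) (K s : R) : cmod w <= K -> cmod (v - w) <= s ->
  cmod w ^+ 2 - 2 * K * s <= cmod v ^+ 2.
Proof.
move=> wK vw; have := ler_cmod_dist w v; rewrite cmodB => H.
have s0 : 0 <= s by apply: le_trans vw.
have w0 := cmod_ge0 w; have v0 := cmod_ge0 v.
case: (leP (cmod w) s) => ws; nra.
Qed.

(* Adding [e |z|^2] to [|f|^2] makes the mean over four symmetric neighbours strictly larger than the value at the centre. *)
Lemma max_principle r rho f f1 f2 (M : R) : C2on r f f1 f2 -> 0 < rho -> rho < r -> 0 <= M ->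
  (forall z, insq rho z -> ~ insqo rho z -> cmod (f z) <= M) ->
  forall z, insq rho z -> cmod (f z) <= M.
Proof.
move=> fC rho0 rr M0 fM z zr; rewrite leNgt; apply/negP => Mz.
(* Small enough that the added [e |w|^2], at most [2 e rho^2] on the square, cannot move the maximum
   to the boundary. *)
pose e := (cmod (f z) ^+ 2 - M ^+ 2) / (2 * rho ^+ 2 + 1).
have K1 : 0 < 2 * rho ^+ 2 + 1 by rewrite ltr_wpDl // mulr_ge0 // sqr_ge0.
have e0 : 0 < e by rewrite divr_gt0 // subr_gt0 ltr_pXn2r ?nnegrE.
have eE : e * (2 * rho ^+ 2 + 1) = cmod (f z) ^+ 2 - M ^+ 2 by rewrite divfK // gt_eqF.
have sub w : insq rho w -> insqo r w by move=> [a b]; split; [apply: le_lt_trans a _|apply: le_lt_trans b _].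
have cf : contsq rho f.
  move=> w wr; have := cder_cont (fC w (sub w wr)).1 => c d d0; have [s s0 H] := c d d0.
  by exists s => // v _ vw; have := H (v - w) vw; rewrite (addrC w) subrK.
pose u w := cmod (f w) ^+ 2 + e * cmod w ^+ 2.
have cu : contsqR rho u.
  apply: contsqRD; first exact: contsqR_cmod_sqr.
  apply: contsqRZ; apply: (@contsqR_cmod_sqr rho id).
  by move=> w _ d d0; exists d => // v _ /ltW.
have [z1 z1r umax] := contsqR_max (ltW rho0) cu.
have uz := umax z zr.
have z1o : insqo rho z1.
  apply: contrapT => nz; have := fM _ z1r nz => fz1.
  have : u z1 <= M ^+ 2 + e * (2 * rho ^+ 2).
    apply: lerD; first by rewrite ler_pXn2r ?nnegrE.
    rewrite ler_wpM2l ?(ltW e0) // cmod_sqr; case: z1r => /ler_norm_sqr a /ler_norm_sqr b; lra.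
  have : 0 <= e * cmod z ^+ 2 by rewrite mulr_ge0 ?(ltW e0) ?sqr_ge0.
  by rewrite /u in uz *; lra.
have [d1 d10 H1] := insqo_nbhs z1o.
set a := f z1; set b := f1 z1; set c := f2 z1 / 2.
pose K := cmod a + cmod b + cmod c + 1.
have K0 : 0 < K by rewrite ltr_wpDl // !addr_ge0.
(* With this tolerance the Taylor error changes each of the four squares by at most [e d^2 / 2],
   less than the gain [e d^2] due to the added term. *)
have s0 : 0 < e / (4 * K) by rewrite divr_gt0 // mulr_gt0.
have [d2 d20 T] := taylor2 fC (sub _ z1r) s0.
pose m := Num.min 1 (Num.min d1 d2).
have m0 : 0 < m by rewrite !lt_min ltr01 d10.
pose d := m / 2.
have d0 : 0 < d by rewrite divr_gt0.
have dm : d < m by rewrite /d; lra.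
move: dm; rewrite !lt_min => /and3P[dl1 dd1 dd2].
set s := e / (4 * K) in s0 T.
have dC : cmod (d%:C%C : C) = d by rewrite cmod_real gtr0_norm.
have key w v : cmod v = d -> w = a + b * v + c * v ^+ 2 ->
   cmod w ^+ 2 - 2 * K * (s * d ^+ 2) <= cmod (f (z1 + v)) ^+ 2.
  move=> vd ->; apply: cmod_sqr_perturb.
    apply: le_trans (ler_cmodD _ _) _; apply: le_trans (lerD (ler_cmodD _ _) (lexx _)) _.
    rewrite (cmodM b) (cmodM c) cmodX vd /K.
    have : cmod b * d <= cmod b by rewrite ler_piMr // ltW.
    have : cmod c * d ^+ 2 <= cmod c by rewrite ler_piMr // expr_le1 // ltW.
    lra.
  have := T v; rewrite vd => /(_ dd2); rewrite -/a -/b -/c.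
  by have -> : f (z1 + v) - (a + b * v + c * v ^+ 2) = f (z1 + v) - a - b * v - c * v ^+ 2 by ring.
have iC : cmod ('i%C * d%:C%C : C) = d by rewrite cmodM cmod_i mul1r.
have i2 : ('i%C : C) ^+ 2 = -1 by exact: sqr_i.
have k1 := key (a + b * d%:C%C + c * d%:C%C ^+ 2) d%:C%C dC erefl.
have k2 := key (a + 'i%C * (b * d%:C%C) - c * d%:C%C ^+ 2) ('i%C * d%:C%C) iC ltac:(by rewrite exprMn i2; ring).
have k3 := key (a - b * d%:C%C + c * d%:C%C ^+ 2) (- d%:C%C) (etrans (cmodN _) dC) ltac:(by ring).
have k4 := key (a - 'i%C * (b * d%:C%C) - c * d%:C%C ^+ 2) (- ('i%C * d%:C%C)) (etrans (cmodN _) iC) ltac:(by rewrite sqrrN exprMn i2; ring).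
have ins v : cmod v = d -> u (z1 + v) <= u z1.
  move=> vd; apply: umax; have [? ?] : insqo rho (z1 + v) by apply: H1; rewrite vd.
  by split; exact: ltW.
have u1 := ins _ dC; have u2 := ins _ iC.
have u3 := ins _ (etrans (cmodN _) dC); have u4 := ins _ (etrans (cmodN _) iC).
have P := parallelogram4 a (b * d%:C%C) (c * d%:C%C ^+ 2).
have Q := parallelogram4 z1 d%:C%C 0; rewrite dC cmod0 !addr0 !subr0 in Q.
rewrite /u -/a in u1 u2 u3 u4.
have Ks : 2 * K * (s * d ^+ 2) = e * d ^+ 2 / 2 by rewrite /s; field; rewrite gt_eqF.
have ed : 0 < e * d ^+ 2 by rewrite mulr_gt0 // exprn_gt0.
have bb := sqr_ge0 (cmod (b * d%:C%C)); have cc := sqr_ge0 (cmod (c * d%:C%C ^+ 2)).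
have {}Q : e * cmod (z1 + d%:C%C) ^+ 2 + e * cmod (z1 + 'i%C * d%:C%C) ^+ 2 + e * cmod (z1 - d%:C%C) ^+ 2 + e * cmod (z1 - 'i%C * d%:C%C) ^+ 2
   = 4 * (e * cmod z1 ^+ 2) + 4 * (e * d ^+ 2) by rewrite -!mulrDr Q; ring.
rewrite Ks in k1 k2 k3 k4; lra.
Qed.

End Holomorphy.

(** * The identity theorem and uniqueness of the continuation *)

Section IdentityTheorem.
Variable R : realType.
Local Notation C := (R[i]).
Implicit Types (f g : C -> C) (z w h p q : C) (x y r : R).

Lemma insq_cmod r z : cmod z <= r -> insq r z.
Proof.
by move=> H; split; apply: le_trans H; [exact: ler_Re_cmod|exact: ler_Im_cmod].
Qed.

Lemma insqo_cmod r z : cmod z < r -> insqo r z.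
Proof.
by move=> H; split; apply: le_lt_trans H; [exact: ler_Re_cmod|exact: ler_Im_cmod].
Qed.

Lemma cmod_boundary r z : 0 <= r -> insq r z -> ~ insqo r z -> r <= cmod z.
Proof.
move=> r0 _ nz; rewrite leNgt; apply/negP => /insqo_cmod; exact: nz.
Qed.

Definition flat0 r g (d : R) := exists g1 g2, C2on r g g1 g2 /\
  forall z, cmod z < d -> g z = 0.

Lemma cder_locally0 g (d : R) z e : (forall w, cmod w < d -> g w = 0) -> cmod z < d ->
  cder g z e -> e = 0.
Proof.
move=> g0 zd ge; apply: (cder_unique ge).
apply: (@cder_ext _ (fun=> 0) g z 0 (d - cmod z)); rewrite ?subr_gt0 //; last exact: cder_cst.
by move=> h hd; rewrite g0 //; apply: le_lt_trans (ler_cmodD _ _) _; lra.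
Qed.

Lemma cder_locally0' g (d : R) z : (forall w, cmod w < d -> g w = 0) -> cmod z < d ->
  cder g z 0.
Proof.
move=> g0 zd; apply: (@cder_ext _ (fun=> 0) g z 0 (d - cmod z)); rewrite ?subr_gt0 //; last exact: cder_cst.
by move=> h hd; rewrite g0 //; apply: le_lt_trans (ler_cmodD _ _) _; lra.
Qed.

(** Near 0 the quotient vanishes identically, whatever the value of the inverse at 0; away from 0
    the product rule gives both derivatives explicitly. *)
Lemma flat0_divz r g (d : R) : 0 < r -> 0 < d -> d <= r -> flat0 r g d -> flat0 r (fun z => g z * z^-1) d.
Proof.
move=> r0 d0 dr [g1 [g2 [gC g0]]].
have g10 w : cmod w < d -> g1 w = 0.
  by move=> wd; apply: (cder_locally0 g0 wd (gC w _).1); apply: insqo_cmod; exact: lt_le_trans wd dr.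
pose G1 z := g1 z * z^-1 + g z * - (z^-1 * z^-1).
have G10 w : cmod w < d -> G1 w = 0 by move=> wd; rewrite /G1 g10 // g0 // !mul0r addr0.
exists G1.
exists (fun z => (g2 z * z^-1 + g1 z * - z ^- 2) +
   (g1 z * - (z^-1 * z^-1) + g z * (0 * (z^-1 * z^-1) + -1 * (- z ^- 2 * z^-1 + z^-1 * - z ^- 2)))).
split; last by move=> z zd; rewrite g0 // mul0r.
move=> z zr; have [d1 d2] := gC z zr; have [z0|z0] := eqVneq z 0.
  have zd : cmod z < d by rewrite z0 cmod0.
  have gz0 w : cmod w < d -> g w * w^-1 = 0 by move=> wd; rewrite g0 // mul0r.
  split; first by rewrite (G10 z zd); exact: (@cder_locally0' (fun w => g w * w^-1) d z gz0 zd).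
  set v := (X in cder _ _ X); have -> : v = 0; last exact: (cder_locally0' G10 zd).
  by rewrite /v (g10 z zd) (g0 z zd) z0 invr0 !(mul0r, mulr0) !addr0.
have iz := cderV z0.
split; first by rewrite /G1 -expr2 exprVn; exact: cderM.
apply: cderD; first exact: cderM.
apply: cderM => //.
apply: (@cder_ext _ (fun w => -1 * (w^-1 * w^-1)) _ _ _ 1) => // [h _|]; first by rewrite mulN1r.
by apply: cderM; [exact: cder_cst|exact: cderM].
Qed.

(** A function that is flat at 0 may be divided by every power of [z]. The maximum principle for
    [g / z^N] on the square of half-side [rho] gives [|g(z)| <= M (|z| / rho)^N], and [N] tends to
    infinity: a substitute for power series. *)
Lemma flat0_eq0 r g (d : R) : 0 < r -> 0 < d -> d <= r -> flat0 r g d ->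
  forall z, cmod z < r -> g z = 0.
Proof.
move=> r0 d0 dr gF z zr.
have [z0|z0] := eqVneq z 0; first by case: gF => [? [? [_ ->]]] //; rewrite z0 cmod0.
have zp : 0 < cmod z by rewrite cmod_gt0.
pose rho := (cmod z + r) / 2.
have rho1 : cmod z < rho by rewrite /rho; lra.
have rho2 : rho < r by rewrite /rho; lra.
have rho0 : 0 < rho by exact: lt_trans rho1.
have gN N : flat0 r (fun w => g w * w^-1 ^+ N) d.
  elim: N => [|N IH].
    by rewrite (_ : (fun w => _) = g) //; apply/funext => w; rewrite expr0 mulr1.
  have := flat0_divz r0 d0 dr IH.
  by congr flat0; apply/funext => w; rewrite -mulrA -exprSr.
have [g1 [g2 [gC _]]] := gF.
have sub w : insq rho w -> insqo r w by move=> [a b]; split; [apply: le_lt_trans a _|apply: le_lt_trans b _].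
have cf : contsq rho g.
  move=> w wr; have := cder_cont (gC w (sub w wr)).1 => c e e0; have [s s0 H] := c e e0.
  by exists s => // v _ vw; have := H (v - w) vw; rewrite (addrC w) subrK.
have [z1 z1r zmax] := contsqR_max (ltW rho0) (contsqR_cmod_sqr cf).
pose M := cmod (g z1).
have gM w : insq rho w -> cmod (g w) <= M.
  by move=> /zmax; rewrite ler_pXn2r ?nnegrE.
have M0 : 0 <= M by exact: cmod_ge0.
have B N : cmod (g z) <= M * (cmod z / rho) ^+ N.
  have [G1 [G2 [GC _]]] := gN N.
  have MN : 0 <= M / rho ^+ N by rewrite divr_ge0 // exprn_ge0 // ltW.
  have := max_principle GC rho0 rho2 MN _ (insq_cmod (ltW rho1)).
  rewrite cmodM cmodX cmodV exprVn => H.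
  rewrite expr_div_n mulrA [M * _]mulrC -mulrA -ler_pdivrMl ?exprn_gt0 // mulrC; apply: H.
  move=> w wr wb; rewrite cmodM cmodX cmodV exprVn; apply: ler_pM; rewrite ?invr_ge0 ?exprn_ge0 //.
  - exact: gM.
  - have wrho := cmod_boundary (ltW rho0) wr wb.
    rewrite lef_pV2 ?posrE ?exprn_gt0 ?(lt_le_trans rho0 wrho) //.
    by apply: lerXn2r; rewrite ?nnegrE ?(ltW rho0).
apply/eqP; rewrite -cmod_eq0 eq_le cmod_ge0 andbT.
have [Mz|Mz] := eqVneq M 0; first by have := B 0%N; rewrite Mz mul0r.
have {Mz} Mp : 0 < M by rewrite lt_def Mz.
rewrite leNgt; apply/negP => gp.
have t0 : 0 <= cmod z / rho by rewrite divr_ge0 // ltW.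
have t1 : `|cmod z / rho| < 1 by rewrite ger0_norm // ltr_pdivrMr // mul1r.
have /cvgrPdist_lt := cvg_expr t1 => /(_ (cmod (g z) / M)).
rewrite divr_gt0 // => /(_ isT)[N _ /(_ N (leqnn N))] /=.
rewrite sub0r normrN ger0_norm ?exprn_ge0 // ltr_pdivlMr // mulrC.
by rewrite ltNge B.
Qed.

(** The limit [D] is only known to have primitives, so it is integrated twice; [G], the second
    primitive minus its affine part, has second derivative [D], vanishes where [D] does near 0, and
    falls under [flat0_eq0]. The second integration costs half of the radius. *)
Lemma identity_theorem0 r (D_ : nat -> C -> C) D (d : R) : 0 < r -> 0 < d ->
  (forall k z, insq r z -> exists e, cder (D_ k) z e) ->
  (forall e : R, 0 < e -> exists k, forall z, insq r z -> cmod (D_ k z - D z) <= e) ->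
  (forall z, cmod z < d -> D z = 0) ->
  forall z, cmod z < r / 2 -> D z = 0.
Proof.
move=> r0 d0 Dd Du D0 z zr.
have [F FD] := exists_primitive_ulim r0 Dd Du.
have r20 : 0 < r / 2 by rewrite divr_gt0.
have sub w : insq (r / 2) w -> insqo r w.
  by move=> [a b]; split; [apply: le_lt_trans a _|apply: le_lt_trans b _]; rewrite ltr_pdivrMr //; lra.
have [||H HF] := @exists_primitive_ulim _ (r / 2) (fun=> F) F r20.
- by move=> _ w /sub /FD Fw; exists (D w).
- by move=> e e0; exists 0%N => w _; rewrite subrr cmod0 ltW.
pose d' := Num.min d (r / 2).
have d'0 : 0 < d' by rewrite lt_min d0.
have d'r : d' <= r / 2 by rewrite ge_min lexx orbT.
have d'd : d' <= d by rewrite ge_min lexx.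
have ts (t : R) w : 0 <= t <= 1 -> cmod (0 + t%:C%C * w) <= cmod w.
  by move=> /andP[t0 t1]; rewrite add0r cmodM cmod_real ger0_norm // ler_piMl.
have Fc w : cmod w < d' -> F w = F 0.
  move=> wd; apply/eqP; rewrite -subr_eq0 -cmod_eq0 eq_le cmod_ge0 andbT.
  have := @cder_segment_bound _ F D 0 w 0; rewrite add0r mul0r mulr0; apply.
    move=> t t01; apply: FD; apply: insqo_cmod; apply: le_lt_trans (ts t w t01) _.
    by apply: lt_trans (lt_le_trans wd d'r) _; rewrite ltr_pdivrMr //; lra.
  move=> t t01; rewrite D0 ?cmod0 //; apply: le_lt_trans (ts t w t01) _; exact: lt_le_trans wd d'd.
pose G w := H w + (- F 0 * w + - H 0).
have GC : C2on (r / 2) G (fun w => F w + - F 0) D.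
  move=> w wr; split.
    rewrite -[- F 0]addr0; apply: cderD; first exact: HF.
    apply: cderD; last exact: cder_cst.
    have := cderM (cder_cst (- F 0) w) (cder_id w); rewrite mul0r add0r mulr1.
    exact.
  rewrite -[D w]addr0; apply: cderD; last exact: cder_cst.
  by apply: FD; apply: sub; case: wr => a b; split; exact: ltW.
have G0 w : cmod w < d' -> G w = 0.
  move=> wd; apply/eqP; rewrite -cmod_eq0 eq_le cmod_ge0 andbT.
  have -> : G w = G (0 + w) - G 0 by rewrite add0r /G mulr0 add0r subrr subr0.
  have := @cder_segment_bound _ G (fun w => F w + - F 0) 0 w 0; rewrite mul0r mulr0; apply.
    move=> t t01; apply: (GC _ _).1; apply: insqo_cmod; apply: le_lt_trans (ts t w t01) _.
    exact: lt_le_trans wd d'r.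
  by move=> t t01; rewrite Fc ?subrr ?cmod0 //; apply: le_lt_trans (ts t w t01) _.
have Gz w : cmod w < r / 2 -> G w = 0.
  by apply: (flat0_eq0 r20 d'0 d'r); exists (fun w => F w + - F 0), D; split.
have G1z w : cmod w < r / 2 -> F w + - F 0 = 0.
  by move=> wr; apply: cder_locally0 Gz wr (GC w (insqo_cmod wr)).1.
exact: cder_locally0 G1z zr (GC z (insqo_cmod zr)).2.
Qed.

Lemma identity_theorem r (D_ : nat -> C -> C) D p (d : R) : 0 < r -> 0 < d ->
  (forall k z, insq r (z - p) -> exists e, cder (D_ k) z e) ->
  (forall e : R, 0 < e -> exists k, forall z, insq r (z - p) -> cmod (D_ k z - D z) <= e) ->
  (forall z, cmod (z - p) < d -> D z = 0) ->
  forall z, cmod (z - p) < r / 2 -> D z = 0.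
Proof.
move=> r0 d0 Dd Du D0 z zr.
have E w : p + w - p = w by rewrite addrC addKr.
have -> : D z = D (p + (z - p)) by rewrite addrC subrK.
apply: (@identity_theorem0 r (fun k w => D_ k (p + w)) (fun w => D (p + w)) d) => //.
- move=> k w wr; have [|e He] := Dd k (p + w); first by rewrite E.
  by exists e; apply: cder_shift.
- by move=> e e0; have [k kP] := Du e e0; exists k => w wr; apply: kP; rewrite E.
- by move=> w wd; apply: D0; rewrite E.
Qed.

Lemma near_cball p (P : C -> Prop) : (\forall z \near (p : C^o), P z) <->
  exists2 r : R, 0 < r & forall z, cmod (z - p) < r -> P z.
Proof.
split.
  move=> /nbhs_ballP[e /= e0 H].
  have [r rE] : exists r : R, e = (r%:C)%C by apply/complex_realP; rewrite realE ltW.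
  exists r; first by rewrite -ltcR -rE.
  by move=> z zr; apply: H; rewrite /ball /= distrC normc_cmod rE ltcR.
move=> [r r0 H]; apply/nbhs_ballP; exists (r%:C)%C; first by rewrite /= ltcR.
by move=> z; rewrite /ball /= distrC normc_cmod ltcR; exact: H.
Qed.

(** The centre is excluded because the value of a meromorphic function at a pole is
    unconstrained. *)
Definition punctured_eq f (K A : C -> C) p :=
  exists2 r : R, 0 < r & forall z, 0 < cmod (z - p) -> cmod (z - p) < r -> f z * K z = A z.

(** Locally uniform convergence on the half-plane [Re > s0]; the radius is chosen before the
    tolerance. *)
Definition loc_unif (s0 : R) (K_ : nat -> C -> C) (K : C -> C) := forall p, s0 < complex.Re p ->
  exists2 r : R, 0 < r & forall e : R, 0 < e -> exists N, forall k z, (N <= k)%N ->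
    cmod (z - p) < r -> cmod (K_ k z - K z) <= e.

Definition centire (f : C -> C) := forall z, exists d, cder f z d.

(** Multiplying by [(z - p)^m] clears the pole: [D = h K - (z - p)^m A] is a uniform limit of
    holomorphic functions and equals [(z - p)^m (f K - A)] off [p]. It vanishes near one point close
    to [q], hence on a disc that covers all points near [p]. *)
Lemma punctured_eq_local f (s0 : R) (K_ A_ : nat -> C -> C) K A p : meromorphic f ->
  (forall k, centire (K_ k)) -> (forall k, centire (A_ k)) ->
  loc_unif s0 K_ K -> loc_unif s0 A_ A -> s0 < complex.Re p ->
  exists2 r : R, 0 < r & forall q q', cmod (q - p) < r -> cmod (q' - p) < r ->
    punctured_eq f K A q -> punctured_eq f K A q'.
Proof.
move=> fm Kd Ad Ku Au sp.
have [m [h [hh hf]]] := fm p.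
move: hh => /near_cball[r1 r10 hd].
move: hf; rewrite /dnbhs /= near_withinE => /near_cball[r2 r20 hf].
have [r3 r30 {}Ku] := Ku p sp; have [r4 r40 {}Au] := Au p sp.
pose s := Num.min (Num.min r1 r2) (Num.min r3 r4).
have s_ : 0 < s by rewrite !lt_min r10 r20 r30.
have [s1 s2 s3 s4] : [/\ s <= r1, s <= r2, s <= r3 & s <= r4].
  by split; rewrite /s !ge_min lexx ?orbT.
(* The square of half-side [8 r] about a point within [2 r] of [p] lies in the disc of radius [18 r]
   about [p], and the square of half-side [18 r] about [p] lies in the disc of radius [s = 40 r]. *)
pose r := s / 40; have r0 : 0 < r by rewrite divr_gt0.
exists r => // q q' qp q'p [d d0 Hq].
have hC : contsq (18 * r) (fun v => h (p + v)).
  apply: cder_contsq => v [va vb].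
  have [|e He] := @derivable_cder R h (p + v).
    apply: hd; rewrite addrC addKr; apply: lt_le_trans s1; apply: le_lt_trans (ler_cmod_ReIm _) _.
    by rewrite /r in va vb *; lra.
  by exists e; apply: cder_shift.
have [v0 v0r hmax] := contsqR_max (ltW (mulr_gt0 (ltr0Sn _ 17) r0)) (contsqR_cmod_sqr hC).
pose M := cmod (h (p + v0)).
have hM z : cmod (z - p) <= 18 * r -> cmod (h z) <= M.
  move=> zp; have := hmax _ (insq_cmod zp).
  by rewrite (addrC p) subrK ler_pXn2r ?nnegrE.
have M0 : 0 <= M by exact: cmod_ge0.
pose D z := h z * K z - (z - p) ^+ m * A z.
have DE z : 0 < cmod (z - p) -> cmod (z - p) < s -> D z = (z - p) ^+ m * (f z * K z - A z).
  move=> z0 zs; rewrite /D -hf; first by ring.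
    exact: lt_le_trans s2.
  by rewrite -subr_eq0 -cmod_gt0.
(* A base point close to [q] but distinct from [q] and [p]; of the two candidates tried, at most one
   equals [p]. *)
have [q1 [q1q q1dr q1p']] : exists q1, [/\ 0 < cmod (q1 - q), cmod (q1 - q) < Num.min d r & 0 < cmod (q1 - p)].
  have dr0 : 0 < Num.min d r by rewrite lt_min d0.
  pose x1 := Num.min d r / 2; pose x2 := Num.min d r / 3.
  have x10 : 0 < x1 by rewrite divr_gt0.
  have x20 : 0 < x2 by rewrite divr_gt0.
  have A1 (x : R) : 0 < x -> x < Num.min d r -> q + x%:C%C != p -> exists q1, [/\ 0 < cmod (q1 - q), cmod (q1 - q) < Num.min d r & 0 < cmod (q1 - p)].
    move=> x0 xd xp; exists (q + x%:C%C).
    have -> : q + x%:C%C - q = x%:C%C by rewrite addrC addKr.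
    by rewrite cmod_real gtr0_norm // cmod_gt0 subr_eq0.
  have [E1|] := eqVneq (q + x1%:C%C) p; last by apply: A1 => //; rewrite /x1 ltr_pdivrMr //; lra.
  apply: (A1 x2) => //; first by rewrite /x2 ltr_pdivrMr //; lra.
  rewrite -E1 -subr_eq0 opprD addrACA subrr add0r -rmorphB /= -cmod_eq0 cmod_real normr_eq0 subr_eq0.
  by rewrite /x1 /x2; apply/negP => /eqP; lra.
move: q1dr; rewrite lt_min => /andP[q1d q1r].
have q1pr : cmod (q1 - p) < 2 * r.
  by rewrite -(subrK q q1) -addrA; apply: le_lt_trans (ler_cmodD _ _) _; lra.
have tri z : cmod (z - p) <= cmod (z - q1) + cmod (q1 - p).
  by have := ler_cmodD (z - q1) (q1 - p); rewrite addrA subrK.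
pose d1 := Num.min (Num.min (cmod (q1 - q)) (d - cmod (q1 - q))) (Num.min (cmod (q1 - p)) r).
have d10 : 0 < d1 by rewrite !lt_min q1q subr_gt0 q1d q1p'.
have zE (z w w' : C) : z - w' = (z - w) + (w - w') by rewrite addrA subrK.
have D0 z : cmod (z - q1) < 4 * r -> D z = 0.
  move=> zq1; have zq1' : cmod (z - q1) < 8 * r / 2 by apply: lt_le_trans zq1 _; lra.
  have inp w : insq (8 * r) (w - q1) -> cmod (w - p) <= 18 * r.
    move=> [wa wb]; apply: le_trans (tri w) _.
    have : cmod (w - q1) <= 16 * r by apply: le_trans (ler_cmod_ReIm _) _; lra.
    lra.
  have r18 : 18 * r < s by rewrite /r; lra.
  apply: (@identity_theorem (8 * r) (fun k z => h z * K_ k z + -1 * (z - p) ^+ m * A_ k z) D q1 d1 _ _ _ _ _ z zq1') => //.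
  - by rewrite mulr_gt0.
  - move=> k w wr; have wp := inp w wr.
    have [|e1 He1] := @derivable_cder R h w.
      by apply: hd; apply: le_lt_trans wp _; exact: lt_le_trans s1.
    have [e2 He2] := Kd k w; have [e3 He3] := Ad k w.
    have [e4 He4] : exists e4, cder (fun z => -1 * (z - p) ^+ m) w e4.
      elim: (m) => [|n [e IH]]; first by exists 0; exact: cder_cst.
      exists (e * (w + - p) + -1 * (w - p) ^+ n * (1 + 0)).
      apply: (@cder_ext _ (fun z => -1 * (z - p) ^+ n * (z + - p)) _ _ _ 1) => // [v _|].
        by rewrite exprSr mulrA.
      by apply: cderM => //; apply: cderD; [exact: cder_id|exact: cder_cst].
    exists ((e1 * K_ k w + h w * e2) + (e4 * A_ k w + (-1 * (w - p) ^+ m) * e3)).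
    by apply: cderD; [exact: cderM He1 He2|exact: cderM He4 He3].
  - move=> e e0; pose P := (18 * r) ^+ m.
    have P0 : 0 <= P by rewrite exprn_ge0 // mulr_ge0 // ltW.
    have K0 : 0 < M + P + 1 by rewrite ltr_wpDl // addr_ge0.
    have e1 : 0 < e / (M + P + 1) by rewrite divr_gt0.
    have [N1 H1] := Ku _ e1; have [N2 H2] := Au _ e1.
    exists (maxn N1 N2) => w /inp wp; have ws := le_lt_trans wp r18.
    have -> : h w * K_ (maxn N1 N2) w + -1 * (w - p) ^+ m * A_ (maxn N1 N2) w - D w =
      h w * (K_ (maxn N1 N2) w - K w) - (w - p) ^+ m * (A_ (maxn N1 N2) w - A w) by rewrite /D; ring.
    apply: le_trans (ler_cmodB _ _) _; rewrite (cmodM (h w)) (cmodM ((w - p) ^+ m)) cmodX.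
    have a1 : cmod (h w) * cmod (K_ (maxn N1 N2) w - K w) <= M * (e / (M + P + 1)).
      by apply: ler_pM => //; [exact: hM|apply: H1; rewrite ?leq_maxl //; exact: lt_le_trans s3].
    have a2 : cmod (w - p) ^+ m * cmod (A_ (maxn N1 N2) w - A w) <= P * (e / (M + P + 1)).
      apply: ler_pM; rewrite ?exprn_ge0 //; first by apply: lerXn2r; rewrite ?nnegrE // mulr_ge0 // ltW.
      by apply: H2; rewrite ?leq_maxr //; exact: lt_le_trans s4.
    apply: le_trans (lerD a1 a2) _; rewrite -mulrDl mulrCA ler_piMr ?(ltW e0) //.
    by rewrite ler_pdivrMr // mul1r lerDl.
  - move=> w; rewrite /d1 !lt_min => /andP[/andP[w1 w2] /andP[w3 w4]].
    rewrite DE; last 2 first.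
    + rewrite cmod_gt0 subr_eq0; apply/eqP => wp; move: w3; rewrite wp cmodB; clear; lra.
    + by apply: le_lt_trans (tri w) _; rewrite /r in w4 q1pr; lra.
    have -> : f w * K w = A w; last by rewrite subrr mulr0.
    apply: Hq.
      by rewrite cmod_gt0 subr_eq0; apply/eqP => wq; move: w1; rewrite wq cmodB; lra.
    by rewrite (zE w q1 q); apply: le_lt_trans (ler_cmodD _ _) _; lra.
pose rho := if q' == p then r else cmod (q' - p).
have rho0 : 0 < rho by rewrite /rho; case: eqP => // /eqP qp'; rewrite cmod_gt0 subr_eq0.
exists (Num.min r rho); first by rewrite lt_min r0.
move=> z z0; rewrite lt_min => /andP[zr zrho].
have zp : 0 < cmod (z - p).
  rewrite cmod_gt0 subr_eq0; apply/eqP => zp; move: zrho z0; rewrite /rho zp.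
  by case: eqP => [->|_]; [rewrite subrr cmod0 ltxx|rewrite cmodB ltxx].
have zq' : cmod (z - p) < 2 * r by rewrite (zE z q' p); apply: le_lt_trans (ler_cmodD _ _) _; lra.
have := DE z zp; rewrite D0; last first.
  by rewrite (zE z p q1); apply: le_lt_trans (ler_cmodD _ _) _; rewrite (cmodB p); lra.
move=> H; have {}H : 0 = (z - p) ^+ m * (f z * K z - A z) by apply: H; apply: lt_trans zq' _; rewrite /r; lra.
apply/eqP; rewrite -subr_eq0; have := esym H => /eqP; rewrite mulf_eq0 expf_eq0 -[z - p == 0]cmod_eq0 (gt_eqF zp) andbF /=.
by [].
Qed.

(** On the horizontal line through [p] the identity holds far to the right. The infimum of the
    abscissas at which it holds cannot lie to the right of [p], since near that infimum
    [punctured_eq_local] carries the identity from one side to the other. *)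
Theorem continuation_unique f (s0 s1 : R) (K_ A_ : nat -> C -> C) K A : meromorphic f ->
  (forall k, centire (K_ k)) -> (forall k, centire (A_ k)) ->
  loc_unif s0 K_ K -> loc_unif s0 A_ A ->
  (forall z, s1 < complex.Re z -> f z * K z = A z) ->
  forall p, s0 < complex.Re p -> punctured_eq f K A p.
Proof.
move=> fm Kd Ad Ku Au fK [x0 y] /= sx0.
pose P x := punctured_eq f K A (x +i* y)%C.
have P1 x : s1 < x -> P x.
  move=> xs; exists (x - s1); rewrite ?subr_gt0 // => z _ zx; apply: fK.
  by have := ler_Re_cmod (z - (x +i* y)%C); rewrite raddfB /= ler_norml; lra.
have loc x : s0 < x -> exists2 r : R, 0 < r & forall x' x'', `|x' - x| < r -> `|x'' - x| < r -> P x' -> P x''.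
  move=> sx; have [|r r0 H] := @punctured_eq_local f s0 K_ A_ K A (x +i* y)%C fm Kd Ad Ku Au; first by [].
  have E (u : R) : cmod ((u +i* y)%C - (x +i* y)%C) = `|u - x|.
    have -> : (u +i* y)%C - (x +i* y)%C = (u - x)%:C%C by apply/eqP; rewrite eq_complex /= subrr !eqxx.
    by rewrite cmod_real.
  by exists r => // x' x'' h1 h2; apply: H; rewrite E.
pose S := [set x | x0 <= x /\ P x].
have hS : has_inf S.
  split; first by exists (Num.max x0 (s1 + 1)); split;
    [rewrite le_max lexx|apply: P1; rewrite lt_max ltrDl ltr01 orbT].
  by exists x0 => x [].
have xi : x0 <= inf S by apply: lb_le_inf; [case: hS|move=> x []].
have [r r0 H] := loc (inf S) (lt_le_trans sx0 xi).
have [x' [x'0 Px'] x'r] := inf_adherent r0 hS.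
have x'i : inf S <= x' by apply: ge_inf => //; case: hS.
have Q x : `|x - inf S| < r -> P x.
  by move=> xr; apply: (H x') => //; rewrite ger0_norm ?subr_ge0 // ltrBlDr addrC.
have [E|xi'] := eqVneq x0 (inf S); first by apply: Q; rewrite E subrr normr0.
have {xi'} xi' : x0 < inf S by rewrite lt_def eq_sym xi'.
pose x2 := Num.max x0 (inf S - r / 2).
have x2i : x2 < inf S by rewrite gt_max xi' /= ltrBlDr ltrDl divr_gt0.
have : inf S <= x2.
  apply: ge_inf; first by case: hS.
  split; first by rewrite le_max lexx.
  apply: Q; rewrite ltr0_norm ?subr_lt0 // opprB.
  have : inf S - r / 2 <= x2 by rewrite le_max lexx orbT.
  lra.
by rewrite leNgt x2i.
Qed.

End IdentityTheorem.

(** * The quasi-character u |-> |u|^(-2s) (u/|u|)^n *)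

Section QuasiCharacter.
Variable R : realType.
Local Notation C := (R[i]).
Implicit Types (s u v w d : C) (n : int) (x y : R).

(* [u |-> |u|^(-2 s) (u / |u|)^n], a multiplicative character of the nonzero complex numbers. *)
Definition qchar n s u : C := cpow (cmod u) (- (2 * s)) * (u / (cmod u)%:C%C) ^ n.

Definition unit_part u : C := u / (cmod u)%:C%C.

Lemma rc_neq0 x : x != 0 -> (x%:C)%C != 0 :> C.
Proof. by rewrite -cmod_eq0 cmod_real normr_eq0. Qed.

Lemma cmod_rc_neq0 u : u != 0 -> (cmod u)%:C%C != 0 :> C.
Proof. by move=> u0; apply: rc_neq0; rewrite cmod_eq0. Qed.

Lemma cmod_unit_part u : u != 0 -> cmod (unit_part u) = 1.
Proof.
move=> u0; rewrite /unit_part cmodM cmodV cmod_real ger0_norm //.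
by rewrite divff // cmod_eq0.
Qed.

Lemma cmod_expz u n : cmod (u ^ n) = cmod u ^ n.
Proof. by case: n => m; rewrite /exprz ?cmodV cmodX. Qed.

Lemma cpowM x y s : 0 < x -> 0 < y -> cpow (x * y) s = cpow x s * cpow y s :> C.
Proof. by move=> x0 y0; rewrite /cpow lnM ?posrE // rmorphD /= mulrDr cexpD. Qed.

Lemma cpow1 s : cpow 1 s = 1 :> C.
Proof. by rewrite /cpow ln1 mulr0 cexp0. Qed.

Lemma cmod_cpow x s : cmod (cpow x s) = expR (complex.Re s * ln x).
Proof. by rewrite /cpow cmod_cexp; case: s => a b /=; rewrite mulr0 subr0. Qed.

Lemma qcharM n s u v : u != 0 -> v != 0 -> qchar n s (u * v) = qchar n s u * qchar n s v.
Proof.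
move=> u0 v0; rewrite /qchar cmodM cpowM ?cmod_gt0 //.
have -> : u * v / (cmod u * cmod v)%:C%C = (u / (cmod u)%:C%C) * (v / (cmod v)%:C%C).
  by rewrite rmorphM /=; field; rewrite !cmod_rc_neq0.
by rewrite expfzMl; ring.
Qed.

Lemma qchar1 n s : qchar n s 1 = 1.
Proof. by rewrite /qchar cmod1 cpow1 divr1 exp1rz mulr1. Qed.

Lemma cmod_qchar n s u : u != 0 -> cmod (qchar n s u) = expR (- 2 * complex.Re s * ln (cmod u)).
Proof.
move=> u0; rewrite /qchar cmodM cmod_cpow cmod_expz -/(unit_part u) cmod_unit_part //.
by rewrite exp1rz mulr1; congr expR; case: (s) => a b /=; ring.
Qed.

Lemma qchar_neq0 n s u : u != 0 -> qchar n s u != 0.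
Proof. by move=> u0; rewrite -cmod_gt0 cmod_qchar // expR_gt0. Qed.

Lemma qcharV n s u : u != 0 -> qchar n s u^-1 = (qchar n s u)^-1.
Proof.
move=> u0; apply: (mulIf (qchar_neq0 n s u0)).
by rewrite -qcharM ?invr_eq0 // !mulVf ?qchar1 // qchar_neq0.
Qed.

Lemma qchar_div n s u v : u != 0 -> v != 0 -> qchar n s (u / v) = qchar n s u / qchar n s v.
Proof. by move=> u0 v0; rewrite qcharM ?invr_eq0 // qcharV. Qed.

Lemma even_expz_sign n : (2 %| n)%Z -> (-1 : C) ^ n = 1.
Proof. by move=> /dvdzP[m ->]; rewrite (mulrC m) -exprz_exp -exprnP sqrrN expr1n exp1rz. Qed.

Lemma qcharN n s u : (2 %| n)%Z -> qchar n s (- u) = qchar n s u.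
Proof. by move=> n2; rewrite /qchar cmodN mulNr -mulN1r expfzMl even_expz_sign // mul1r. Qed.

Lemma qchar_real n s x : (2 %| n)%Z -> x != 0 -> qchar n s x%:C%C = cpow `|x| (- (2 * s)).
Proof.
move=> n2 x0; rewrite /qchar cmod_real; case: (ltgtP 0 x) x0 => // x0 _.
  by rewrite gtr0_norm // divff ?exp1rz ?mulr1 // rc_neq0 // gt_eqF.
rewrite ltr0_norm // rmorphN /= invrN mulrN divff ?rc_neq0 ?lt_eqF //.
by rewrite even_expz_sign // mulr1.
Qed.

(** Separates the positive weight [|u|^(-2 Re s)], which varies slowly, from the unimodular
    character at [i Im s], which oscillates. *)
Lemma qchar_split n s u : u != 0 -> qchar n s u =
  (expR (- 2 * complex.Re s * ln (cmod u)))%:C%C * qchar n (0 +i* complex.Im s)%C u.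
Proof.
move=> u0; rewrite /qchar mulrA; congr (_ * _); rewrite /cpow.
have <- : cexp (- 2 * complex.Re s * ln (cmod u))%:C%C = (expR (- 2 * complex.Re s * ln (cmod u)))%:C%C.
  by rewrite /cexp /= -/(cis _) cis0 mulr1.
rewrite -cexpD; congr cexp; case: s => a b.
by apply/eqP; rewrite eq_complex /=; apply/andP; split; apply/eqP; ring.
Qed.

Lemma atan_le_norm x : `|atan x| <= `|x|.
Proof.
wlog x0 : x / 0 <= x.
  by move=> W; case: (leP 0 x) => [/W//|/ltW x0]; have := W (- x); rewrite atanN !normrN oppr_ge0; apply.
have D y : is_derive y 1 (fun x => x - atan x) (1 - (1 + y ^+ 2)^-1).
  by apply: is_derive_eq.
have := ge0_derive_le D _ x0; rewrite atan0 subr0 subr_ge0 => H.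
rewrite !ger0_norm //; first by apply: H => y _; rewrite subr_ge0 invf_le1 ?lerDl ?sqr_ge0 // ltr_pwDl ?sqr_ge0.
by rewrite -(atan0 R) le_atan.
Qed.

Lemma cmod_1D_bounds d : cmod d <= 2^-1 -> [/\ 2^-1 <= cmod (1 + d),
  cmod (1 + d) - 1 <= complex.Re d + cmod d ^+ 2 & complex.Re d <= cmod (1 + d) - 1].
Proof.
move=> d2; have Rd := le_trans (ler_Re_cmod d) d2.
have a1 := ler_Re_cmod (1 + d); rewrite raddfD /= in a1.
have {}a1 : 1 + complex.Re d <= cmod (1 + d) by apply: le_trans a1; exact: ler_norm.
move: Rd; rewrite ler_norml => /andP[R1 R2].
have E := cmod_sqr (1 + d); rewrite !raddfD /= add0r in E.
have E2 := cmod_sqr d.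
have i2 := sqr_ge0 (complex.Im d); have r2 := sqr_ge0 (complex.Re d).
split; [lra| |lra].
rewrite leNgt; apply/negP => H.
have : (1 + complex.Re d + cmod d ^+ 2) ^+ 2 < cmod (1 + d) ^+ 2.
  rewrite ltr_pXn2r ?nnegrE //; first by lra.
  by have := sqr_ge0 (cmod d); lra.
have := sqr_ge0 (cmod d ^+ 2); rewrite E sqrrD E2 mulr2n; nra.
Qed.

Lemma ln_cmod_1D d : cmod d <= 2^-1 -> `|ln (cmod (1 + d)) - complex.Re d| <= 2 * cmod d ^+ 2.
Proof.
move=> d2; have [r2 ru rl] := cmod_1D_bounds d2.
set r := cmod (1 + d) in r2 ru rl *.
have r0 : 0 < r by apply: lt_le_trans r2.
have d0 := sqr_ge0 (cmod d).
have l1 : ln r <= r - 1 by have := @le_ln1Dx R (r - 1); rewrite (addrC 1) subrK; apply; lra.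
have l2 : 1 - r^-1 <= ln r.
  have ir : 0 < r^-1 by rewrite invr_gt0.
  have := @le_ln1Dx R (r^-1 - 1); rewrite (addrC 1) subrK lnV ?posrE // => H.
  by have := H ltac:(lra); lra.
rewrite ler_norml; apply/andP; split; last by lra.
have iE : 1 - r^-1 = (r - 1) - (r - 1) ^+ 2 / r by field; rewrite gt_eqF.
have a : `|r - 1| <= cmod d.
  have := ler_cmod_dist (1 + d) 1; rewrite cmod1 -/r (addrC 1) addrK => h1.
  have := ler_cmod_dist 1 (1 + d); rewrite cmod1 -/r opprD addrA subrr add0r cmodN => h2.
  by rewrite ler_norml; lra.
have b : (r - 1) ^+ 2 / r <= 2 * cmod d ^+ 2.
  rewrite ler_pdivrMr //; have := ler_norm_sqr a; nra.
lra.
Qed.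

(** The argument of [1 + d] is the arctangent of the quotient of its imaginary by its real part, the
    latter being at least 1/2. *)
Lemma unit_part_cis d : cmod d <= 2^-1 -> exists th : R,
  [/\ unit_part (1 + d) = cis th, `|th| <= 2 * cmod d & `|th - complex.Im d| <= 4 * cmod d ^+ 2].
Proof.
move=> d2; have [r2 ru rl] := cmod_1D_bounds d2.
have := ler_Re_cmod d; have := ler_Im_cmod d; rewrite !ler_norml => /andP[i1 i2] /andP[e1 e2].
have E := cmod_sqr (1 + d); rewrite !raddfD /= add0r in E.
set r := cmod (1 + d) in r2 ru rl E *.
have r0 : 0 < r by apply: lt_le_trans r2.
set a := 1 + complex.Re d in E; set b := complex.Im d in i1 i2 E *.
have a2 : 2^-1 <= a by rewrite /a; lra.
have a0 : 0 < a by lra.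
have sq : Num.sqrt (1 + (b / a) ^+ 2) = r / a.
  have -> : 1 + (b / a) ^+ 2 = (r / a) ^+ 2 by rewrite !expr_div_n E; field; rewrite gt_eqF.
  by rewrite sqrtr_sqr ger0_norm // divr_ge0 // ltW.
have c : cos (atan (b / a)) = a / r by rewrite cos_atan sq invf_div.
have s : sin (atan (b / a)) = b / r.
  have := (atan_def (b / a)).2; rewrite /tan c => H.
  have -> : b / r = (b / a) * (a / r) by field; rewrite !gt_eqF.
  by rewrite -[in RHS]H divfK // mulf_neq0 ?invr_neq0 ?gt_eqF.
exists (atan (b / a)); have t1 : `|atan (b / a)| <= 2 * cmod d.
  apply: le_trans (atan_le_norm _) _; rewrite normrM normfV (ger0_norm (ltW a0)) ler_pdivrMr //.
  have : `|b| <= cmod d by rewrite ler_norml i1.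
  have := cmod_ge0 d; nra.
split => //.
  have rn : r%:C%C != 0 :> C by rewrite rc_neq0 // gt_eqF.
  rewrite /unit_part -/r /cis c s; apply: (mulIf rn); rewrite divfK //.
  apply/eqP; rewrite eq_complex /= !mulr0 subr0 add0r !divfK ?(gt_eqF r0) //.
  by rewrite /a /b; case: (d) => p q; rewrite /= add0r !eqxx.
have S := ler_sin_id (atan (b / a)); rewrite s in S.
have S2 : `|atan (b / a)| ^+ 2 <= (2 * cmod d) ^+ 2 by apply: lerXn2r; rewrite ?nnegrE // mulr_ge0.
rewrite real_normK ?num_real // exprMn in S2.
have B : `|b / r - b| <= 2 * cmod d ^+ 2.
  have -> : b / r - b = b * ((1 - r) / r) by field; rewrite gt_eqF.
  have h : `|(1 - r) / r| <= 2 * cmod d.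
    rewrite normrM normfV (gtr0_norm r0) ler_pdivrMr // ler_norml.
    have := ler_cmod_dist (1 + d) 1; rewrite cmod1 -/r (addrC 1) addrK => h1.
    have := ler_cmod_dist 1 (1 + d); rewrite cmod1 -/r opprD addrA subrr add0r cmodN => h2.
    by have := cmod_ge0 d; nra.
  rewrite normrM; apply: le_trans (ler_pM _ _ (_ : _ <= cmod d) h) _ => //.
    by rewrite ler_norml i1.
  by rewrite expr2; lra.
have -> : atan (b / a) - b = (atan (b / a) - b / r) + (b / r - b) by ring.
by apply: le_trans (ler_normD _ _) _; lra.
Qed.

(** Bounds the first order term [qchar_log n s d] of the logarithm of the character at [1 + d],
    relative to [|d|]. At [s = i t] it is [|n| + 2 |t|], the quantity A of all estimates. *)
Definition conductor n s : R := `|n%:~R| + 2 * cmod s.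

Lemma conductor_ge0 n s : 0 <= conductor n s.
Proof. by rewrite addr_ge0 // mulr_ge0. Qed.

Lemma cis_expz x n : cis x ^ n = cis (n%:~R * x).
Proof.
have P (m : nat) : cis x ^+ m = cis (m%:R * x).
  by elim: m => [|m IH]; rewrite ?mul0r ?cis0 ?expr0 // exprS IH -cisD -natr1 mulrDl mul1r addrC.
case: n => m; first by rewrite -exprnP P.
rewrite NegzE -exprnN P rmorphN /= mulNr.
apply: (mulIf (_ : cis (m.+1%:R * x) != 0)); first by rewrite -cmod_gt0 cmod_cis.
by rewrite mulVf -?cisD ?addNr ?cis0 // -cmod_gt0 cmod_cis.
Qed.

Definition qchar_log n s d : C :=
  - (2 * s) * (complex.Re d)%:C%C + (0 +i* (n%:~R * complex.Im d))%C.

Lemma qchar_cexp n s d : cmod d <= 2^-1 -> exists zeta,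
  [/\ qchar n s (1 + d) = cexp zeta, cmod zeta <= 2 * conductor n s * cmod d &
      cmod (zeta - qchar_log n s d) <= 4 * conductor n s * cmod d ^+ 2].
Proof.
move=> d2; have [th [ue t1 t2]] := unit_part_cis d2; have L := ln_cmod_1D d2.
have L1 : `|ln (cmod (1 + d))| <= 2 * cmod d.
  have -> : ln (cmod (1 + d)) = (ln (cmod (1 + d)) - complex.Re d) + complex.Re d by ring.
  apply: le_trans (ler_normD _ _) _; have := ler_Re_cmod d; have := cmod_ge0 d; nra.
exists (- (2 * s) * (ln (cmod (1 + d)))%:C%C + (0 +i* (n%:~R * th))%C); split.
- by rewrite /qchar -/(unit_part _) ue cis_expz cexpD cexp_im.
- apply: le_trans (ler_cmodD _ _) _; rewrite !(cmodM, cmodN) cmod_nat cmod_real.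
  have -> : cmod (0 +i* (n%:~R * th))%C = `|n%:~R| * `|th| by rewrite /cmod /= expr0n add0r sqrtr_sqr normrM.
  have a : `|n%:~R| * `|th| <= `|n%:~R| * (2 * cmod d) by rewrite ler_wpM2l.
  have b : cmod s * `|ln (cmod (1 + d))| <= cmod s * (2 * cmod d) by rewrite ler_wpM2l.
  by rewrite /conductor; lra.
have -> : - (2 * s) * (ln (cmod (1 + d)))%:C%C + (0 +i* (n%:~R * th))%C - qchar_log n s d =
   - (2 * s) * (ln (cmod (1 + d)) - complex.Re d)%:C%C + (0 +i* (n%:~R * (th - complex.Im d)))%C.
  have -> : (0 +i* (n%:~R * (th - complex.Im d)))%C = (0 +i* (n%:~R * th))%C - (0 +i* (n%:~R * complex.Im d))%C :> C.
    by apply/eqP; rewrite eq_complex /= subrr eqxx /= mulrBr.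
  by rewrite /qchar_log rmorphB /=; ring.
apply: le_trans (ler_cmodD _ _) _; rewrite !(cmodM, cmodN) cmod_nat cmod_real.
have -> : cmod (0 +i* (n%:~R * (th - complex.Im d)))%C = `|n%:~R| * `|th - complex.Im d|.
  by rewrite /cmod /= expr0n add0r sqrtr_sqr normrM.
have a : `|n%:~R| * `|th - complex.Im d| <= `|n%:~R| * (4 * cmod d ^+ 2) by rewrite ler_wpM2l.
have b : cmod s * `|ln (cmod (1 + d)) - complex.Re d| <= cmod s * (2 * cmod d ^+ 2) by rewrite ler_wpM2l.
have : 0 <= cmod s * cmod d ^+ 2 by rewrite mulr_ge0 // sqr_ge0.
by rewrite /conductor; lra.
Qed.

Lemma qchar_sub1 n s d : cmod d <= 2^-1 -> conductor n s * cmod d <= 4^-1 ->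
  cmod (qchar n s (1 + d) - 1) <= 10 * (conductor n s * cmod d).
Proof.
move=> d2 dA; have [zeta [-> z1 _]] := qchar_cexp n s d2.
have zh : cmod zeta <= 2^-1 by lra.
apply: le_trans (ler_cexp_sub1 _ _) _; last by lra.
  by apply: le_trans (ler_norm _) _; apply: le_trans (ler_Re_cmod _) _.
by apply: le_trans zh _; lra.
Qed.

Lemma qchar_sub1_log n s d : cmod d <= 2^-1 -> conductor n s * cmod d <= 4^-1 ->
  cmod (qchar n s (1 + d) - 1 - qchar_log n s d) <=
  (16 * conductor n s ^+ 2 + 4 * conductor n s) * cmod d ^+ 2.
Proof.
move=> d2 dA; have [zeta [-> z1 z2]] := qchar_cexp n s d2.
have zh : cmod zeta <= 2^-1 by lra.
have zR : complex.Re zeta <= 2^-1.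
  by apply: le_trans (ler_norm _) _; apply: le_trans (ler_Re_cmod _) _.
have := ler_cexp_sub1_id zR.
have -> : cexp zeta - 1 - qchar_log n s d = (cexp zeta - 1 - zeta) + (zeta - qchar_log n s d) by ring.
move=> H; apply: le_trans (ler_cmodD _ _) _.
have : cmod zeta ^+ 2 <= (2 * conductor n s * cmod d) ^+ 2.
  by apply: lerXn2r; rewrite ?nnegrE // !mulr_ge0 // conductor_ge0.
rewrite !exprMn; lra.
Qed.

End QuasiCharacter.

(** * Van der Corput differencing *)

Section FiniteSums.
Variable R : realType.
Local Notation C := (R[i]).

Lemma sum_sqr_le (n : nat) (x : nat -> R) :
  (\sum_(i < n) x i) ^+ 2 <= n%:R * \sum_(i < n) x i ^+ 2.
Proof.
elim: n => [|n IH]; first by rewrite !big_ord0 expr0n mul0r.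
rewrite !big_ord_recr /=; set S := \sum_(_ < _) _ in IH *; set Q := \sum_(_ < _) _ in IH *.
case: n @S @Q IH => [|n] S Q IH.
  by rewrite /S /Q !big_ord0 !add0r mul1r.
have n0 : 0 < n.+1%:R :> R by rewrite ltr0n.
set N := n.+1%:R in IH n0 *; have -> : n.+2%:R = N + 1 by rewrite /N natr1.
have : N * (2 * S * x n.+1) <= N * (Q + N * x n.+1 ^+ 2).
  have := sqr_ge0 (S - N * x n.+1); rewrite sqrrB exprMn; lra.
rewrite ler_pM2l //; rewrite sqrrD; lra.
Qed.

Lemma cmod_sum_sqr_le (n : nat) (f : nat -> C) :
  cmod (\sum_(i < n) f i) ^+ 2 <= n%:R * \sum_(i < n) cmod (f i) ^+ 2.
Proof.
apply: le_trans (sum_sqr_le n (fun i => cmod (f i))).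
by apply: lerXn2r; rewrite ?nnegrE ?ler_cmod_sum // sumr_ge0.
Qed.

Lemma cmod_sqr_sum (n : nat) (f : nat -> C) :
  (cmod (\sum_(j < n) f j) ^+ 2)%:C%C = \sum_(j < n) \sum_(j' < n) f j * (f j')^*%C.
Proof.
rewrite -mulcJ_cmod rmorph_sum mulr_suml; apply: eq_bigr => j _.
by rewrite mulr_sumr.
Qed.

Lemma sum_shift (V : zmodType) (f : nat -> V) (L J j : nat) : (j <= J)%N ->
  (forall l, (L <= l)%N -> f l = 0) ->
  \sum_(p < L + J) (if (j <= p)%N then f (p - j)%N else 0) = \sum_(l < L) f l.
Proof.
move=> jJ f0.
rewrite -(big_mkord xpredT (fun p => if (j <= p)%N then f (p - j)%N else 0)).
rewrite (big_cat_nat (n := j)) //=; last by rewrite (leq_trans jJ) // leq_addl.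
rewrite big_nat big1 ?add0r; last by move=> i /andP[_ ij]; rewrite leqNgt ij.
rewrite -{1}(add0n j) big_addn.
rewrite (eq_bigr f) => [|i _]; last by rewrite leq_addl addnK.
rewrite (big_cat_nat (n := L)) //=; last by rewrite -addnBA // leq_addr.
rewrite [X in _ + X]big_nat [X in _ + X]big1 ?addr0; last by move=> i /andP[Li _]; exact: f0.
by rewrite big_mkord.
Qed.

Lemma sum_dist_le (b : nat -> R) (J j : nat) : (forall h, 0 <= b h) -> (j < J)%N ->
  \sum_(j' < J) b (if (j' <= j)%N then (j - j')%N else (j' - j)%N) <= b 0%N + 2 * \sum_(1 <= h < J) b h.
Proof.
move=> b0 jJ; rewrite -(big_mkord xpredT (fun j' => b (if (j' <= j)%N then (j - j')%N else (j' - j)%N))).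
rewrite (big_cat_nat (n := j)) ?(ltnW jJ) //= (big_ltn jJ) leqnn subnn.
have s0 m n : 0 <= \sum_(m <= h < n) b h by rewrite big_nat sumr_ge0.
have A : \sum_(0 <= i < j) b (if (i <= j)%N then (j - i)%N else (i - j)%N) <= \sum_(1 <= h < J) b h.
  rewrite big_nat_rev /= add0n (@eq_big_nat _ _ _ _ _ _ (fun i => b i.+1)); last first.
    by move=> i /andP[_ ij]; rewrite leq_subr; congr b; rewrite subKn.
  by rewrite [X in _ <= X](big_cat_nat (n := j.+1)) //= -(big_add1 _ _ 0 j.+1 xpredT b) /= lerDl.
have B : \sum_(j.+1 <= i < J) b (if (i <= j)%N then (j - i)%N else (i - j)%N) <= \sum_(1 <= h < J) b h.
  rewrite -{1}(add1n j) big_addn (@eq_big_nat _ _ _ _ _ _ b); last first.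
    by move=> i /andP[i1 _]; rewrite -{2}(add0n j) leq_add2r leqNgt i1 /= addnK.
  rewrite [X in _ <= X](big_cat_nat (n := J - j)) //= ?lerDl ?leq_subr //.
  by rewrite subn_gt0.
lra.
Qed.

(** Only the inner variable is shifted. [J] times the double sum is the sum over a window of length
    [L + J] of averages [b i p] of [J] shifted copies; Cauchy-Schwarz and expansion of the square
    leave the correlations at the shifts [h < J]. *)
Lemma van_der_corput (m L J : nat) (a : nat -> nat -> C) : (0 < J)%N ->
  (forall i l, (L <= l)%N -> a i l = 0) ->
  J%:R * cmod (\sum_(i < m) \sum_(l < L) a i l) ^+ 2 <=
  m%:R * (L + J)%:R * (\sum_(i < m) \sum_(l < L) cmod (a i l) ^+ 2 +
    2 * \sum_(1 <= h < J) cmod (\sum_(i < m) \sum_(l < L) a i (l + h)%N * (a i l)^*%C)).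
Proof.
move=> J0 a0.
pose beta h := cmod (\sum_(i < m) \sum_(l < L) a i (l + h)%N * (a i l)^*%C).
pose b i p := \sum_(j < J) (if (j <= p)%N then a i (p - j)%N else 0).
have sb : \sum_(i < m) \sum_(p < L + J) b i p = J%:R * \sum_(i < m) \sum_(l < L) a i l.
  rewrite mulr_sumr; apply: eq_bigr => i _; rewrite exchange_big /=.
  rewrite (eq_bigr (fun=> \sum_(l < L) a i l)) => [|j _].
    by rewrite sumr_const card_ord mulr_natl.
  by apply: sum_shift => [|l]; [exact: ltnW|exact: a0].
have cs : cmod (\sum_(i < m) \sum_(p < L + J) b i p) ^+ 2 <=
    m%:R * (L + J)%:R * \sum_(i < m) \sum_(p < L + J) cmod (b i p) ^+ 2.
  apply: le_trans (cmod_sum_sqr_le m (fun i => \sum_(p < L + J) b i p)) _.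
  rewrite -mulrA ler_wpM2l // mulr_sumr ler_sum // => i _.
  exact: cmod_sum_sqr_le.
pose c j j' := \sum_(i < m) \sum_(p < L + J) (if (j <= p)%N then a i (p - j)%N else 0) *
   (if (j' <= p)%N then a i (p - j')%N else 0)^*%C.
have cJ j j' : c j' j = (c j j')^*%C.
  rewrite /c rmorph_sum; apply: eq_bigr => i _; rewrite rmorph_sum; apply: eq_bigr => p _.
  by rewrite rmorphM /= conjcK mulrC.
(* The window [L + J] contains every shifted copy entirely, so the inner product of two copies
   depends on their shifts through the difference alone. *)
have cle j j' : (j' <= j)%N -> (j < J)%N -> cmod (c j j') = beta (j - j')%N.
  move=> jj jJ; rewrite -cmodJ -cJ /c /beta; congr cmod; apply: eq_bigr => i _.
  rewrite -(@sum_shift _ (fun l => a i (l + (j - j'))%N * (a i l)^*%C) L J j (ltnW jJ)); last first.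
    by move=> l Ll; rewrite (a0 i l) // conjc0 mulr0.
  apply: eq_bigr => p _; case: (leqP j p) => jp; last by rewrite conjc0 mulr0.
  by rewrite (leq_trans jj jp); congr (a i _ * _); rewrite addnBA // subnK.
have bb : \sum_(i < m) \sum_(p < L + J) cmod (b i p) ^+ 2 <= \sum_(j < J) \sum_(j' < J) cmod (c j j').
  have E : (\sum_(i < m) \sum_(p < L + J) cmod (b i p) ^+ 2)%:C%C = \sum_(j < J) \sum_(j' < J) c j j'.
    rewrite rmorph_sum /= (eq_bigr (fun i : 'I_m => \sum_(j < J) \sum_(j' < J) \sum_(p < L + J)
      (if (j <= p)%N then a i (p - j)%N else 0) * (if (j' <= p)%N then a i (p - j')%N else 0)^*%C)) => [|i _].
      rewrite exchange_big /=; apply: eq_bigr => j _; rewrite exchange_big /=.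
      by apply: eq_bigr => j' _.
    rewrite rmorph_sum /= (eq_bigr _ (fun (p : 'I_(L + J)) _ => cmod_sqr_sum J (fun j => if (j <= p)%N then a i (p - j)%N else 0))).
    by rewrite exchange_big /=; apply: eq_bigr => j _; rewrite exchange_big.
  have -> : \sum_(i < m) \sum_(p < L + J) cmod (b i p) ^+ 2 = cmod (\sum_(j < J) \sum_(j' < J) c j j').
    by rewrite -E cmod_real ger0_norm // sumr_ge0 // => i _; rewrite sumr_ge0 // => p _; rewrite sqr_ge0.
  apply: le_trans (ler_cmod_sum _ _ _) _; apply: ler_sum => j _; exact: ler_cmod_sum.
have b0 : beta 0%N = \sum_(i < m) \sum_(l < L) cmod (a i l) ^+ 2.
  rewrite /beta; under eq_bigr => i _ do under eq_bigr => l _ do rewrite addn0 mulcJ_cmod.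
  under eq_bigr => i _ do rewrite -rmorph_sum /=.
  rewrite -rmorph_sum /= cmod_real ger0_norm // sumr_ge0 // => i _; rewrite sumr_ge0 // => l _; exact: sqr_ge0.
have ccle : \sum_(j < J) \sum_(j' < J) cmod (c j j') <= J%:R * (beta 0%N + 2 * \sum_(1 <= h < J) beta h).
  have -> (X : R) : J%:R * X = \sum_(j < J) X by rewrite sumr_const card_ord mulr_natl.
  apply: ler_sum => j _.
  apply: le_trans (sum_dist_le (b := beta) _ (ltn_ord j)) => [|h]; last exact: cmod_ge0.
  apply: ler_sum => j' _; case: (leqP j' j) => [jj|/ltnW jj]; first by rewrite cle.
  by rewrite cJ cmodJ cle.
have J0' : 0 < J%:R :> R by rewrite ltr0n.
rewrite -b0 -(ler_pM2l J0').
have -> : J%:R * (J%:R * cmod (\sum_(i < m) \sum_(l < L) a i l) ^+ 2) = cmod (\sum_(i < m) \sum_(p < L + J) b i p) ^+ 2.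
  by rewrite sb cmodM cmod_nat; ring.
apply: le_trans cs _; rewrite mulrCA ler_wpM2l ?mulr_ge0 //.
exact: le_trans bb ccle.
Qed.

Lemma abel_sum (H Q : nat -> C) (L : nat) :
  \sum_(l < L.+1) H l * (Q l.+1 - Q l) =
  H L * Q L.+1 - H 0%N * Q 0%N - \sum_(l < L) (H l.+1 - H l) * Q l.+1.
Proof.
elim: L => [|L IH]; first by rewrite big_ord_recr !big_ord0 /=; ring.
by rewrite big_ord_recr IH big_ord_recr /=; ring.
Qed.

Lemma abel_bound (H Q : nat -> C) (L : nat) (h h' : R) : 0 <= h -> 0 <= h' ->
  (forall l, (l < L)%N -> cmod (H l) <= h) ->
  (forall l, (l.+1 < L)%N -> cmod (H l.+1 - H l) <= h') ->
  (forall l, (l <= L)%N -> cmod (Q l) <= 1) ->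
  cmod (\sum_(l < L) H l * (Q l.+1 - Q l)) <= 2 * h + L%:R * h'.
Proof.
case: L => [|L] h0 h'0 Hh Hh' HQ; first by rewrite big_ord0 cmod0 mul0r addr0 mulr_ge0.
rewrite abel_sum; apply: le_trans (ler_cmodB _ _) _.
have a1 : cmod (H L * Q L.+1) <= h by rewrite cmodM -[h]mulr1 ler_pM // ?Hh ?HQ.
have a2 : cmod (H 0%N * Q 0%N) <= h by rewrite cmodM -[h]mulr1 ler_pM // ?Hh ?HQ.
have a3 : cmod (\sum_(l < L) (H l.+1 - H l) * Q l.+1) <= L%:R * h'.
  apply: le_trans (ler_cmod_sum _ _ _) _.
  have -> : L%:R * h' = \sum_(j < L) h' by rewrite sumr_const card_ord mulr_natl.
  apply: ler_sum => l _.
  rewrite cmodM -[X in _ <= X]mulr1 ler_pM //; [apply: Hh'; rewrite ltnS; exact: ltn_ord|apply: HQ; exact: leq_trans (ltn_ord l) (leqnSn L)].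
have : L%:R * h' <= L.+1%:R * h' by rewrite ler_wpM2r // ler_nat.
by have := ler_cmodB (H L * Q L.+1) (H 0%N * Q 0%N); lra.
Qed.

(** The numbers [conj a_i / D] are the least-norm solution of [m1 a1 + m2 a2 = 1]. They are of size
    [1 / P] as soon as [D] is not much smaller than [P^2], and a relative change [eta] of the [a_i]
    changes them by a multiple of [eta / P]. *)
Lemma sos_ratio (a1 a2 b1 b2 : C) (P c eta : R) : 0 < P -> 0 < c ->
  cmod a1 <= P -> cmod a2 <= P -> cmod b1 <= P -> cmod b2 <= P ->
  cmod (a1 - b1) <= P * eta -> cmod (a2 - b2) <= P * eta ->
  let D := cmod a1 ^+ 2 + cmod a2 ^+ 2 in let D' := cmod b1 ^+ 2 + cmod b2 ^+ 2 in
  c * P ^+ 2 <= D -> c * P ^+ 2 <= D' ->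
  [/\ cmod (a1^*%C / D%:C%C) <= (c * P)^-1, cmod (a2^*%C / D%:C%C) <= (c * P)^-1,
    cmod (a1^*%C / D%:C%C - b1^*%C / D'%:C%C) <= (c * P)^-1 * (eta * (1 + 4 / c)) &
    cmod (a2^*%C / D%:C%C - b2^*%C / D'%:C%C) <= (c * P)^-1 * (eta * (1 + 4 / c))].
Proof.
move=> P0 c0 A1 A2 B1 B2 E1 E2 D D' HD HD'.
have e0 : 0 <= eta by rewrite -(pmulr_rge0 _ P0) (le_trans _ E1).
have cP : 0 < c * P ^+ 2 by rewrite mulr_gt0 // exprn_gt0.
have D0 : 0 < D by exact: lt_le_trans HD.
have D'0 : 0 < D' by exact: lt_le_trans HD'.
have DD : `|D' - D| <= 4 * P ^+ 2 * eta.
  have sq (u v : C) : cmod u <= P -> cmod v <= P -> cmod (u - v) <= P * eta -> `|cmod v ^+ 2 - cmod u ^+ 2| <= 2 * P ^+ 2 * eta.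
    move=> uP vP uv.
    have h : `|cmod v - cmod u| <= P * eta.
      apply: le_trans uv; have := ler_cmod_dist u v; have := ler_cmod_dist v u.
      by rewrite (cmodB v) ler_norml; lra.
    have q : cmod v + cmod u <= 2 * P by lra.
    have q0 : 0 <= cmod v + cmod u by rewrite addr_ge0.
    rewrite subr_sqr normrM (ger0_norm q0); apply: le_trans (ler_pM (normr_ge0 _) q0 h q) _.
    by rewrite le_eqVlt; apply/orP; left; apply/eqP; ring.
  have -> : D' - D = (cmod b1 ^+ 2 - cmod a1 ^+ 2) + (cmod b2 ^+ 2 - cmod a2 ^+ 2) by rewrite /D /D'; ring.
  have -> : 4 * P ^+ 2 * eta = 2 * P ^+ 2 * eta + 2 * P ^+ 2 * eta by ring.
  by apply: le_trans (ler_normD _ _) _; apply: lerD; exact: sq.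
have key1 (u : C) : cmod u <= P -> cmod (u^*%C / D%:C%C) <= (c * P)^-1.
  move=> uP; rewrite cmodM cmodV cmodJ cmod_real gtr0_norm // ler_pdivrMr //.
  have -> : (c * P)^-1 * D = D / (c * P ^+ 2) * P by field; rewrite !gt_eqF.
  apply: le_trans uP _; rewrite ler_peMl ?(ltW P0) //.
  by rewrite ler_pdivlMr // mul1r.
have key2 (u v : C) : cmod u <= P -> cmod v <= P -> cmod (u - v) <= P * eta ->
    cmod (u^*%C / D%:C%C - v^*%C / D'%:C%C) <= (c * P)^-1 * (eta * (1 + 4 / c)).
  move=> uP vP uv.
  have -> : u^*%C / D%:C%C - v^*%C / D'%:C%C = (u - v)^*%C / D%:C%C + v^*%C * (D' - D)%:C%C / (D%:C%C * D'%:C%C).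
    by rewrite !rmorphB /=; field; rewrite !rc_neq0 ?gt_eqF.
  apply: le_trans (ler_cmodD _ _) _; rewrite !(cmodM, cmodV, cmodJ, cmod_real) (gtr0_norm D0) (gtr0_norm D'0).
  have t1 : cmod (u - v) / D <= (P * eta) / (c * P ^+ 2).
    by apply: ler_pM; rewrite ?invr_ge0 ?(ltW D0) // lef_pV2 ?posrE.
  have t2 : cmod v * `|D' - D| / (D * D') <= P * (4 * P ^+ 2 * eta) / (c * P ^+ 2 * (c * P ^+ 2)).
    apply: ler_pM; rewrite ?mulr_ge0 ?invr_ge0 ?mulr_ge0 ?(ltW D0) ?(ltW D'0) //.
      by apply: ler_pM.
    by rewrite lef_pV2 ?posrE ?mulr_gt0 // ler_pM // ltW.
  apply: le_trans (lerD t1 t2) _; rewrite le_eqVlt; apply/orP; left; apply/eqP.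
  by field; rewrite !gt_eqF.
by split; [exact: key1|exact: key1|exact: key2|exact: key2].
Qed.

(** Each [1 / (h + b)] is at most [ln (h + b) - ln (h - 1 + b)], and the differences telescope. *)
Lemma sum_harmonic_le (b : R) (J : nat) : 0 < b ->
  \sum_(1 <= h < J) 2 * b / (h%:R + b) <= 2 * b * ln (1 + J%:R / b).
Proof.
move=> b0; have T (K : nat) : \sum_(1 <= h < K.+1) 2 * b / (h%:R + b) <= 2 * b * (ln (K%:R + b) - ln b).
  elim: K => [|K IH]; first by rewrite big_geq // add0r subrr mulr0.
  rewrite big_nat_recr //=.
  have q0 : 0 < K%:R + b by rewrite ltr_wpDl.
  have q1 : 0 < K.+1%:R + b by rewrite ltr_wpDl.
  have := @le_ln1Dx R (- (K.+1%:R + b)^-1).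
  have -> : 1 + - (K.+1%:R + b)^-1 = (K%:R + b) / (K.+1%:R + b).
    have -> : K%:R + b = (K.+1%:R + b) - 1 by rewrite -natr1; ring.
    by rewrite mulrBl divff ?gt_eqF // mul1r.
  rewrite ltrN2 invf_lt1 // ln_div ?posrE // => H.
  have {}H : (K.+1%:R + b)^-1 <= ln (K.+1%:R + b) - ln (K%:R + b).
    suff : ln (K%:R + b) - ln (K.+1%:R + b) <= - (K.+1%:R + b)^-1 by lra.
    by apply: H; rewrite ltr_pwDr // ler1n.
  have : 2 * b / (K.+1%:R + b) <= 2 * b * (ln (K.+1%:R + b) - ln (K%:R + b)) by rewrite ler_wpM2l // mulr_ge0 // ltW.
  lra.
have -> : 1 + J%:R / b = (J%:R + b) / b by field; rewrite gt_eqF.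
have Jb : 0 < J%:R + b by rewrite ltr_wpDl.
rewrite ln_div ?posrE //.
case: J Jb => [|J] Jb; first by rewrite big_geq // add0r subrr mulr0.
apply: le_trans (T J) _; rewrite ler_wpM2l ?mulr_ge0 ?(ltW b0) // lerD2r ler_ln ?posrE //.
  by rewrite lerD2r ler_nat.
by rewrite ltr_wpDl.
Qed.

End FiniteSums.

(** The real inequality behind [sos_lower]. The linear form [u |-> Re (a u)] cannot be small at both
    [y] and [z = x + i y]: its values [y a1] and [a1 x - a2 y] have squares summing to at least
    [|a|^2 y^2 / 2]. The other terms are linearisation errors, absorbed because
    [W y <= 1 / 3000]. *)
Lemma sos_real (R : realFieldType) (a1 a2 x y W z2 X1 Xz : R) :
  16 / 25 <= y ^+ 2 -> x ^+ 2 <= 4^-1 -> 0 <= z2 -> z2 <= 4 * y ^+ 2 ->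
  0 <= W * y -> W * y <= 1 / 3000 -> W ^+ 2 / 2 <= a1 ^+ 2 + a2 ^+ 2 ->
  a1 ^+ 2 / 4 - W ^+ 2 / 128 - (80 * W ^+ 2) ^+ 2 <= X1 ^+ 2 ->
  (a1 * x - a2 * y) ^+ 2 / 4 - W ^+ 2 * z2 / 128 - (80 * W ^+ 2 * z2) ^+ 2 <= Xz ^+ 2 ->
  W ^+ 2 * y ^+ 2 / 128 <= y ^+ 2 * X1 ^+ 2 + Xz ^+ 2.
Proof.
move=> y2 x2 z0 z2y Wy0 Wy aW r1 rz.
have ys := sqr_ge0 y; have ws := sqr_ge0 W.
have q1 : (a1 ^+ 2 + a2 ^+ 2) * y ^+ 2 / 2 <= y ^+ 2 * a1 ^+ 2 + (a1 * x - a2 * y) ^+ 2.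
  have b1 := sqr_ge0 (2 * (a1 * x) - a2 * y).
  have b2 : a1 ^+ 2 * x ^+ 2 <= a1 ^+ 2 * 4^-1 by rewrite ler_wpM2l // sqr_ge0.
  have b3 : a1 ^+ 2 * (16 / 25) <= a1 ^+ 2 * y ^+ 2 by rewrite ler_wpM2l // sqr_ge0.
  have b4 := sqr_ge0 a1; clear -b1 b2 b3 b4.
  have E1 : (2 * (a1 * x) - a2 * y) ^+ 2 = 4 * (a1 ^+ 2 * x ^+ 2) - 4 * (a1 * x) * (a2 * y) + a2 ^+ 2 * y ^+ 2 by ring.
  have -> : (a1 * x - a2 * y) ^+ 2 = a1 ^+ 2 * x ^+ 2 - 2 * (a1 * x) * (a2 * y) + a2 ^+ 2 * y ^+ 2 by ring.
  rewrite E1 in b1; lra.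
set V := W ^+ 2 * y ^+ 2.
have V0 : 0 <= V by rewrite mulr_ge0.
have V2 : (100 * V) ^+ 2 <= V / 900.
  have k : (100 * (W * y)) ^+ 2 <= 30^-1 ^+ 2.
    apply: lerXn2r; rewrite ?nnegrE ?invr_ge0 ?ler0n //; last by clear -Wy; lra.
    by apply: mulr_ge0 => //; exact: ler0n.
  have -> : (100 * V) ^+ 2 = V * (100 * (W * y)) ^+ 2 by rewrite /V; ring.
  rewrite ler_wpM2l //; apply: le_trans k _; clear; lra.
have aV : V / 2 <= (a1 ^+ 2 + a2 ^+ 2) * y ^+ 2.
  by have := ler_wpM2r ys aW; rewrite mulrAC.
have e1 : y ^+ 2 * (80 * W ^+ 2) ^+ 2 <= (100 * V) ^+ 2.
  have b : 16 / 25 * (y ^+ 2 * (W ^+ 2) ^+ 2) <= y ^+ 2 * (y ^+ 2 * (W ^+ 2) ^+ 2).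
    by rewrite ler_wpM2r // mulr_ge0 // sqr_ge0.
  have -> : (100 * V) ^+ 2 = 100 ^+ 2 * (y ^+ 2 * (y ^+ 2 * (W ^+ 2) ^+ 2)) by rewrite /V; ring.
  have -> : y ^+ 2 * (80 * W ^+ 2) ^+ 2 = 6400 * (y ^+ 2 * (W ^+ 2) ^+ 2) by ring.
  clear -b; lra.
have e2 : (80 * W ^+ 2 * z2) ^+ 2 <= 256 / 25 * (100 * V) ^+ 2.
  have k0 : 0 <= 80 * W ^+ 2 by rewrite mulr_ge0.
  apply: le_trans (_ : (80 * W ^+ 2 * (4 * y ^+ 2)) ^+ 2 <= _).
    apply: lerXn2r; rewrite ?nnegrE.
    - exact: mulr_ge0.
    - by apply: mulr_ge0 => //; apply: mulr_ge0.
    - exact: ler_wpM2l.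
  by rewrite le_eqVlt; apply/orP; left; apply/eqP; rewrite /V; field.
have e3 : W ^+ 2 * z2 <= 4 * V by rewrite /V; have := ler_wpM2l ws z2y; rewrite mulrCA.
have {}r1 : y ^+ 2 * a1 ^+ 2 / 4 - V / 128 - y ^+ 2 * (80 * W ^+ 2) ^+ 2 <= y ^+ 2 * X1 ^+ 2.
  have := ler_wpM2l ys r1; congr (_ <= _); rewrite /V; ring.
move: q1 aV e1 e2 e3 r1 rz V2 V0; clear.
move: (y ^+ 2 * a1 ^+ 2) ((a1 * x - a2 * y) ^+ 2) ((a1 ^+ 2 + a2 ^+ 2) * y ^+ 2) => P1 P2 P3.
move: (y ^+ 2 * (80 * W ^+ 2) ^+ 2) ((80 * W ^+ 2 * z2) ^+ 2) (W ^+ 2 * z2) ((100 * V) ^+ 2) => P4 P5 P6 P7.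
move: (y ^+ 2 * X1 ^+ 2) (Xz ^+ 2) => P8 P9; lra.
Qed.

(** * The phase of a correlation and its variation along the lattice *)

Section Correlation.
Variable R : realType.
Local Notation C := (R[i]).
Variables (n : int) (z s : C).
Hypotheses (zx : `|complex.Re z| <= 2^-1) (zy : 4 / 5 <= complex.Im z).
Hypothesis (s12 : 2^-1 <= complex.Re s <= 1).

Local Notation y := (complex.Im z).
Local Notation t := (complex.Im s).
Local Notation s0 := (0 +i* t)%C.
Local Notation psi := (qchar n s0).
Local Notation phi := (qchar n s).
Local Notation A := (conductor n s0).

Lemma im_gt0 : 0 < y.
Proof. by apply: lt_le_trans zy; rewrite divr_gt0. Qed.
Local Hint Resolve im_gt0 : core.

Lemma im_bounds : [/\ cmod z <= 2 * y, 1 <= 2 * y & `|complex.Re z| <= y].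
Proof.
have := ler_cmod_ReIm z; rewrite (gtr0_norm im_gt0) => H.
by split; have := zx; have := zy; lra.
Qed.

Variables (N : R) (h : nat).
Hypotheses (A1 : 1 <= A) (h0 : (0 < h)%N).
Hypotheses (hA : A * h%:R * y <= N ^+ 2 / 3000) (hN : h%:R <= N / 3000) (yN : y <= N / 3000).

Lemma scale_gt0 : 0 < N.
Proof. by have := zy; have := yN; lra. Qed.
Local Hint Resolve scale_gt0 : core.

Lemma h_gt0 : 0 < h%:R :> R.
Proof. by rewrite ltr0n. Qed.
Local Hint Resolve h_gt0 : core.

Definition good u := N <= cmod u.

Lemma good_gt0 u : good u -> 0 < cmod u.
Proof. exact: lt_le_trans. Qed.

Lemma good_neq0 u : good u -> u != 0.
Proof. by move=> /good_gt0; rewrite cmod_gt0. Qed.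

(** [1 - defect] is the cross-ratio [(u + v + h) u / ((u + v) (u + h))], so [psi (1 - defect)] is
    the quotient of the correlation phase [psi ((u + h) / u)] at [u + v] by its value at [u]. *)
Definition defect (v u : C) : C := h%:R * v / ((u + v) * (u + h%:R)).
Definition ratio_m1 v u : C := psi (1 - defect v u) - 1.

Lemma good_inv u : good u -> (cmod u)^-1 <= N^-1.
Proof. by move=> gu; rewrite lef_pV2 ?posrE ?good_gt0. Qed.

Lemma defect_le v u : good (u + v) -> good (u + h%:R) ->
  cmod (defect v u) <= h%:R * cmod v / N ^+ 2.
Proof.
move=> g1 g2; rewrite /defect !(cmodM, cmodV) cmod_nat ler_wpM2l ?mulr_ge0 //.
rewrite invfM -exprVn expr2; apply: ler_pM; rewrite ?invr_ge0 //; exact: good_inv.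
Qed.

Lemma defect_diff v w u : good (u + v) -> good (u + h%:R) -> good (u + w + v) -> good (u + w + h%:R) ->
  cmod (defect v (u + w) - defect v u) <= 2 * (h%:R * cmod v / N ^+ 2) * (cmod w / N).
Proof.
move=> g1 g2 g3 g4.
have n1 := good_neq0 g1; have n2 := good_neq0 g2; have n3 := good_neq0 g3; have n4 := good_neq0 g4.
have -> : defect v (u + w) - defect v u = - (h%:R * v * w) *
   ((u + v)^-1 * (u + h%:R)^-1 * (u + w + h%:R)^-1 + (u + v)^-1 * (u + w + v)^-1 * (u + w + h%:R)^-1).
  by rewrite /defect; field; rewrite n1 n2 n3 n4.
rewrite cmodM cmodN !cmodM cmod_nat.
have b3 a b c : good a -> good b -> good c -> cmod (a^-1 * b^-1 * c^-1) <= N^-1 * N^-1 * N^-1.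
  by move=> ga gb gc; rewrite !(cmodM, cmodV); do !apply: ler_pM; rewrite ?mulr_ge0 ?invr_ge0 //; exact: good_inv.
apply: le_trans (ler_wpM2l _ (le_trans (ler_cmodD _ _) (lerD (b3 _ _ _ g1 g2 g4) (b3 _ _ _ g1 g3 g4)))) _.
  by rewrite !mulr_ge0.
by rewrite le_eqVlt; apply/orP; left; apply/eqP; field; rewrite gt_eqF.
Qed.

(** The size of the phase gradient of the correlation at shift [h] and distance [N]. The standing
    hypothesis keeps [freq y] below 1/3000, so that a lattice step never turns the phase by a full
    circle. *)
Definition freq : R := A * h%:R / N ^+ 2.

Lemma freq_gt0 : 0 < freq.
Proof. by rewrite /freq divr_gt0 ?mulr_gt0 ?exprn_gt0 // (lt_le_trans ltr01). Qed.
Local Hint Resolve freq_gt0 : core.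

Lemma freq_small : freq * y <= 1 / 3000.
Proof.
rewrite /freq mulrAC ler_pdivrMr ?exprn_gt0 //; by apply: le_trans hA _; rewrite div1r mulrC.
Qed.

Definition short v := cmod v <= 2 * y.

Lemma short1 : short 1.
Proof. by rewrite /short cmod1; case: im_bounds. Qed.

Lemma shortz : short z.
Proof. by rewrite /short; case: im_bounds. Qed.

Lemma defect_small v u : short v -> good (u + v) -> good (u + h%:R) ->
  cmod (defect v u) <= 4^-1 /\ A * cmod (defect v u) <= 4^-1.
Proof.
move=> sv g1 g2; have H := defect_le g1 g2.
have A0 : 0 <= A by exact: le_trans A1.
have : A * cmod (defect v u) <= 4^-1.
  apply: le_trans (ler_wpM2l A0 H) _.
  have -> : A * (h%:R * cmod v / N ^+ 2) = freq * cmod v by rewrite /freq; ring.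
  apply: le_trans (ler_wpM2l (ltW freq_gt0) sv) _.
  by have := freq_small; lra.
move=> p; split=> //; apply: le_trans p; by rewrite ler_peMl.
Qed.

Lemma ratio_m1_le v u : short v -> good (u + v) -> good (u + h%:R) ->
  cmod (ratio_m1 v u) <= 10 * (freq * cmod v).
Proof.
move=> sv g1 g2; have [d1 d2] := defect_small sv g1 g2.
rewrite /ratio_m1; have := @qchar_sub1 R n s0 (- defect v u); rewrite cmodN => H.
apply: le_trans (H _ d2) _; first by lra.
rewrite ler_pM2l // /freq.
have -> : A * h%:R / N ^+ 2 * cmod v = A * (h%:R * cmod v / N ^+ 2) by ring.
by rewrite ler_wpM2l ?defect_le // (le_trans _ A1).
Qed.

Lemma cmod_psi u : u != 0 -> cmod (psi u) = 1.
Proof. by move=> u0; rewrite cmod_qchar //= mulr0 mul0r expR0. Qed.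

Lemma one_sub_defect v u : short v -> good (u + v) -> good (u + h%:R) -> 3 / 4 <= cmod (1 - defect v u).
Proof.
move=> sv g1 g2; have [d1 _] := defect_small sv g1 g2.
by have := ler_cmod_dist 1 (defect v u); rewrite cmod1; lra.
Qed.

(** Moving [u] by [w] multiplies [1 - defect] by [1 + r] with [r] of order
    [(h |v| / N^2) (|w| / N)], so the ratio changes by a fraction [|w| / N] of its size. *)
Lemma ratio_m1_diff v w u : short v -> cmod w <= N / 4 ->
  good (u + v) -> good (u + h%:R) -> good (u + w + v) -> good (u + w + h%:R) ->
  cmod (ratio_m1 v (u + w) - ratio_m1 v u) <= 40 * (freq * cmod v) * (cmod w / N).
Proof.
move=> sv wN g1 g2 g3 g4; have D := defect_diff g1 g2 g3 g4.
have o1 := one_sub_defect sv g1 g2; have o2 := one_sub_defect sv g3 g4.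
have n1 : 1 - defect v u != 0 by rewrite -cmod_gt0 (lt_le_trans _ o1) // divr_gt0.
have n2 : 1 - defect v (u + w) != 0 by rewrite -cmod_gt0 (lt_le_trans _ o2) // divr_gt0.
pose r := (defect v u - defect v (u + w)) / (1 - defect v u).
have rE : (1 - defect v (u + w)) / (1 - defect v u) = 1 + r by rewrite /r; field.
have -> : ratio_m1 v (u + w) - ratio_m1 v u = psi (1 - defect v u) * (psi (1 + r) - 1).
  rewrite /ratio_m1 -rE qchar_div // mulrBr mulrC divfK ?qchar_neq0 //; ring.
rewrite cmodM cmod_psi // mul1r.
have A0 : 0 <= A by exact: le_trans A1.
set e := h%:R * cmod v / N ^+ 2 in D; set wN' := cmod w / N in D *.
have wN4 : wN' <= 4^-1 by rewrite ler_pdivrMr //; lra.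
have wN0 : 0 <= wN' by rewrite divr_ge0 // ltW.
have Ae : A * e = freq * cmod v by rewrite /e /freq; ring.
have e0 : 0 <= e by rewrite !mulr_ge0 ?invr_ge0 ?exprn_ge0 // ltW.
have Ae2 : A * e <= 1 / 1500.
  by rewrite Ae; apply: le_trans (ler_wpM2l (ltW freq_gt0) sv) _; have := freq_small; lra.
have rle : cmod r <= 4 * e * wN'.
  rewrite /r cmodM cmodV cmodB ler_pdivrMr; last by lra.
  apply: le_trans D _; have : 0 <= e * wN' by rewrite mulr_ge0.
  nra.
have Ar : A * cmod r <= 4 * (A * e) * wN'.
  by apply: le_trans (ler_wpM2l A0 rle) _; rewrite le_eqVlt; apply/orP; left; apply/eqP; ring.
have Ar4 : A * cmod r <= 4^-1.
  have : (A * e) * wN' <= 1 / 1500 * 4^-1 by apply: ler_pM => //; rewrite mulr_ge0.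
  lra.
have r2 : cmod r <= 2^-1.
  have : cmod r <= A * cmod r by rewrite ler_peMl.
  lra.
by apply: le_trans (qchar_sub1 r2 Ar4) _; rewrite -Ae; lra.
Qed.

(** The phase gradient of [psi] at 1: to first order the logarithm of [psi (1 + d)] is
    [i Re (slope d)]. Its modulus is comparable with [A]. *)
Definition slope : C := ((- (2 * t)) -i* n%:~R)%C.

Lemma slope_bounds : cmod slope <= A /\ A ^+ 2 / 2 <= cmod slope ^+ 2.
Proof.
have sE : cmod s0 = `|t| by rewrite /cmod /= expr0n add0r sqrtr_sqr.
have a2 : cmod slope ^+ 2 = `|n%:~R| ^+ 2 + 4 * `|t| ^+ 2.
  by rewrite cmod_sqr /= !real_normK ?num_real //; ring.
have ta := normr_ge0 t; have na := normr_ge0 (n%:~R : R).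
rewrite /conductor sE; split.
  by rewrite -(ler_pXn2r (n := 2)) ?nnegrE ?addr_ge0 ?mulr_ge0 // a2 sqrrD exprMn; nra.
rewrite a2 sqrrD exprMn; have := sqr_ge0 (`|n%:~R| - 2 * `|t|); rewrite sqrrB exprMn; lra.
Qed.

Lemma qchar_log_slope d : qchar_log n s0 d = 'i%C * (complex.Re (slope * d))%:C%C.
Proof.
rewrite /qchar_log /slope; case: d => d1 d2; apply/eqP; rewrite eq_complex /=.
by apply/andP; split; apply/eqP; ring.
Qed.

(** Linearisation: [defect v u] is [h v / u^2] up to one eighth of its size, and
    [psi (1 - defect) - 1] is [i] times a real linear form up to a quadratic error. Two applications
    of [(a + b)^2 <= 2 a^2 + 2 b^2] produce the factors 1/4 and 1/128. *)
Lemma ratio_m1_ge v u (K : R) : short v -> good (u + v) -> good (u + h%:R) -> good u -> cmod u <= 24 * N ->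
  K = h%:R / cmod u ^+ 2 ->
  complex.Re (slope * (h%:R / u ^+ 2) * v) ^+ 2 / 4 - (A * K * cmod v) ^+ 2 / 128
    - (80 * (A * K) ^+ 2 * cmod v ^+ 2) ^+ 2 <= cmod (ratio_m1 v u) ^+ 2.
Proof.
move=> sv g1 g2 g0 u24 KE.
have n1 := good_neq0 g1; have n2 := good_neq0 g2; have n0 := good_neq0 g0.
have [d1 d2] := defect_small sv g1 g2.
have A0 : 0 <= A by exact: le_trans A1.
have K0 : 0 <= K by rewrite KE divr_ge0 // sqr_ge0.
pose k := h%:R / u ^+ 2 : C.
have kK : cmod k = K by rewrite /k cmodM cmodV cmodX cmod_nat KE.
have v0 := cmod_ge0 v.
have dk : cmod (defect v u - k * v) <= K * cmod v / 8.
  have -> : defect v u - k * v = - (k * v) * ((u * (v + h%:R) + v * h%:R) / ((u + v) * (u + h%:R))).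
    by rewrite /defect /k; field; rewrite n0 n1 n2.
  rewrite cmodM cmodN (cmodM k) kK ler_wpM2l ?mulr_ge0 //.
  rewrite cmodM cmodV ler_pdivrMr ?cmod_gt0 ?mulf_neq0 //.
  have lo : N ^+ 2 <= cmod ((u + v) * (u + h%:R)) by rewrite cmodM expr2 ler_pM // ltW.
  apply: le_trans (_ : N ^+ 2 / 8 <= _); last by lra.
  apply: le_trans (ler_cmodD _ _) _; rewrite !cmodM cmod_nat.
  have vh : cmod (v + h%:R) <= N / 1000.
    by apply: le_trans (ler_cmodD _ _) _; rewrite cmod_nat; move: sv hN yN; rewrite /short; lra.
  have b1 : cmod u * cmod (v + h%:R) <= 24 * N * (N / 1000) by apply: ler_pM.
  have b2 : cmod v * h%:R <= N / 1000 * (N / 1000).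
    have N0 := scale_gt0; apply: ler_pM; [exact: cmod_ge0|exact: ler0n| |].
      by move: sv yN; rewrite /short; lra.
    by move: hN; lra.
  by have := sqr_ge0 N; rewrite expr2; lra.
have [sA _] := slope_bounds.
set p := complex.Re (slope * k * v).
pose l := complex.Re (slope * defect v u).
have lp : `|l - p| <= A * (K * cmod v / 8).
  rewrite /l /p -raddfB; apply: le_trans (ler_Re_cmod _) _.
  by rewrite -mulrA -mulrBr cmodM ler_pM.
have dle : cmod (defect v u) <= 2 * (K * cmod v).
  have -> : defect v u = (defect v u - k * v) + k * v by ring.
  apply: le_trans (ler_cmodD _ _) _; rewrite cmodM kK; have : 0 <= K * cmod v by rewrite mulr_ge0.
  lra.
pose E := ratio_m1 v u - qchar_log n s0 (- defect v u).
have Ele : cmod E <= 80 * (A * K) ^+ 2 * cmod v ^+ 2.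
  have := @qchar_sub1_log R n s0 (- defect v u); rewrite cmodN => H.
  apply: le_trans (H _ d2) _; first by lra.
  have b : cmod (defect v u) ^+ 2 <= (2 * (K * cmod v)) ^+ 2 by apply: lerXn2r; rewrite ?nnegrE // !mulr_ge0.
  have c : 16 * A ^+ 2 + 4 * A <= 20 * A ^+ 2 by have := A1; nra.
  apply: le_trans (ler_pM _ (sqr_ge0 _) c b) _; first by have := sqr_ge0 A; lra.
  by rewrite le_eqVlt; apply/orP; left; apply/eqP; ring.
have lX : l ^+ 2 <= 2 * cmod (ratio_m1 v u) ^+ 2 + 2 * cmod E ^+ 2.
  have : `|l| <= cmod (ratio_m1 v u) + cmod E.
    have -> : `|l| = cmod (ratio_m1 v u - E).
      by rewrite /E opprB addrC subrK qchar_log_slope mulrN raddfN rmorphN /= mulrN cmodN cmodM cmod_i mul1r cmod_real.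
    exact: ler_cmodB.
  move=> /ler_norm_sqr; have := sqr_ge0 (cmod (ratio_m1 v u) - cmod E); rewrite sqrrB sqrrD; lra.
have E2 : cmod E ^+ 2 <= (80 * (A * K) ^+ 2 * cmod v ^+ 2) ^+ 2.
  by apply: lerXn2r; rewrite ?nnegrE // !mulr_ge0 // sqr_ge0.
have P2 := ler_norm_sqr lp.
have -> : (A * K * cmod v) ^+ 2 / 128 = (A * (K * cmod v / 8)) ^+ 2 / 2 by field.
have := sqr_ge0 (2 * l - p); have -> : (2 * l - p) ^+ 2 = 4 * l ^+ 2 - 4 * l * p + p ^+ 2 by ring.
have : (l - p) ^+ 2 = l ^+ 2 - 2 * l * p + p ^+ 2 by ring.
lra.
Qed.

(** [2^7] is the 128 of [sos_real], [24^4] comes from replacing [|u|], at most [24 N], by [N] in the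
    square of [h / |u|^2], and [40^2] is the normalisation of [pbound]. *)
Definition cD : R := (2 ^+ 7 * 24 ^+ 4 * 40 ^+ 2)^-1.

Lemma cD_gt0 : 0 < cD.
Proof. by rewrite invr_gt0 !mulr_gt0 ?exprn_gt0 ?ltr0n. Qed.
Local Hint Resolve cD_gt0 : core.

(** A common upper bound for the moduli of [y * ratio_m1 1] and [ratio_m1 z]. The factor [y] puts
    the short direction 1 on the same footing as [z], whose length is about [y]. *)
Definition pbound : R := 40 * (freq * y).

Lemma pbound_gt0 : 0 < pbound.
Proof. by rewrite mulr_gt0 // mulr_gt0. Qed.
Local Hint Resolve pbound_gt0 : core.

(* The two lattice directions together see the gradient: one of the two ratios is far from [1]. *)
Lemma sos_lower u : good u -> good (u + 1) -> good (u + z) -> good (u + h%:R) -> cmod u <= 24 * N ->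
  cD * pbound ^+ 2 <= cmod (y%:C%C * ratio_m1 1 u) ^+ 2 + cmod (ratio_m1 z u) ^+ 2.
Proof.
move=> g0 g1 gz gh u24.
have A0 : 0 <= A by exact: le_trans A1.
have uN : 0 < cmod u by exact: good_gt0.
pose K := h%:R / cmod u ^+ 2.
have K0 : 0 < K by rewrite divr_gt0 // exprn_gt0.
have r1 := ratio_m1_ge short1 g1 gh g0 u24 (erefl K).
have rz := ratio_m1_ge shortz gz gh g0 u24 (erefl K).
rewrite cmodM cmod_real gtr0_norm // (exprMn _ y).
rewrite !(mulr1, cmod1, expr1n) in r1.
set al := slope * (h%:R / u ^+ 2) in r1 rz.
have alE : cmod al ^+ 2 = cmod slope ^+ 2 * K ^+ 2.
  by rewrite /al !(cmodM, cmodV, cmodX) cmod_nat -exprMn.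
have [_ sA] := slope_bounds.
have al2 : (A * K) ^+ 2 / 2 <= cmod al ^+ 2.
  by rewrite alE exprMn mulrAC ler_wpM2r // sqr_ge0.
set W := A * K in r1 rz al2.
have W0 : 0 <= W by rewrite mulr_ge0 // ltW.
have Wy : W * y <= 1 / 3000.
  apply: le_trans freq_small; rewrite ler_wpM2r ?(ltW im_gt0) // /W /K /freq mulrA.
  by rewrite ler_wpM2l ?mulr_ge0 // lef_pV2 ?posrE ?exprn_gt0 // lerXn2r ?nnegrE // ltW.
have [zz yy xx] := im_bounds.
have z2 : cmod z ^+ 2 <= 4 * y ^+ 2.
  have -> : 4 * y ^+ 2 = (2 * y) ^+ 2 by ring.
  by rewrite lerXn2r ?nnegrE // mulr_ge0 // ltW.
have reE : complex.Re (al * z) = complex.Re al * complex.Re z - complex.Im al * y by case: (al) => a b; case: (z) => c d /=.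
have main : W ^+ 2 * y ^+ 2 / 128 <= y ^+ 2 * cmod (ratio_m1 1 u) ^+ 2 + cmod (ratio_m1 z u) ^+ 2.
  apply: (@sos_real _ (complex.Re al) (complex.Im al) (complex.Re z) y W (cmod z ^+ 2) _ _ _ _ _ z2 _ Wy _ r1).
  - have -> : 16 / 25 = (4 / 5) ^+ 2 :> R by field.
    by rewrite lerXn2r ?nnegrE ?(le_trans _ zy) // divr_ge0.
  - have -> : 4^-1 = 2^-1 ^+ 2 :> R by field.
    exact: ler_norm_sqr zx.
  - by rewrite sqr_ge0.
  - by rewrite mulr_ge0 // ltW.
  - by rewrite -cmod_sqr.
  - by rewrite -reE -exprMn.
apply: le_trans main.
have Wlow : freq * y <= 24 ^+ 2 * (W * y).
  rewrite mulrA ler_wpM2r ?(ltW im_gt0) // /freq /W /K.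
  have -> : 24 ^+ 2 * (A * (h%:R / cmod u ^+ 2)) = A * h%:R * (24 ^+ 2 / cmod u ^+ 2) by ring.
  have Ah : 0 <= A * h%:R by rewrite mulr_ge0 // ltW.
  apply: ler_wpM2l => //.
  have uN2 : cmod u ^+ 2 <= (24 * N) ^+ 2.
    by apply: lerXn2r; rewrite ?nnegrE ?mulr_ge0 ?ler0n ?(ltW scale_gt0).
  have N2 : 0 < N ^+ 2 by rewrite exprn_gt0.
  have u2 : 0 < cmod u ^+ 2 by rewrite exprn_gt0.
  by rewrite ler_pdivlMr // mulrC ler_pdivrMr // -exprMn.
have fy0 : 0 <= freq * y by rewrite mulr_ge0 // ltW.
have {Wlow} : (freq * y) ^+ 2 <= (24 ^+ 2 * (W * y)) ^+ 2.
  by apply: lerXn2r => //; rewrite nnegrE //; exact: le_trans fy0 Wlow.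
have -> : cD * pbound ^+ 2 = (freq * y) ^+ 2 / (2 ^+ 7 * 24 ^+ 4).
  have gen (a k F : R) : a != 0 -> k != 0 -> (a * k)^-1 * (k * F) = F / a by move=> a0 k0; field; rewrite a0 k0.
  rewrite /cD /pbound (_ : (40 * (freq * y)) ^+ 2 = 40 ^+ 2 * (freq * y) ^+ 2); last exact: exprMn.
  by rewrite gen ?mulf_neq0 ?expf_neq0 ?pnatr_eq0.
move=> H; rewrite ler_pdivrMr ?mulr_gt0 ?exprn_gt0 ?ltr0n //; apply: le_trans H _.
rewrite (_ : (24 ^+ 2 * (W * y)) ^+ 2 = 24 ^+ 4 * (W ^+ 2 * y ^+ 2)); last by ring.
have gen (a b F : R) : b != 0 -> F / b * (b * a) = a * F by move=> b0; field.
by rewrite (_ : (128 : R) = 2 ^+ 7) ?gen ?expf_neq0 ?pnatr_eq0 // -natrX.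
Qed.

End Correlation.

(** * Correlation sums by partial summation in two directions *)

Section CorrelationSum.
Variable R : realType.
Local Notation C := (R[i]).
Variables (n : int) (z s : C).
Hypotheses (zx : `|complex.Re z| <= 2^-1) (zy : 4 / 5 <= complex.Im z).
Hypothesis (s12 : 2^-1 <= complex.Re s <= 1).

Local Notation y := (complex.Im z).
Local Notation s0 := (0 +i* complex.Im s)%C.
Local Notation psi := (qchar n s0).
Local Notation phi := (qchar n s).
Local Notation A := (conductor n s0).

Variables (N : R) (h : nat).
Hypotheses (A1 : 1 <= A) (h0 : (0 < h)%N).
Hypotheses (hA : A * h%:R * y <= N ^+ 2 / 3000) (hN : h%:R <= N / 3000) (yN : y <= N / 3000).

Local Notation ratio := (ratio_m1 n s h).
Local Notation P := (pbound n z s N h).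
Local Notation cD := (cD R).
Let y0 : 0 < y := im_gt0 zy.
Let N0 : 0 < N := scale_gt0 zy yN.
Let P0 : 0 < P := pbound_gt0 zy A1 h0 yN.
Let f0 : 0 < freq n s N h := freq_gt0 zy A1 h0 yN.
Let c0 : 0 < cD := cD_gt0 R.

Definition weight (u : C) : R := expR (- 2 * complex.Re s * ln (cmod u)).
Definition weight0 : R := expR (- 2 * complex.Re s * ln N).

Lemma weight_le u : good N u -> weight u <= weight0.
Proof.
move=> gu; rewrite ler_expR; have /andP[s1 _] := s12.
have : ln N <= ln (cmod u) by rewrite ler_ln ?posrE // (lt_le_trans N0).
have := s1; nra.
Qed.

(** The weight is the modulus of the character with [n = 0] and real exponent at most 1, whose
    conductor is at most 2, so its relative variation is read off from [qchar_sub1]. *)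
Lemma weight_diff u w : good N u -> good N (u + w) -> short z w ->
  `|weight (u + w) - weight u| <= 20 * (cmod w / N) * weight0.
Proof.
move=> gu guw sw.
have u0 : u != 0 by exact: (good_neq0 zy yN gu).
have uw0 : u + w != 0 by exact: (good_neq0 zy yN guw).
pose r := w / u.
have E : u + w = u * (1 + r) by rewrite /r mulrDr mulr1 mulrCA divff // mulr1.
have r0 : 1 + r != 0 by apply: contraNneq uw0 => H; rewrite E H mulr0.
have rle : cmod r <= cmod w / N.
  by rewrite /r cmodM cmodV ler_wpM2l // lef_pV2 ?posrE // (lt_le_trans N0).
have wN : cmod w / N <= 1 / 16.
  by rewrite ler_pdivrMr //; apply: le_trans sw _; have := yN; have := N0; lra.
have /andP[s1 s2] := s12.
have sg : cmod ((complex.Re s)%:C%C) <= 1 :> R by rewrite cmod_real ger0_norm //; lra.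
have cond2 : conductor 0 ((complex.Re s)%:C)%C <= 2 :> R by rewrite /conductor normr0 add0r; lra.
have cr : conductor 0 ((complex.Re s)%:C)%C * cmod r <= 2 * (cmod w / N) by apply: ler_pM => //; exact: conductor_ge0.
have r2 : cmod r <= 2^-1 by lra.
have r4 : conductor 0 ((complex.Re s)%:C)%C * cmod r <= 4^-1 by lra.
have Q := qchar_sub1 r2 r4.
have WE v : v != 0 -> weight v = cmod (qchar 0 ((complex.Re s)%:C)%C v) by move=> v0; rewrite cmod_qchar.
rewrite !WE // E qcharM //; set q := qchar 0 _ u; set q1 := qchar 0 _ _ in Q *.
have -> : cmod (q * q1) - cmod q = cmod q * (cmod q1 - 1) by rewrite cmodM; ring.
rewrite normrM (ger0_norm (cmod_ge0 _)) mulrC.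
have qw : cmod q <= weight0 by rewrite /q -WE // weight_le.
apply: ler_pM => //.
have -> : cmod q1 - 1 = cmod q1 - cmod (1 : C) by rewrite cmod1.
have d1 := ler_cmod_dist q1 1; have d2 := ler_cmod_dist 1 q1.
rewrite (cmodB 1) in d2.
by apply: le_trans (_ : cmod (q1 - 1) <= _); [rewrite ler_norml; lra|lra].
Qed.

Definition Qh (u : C) : C := psi ((u + h%:R) / u).
Definition amp (u : C) : R := weight (u + h%:R) * weight u.
Definition vgood (u : C) : bool :=
  [&& good N u, good N (u + 1), good N (u + z), good N (u + h%:R) & cmod u <= 24 * N].
Definition Dn (u : C) : R := cmod (y%:C%C * ratio 1 u) ^+ 2 + cmod (ratio z u) ^+ 2.
Definition M1 (u : C) : C := (y%:C%C * ratio 1 u)^*%C / (Dn u)%:C%C.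
Definition M2 (u : C) : C := (ratio z u)^*%C / (Dn u)%:C%C.
Definition H1 (u : C) : C := (amp u * y)%:C%C * M1 u.
Definition H2 (u : C) : C := (amp u * 1)%:C%C * M2 u.

Let gn u : good N u -> u != 0 := @good_neq0 R z zy N yN u.

Lemma corr_term u : good N u -> good N (u + h%:R) ->
  phi (u + h%:R) * (phi u)^*%C = (amp u)%:C%C * Qh u.
Proof.
move=> /gn g0 /gn g1; rewrite (qchar_split _ _ g0) (qchar_split _ _ g1).
have rM (a b : R) : (a * b)%:C%C = a%:C%C * b%:C%C :> C by exact: rmorphM.
rewrite /Qh /amp qchar_div // rM -/(weight u) -/(weight (u + h%:R)).
have -> : (psi u)^-1 = (psi u)^*%C.
  have p0 : psi u != 0 by exact: qchar_neq0.
  by apply: (mulfI p0); rewrite divff // mulcJ_cmod cmod_psi // expr1n.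
have cM (a b : C) : (a * b)^*%C = a^*%C * b^*%C by exact: rmorphM.
have cR (x : R) : (x%:C%C)^*%C = x%:C%C :> C by apply/eqP; rewrite eq_complex /= oppr0 !eqxx.
rewrite (cM (weight u)%:C%C) cR; ring.
Qed.

Lemma Qh_shift v u : good N u -> good N (u + v) -> good N (u + h%:R) -> good N (u + v + h%:R) ->
  Qh (u + v) - Qh u = Qh u * ratio v u.
Proof.
move=> /gn g0 /gn g1 /gn g2 /gn g3.
have d0 : 1 - defect h v u = (u + v + h%:R) * u / ((u + v) * (u + h%:R)).
  by rewrite /defect; field; rewrite g1 g2.
rewrite /ratio_m1 d0 /Qh mulrBr mulr1; congr (_ - _).
rewrite -qcharM ?mulf_neq0 ?invr_eq0 ?mulf_neq0 //.
by congr psi; field; rewrite g0 g1 g2.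
Qed.

Lemma Dn_ge u : vgood u -> cD * P ^+ 2 <= Dn u.
Proof. by case/and5P => g0 g1 gz gh g24; exact: (sos_lower zx zy A1 h0 hA hN yN). Qed.

(** The term becomes a combination of differences of [Qh] along the two lattice directions:
    [Qh (u + v) - Qh u = Qh u * ratio v u], and the coefficients solve
    [M1 (y ratio 1) + M2 (ratio z) = 1]. In one direction alone the ratio may vanish; the sum of
    squares [Dn] may not. *)
Lemma amp_Qh u : vgood u -> good N (u + 1 + h%:R) -> good N (u + z + h%:R) ->
  (amp u)%:C%C * Qh u = H1 u * (Qh (u + 1) - Qh u) + H2 u * (Qh (u + z) - Qh u).
Proof.
move=> vg g1h gzh; have := vg; case/and5P => g0 g1 gz gh _.
rewrite (Qh_shift g0 g1) // (Qh_shift g0 gz) // /H1 /H2 /M1 /M2.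
have D0 : 0 < Dn u by apply: lt_le_trans (Dn_ge vg); apply: mulr_gt0; [exact: c0|exact: exprn_gt0].
have Dc : (Dn u)%:C%C != 0 :> C by rewrite rc_neq0 // gt_eqF.
rewrite mulr1 (_ : (amp u * y)%:C%C = (amp u)%:C%C * y%:C%C); last exact: rmorphM.
have E : (Dn u)%:C%C = (y%:C%C * ratio 1 u)^*%C * (y%:C%C * ratio 1 u) + (ratio z u)^*%C * ratio z u :> C.
  by rewrite /Dn rmorphD /= -!mulcJ_cmod; congr (_ + _); rewrite mulrC.
have -> : (amp u)%:C%C * Qh u = (amp u)%:C%C * Qh u * (Dn u)%:C%C / (Dn u)%:C%C by rewrite mulfK.
by rewrite [in X in X / _]E; field.
Qed.

(** The relative variation of [H1] and [H2] per unit of [|w| / N]: 40 from the amplitude, the rest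
    from [sos_ratio] with [eta = 2 |w| / N]. *)
Definition slack : R := 40 + 2 * (1 + 4 / cD).

Lemma M_bounds u w : vgood u -> vgood (u + w) -> short z w ->
  [/\ cmod (M1 (u + w)) <= (cD * P)^-1, cmod (M2 (u + w)) <= (cD * P)^-1,
    cmod (M1 (u + w) - M1 u) <= (cD * P)^-1 * (2 * (cmod w / N) * (1 + 4 / cD)) &
    cmod (M2 (u + w) - M2 u) <= (cD * P)^-1 * (2 * (cmod w / N) * (1 + 4 / cD))].
Proof.
move=> vu vuw sw.
have [/and5P[g0 g1 gz gh _] /and5P[g0' g1' gz' gh' _]] := (vu, vuw).
have sz := shortz zx zy; have s1 := short1 zx zy.
have wN : cmod w <= N / 4 by apply: le_trans sw _; have := yN; have := N0; lra.
have rle v u' : short z v -> good N (u' + v) -> good N (u' + h%:R) -> cmod (ratio v u') <= 10 * (freq n s N h * cmod v).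
  exact: (ratio_m1_le zy A1 h0 hA yN).
have zle : freq n s N h * cmod z <= freq n s N h * (2 * y) by rewrite ler_wpM2l // ltW.
have fy : 0 < freq n s N h * y by rewrite mulr_gt0.
have PE : P = 40 * (freq n s N h * y) by [].
have b1 u' : good N (u' + 1) -> good N (u' + h%:R) -> cmod (y%:C%C * ratio 1 u') <= P.
  move=> a b; rewrite cmodM cmod_real gtr0_norm //.
  have := ler_wpM2l (ltW y0) (rle 1 u' s1 a b); rewrite cmod1 mulr1 => H.
  by apply: le_trans H _; rewrite PE; lra.
have b2 u' : good N (u' + z) -> good N (u' + h%:R) -> cmod (ratio z u') <= P.
  by move=> a b; apply: le_trans (rle z u' sz a b) _; rewrite PE; lra.
have wN0 : 0 <= cmod w / N by rewrite divr_ge0 // ltW.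
have d1 : cmod (y%:C%C * ratio 1 (u + w) - y%:C%C * ratio 1 u) <= P * (2 * (cmod w / N)).
  rewrite -mulrBr cmodM cmod_real gtr0_norm //.
  have := ler_wpM2l (ltW y0) (ratio_m1_diff zy A1 h0 hA yN s1 wN g1 gh g1' gh').
  rewrite cmod1 mulr1 => H; apply: le_trans H _.
  have : 0 <= freq n s N h * y * (cmod w / N) by rewrite mulr_ge0 // ltW.
  by rewrite PE; lra.
have d2 : cmod (ratio z (u + w) - ratio z u) <= P * (2 * (cmod w / N)).
  apply: le_trans (ratio_m1_diff zy A1 h0 hA yN sz wN gz gh gz' gh') _.
  have := ler_wpM2r wN0 zle; rewrite PE; lra.
exact: (sos_ratio P0 c0 (b1 _ g1' gh') (b2 _ gz' gh') (b1 _ g1 gh) (b2 _ gz gh) d1 d2 (Dn_ge vuw) (Dn_ge vu)).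
Qed.

Lemma amp_bounds u w : vgood u -> vgood (u + w) -> short z w ->
  [/\ 0 <= amp u, amp u <= weight0 ^+ 2 & `|amp (u + w) - amp u| <= 40 * (cmod w / N) * weight0 ^+ 2].
Proof.
move=> /and5P[g0 _ _ gh _] /and5P[g0' _ _ gh' _] sw.
have w0 v : 0 <= weight v by exact: expR_ge0.
have W0 : 0 <= weight0 by exact: expR_ge0.
have wl := weight_le g0; have wl' := weight_le g0'; have wh := weight_le gh.
split; [exact: mulr_ge0 (w0 _) (w0 _)|by rewrite expr2; exact: ler_pM (w0 _) (w0 _) wh wl|].
have gh'' : good N (u + h%:R + w) by rewrite addrAC.
have D1 := weight_diff g0 g0' sw; have D2 := weight_diff gh gh'' sw.
rewrite addrAC in D2.
have -> : amp (u + w) - amp u = (weight (u + w + h%:R) - weight (u + h%:R)) * weight (u + w)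
   + weight (u + h%:R) * (weight (u + w) - weight u).
  by rewrite /amp; move: (weight (u + w + h%:R)) (weight (u + h%:R)) (weight (u + w)) (weight u) => a b c d; ring.
apply: le_trans (ler_normD _ _) _; rewrite !normrM (ger0_norm (w0 _)) (ger0_norm (w0 _)).
have t1 := ler_pM (normr_ge0 _) (w0 _) D2 wl'.
have t2 := ler_pM (w0 _) (normr_ge0 _) wh D1.
apply: le_trans (lerD t1 t2) _; rewrite le_eqVlt; apply/orP; left; apply/eqP; ring.
Qed.

Lemma amp_M_diff (k m0 : R) (M : C -> C) u w : 0 <= k -> vgood u -> vgood (u + w) -> short z w ->
  cmod (M (u + w)) <= m0 -> cmod (M (u + w) - M u) <= m0 * (2 * (cmod w / N) * (1 + 4 / cD)) ->
  cmod ((amp (u + w) * k)%:C%C * M (u + w) - (amp u * k)%:C%C * M u)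
  <= weight0 ^+ 2 * (k * m0) * (cmod w / N) * slack.
Proof.
move=> k0 vu vuw sw Mm Md; have [a0 a1 a2] := amp_bounds vu vuw sw.
have -> : (amp (u + w) * k)%:C%C * M (u + w) - (amp u * k)%:C%C * M u =
  k%:C%C * ((amp (u + w) - amp u)%:C%C * M (u + w) + (amp u)%:C%C * (M (u + w) - M u)).
  have rM (a b : R) : (a * b)%:C%C = a%:C%C * b%:C%C :> C by exact: rmorphM.
  have rB (a b : R) : (a - b)%:C%C = a%:C%C - b%:C%C :> C by exact: rmorphB.
  rewrite (rM (amp _) k) (rM (amp u) k) rB.
  by move: (amp (u + w))%:C%C (amp u)%:C%C k%:C%C (M (u + w)) (M u) => *; ring.
rewrite cmodM cmod_real (ger0_norm k0).
have t1 : cmod ((amp (u + w) - amp u)%:C%C * M (u + w)) <= 40 * (cmod w / N) * weight0 ^+ 2 * m0.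
  by rewrite cmodM cmod_real ler_pM.
have t2 : cmod ((amp u)%:C%C * (M (u + w) - M u)) <= weight0 ^+ 2 * (m0 * (2 * (cmod w / N) * (1 + 4 / cD))).
  by rewrite cmodM cmod_real (ger0_norm a0) ler_pM.
apply: le_trans (ler_wpM2l k0 (le_trans (ler_cmodD _ _) (lerD t1 t2))) _.
by rewrite le_eqVlt; apply/orP; left; apply/eqP; rewrite /slack; ring.
Qed.

Lemma amp_M_le (k m0 : R) (M : C -> C) u : 0 <= k -> vgood u -> cmod (M u) <= m0 ->
  cmod ((amp u * k)%:C%C * M u) <= weight0 ^+ 2 * (k * m0).
Proof.
move=> k0 vu Mm; have vu0 : vgood (u + 0) by rewrite addr0.
have s00 : short z 0 by rewrite /short cmod0 mulr_ge0 // ltW.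
have [a0 a1 _] := amp_bounds vu vu0 s00.
rewrite cmodM cmod_real (ger0_norm (mulr_ge0 a0 k0)).
have -> : weight0 ^+ 2 * (k * m0) = weight0 ^+ 2 * k * m0 by ring.
apply: ler_pM; [exact: (mulr_ge0 a0 k0)|exact: cmod_ge0|exact: ler_wpM2r|exact: Mm].
Qed.

(** What [abel_bound] gives in both directions for [m = 24 N / y] and [L = 24 N]: boundary terms
    [2 + 2], variations [24 slack + 48 slack]. *)
Definition corr_const : R := 24 * (4 + 72 * slack) / (40 * cD).

Definition pt (u0 : C) (i l : nat) : C := u0 + i%:R * z + l%:R.

Lemma pt_r u0 i l : pt u0 i l.+1 = pt u0 i l + 1.
Proof. by rewrite /pt -natr1 addrA. Qed.

Lemma pt_d u0 i l : pt u0 i.+1 l = pt u0 i l + z.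
Proof. by rewrite /pt -natr1; ring. Qed.

Lemma pt_h u0 i l k : pt u0 i (l + k) = pt u0 i l + k%:R.
Proof. by rewrite /pt natrD addrA. Qed.

Lemma slack_gt0 : 0 < slack.
Proof. by rewrite /slack ltr_pwDl // ?mulr_ge0 // addr_ge0 // divr_ge0 // ltW. Qed.

(** Partial summation along rows for the [H1] part and along columns for the [H2] part, with
    [|Qh| <= 1]. Since [N / (freq y) = (N^2 / y) (N / (A h))], the gain over the number of points is
    the factor [N / (A h)]. *)
Lemma corr_bound u0 (m L : nat) :
  (forall i l, (i <= m)%N -> (l <= L + h)%N -> N <= cmod (pt u0 i l) <= 24 * N) ->
  m%:R <= 24 * N / y -> L%:R <= 24 * N ->
  cmod (\sum_(i < m) \sum_(l < L) phi (pt u0 i (l + h)) * (phi (pt u0 i l))^*%C) <=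
  corr_const * weight0 ^+ 2 * (N / (freq n s N h * y)).
Proof.
move=> grid mN LN.
have g i l : (i <= m)%N -> (l <= L + h)%N -> good N (pt u0 i l).
  by move=> im lL; case/andP: (grid i l im lL).
have lh l : (l <= L)%N -> (l <= L + h)%N by move=> lL; exact: leq_trans lL (leq_addr _ _).
have vg i l : (i < m)%N -> (l < L)%N -> vgood (pt u0 i l).
  move=> im lL; apply/and5P; split; rewrite -?pt_r -?pt_d -?pt_h; try apply: g => //.
  - exact: ltnW.
  - by apply: lh; exact: ltnW.
  - exact: ltnW.
  - exact: lh.
  - by apply: lh; exact: ltnW.
  - exact: ltnW.
  - by rewrite leq_add2r ltnW.
  - by case/andP: (grid i l (ltnW im) (lh _ (ltnW lL))).
have E i l : (i < m)%N -> (l < L)%N -> phi (pt u0 i (l + h)) * (phi (pt u0 i l))^*%C =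
    H1 (pt u0 i l) * (Qh (pt u0 i l.+1) - Qh (pt u0 i l)) + H2 (pt u0 i l) * (Qh (pt u0 i.+1 l) - Qh (pt u0 i l)).
  move=> im lL; have v := vg i l im lL; have := v; case/and5P => g0 g1 gz gh _.
  rewrite pt_h corr_term // pt_r pt_d; apply: amp_Qh => //.
    by rewrite -pt_r -pt_h; apply: g; [exact: ltnW|rewrite leq_add2r].
  by rewrite -pt_d -pt_h; apply: g => //; rewrite leq_add2r ltnW.
rewrite (eq_bigr (fun i : 'I_m => \sum_(l < L) H1 (pt u0 i l) * (Qh (pt u0 i l.+1) - Qh (pt u0 i l))
   + \sum_(l < L) H2 (pt u0 i l) * (Qh (pt u0 i.+1 l) - Qh (pt u0 i l)))); last first.
  by move=> i _; rewrite -big_split; apply: eq_bigr => l _; rewrite E.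
rewrite big_split /= [X in _ + X]exchange_big /=.
set m0 := (cD * P)^-1; have m00 : 0 <= m0 by rewrite invr_ge0 mulr_ge0 // ltW.
have W2 : 0 <= weight0 ^+ 2 by rewrite sqr_ge0.
pose h1 := weight0 ^+ 2 * (y * m0); pose h2 := weight0 ^+ 2 * (1 * m0).
have h10 : 0 <= h1 by rewrite mulr_ge0 // mulr_ge0 // ltW.
have h20 : 0 <= h2 by rewrite mulr_ge0 // mulr_ge0.
have sl0 := ltW slack_gt0.
have Ni : 0 <= N^-1 by rewrite invr_ge0 ltW.
have q1 : 0 <= h1 * N^-1 * slack := mulr_ge0 (mulr_ge0 h10 Ni) sl0.
have yN0 : 0 <= 2 * y / N by rewrite divr_ge0 ?(ltW N0) // mulr_ge0 // ltW.
have q2 : 0 <= h2 * (2 * y / N) * slack := mulr_ge0 (mulr_ge0 h20 yN0) sl0.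
have N24 : 0 <= 24 * N by rewrite mulr_ge0 // ltW.
have sz := shortz zx zy; have s1 := short1 zx zy.
have s00 : short z 0 by rewrite /short cmod0 mulr_ge0 // ltW.
have Qle i l : (i <= m)%N -> (l <= L)%N -> cmod (Qh (pt u0 i l)) <= 1.
  move=> im lL; rewrite /Qh cmod_psi // mulf_neq0 ?invr_eq0 ?gn ?g ?lh //.
  by rewrite -pt_h; apply: g => //; rewrite leq_add2r.
have Mle i l : (i < m)%N -> (l < L)%N -> cmod (M1 (pt u0 i l)) <= m0 /\ cmod (M2 (pt u0 i l)) <= m0.
  move=> im lL; have v := vg i l im lL; have v0 : vgood (pt u0 i l + 0) by rewrite addr0.
  by have [] := M_bounds v v0 s00; rewrite addr0.
have R1 (i : 'I_m) : cmod (\sum_(l < L) H1 (pt u0 i l) * (Qh (pt u0 i l.+1) - Qh (pt u0 i l))) <=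
    2 * h1 + L%:R * (h1 * N^-1 * slack).
  apply: (@abel_bound R (fun l => H1 (pt u0 i l)) (fun l => Qh (pt u0 i l))) => //.
  - by move=> l lL; apply: amp_M_le; [exact: ltW|exact: vg|case: (Mle i l (ltn_ord i) lL)].
  - move=> l lL; have v1 := vg i l (ltn_ord i) (ltnW lL); have v2 := vg i l.+1 (ltn_ord i) lL.
    rewrite pt_r in v2 *; have [b1 _ b3 _] := M_bounds v1 v2 s1.
    have := amp_M_diff (ltW y0) v1 v2 s1 b1 b3; rewrite cmod1 mul1r; exact.
  - by move=> l lL; apply: Qle => //; exact: ltnW.
have R2 (l : 'I_L) : cmod (\sum_(i < m) H2 (pt u0 i l) * (Qh (pt u0 i.+1 l) - Qh (pt u0 i l))) <=
    2 * h2 + m%:R * (h2 * (2 * y / N) * slack).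
  apply: (@abel_bound R (fun i => H2 (pt u0 i l)) (fun i => Qh (pt u0 i l))) => //.
  - by move=> i im; apply: amp_M_le; [exact: ler01|exact: vg|case: (Mle i l im (ltn_ord l))].
  - move=> i im; have v1 := vg i l (ltnW im) (ltn_ord l); have v2 := vg i.+1 l im (ltn_ord l).
    rewrite pt_d in v2 *; have [_ b2 _ b4] := M_bounds v1 v2 sz.
    have := amp_M_diff (@ler01 R) v1 v2 sz b2 b4 => H; apply: le_trans H _.
    rewrite -/h2 ler_wpM2r // ler_wpM2l // ler_pM2r ?invr_gt0 //.
  - by move=> i im; apply: Qle => //; exact: ltnW.
have S1 : cmod (\sum_(i < m) \sum_(l < L) H1 (pt u0 i l) * (Qh (pt u0 i l.+1) - Qh (pt u0 i l))) <=
   m%:R * (2 * h1 + L%:R * (h1 * N^-1 * slack)).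
  apply: le_trans (ler_cmod_sum _ _ _) _.
  have -> (X : R) : m%:R * X = \sum_(j < m) X by rewrite sumr_const card_ord mulr_natl.
  by apply: ler_sum => i _; exact: R1.
have S2 : cmod (\sum_(l < L) \sum_(i < m) H2 (pt u0 i l) * (Qh (pt u0 i.+1 l) - Qh (pt u0 i l))) <=
   L%:R * (2 * h2 + m%:R * (h2 * (2 * y / N) * slack)).
  apply: le_trans (ler_cmod_sum _ _ _) _.
  have -> (X : R) : L%:R * X = \sum_(j < L) X by rewrite sumr_const card_ord mulr_natl.
  by apply: ler_sum => i _; exact: R2.
apply: le_trans (ler_cmodD _ _) _; apply: le_trans (lerD S1 S2) _.
have L0 : 0 <= L%:R :> R by []. have mm0 : 0 <= m%:R :> R by [].
have T1 : m%:R * (2 * h1 + L%:R * (h1 * N^-1 * slack)) <= 24 * N / y * (2 * h1 + 24 * N * (h1 * N^-1 * slack)).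
  have r1 : 0 <= L%:R * (h1 * N^-1 * slack) := mulr_ge0 L0 q1.
  apply: ler_pM => //; first by apply: addr_ge0 => //; apply: mulr_ge0.
  by rewrite lerD2l; apply: ler_wpM2r.
have T2 : L%:R * (2 * h2 + m%:R * (h2 * (2 * y / N) * slack)) <= 24 * N * (2 * h2 + 24 * N / y * (h2 * (2 * y / N) * slack)).
  have r2 : 0 <= m%:R * (h2 * (2 * y / N) * slack) := mulr_ge0 mm0 q2.
  apply: ler_pM => //; first by apply: addr_ge0 => //; apply: mulr_ge0.
  by rewrite lerD2l; apply: ler_wpM2r.
apply: le_trans (lerD T1 T2) _; rewrite le_eqVlt; apply/orP; left; apply/eqP.
rewrite /h1 /h2 /m0 /corr_const /pbound; field.
by rewrite !gt_eqF.
Qed.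

End CorrelationSum.

(** * Square-root cancellation on a rectangle *)

Section RectangleSum.
Variable R : realType.
Local Notation C := (R[i]).

Lemma weight0_sqr_le (s : C) (N : R) : 2^-1 <= complex.Re s <= 1 -> 1 <= N ->
  weight0 s N ^+ 2 * N ^+ 2 <= 1.
Proof.
move=> /andP[s1 _] N1; have N0 : 0 < N by exact: lt_le_trans N1.
rewrite -exprMn expr_le1 ?mulr_ge0 ?expR_ge0 // ?(ltW N0) //.
rewrite /weight0 -{2}(lnK (x := N)) ?posrE // -expRD expR_le1.
have := ln_ge0 N1; nra.
Qed.

(** The arithmetic of the differencing inequality: [M] is of order [N^2 / y] and [J] of order
    [N^2 / (A y)], so their quotient is of order [A], while the bracket is bounded up to the
    logarithm [l]. *)
Lemma vdc_combine (S2 J M B C' C3 c3 l A y N B1 B2 T : R) :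
  0 < J -> 0 < c3 -> 0 <= B -> 0 <= C' -> 0 <= l -> 1 <= A -> 1 <= 2 * y -> 0 < C3 -> 0 < T -> 0 < N ->
  J * S2 <= M * (B1 + 2 * B2) -> 0 <= M -> M <= T * (N ^+ 2 / y) -> 0 <= B1 -> 0 <= B2 ->
  B1 <= B / y -> B2 <= C' / y * (2 * (N / A) * l) -> N <= C3 * A * y ->
  c3 * N ^+ 2 / (A * y) <= 2 * J ->
  S2 <= c3^-1 * (2 * T * (2 * B + 4 * C' * C3)) * (A * (1 + l)).
Proof.
move=> J0 c30 B0 C'0 l0 A1 y1 C30 T0 N0 V M0 ML B10 B20 B1L B2L NL XJ.
have y0 : 0 < y by lra.
have A0 : 0 < A by lra.
have yA : 0 < A * y by rewrite mulr_gt0.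
have h1 : B1 <= 2 * B.
  apply: le_trans B1L _; rewrite ler_pdivrMr //; move: B0 y1; clear; nra.
have h2 : B2 <= 2 * C' * C3 * l.
  apply: le_trans B2L _.
  have -> : C' / y * (2 * (N / A) * l) = (2 * C' * l) * (N / (A * y)) by field; rewrite !gt_eqF.
  have -> : 2 * C' * C3 * l = (2 * C' * l) * C3 by ring.
  rewrite ler_wpM2l ?ler_pdivrMr ?(mulrA C3) //.
  by apply: mulr_ge0 => //; apply: mulr_ge0.
have h3 : N ^+ 2 / y <= c3^-1 * (2 * J * A).
  rewrite ler_pdivlMl //; move: XJ; rewrite ler_pdivrMr // => XJ.
  by rewrite mulrA ler_pdivrMr // -(mulrA (2 * J)).
have h4 : M <= T * (c3^-1 * (2 * J * A)) by apply: le_trans ML _; rewrite ler_wpM2l // ltW.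
have h5 : B1 + 2 * B2 <= (2 * B + 4 * C' * C3) * (1 + l).
  have t1 : 0 <= B * l by rewrite mulr_ge0.
  have t2 : 0 <= C' * C3 by rewrite mulr_ge0 // ltW.
  by move: t1 t2 h1 h2; clear; lra.
have h6 : M * (B1 + 2 * B2) <= T * (c3^-1 * (2 * J * A)) * ((2 * B + 4 * C' * C3) * (1 + l)).
  by apply: ler_pM => //; rewrite addr_ge0 ?mulr_ge0.
rewrite -(ler_pM2l J0); apply: le_trans (le_trans V h6) _.
by rewrite le_eqVlt; apply/orP; left; apply/eqP; ring.
Qed.

(** Differencing with the largest admissible number [J] of shifts, about [N^2 / (A y)]. Each
    correlation is bounded by the better of the number of points and [corr_bound], and summing over
    [h < J] costs a logarithm. The unimodular twists [e1], [e2] make the result usable for all sign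
    characters. *)
Lemma rect_sum (C3 : R) : 1 <= C3 -> exists2 K : R, 0 < K &
  forall (n : int) (z s u0 e1 e2 : C) (N : R) (m L : nat),
  let y := complex.Im z in let A := conductor n (0 +i* complex.Im s)%C in
  `|complex.Re z| <= 2^-1 -> 4 / 5 <= y -> 2^-1 <= complex.Re s <= 1 ->
  1 <= A -> y <= N / 3000 -> N <= C3 * A * y ->
  (forall i l, (i <= m)%N -> (l <= L)%N -> N <= cmod (pt z u0 i l) <= 24 * N) ->
  m%:R <= 24 * N / y -> L%:R <= 24 * N -> cmod e1 = 1 -> cmod e2 = 1 ->
  cmod (\sum_(i < m) \sum_(l < L) e1 ^+ i * e2 ^+ l * qchar n s (pt z u0 i l)) ^+ 2
    <= K * (A * (1 + ln (1 + A))).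
Proof.
move=> C31; set CB := corr_const R.
have CB0 : 0 <= CB.
  rewrite /CB /corr_const; have := slack_gt0 R; have := cD_gt0 R => c0 sl.
  by rewrite divr_ge0 // ?mulr_ge0 ?addr_ge0 ?mulr_ge0 ?ler0n // ltW.
have [k30 k301 k30E] : exists2 k : R, 1 <= k & k = 3000 by exists 3000 => //; rewrite ler1n.
have k300 : 0 < k30 by exact: lt_le_trans k301.
have [B B0 BE] : exists2 B : R, 0 < B & B = 24 * 24 by exists (24 * 24) => //; rewrite mulr_gt0 ?ltr0n.
have [T T0 TE] : exists2 T : R, 0 < T & T = 24 * 25 by exists (24 * 25) => //; rewrite mulr_gt0 ?ltr0n.
(* For shifts below [c3 N^2 / (A y)] one has [A h y <= N^2 / 3000], and, because [N <= C3 A y], also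
   [h <= N / 3000]. *)
pose c3 := (k30 * C3)^-1.
have C30 : 0 < C3 by exact: lt_le_trans C31.
have c30 : 0 < c3 by rewrite invr_gt0 mulr_gt0.
pose C' := B + CB.
have C'0 : 0 < C' by rewrite ltr_pwDl.
pose K := c3^-1 * (2 * T * (2 * B + 4 * C' * C3) + B ^+ 2 * 2).
have K10 : 0 <= 2 * T * (2 * B + 4 * C' * C3).
  have := mulr_gt0 C'0 C30; move: T0 B0; clear => T0 B0 CC.
  by rewrite mulr_ge0 //; lra.
have K0 : 0 < K.
  rewrite /K; apply: mulr_gt0; first by rewrite invr_gt0.
  by apply: ltr_wpDl => //; apply: mulr_gt0 => //; exact: exprn_gt0.
exists K => // n z s u0 e1 e2 N m L y A zx zy s12 A1 yN0 NA grid mN LN e1u e2u.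
have yN : y <= N / k30 by rewrite k30E.
have y0 : 0 < y := im_gt0 zy.
have N0 : 0 < N := scale_gt0 zy yN0.
have A0 : 0 < A by exact: lt_le_trans A1.
have N1 : 1 <= N by have := yN0; have := zy; rewrite -/y; clear; lra.
set W2 := weight0 s N ^+ 2.
have W20 : 0 <= W2 by rewrite sqr_ge0.
have W2N : W2 * N ^+ 2 <= 1 := weight0_sqr_le s12 N1.
have lnA : 0 <= ln (1 + A) by rewrite ln_ge0 // lerDl ltW.
pose phi i l := qchar n s (pt z u0 i l).
have pt0 i l : (i <= m)%N -> (l <= L)%N -> pt z u0 i l != 0.
  by move=> im lL; case/andP: (grid i l im lL) => g _; rewrite -cmod_gt0 (lt_le_trans N0).
have phile i l : (i <= m)%N -> (l <= L)%N -> cmod (phi i l) <= weight0 s N.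
  move=> im lL; rewrite cmod_qchar ?pt0 //.
  by apply: (weight_le zy s12 yN0); case/andP: (grid i l im lL).
have e1i i : cmod (e1 ^+ i) = 1 by rewrite cmodX e1u expr1n.
have e2i i : cmod (e2 ^+ i) = 1 by rewrite cmodX e2u expr1n.
pose a i l := if (l < L)%N then e1 ^+ i * e2 ^+ l * phi i l else 0.
have aE : \sum_(i < m) \sum_(l < L) e1 ^+ i * e2 ^+ l * phi i l = \sum_(i < m) \sum_(l < L) a i l.
  by apply: eq_bigr => i _; apply: eq_bigr => l _; rewrite /a ltn_ord.
have ale i l : (i <= m)%N -> cmod (a i l) <= weight0 s N.
  move=> im; rewrite /a; case: ifP => [lL|_]; last by rewrite cmod0 expR_ge0.
  rewrite (cmodM _ (phi i l)) (cmodM (e1 ^+ i)) e1i e2i !mul1r; apply: phile => //; exact: ltnW.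
have mL : m%:R * L%:R <= 24 * N / y * (24 * N) by apply: ler_pM.
have mLW : m%:R * L%:R * W2 <= B / y.
  apply: le_trans (ler_wpM2r W20 mL) _.
  have -> : 24 * N / y * (24 * N) * W2 = B / y * (W2 * N ^+ 2) by rewrite BE; ring.
  by rewrite ler_piMr // divr_ge0 // ltW.
set S := cmod _; have SE : S = cmod (\sum_(i < m) \sum_(l < L) a i l) by rewrite /S -aE.
have cst_sum (k : nat) (X : R) : \sum_(j < k) X = k%:R * X by rewrite sumr_const card_ord mulr_natl.
pose X := c3 * N ^+ 2 / (A * y).
have Ay : 0 < A * y by rewrite mulr_gt0.
have X0 : 0 < X by rewrite divr_gt0 // mulr_gt0 // exprn_gt0.
have XE : X * (A * y) = c3 * N ^+ 2 by rewrite divfK // gt_eqF.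
have c3C3 : c3 * C3 = k30^-1 by rewrite /c3 invfM -mulrA mulVf ?mulr1 // gt_eqF.
have XN : X <= N / k30.
  rewrite ler_pdivrMr // -c3C3.
  have -> : N * (c3 * C3) * (A * y) = c3 * N * (C3 * A * y) by ring.
  by rewrite expr2 mulrA ler_wpM2l // mulr_ge0 // ltW.
have i30 : (k30^-1 : R) <= 1 by rewrite invf_le1.
have i30' : (0 : R) <= k30^-1 by rewrite invr_ge0 ltW.
have XN1 : X <= N by apply: le_trans XN _; rewrite ler_piMr // ltW.
(* If no shift is admissible then [c3 N^2 <= A y], and the trivial bound is already of the required
   size. *)
case: (posnP (Num.truncn X)) => [X1|J0].
  have X2 : X < 1 by have /andP[_] := truncn_itv (ltW X0); rewrite X1.
  have c3N : c3 * N ^+ 2 <= A * y by rewrite -XE ler_piMl // ltW.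
  have Sle : S <= m%:R * L%:R * weight0 s N.
    rewrite SE; apply: le_trans (ler_cmod_sum _ _ _) _; rewrite -mulrA -cst_sum; apply: ler_sum => i _.
    apply: le_trans (ler_cmod_sum _ _ _) _; rewrite -cst_sum; apply: ler_sum => l _.
    by apply: ale; exact: ltnW.
  have S2 : S ^+ 2 <= (m%:R * L%:R) ^+ 2 * W2.
    by rewrite /W2 -exprMn; apply: lerXn2r; rewrite ?nnegrE ?cmod_ge0 // !mulr_ge0 // expR_ge0.
  apply: le_trans S2 _.
  have t : (m%:R * L%:R) ^+ 2 * W2 <= (24 * N / y * (24 * N)) * (B / y).
    rewrite expr2 -mulrA; apply: ler_pM => //; first by rewrite mulr_ge0.
  apply: le_trans t _.
  have -> : 24 * N / y * (24 * N) * (B / y) = B ^+ 2 * (N ^+ 2 / y ^+ 2) by rewrite BE; field; rewrite gt_eqF.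
  have N2 : N ^+ 2 / y ^+ 2 <= c3^-1 * (2 * A).
    rewrite ler_pdivrMr ?exprn_gt0 // -mulrA ler_pdivlMl //.
    apply: le_trans c3N _; have y1 : 1 <= 2 * y by have := zy; rewrite -/y; clear; lra.
    have -> : 2 * A * y ^+ 2 = A * y * (2 * y) by ring.
    by rewrite ler_peMr // ltW.
  apply: le_trans (ler_wpM2l (sqr_ge0 _) N2) _.
  have -> : B ^+ 2 * (c3^-1 * (2 * A)) = c3^-1 * (B ^+ 2 * 2) * A by ring.
  apply: (@le_trans _ _ (K * A)); last by rewrite ler_wpM2l ?(ltW K0) // ler_peMr ?(ltW A0) // lerDl.
  apply: ler_wpM2r (ltW A0) _ _ _; apply: ler_wpM2l; first by rewrite invr_ge0 ltW.
  by rewrite lerDr.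
set J := Num.truncn X in J0 *.
have /andP[JX JX1] : J%:R <= X < J.+1%:R := truncn_itv (ltW X0).
have XJ : X <= 2 * J%:R.
  apply: le_trans (ltW JX1) _; rewrite -natr1 mulr2n mulrDl mul1r lerD2l ler1n //.
(* At [h = b] the saving [N / (A h)] becomes effective; [2 b / (h + b)] dominates both 1 for
   [h <= b] and [b / h] beyond. *)
pose b := N / A; have b0 : 0 < b by rewrite divr_gt0.
have bh h : (0 < h)%N -> (h < J)%N ->
    cmod (\sum_(i < m) \sum_(l < L) a i (l + h)%N * (a i l)^*%C) <= C' / y * (2 * b / (h%:R + b)).
  move=> h0 hJ; have hr : 0 < h%:R :> R by rewrite ltr0n.
  have hX : h%:R <= X by apply: le_trans JX; rewrite ler_nat ltnW.
  have hb : 0 < h%:R + b by rewrite addr_gt0.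
  have pos : 0 <= C' / y * (2 * b / (h%:R + b)).
    apply: mulr_ge0; first exact: divr_ge0 (ltW C'0) (ltW y0).
    by apply: divr_ge0 (ltW hb); apply: mulr_ge0 => //; exact: ltW.
  case: (leP h%:R b) => hb'.
    apply: (@le_trans _ _ (B / y)).
      apply: le_trans mLW; apply: le_trans (ler_cmod_sum _ _ _) _; rewrite -mulrA -cst_sum.
      apply: ler_sum => i _; apply: le_trans (ler_cmod_sum _ _ _) _; rewrite -cst_sum; apply: ler_sum => l _.
      rewrite cmodM cmodJ /W2 expr2; apply: ler_pM => //; exact: ale (ltnW (ltn_ord i)).
    apply: (@le_trans _ _ (C' / y)); first by rewrite ler_wpM2r ?invr_ge0 ?(ltW y0) // lerDl.
    rewrite ler_peMr ?divr_ge0 ?(ltW C'0) ?(ltW y0) // ler_pdivlMr // mul1r.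
    by move: hb'; clear; lra.
  case: (leqP h L) => hL; last first.
    rewrite big1 ?cmod0 // => i _; rewrite big1 // => l _; rewrite {1}/a.
    by rewrite ltnNge (leq_trans (ltnW hL) (leq_addl _ _)) /= mul0r.
  (* In a correlation the twists cancel against their conjugates, up to the factor [e2^h] of modulus
     1. *)
  have sumE : \sum_(i < m) \sum_(l < L) a i (l + h)%N * (a i l)^*%C =
      e2 ^+ h * \sum_(i < m) \sum_(l < L - h) phi i (l + h)%N * (phi i l)^*%C.
    rewrite mulr_sumr; apply: eq_bigr => i _; rewrite mulr_sumr.
    rewrite -(big_mkord xpredT (fun l => a i (l + h)%N * (a i l)^*%C)) (big_cat_nat (n := L - h)) ?leq_subr //=.
    rewrite [X in _ + X]big_nat [X in _ + X]big1 ?addr0; last first.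
      move=> l /andP[lL _]; rewrite {1}/a ifF ?mul0r //.
      by apply/negbTE; rewrite -leqNgt addnC -leq_subLR.
    rewrite big_mkord; apply: eq_bigr => l _.
    have lL : (l + h < L)%N by have := ltn_ord l; rewrite ltn_subRL addnC.
    rewrite /a lL (leq_ltn_trans (leq_addr _ _) lL) exprD.
    have cM (u v : C) : (u * v)^*%C = u^*%C * v^*%C by exact: rmorphM.
    have u1 : e1 ^+ i * (e1 ^+ i)^*%C = 1 by rewrite mulcJ_cmod e1i expr1n.
    have u2 : e2 ^+ l * (e2 ^+ l)^*%C = 1 by rewrite mulcJ_cmod e2i expr1n.
    rewrite (cM _ (phi i l)) (cM (e1 ^+ i)).
    transitivity ((e1 ^+ i * (e1 ^+ i)^*%C) * (e2 ^+ l * (e2 ^+ l)^*%C) * (e2 ^+ h * (phi i (l + h)%N * (phi i l)^*%C))).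
      by ring.
    by rewrite u1 u2 !mul1r.
  rewrite sumE cmodM e2i mul1r.
  have hA : A * h%:R * y <= N ^+ 2 / k30.
    have -> : A * h%:R * y = h%:R * (A * y) by ring.
    apply: le_trans (ler_wpM2r (ltW Ay) hX) _; rewrite XE mulrC; apply: ler_wpM2l (sqr_ge0 _) _ _ _.
    by rewrite /c3 invfM ler_piMr // invf_le1.
  have hN : h%:R <= N / k30 by apply: le_trans hX XN.
  have LhN : (L - h)%:R <= 24 * N by apply: le_trans LN; rewrite ler_nat leq_subr.
  have gr i l : (i <= m)%N -> (l <= L - h + h)%N -> N <= cmod (pt z u0 i l) <= 24 * N.
    by rewrite subnK //; exact: grid.
  rewrite k30E in hA hN; have := corr_bound zx zy s12 A1 h0 hA hN yN0 gr mN LhN; rewrite -/phi -/CB -/W2 => CBound.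
  apply: le_trans CBound _.
  have -> : N / (freq n s N h * y) = N ^+ 2 * (b / h%:R) / y.
    rewrite /freq /b -/A; field.
    by rewrite !gt_eqF.
  apply: (@le_trans _ _ (CB * (b / h%:R) / y)).
    have -> : CB * W2 * (N ^+ 2 * (b / h%:R) / y) = (CB * (b / h%:R) / y) * (W2 * N ^+ 2) by ring.
    rewrite ler_piMr //; apply: divr_ge0 (ltW y0); apply: mulr_ge0 => //.
    by apply: divr_ge0; exact: ltW.
  have q : b / h%:R <= 2 * b / (h%:R + b).
    rewrite ler_pdivrMr // mulrAC ler_pdivlMr //; move: b0 hr hb'; clear; nra.
  have -> : C' / y * (2 * b / (h%:R + b)) = C' * (2 * b / (h%:R + b)) / y by ring.
  rewrite ler_wpM2r ?invr_ge0 ?(ltW y0) //; apply: ler_pM => //.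
    by rewrite divr_ge0 // ltW.
  by rewrite /C' lerDr ltW.
have aL i l : (L <= l)%N -> a i l = 0 by move=> Ll; rewrite /a ltnNge Ll.
have V := van_der_corput m J0 aL.
rewrite -SE in V.
have B1 : \sum_(i < m) \sum_(l < L) cmod (a i l) ^+ 2 <= B / y.
  apply: le_trans mLW; rewrite -mulrA -cst_sum; apply: ler_sum => i _.
  rewrite -cst_sum; apply: ler_sum => l _.
  by apply: lerXn2r; rewrite ?nnegrE ?cmod_ge0 ?expR_ge0 //; exact: ale (ltnW (ltn_ord i)).
have JX2 : J%:R <= X by [].
have NbA : N / A <= C3 * y by rewrite ler_pdivrMr // mulrAC.
have JA : 1 + J%:R / b <= 1 + A.
  rewrite lerD2l /b invf_div mulrA ler_pdivrMr //; apply: (@le_trans _ _ (X * A)).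
    by rewrite ler_wpM2r // ltW.
  have -> : X * A = c3 * (N / y) * N by rewrite /X; field; rewrite !gt_eqF.
  rewrite ler_wpM2r ?(ltW N0) // mulrA ler_pdivrMr //; apply: le_trans (ler_wpM2l (ltW c30) NA) _.
  have -> : c3 * (C3 * A * y) = (c3 * C3) * (A * y) by ring.
  by rewrite c3C3 ler_piMl // ltW.
have B2 : \sum_(1 <= h < J) cmod (\sum_(i < m) \sum_(l < L) a i (l + h)%N * (a i l)^*%C) <=
    C' / y * (2 * b * ln (1 + A)).
  have Cy : 0 <= C' / y by rewrite divr_ge0 // ltW.
  apply: le_trans (_ : \sum_(1 <= h < J) C' / y * (2 * b / (h%:R + b)) <= _).
    by rewrite !big_nat; apply: ler_sum => h /andP[h1 h2]; exact: bh.
  rewrite -mulr_sumr ler_wpM2l //; apply: le_trans (sum_harmonic_le J b0) _.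
  apply: ler_wpM2l; first by apply: mulr_ge0 => //; exact: ltW.
  rewrite ler_ln ?posrE //; first by rewrite ltr_wpDr // divr_ge0 // ltW.
  by rewrite ltr_wpDr // ltW.
have B10 : 0 <= \sum_(i < m) \sum_(l < L) cmod (a i l) ^+ 2.
  by apply: sumr_ge0 => i _; apply: sumr_ge0 => l _; exact: sqr_ge0.
have B20 : 0 <= \sum_(1 <= h < J) cmod (\sum_(i < m) \sum_(l < L) a i (l + h)%N * (a i l)^*%C).
  by apply: sumr_ge0.
have y1 : 1 <= 2 * y by have := zy; rewrite -/y; clear; lra.
have mLJ : m%:R * (L%:R + J%:R) <= T * (N ^+ 2 / y).
  have JN : J%:R <= N by apply: le_trans XN1.
  have LJ : L%:R + J%:R <= 25 * N by move: JN LN; clear; lra.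
  apply: le_trans (_ : 24 * N / y * (25 * N) <= _); first by apply: ler_pM => //; rewrite addr_ge0.
  by rewrite TE le_eqVlt; apply/orP; left; apply/eqP; field; rewrite gt_eqF.
have Jr : 0 < J%:R :> R by rewrite ltr0n.
have mLJ0 : 0 <= m%:R * (L%:R + J%:R) :> R by rewrite mulr_ge0 ?addr_ge0.
rewrite natrD in V; have V' : J%:R * S ^+ 2 <= m%:R * (L%:R + J%:R) * (\sum_(i < m) \sum_(l < L) cmod (a i l) ^+ 2 +
    2 * \sum_(1 <= h < J) cmod (\sum_(i < m) \sum_(l < L) a i (l + h)%N * (a i l)^*%C)) by [].
have := vdc_combine Jr c30 (ltW B0) (ltW C'0) lnA A1 y1 C30 T0 N0 V' mLJ0 mLJ B10 B20 B1 B2 NA XJ.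
move=> H; apply: le_trans H _; rewrite ler_wpM2r ?mulr_ge0 ?(ltW A0) ?addr_ge0 //.
rewrite /K; apply: ler_wpM2l; first by rewrite invr_ge0 ltW.
by rewrite lerDl mulr_ge0 ?sqr_ge0.
Qed.

End RectangleSum.

(** * Alternating lattice sums *)

Section Boxes.
Variable V : zmodType.
Implicit Types (f : int -> V) (F : int -> int -> V).

Definition seg f (a : int) (L : nat) : V := \sum_(l < L) f (a + l%:Z).
Definition box F (a : int) (m : nat) (b : int) (L : nat) : V := seg (fun c => seg (F c) b L) a m.

Lemma seg_cat f a (L1 L2 : nat) : seg f a (L1 + L2) = seg f a L1 + seg f (a + L1%:Z) L2.
Proof.
rewrite /seg big_split_ord /=; congr (_ + _); apply: eq_bigr => l _.
by rewrite PoszD addrA.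
Qed.

Lemma segD f g a L : seg (fun x => f x + g x) a L = seg f a L + seg g a L.
Proof. exact: big_split. Qed.

Lemma boxE F a m b L : box F a m b L = \sum_(i < m) \sum_(l < L) F (a + i%:Z) (b + l%:Z).
Proof. by []. Qed.

Lemma box_tr F a m b L : box F a m b L = box (fun d c => F c d) b L a m.
Proof. by rewrite !boxE exchange_big. Qed.

(** Half-open boxes [-P <= c < P], [-Q <= d < Q]: the even points of the box of size [2 P], [2 Q]
    are exactly the doubles of the points of the box of size [P], [Q]. *)
Definition sbox F (P Q : nat) : V := box F (- P%:Z) (P + P) (- Q%:Z) (Q + Q).

Lemma sbox_split F (P Q p q : nat) : sbox F (P + p) (Q + q) = sbox F P Q +
  (box F (- (P + p)%N%:Z) p (- (Q + q)%N%:Z) (Q + q + (Q + q)) +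
   box F P%:Z p (- (Q + q)%N%:Z) (Q + q + (Q + q)) +
   (box F (- P%:Z) (P + P) (- (Q + q)%N%:Z) q + box F (- P%:Z) (P + P) Q%:Z q)).
Proof.
have split3 (f : int -> V) (X x : nat) : seg f (- (X + x)%N%:Z) (X + x + (X + x)) =
    seg f (- (X + x)%N%:Z) x + seg f (- X%:Z) (X + X) + seg f X%:Z x.
  have -> : (X + x + (X + x) = x + (X + X) + x)%N by lia.
  rewrite !seg_cat; rewrite -addrA -[RHS]addrA; congr (_ + _).
  have -> : - (X + x)%N%:Z + x%:Z = - X%:Z :> int by lia.
  have -> : - (X + x)%N%:Z + (x + (X + X))%N%:Z = X%:Z :> int by lia.
  by [].
rewrite /sbox /box split3.
set r := fun c => _.
have -> : seg r (- P%:Z) (P + P) = seg (fun c => seg (F c) (- (Q + q)%N%:Z) q) (- P%:Z) (P + P) +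
    seg (fun c => seg (F c) (- Q%:Z) (Q + Q)) (- P%:Z) (P + P) +
    seg (fun c => seg (F c) Q%:Z q) (- P%:Z) (P + P).
  by rewrite -!segD; apply: eq_bigr => i _; exact: split3.
by rewrite !addrA [LHS](ACl (3*1*5*2*4)).
Qed.
End Boxes.

Section BoxBounds.
Variable R : realType.
Local Notation C := (R[i]).

Lemma ler_box (F : int -> int -> C) (a b : int) (m L : nat) (B : R) :
  (forall i l, (i < m)%N -> (l < L)%N -> cmod (F (a + i%:Z) (b + l%:Z)) <= B) ->
  cmod (box F a m b L) <= m%:R * L%:R * B.
Proof.
move=> H; rewrite boxE; apply: le_trans (ler_cmod_sum _ _ _) _.
have -> : m%:R * L%:R * B = \sum_(i < m) (L%:R * B) by rewrite sumr_const card_ord -mulrA mulr_natl.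
apply: ler_sum => i _; apply: le_trans (ler_cmod_sum _ _ _) _.
have -> : L%:R * B = \sum_(i < L) B by rewrite sumr_const card_ord mulr_natl.
by apply: ler_sum => l _; apply: H.
Qed.

Lemma ler_boxr (F : int -> int -> R) (a b : int) (m L : nat) (B : R) :
  (forall i l, (i < m)%N -> (l < L)%N -> F (a + i%:Z) (b + l%:Z) <= B) ->
  box F a m b L <= m%:R * L%:R * B.
Proof.
move=> H; rewrite boxE.
have -> : m%:R * L%:R * B = \sum_(i < m) (L%:R * B) by rewrite sumr_const card_ord -mulrA mulr_natl.
apply: ler_sum => i _; have -> : L%:R * B = \sum_(i < L) B by rewrite sumr_const card_ord mulr_natl.
by apply: ler_sum => l _; apply: H.
Qed.

Lemma box_lines (F : int -> int -> C) (g : int -> int -> R) (a b : int) (m L : nat) (w : R) :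
  (forall i, (i < m)%N -> cmod (seg (F (a + i%:Z)) b L) <= w + seg (g (a + i%:Z)) b L) ->
  cmod (box F a m b L) <= m%:R * w + box g a m b L.
Proof.
move=> H; rewrite /box {1}/seg; apply: le_trans (ler_cmod_sum _ _ _) _.
have -> : m%:R * w = \sum_(i < m) w by rewrite sumr_const card_ord mulr_natl.
by rewrite -big_split; apply: ler_sum => i _; exact: H.
Qed.

(* Abel summation along each line of the annulus, with boundary terms only at its outer edges: every point of
   the annulus satisfies [P <= |p|] or [Q <= |l|]. *)
Lemma annulus_lines (F : int -> int -> C) (g w : int -> int -> R) (P Q p q : nat) (W1 W2 : R) :
  (forall (r b : int) (L : nat), (forall l : nat, (l <= L)%N -> (P <= absz r)%N || (Q <= absz (b + l%:Z)%R)%N) ->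
    cmod (seg (F r) b L) <= w r b + w r (b + L%:Z) + seg (g r) b L) ->
  (forall r l : int, (P <= absz r)%N || (Q <= absz l)%N -> w r l <= W1) ->
  (forall r l : int, (Q + q <= absz l)%N -> w r l <= W2) ->
  cmod (sbox F (P + p) (Q + q) - sbox F P Q) <=
    4 * p%:R * W2 + 8 * P%:R * W1 + (sbox g (P + p) (Q + q) - sbox g P Q).
Proof.
move=> Hl H1 H2; rewrite !sbox_split !(addrC (sbox _ P Q)) !addrK.
set b1 := box F _ _ _ _; set b2 := box F _ _ _ _; set b3 := box F _ _ _ _; set b4 := box F _ _ _ _.
have B1 : cmod b1 <= p%:R * (W2 + W2) + box g (- (P + p)%N%:Z) p (- (Q + q)%N%:Z) (Q + q + (Q + q)).
  apply: box_lines => i ip; apply: le_trans (Hl _ _ _ _) _.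
    by move=> l _; apply/orP; left; lia.
  by apply: lerD => //; apply: lerD; apply: H2; lia.
have B2 : cmod b2 <= p%:R * (W2 + W2) + box g P%:Z p (- (Q + q)%N%:Z) (Q + q + (Q + q)).
  apply: box_lines => i ip; apply: le_trans (Hl _ _ _ _) _.
    by move=> l _; apply/orP; left; lia.
  by apply: lerD => //; apply: lerD; apply: H2; lia.
have B3 : cmod b3 <= (P + P)%:R * (W1 + W1) + box g (- P%:Z) (P + P) (- (Q + q)%N%:Z) q.
  apply: box_lines => i ip; apply: le_trans (Hl _ _ _ _) _.
    by move=> l lq; apply/orP; right; lia.
  by apply: lerD => //; apply: lerD; apply: H1; apply/orP; right; lia.
have B4 : cmod b4 <= (P + P)%:R * (W1 + W1) + box g (- P%:Z) (P + P) Q%:Z q.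
  apply: box_lines => i ip; apply: le_trans (Hl _ _ _ _) _.
    by move=> l lq; apply/orP; right; lia.
  by apply: lerD => //; apply: lerD; apply: H1; apply/orP; right; lia.
have := ler_cmodD (b1 + b2) (b3 + b4); have := ler_cmodD b1 b2; have := ler_cmodD b3 b4.
move: B1 B2 B3 B4; rewrite natrD; clear; lra.
Qed.

(** The annulus between the box and its double has [16 P Q - 4 P Q] points. *)
Lemma annulus_le (g : int -> int -> R) (P Q : nat) (B : R) : (0 < P)%N -> (0 < Q)%N ->
  (forall c d : int, (P <= absz c)%N || (Q <= absz d)%N -> g c d <= B) ->
  sbox g (P + P) (Q + Q) - sbox g P Q <= 12 * P%:R * Q%:R * B.
Proof.
move=> P0 Q0 H; rewrite sbox_split (addrC (sbox _ P Q)) addrK.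
have B1 : box g (- (P + P)%N%:Z) P (- (Q + Q)%N%:Z) (Q + Q + (Q + Q)) <= P%:R * (Q + Q + (Q + Q))%:R * B.
  by apply: ler_boxr => i l ip lq; apply: H; apply/orP; left; lia.
have B2 : box g P%:Z P (- (Q + Q)%N%:Z) (Q + Q + (Q + Q)) <= P%:R * (Q + Q + (Q + Q))%:R * B.
  by apply: ler_boxr => i l ip lq; apply: H; apply/orP; left; lia.
have B3 : box g (- P%:Z) (P + P) (- (Q + Q)%N%:Z) Q <= (P + P)%:R * Q%:R * B.
  by apply: ler_boxr => i l ip lq; apply: H; apply/orP; right; lia.
have B4 : box g (- P%:Z) (P + P) Q%:Z Q <= (P + P)%:R * Q%:R * B.
  by apply: ler_boxr => i l ip lq; apply: H; apply/orP; right; lia.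
move: B1 B2 B3 B4; rewrite !natrD; clear; lra.
Qed.
End BoxBounds.

(** * Partial summation along alternating lines *)

Section AlternatingLine.
Variable R : realType.
Local Notation C := (R[i]).
Variables (n : int) (s : C).
Local Notation A := (conductor n s).
Local Notation phi := (qchar n s).

Lemma abel_alt (M f : nat -> C) (L : nat) : (forall l, (l < L)%N -> f l = M l * (f l.+1 - f l)) ->
  cmod (M 0%N) <= 1 -> cmod (M L) <= 1 ->
  cmod (\sum_(l < L) f l) <= cmod (f 0%N) + cmod (f L) + \sum_(l < L) cmod (M l.+1 - M l) * cmod (f l.+1).
Proof.
move=> H M0 ML.
have -> : \sum_(l < L) f l = M L * f L - M 0%N * f 0%N - \sum_(l < L) (M l.+1 - M l) * f l.+1.
  transitivity (\sum_(l < L) M l * (f l.+1 - f l)); first by apply: eq_bigr => l _; exact: H.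
  by elim: (L) => [|k IH]; rewrite ?big_ord0 ?subr0 ?subrr // !big_ord_recr /= IH; ring.
have e1 : cmod (M L * f L) <= cmod (f L) by rewrite cmodM ler_piMl.
have e2 : cmod (M 0%N * f 0%N) <= cmod (f 0%N) by rewrite cmodM ler_piMl.
have e3 : cmod (\sum_(l < L) (M l.+1 - M l) * f l.+1) <= \sum_(l < L) cmod (M l.+1 - M l) * cmod (f l.+1).
  by apply: le_trans (ler_cmod_sum _ _ _) _; apply: ler_sum => l _; rewrite cmodM.
have := ler_cmodB (M L * f L - M 0%N * f 0%N) (\sum_(l < L) (M l.+1 - M l) * f l.+1).
have := ler_cmodB (M L * f L) (M 0%N * f 0%N); move: e1 e2 e3; clear; lra.
Qed.

Lemma invr_diff (a b : C) : a != 0 -> b != 0 -> - b^-1 - (- a^-1) = (b - a) / (a * b).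
Proof. by move=> a0 b0; field; rewrite a0 b0. Qed.

(** Consecutive terms satisfy [f (l + 1) = - q f l] with [q] close to 1, so
    [f l = - (f (l + 1) - f l) / (1 + q)]. Partial summation leaves boundary terms and the variation
    of [1 / (1 + q)], of order [A |v|^2 / |u|^2]. The hypothesis that [|u|] exceeds [20 (A + 1) |v|]
    is what keeps [q] close to 1. *)
Lemma alternating_line (u0 v e : C) (L : nat) : cmod e = 1 ->
  (forall l, (l <= L)%N -> 20 * (A + 1) * cmod v <= cmod (u0 + l%:R * v) /\ u0 + l%:R * v != 0) ->
  cmod (\sum_(l < L) e * (-1) ^+ l * phi (u0 + l%:R * v)) <=
    4 * cmod (phi u0) + 4 * cmod (phi (u0 + L%:R * v)) +
    \sum_(l < L) 20 * A * cmod v ^+ 2 / cmod (u0 + l%:R * v) ^+ 2 * cmod (phi (u0 + l%:R * v)).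
Proof.
move=> e1 H; have A0 : 0 <= A := conductor_ge0 n s.
have pos (w : C) : 1 <= cmod w -> 0 < cmod w by exact: lt_le_trans ltr01.
pose u l := u0 + l%:R * v.
have uS l : u l.+1 = u l + v by rewrite /u -natr1 mulrDl mul1r addrA.
pose f l := e * (-1) ^+ l * phi (u l).
have fc l : cmod (f l) = cmod (phi (u l)) by rewrite /f !cmodM e1 cmodX cmodN cmod1 expr1n !mul1r.
pose q l := phi (1 + v / u l).
have small l : (l <= L)%N -> [/\ cmod (v / u l) <= 20^-1, A * cmod (v / u l) <= 20^-1 & u l != 0].
  move=> lL; have [h1 h2] := H l lL; have ul : 0 < cmod (u l) by rewrite cmod_gt0.
  have v0 := cmod_ge0 v.
  have q1 : cmod v / cmod (u l) * (20 * (A + 1)) <= 1 by rewrite mulrAC ler_pdivrMr // mul1r mulrC.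
  have q0 : 0 <= cmod v / cmod (u l) by rewrite divr_ge0.
  rewrite cmodM cmodV; split => //.
    have : 0 <= A * (cmod v / cmod (u l)) by rewrite mulr_ge0.
    by move: q1; clear; lra.
  by move: q1 q0; clear; lra.
have q1 l : (l <= L)%N -> cmod (q l - 1) <= 2^-1.
  move=> lL; have [h1 h2 h3] := small l lL; apply: le_trans (qchar_sub1 _ _) _; move: h1 h2; clear; lra.
have q1' l : (l <= L)%N -> 1 <= cmod (1 + q l) /\ cmod (q l) <= 2.
  move=> lL; have := q1 l lL; have c2 : cmod (2 : C) = 2 by rewrite (cmod_nat R 2).
  have := ler_cmod_dist 2 (1 - q l); have -> : 2 - (1 - q l) = 1 + q l by ring.
  have := ler_cmodD (q l - 1) 1; rewrite subrK cmod1 c2 cmodB; clear; lra.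
have ratio l : (l < L)%N -> phi (u l.+1) = phi (u l) * q l.
  move=> lL; have [_ _ ul] := small l (ltnW lL); have [_ _ ul1] := small l.+1 lL.
  have E : u l.+1 = u l * (1 + v / u l) by rewrite uS mulrDr mulr1 mulrCA divff // mulr1.
  by rewrite E qcharM //; apply: contraNneq ul1 => Z; rewrite E Z mulr0.
pose M l := - (1 + q l)^-1.
have M1 l : (l <= L)%N -> cmod (M l) <= 1.
  by move=> lL; rewrite cmodN cmodV invf_le1; have [h _] := q1' l lL; rewrite ?pos.
have fM l : (l < L)%N -> f l = M l * (f l.+1 - f l).
  move=> lL; rewrite /f (ratio l lL) exprS /M.
  have [h _] := q1' l (ltnW lL); have : 1 + q l != 0 by rewrite -cmod_gt0 pos.
  by move=> h0; field.
case: (posnP L) => [L0|L0].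
  by rewrite L0 !big_ord0 cmod0 addr0 !addr_ge0 // mulr_ge0.
(* The last term is set aside: otherwise the error sum would contain the point of index [L], which
   is outside the segment. *)
have Hs : cmod (\sum_(l < L.-1) f l) <= cmod (f 0%N) + cmod (f L.-1) +
    \sum_(l < L.-1) cmod (M l.+1 - M l) * cmod (f l.+1).
  apply: abel_alt => [l lL||]; [|exact: M1|exact: M1 (leq_pred _)].
  by apply: fM; lia.
have MD l : (l < L.-1)%N -> cmod (M l.+1 - M l) <= 20 * A * cmod v ^+ 2 / cmod (u l.+1) ^+ 2.
  move=> lL; have lL1 : (l.+1 <= L)%N by lia. 
  have [h1 h2 ul] := small l (ltnW lL1); have [h1' h2' ul1] := small l.+1 lL1.
  have [g1 g2] := q1' l (ltnW lL1); have [g1' g2'] := q1' l.+1 lL1.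
  have n1 : 1 + q l != 0 by rewrite -cmod_gt0 pos.
  have n2 : 1 + q l.+1 != 0 by rewrite -cmod_gt0 pos.
  have -> : M l.+1 - M l = (q l.+1 - q l) / ((1 + q l) * (1 + q l.+1)) by rewrite /M (invr_diff n1 n2) opprD addrACA subrr add0r.
  pose d := - (v / u l.+1) ^+ 2.
  have x0 : 1 + v / u l != 0.
    have E : u l.+1 = u l * (1 + v / u l) by rewrite uS mulrDr mulr1 mulrCA divff // mulr1.
    by apply: contraNneq ul1 => Z; rewrite E Z mulr0.
  have xE : 1 + v / u l.+1 = (1 + v / u l) * (1 + d).
    rewrite /d; have uE : u l = u l.+1 - v by rewrite uS addrK.
    by rewrite uE; field; rewrite ul1 -uE ul.
  have dE : cmod d = cmod (v / u l.+1) ^+ 2 by rewrite cmodN cmodX.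
  have dle : cmod d <= 20^-1 * cmod (v / u l.+1) by rewrite dE expr2 ler_wpM2r.
  have d0 : 1 + d != 0.
    rewrite -cmod_gt0; have := ler_cmodB (1 + d) d; rewrite addrK cmod1.
    by move: h1' dle; clear; lra.
  have qE : q l.+1 - q l = q l * (phi (1 + d) - 1) by rewrite /q xE qcharM // mulrBr mulr1.
  have dA : A * cmod d <= 20^-1 * (A * cmod (v / u l.+1)) by rewrite mulrCA ler_wpM2l.
  have D1 : cmod (phi (1 + d) - 1) <= 10 * (A * cmod d).
    by apply: qchar_sub1; move: h1' h2' dle dA; clear; lra.
  rewrite cmodM cmodV (cmodM (1 + q l)) qE cmodM.
  have i1 : (cmod (1 + q l) * cmod (1 + q l.+1))^-1 <= 1.
    rewrite invf_le1; first exact: mulr_ege1 g1 g1'.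
    exact: mulr_gt0 (lt_le_trans ltr01 g1) (lt_le_trans ltr01 g1').
  apply: (@le_trans _ _ (cmod (q l) * cmod (phi (1 + d) - 1))); first by rewrite ler_piMr // mulr_ge0.
  apply: (@le_trans _ _ (2 * (10 * (A * cmod d)))); first by apply: ler_pM.
  by rewrite dE cmodM cmodV exprMn exprVn; rewrite le_eqVlt; apply/orP; left; apply/eqP; ring.
have -> : \sum_(l < L) e * (-1) ^+ l * phi (u0 + l%:R * v) = \sum_(l < L.-1) f l + f L.-1.
  by case: (L) L0 => // L' _; rewrite big_ord_recr.
have qL : cmod (f L.-1) <= 2 * cmod (phi (u L)).
  rewrite fc -{2}(prednK L0) (ratio L.-1) ?prednK // cmodM.
  have := q1 L.-1 (leq_pred _); have := ler_cmod_dist 1 (1 - q L.-1).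
  have -> : 1 - (1 - q L.-1) = q L.-1 by ring.
  by rewrite cmod1 (cmodB 1); have := cmod_ge0 (phi (u L.-1)); clear; nra.
have sL : \sum_(l < L.-1) cmod (M l.+1 - M l) * cmod (f l.+1) <=
    \sum_(l < L) 20 * A * cmod v ^+ 2 / cmod (u0 + l%:R * v) ^+ 2 * cmod (phi (u0 + l%:R * v)).
  rewrite -[in leRHS](prednK L0) big_ord_recl -[leLHS]add0r; apply: lerD.
    by rewrite mulr_ge0 // divr_ge0 ?sqr_ge0 // !mulr_ge0 // sqr_ge0.
  by apply: ler_sum => l _; rewrite fc; apply: ler_wpM2r => //; exact: MD.
have f0 : cmod (f 0%N) = cmod (phi u0) by rewrite fc /u mul0r addr0.
have := ler_cmodD (\sum_(l < L.-1) f l) (f L.-1); rewrite -/(u L).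
have p0 := cmod_ge0 (phi u0); have pL := cmod_ge0 (phi (u L)).
move: Hs qL sL f0 p0 pL; set s1 := \sum_(_ < _) f _; set s2 := \sum_(_ < _) _; set s3 := \sum_(_ < _) _; move: (cmod s1) s2 s3.
move: (cmod (f 0%N)) (cmod (f L.-1)) (cmod (phi u0)) (cmod (phi (u L))) (cmod (s1 + f L.-1)).
by clear => *; lra.
Qed.
End AlternatingLine.

(** * Lattice points of a reduced basis in stretched boxes *)

Section LatticeShells.
Variable R : realType.
Local Notation C := (R[i]).

(** Extended by 0 at the origin, so that sums may run over complete boxes. *)
Definition phi0 (n : int) (s u : C) : C := if u == 0 then 0 else qchar n s u.
Definition lpt (z : C) (c d : int) : C := c%:~R * z + d%:~R.
Definition wpow (sg N : R) : R := expR (- 2 * sg * ln N).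
Definition chiphi n (z s e1 e2 : C) (c d : int) : C := e1 ^ c * e2 ^ d * phi0 n s (lpt z c d).

Lemma phi0E n s u : u != 0 -> phi0 n s u = qchar n s u.
Proof. by rewrite /phi0 => /negbTE ->. Qed.

Lemma cmod_phi0_le n s u N : 0 <= complex.Re s -> 0 < N -> N <= cmod u ->
  cmod (phi0 n s u) <= wpow (complex.Re s) N.
Proof.
move=> s0 N0 Nu; have u0 : u != 0 by rewrite -cmod_gt0 (lt_le_trans N0).
rewrite phi0E // cmod_qchar // ler_expR.
have : ln N <= ln (cmod u) by rewrite ler_ln ?posrE // (lt_le_trans N0).
by move: s0; clear; nra.
Qed.

Lemma wpow_mul sg N : 0 < N -> N * wpow sg N = expR ((1 - 2 * sg) * ln N).
Proof. by move=> N0; rewrite /wpow -{1}(lnK (x := N)) ?posrE // -expRD; congr expR; ring. Qed.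

Lemma wpow_le sg N N' : 2^-1 <= sg -> 0 < N -> N <= N' -> N' * wpow sg N' <= N * wpow sg N.
Proof.
move=> s1 N0 NN'; have N'0 : 0 < N' by exact: lt_le_trans NN'.
rewrite !wpow_mul // ler_expR.
have : ln N <= ln N' by rewrite ler_ln ?posrE.
by move: s1; clear; nra.
Qed.

(** [N^(1 - 2 sg)] is at most [4^(2 sg - 1)], because [N >= 1/4] and the exponent lies in
    [[-1, 0]]. *)
Lemma wpow_le4 sg N : 2^-1 <= sg <= 1 -> 4^-1 <= N -> wpow sg N <= 4 / N.
Proof.
move=> /andP[s1 s2] N4; have N0 : 0 < N by apply: lt_le_trans N4; rewrite invr_gt0.
rewrite ler_pdivlMr // mulrC wpow_mul //.
have l4 : - ln 4 <= ln N by rewrite -lnV ?posrE // ler_ln ?posrE // invr_gt0.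
have p4 : 0 <= ln 4 :> R by rewrite ln_ge0 // ler1n.
rewrite -[leRHS](lnK (x := 4)) ?posrE // ler_expR; move: l4 p4 s1 s2; clear; nra.
Qed.

Lemma absz_ler (c : int) (m : nat) : (absz c <= m)%N -> `|c%:~R : R| <= m%:R.
Proof. by move=> H; rewrite -intr_norm -[m%:R]/(m%:Z%:~R) ler_int; lia. Qed.

Lemma absz_ger (c : int) (m : nat) : (m <= absz c)%N -> m%:R <= `|c%:~R : R|.
Proof. by move=> H; rewrite -intr_norm -[m%:R]/(m%:Z%:~R) ler_int; lia. Qed.

Lemma Re_lpt z c d : complex.Re (lpt z c d) = c%:~R * complex.Re z + d%:~R.
Proof. by case: z => a b; rewrite /lpt -!(rmorph_int (real_complex R)) /=; ring. Qed.

Lemma Im_lpt z c d : complex.Im (lpt z c d) = c%:~R * complex.Im z.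
Proof. by case: z => a b; rewrite /lpt -!(rmorph_int (real_complex R)) /=; ring. Qed.

Lemma lpt_pt z a b i l : lpt z (a + i%:Z) (b + l%:Z) = pt z (lpt z a b) i l.
Proof. by rewrite /lpt /pt !rmorphD /=; ring. Qed.

Variables (z : C) (Y : nat).
Hypotheses (zx : `|complex.Re z| <= 2^-1) (zy : 4 / 5 <= complex.Im z).
Local Notation y := (complex.Im z).
Hypotheses (yY : y <= Y%:R) (Yy : Y%:R <= 9 / 4 * y).

Let y0 : 0 < y := im_gt0 zy.
Let Y0 : (0 < Y)%N.
Proof. by rewrite -(ltr_nat R) (lt_le_trans y0). Qed.
Let Y1 : 1 <= Y%:R :> R.
Proof. by rewrite ler1n. Qed.

(** The boxes are stretched by [Y], comparable with [y], so that [|c z + d|] has the same order on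
    all four sides. If [|c| >= P] the imaginary part decides, since [y >= 4 Y / 9]; otherwise the
    real part, since [|c Re z| <= P / 2]. *)
Lemma lpt_ge (P : nat) (c d : int) : (P <= absz c)%N || (P * Y <= absz d)%N ->
  P%:R * Y%:R / 4 <= cmod (lpt z c d).
Proof.
have P0 : 0 <= P%:R :> R by [].
case: (leqP P (absz c)) => /= [H _|Pc H].
  apply: le_trans (ler_Im_cmod _); rewrite Im_lpt normrM (gtr0_norm y0).
  have {}H := absz_ger H; apply: (@le_trans _ _ (P%:R * y)); last by rewrite ler_pM2r.
  rewrite -mulrA ler_wpM2l //; move: Yy y0; lra.
apply: le_trans (ler_Re_cmod _); rewrite Re_lpt.
have {}H := absz_ger H; have {}Pc := absz_ler (ltnW Pc); rewrite natrM in H.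
have D := lerB_dist (d%:~R : R) (- (c%:~R * complex.Re z)); rewrite opprK normrN normrM in D.
have cx : `|c%:~R| * `|complex.Re z| <= P%:R * 2^-1 by apply: ler_pM.
have PY : P%:R * 1 <= P%:R * Y%:R :> R by rewrite ler_wpM2l.
rewrite addrC; move: P0 D cx PY H; lra.
Qed.

Lemma lpt_le (P : nat) (c d : int) : (absz c <= P)%N -> (absz d <= P * Y)%N ->
  cmod (lpt z c d) <= 3 * (P%:R * Y%:R).
Proof.
move=> /absz_ler cP /absz_ler; rewrite natrM => dP; apply: le_trans (ler_cmod_ReIm _) _.
rewrite Re_lpt Im_lpt.
have h1 := ler_normD (c%:~R * complex.Re z) (d%:~R).
rewrite !normrM (gtr0_norm y0) in h1 *.
have cx : `|c%:~R| * `|complex.Re z| <= P%:R * 2^-1 by apply: ler_pM.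
have cy : `|c%:~R| * y <= P%:R * Y%:R by apply: ler_pM => //; exact: ltW.
have PY : P%:R * 1 <= P%:R * Y%:R :> R by rewrite ler_wpM2l.
have P0 : 0 <= P%:R :> R by []; move: h1 cx cy dP PY P0; lra.
Qed.

Variables (n : int) (s : C).
Local Notation A := (conductor n (0 +i* complex.Im s)%C).
Local Notation F := (chiphi n z s).

Lemma cmod_chiphi e1 e2 c d : cmod e1 = 1 -> cmod e2 = 1 -> cmod (F e1 e2 c d) = cmod (phi0 n s (lpt z c d)).
Proof. by move=> h1 h2; rewrite !cmodM !cmod_expz h1 h2 !exp1rz !mul1r. Qed.

Lemma chiphi_line e1 e2 a b (i l : nat) : e1 != 0 -> e2 != 0 ->
  F e1 e2 (a + i%:Z) (b + l%:Z) = e1 ^ a * e2 ^ b * (e1 ^+ i * e2 ^+ l * phi0 n s (pt z (lpt z a b) i l)).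
Proof.
by move=> h1 h2; rewrite /chiphi !expfzDr // lpt_pt -!exprnP; ring.
Qed.

(** At most [8 P^2 Y] points, each of weight at most [16 / (P Y)]. *)
Lemma rect_trivial e1 e2 a b (m L P : nat) : 2^-1 <= complex.Re s <= 1 -> cmod e1 = 1 -> cmod e2 = 1 ->
  (0 < P)%N ->
  (forall i l, (i < m)%N -> (l < L)%N -> (P <= absz (a + i%:Z)%R)%N || (P * Y <= absz (b + l%:Z)%R)%N) ->
  (m <= 2 * P)%N -> (L <= 4 * (P * Y))%N -> cmod (box (F e1 e2) a m b L) <= 128 * P%:R.
Proof.
move=> s12 h1 h2 P0 H mP LP.
have PY : 1 <= P%:R * Y%:R :> R by rewrite mulr_ege1 // ler1n.
have N0 : 0 < P%:R * Y%:R / 4 :> R by move: PY; lra.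
have N4 : 4^-1 <= P%:R * Y%:R / 4 :> R by move: PY; lra.
apply: (@le_trans _ _ (m%:R * L%:R * (4 / (P%:R * Y%:R / 4)))).
  apply: ler_box => i l im lL; rewrite cmod_chiphi //.
  apply: le_trans (wpow_le4 s12 N4); apply: cmod_phi0_le => //; last exact: lpt_ge (H i l im lL).
  by case/andP: s12 => + _; lra.
have mL : m%:R * L%:R <= (2 * P%:R) * (4 * (P%:R * Y%:R)) :> R.
  by apply: ler_pM => //; rewrite -?natrM ler_nat.
apply: le_trans (ler_wpM2r _ mL) _; first by rewrite divr_ge0 // ltW.
rewrite le_eqVlt; apply/orP; left; apply/eqP; field.
by rewrite !pnatr_eq0 -!lt0n P0 Y0.
Qed.

End LatticeShells.

(** * Shells up to the conductor *)

Section ShellBound.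
Variable R : realType.
Local Notation C := (R[i]).

(** The square root of the right side of [rect_sum], with [1 + A] in place of [A] to cover small
    conductors. *)
Definition growth (A : R) : R := Num.sqrt ((1 + A) * (1 + ln (1 + A))).

Lemma growth_ge1 A : 0 <= A -> 1 <= growth A.
Proof.
move=> A0; rewrite /growth -[leLHS]sqrtr1 ler_sqrt ?mulr_ge0 ?addr_ge0 ?ln_ge0 ?lerDl //.
by rewrite mulr_ege1 // lerDl // ln_ge0 // lerDl.
Qed.

Lemma ler_cmod4 (b1 b2 b3 b4 : C) (B : R) : cmod b1 <= B -> cmod b2 <= B -> cmod b3 <= B -> cmod b4 <= B ->
  cmod (b1 + b2 + (b3 + b4)) <= 4 * B.
Proof.
have := ler_cmodD (b1 + b2) (b3 + b4); have := ler_cmodD b1 b2; have := ler_cmodD b3 b4; lra.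
Qed.

(** The annulus is cut into four rectangles, and [rect_sum] is applied to each with [N = P Y / 4].
    The bound on [P] by the conductor provides the hypothesis [N <= C3 A y]. *)
Lemma shell_bound (C0 : R) : 1 <= C0 -> exists2 K : R, 0 < K &
  forall (z : C) (Y : nat) (n : int) (s e1 e2 : C) (P : nat),
  let A := conductor n (0 +i* complex.Im s)%C in
  `|complex.Re z| <= 2^-1 -> 4 / 5 <= complex.Im z ->
  complex.Im z <= Y%:R -> Y%:R <= 9 / 4 * complex.Im z ->
  2^-1 <= complex.Re s <= 1 -> cmod e1 = 1 -> cmod e2 = 1 -> (0 < P)%N -> P%:R <= C0 * (A + 2) ->
  cmod (sbox (chiphi n z s e1 e2) (P + P) (P * Y + P * Y) - sbox (chiphi n z s e1 e2) P (P * Y)) <= K * growth A.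
Proof.
move=> C01; have C31 : 1 <= 2 * C0 by move: C01; clear; lra.
have [K' K'0 HK] := rect_sum C31.
(* With [N = P Y / 4], the requirement [y <= N / 3000] holds as soon as [P] exceeds [4 * 3000];
   smaller [P] are treated trivially. *)
have [k k0 kE] : exists2 k : R, 0 <= k & k = 4 * 3000 by exists (4 * 3000); [apply: mulr_ge0; exact: ler0n|].
pose K1 := Num.sqrt K' + 128 * (k + 3 * C0).
have sK : 0 <= Num.sqrt K' by exact: sqrtr_ge0.
have C00 : 0 < C0 by exact: lt_le_trans C01.
have K10 : 0 < K1 by rewrite /K1; move: k0 sK C00; clear; lra.
exists (4 * K1); first by rewrite mulr_gt0.
move=> z Y n s e1 e2 P A zx zy yY Yy s12 h1 h2 P0 PC.
have A0 : 0 <= A by exact: conductor_ge0.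
have gA := growth_ge1 A0.
have y0 : 0 < complex.Im z := im_gt0 zy.
have Y0 : (0 < Y)%N by rewrite -(ltr_nat R) (lt_le_trans y0).
have e10 : e1 != 0 by rewrite -cmod_gt0 h1.
have e20 : e2 != 0 by rewrite -cmod_gt0 h2.
have rect a b m L : (forall i l, (i <= m)%N -> (l <= L)%N ->
    ((P <= absz (a + i%:Z)%R)%N || (P * Y <= absz (b + l%:Z)%R)%N) &&
    ((absz (a + i%:Z)%R <= P + P)%N && (absz (b + l%:Z)%R <= (P + P) * Y)%N)) ->
    (m <= 2 * P)%N -> (L <= 4 * (P * Y))%N -> cmod (box (chiphi n z s e1 e2) a m b L) <= K1 * growth A.
  move=> H mP LP.
  have triv : P%:R <= k + 3 * C0 -> cmod (box (chiphi n z s e1 e2) a m b L) <= K1 * growth A.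
    move=> Pk; apply: (@le_trans _ _ (128 * P%:R)).
      by apply: (rect_trivial zx zy yY Yy) => // i l im lL; case/andP: (H i l (ltnW im) (ltnW lL)).
    apply: (@le_trans _ _ K1); last by rewrite ler_peMr // ltW.
    by rewrite /K1; move: Pk sK; clear; lra.
  case: (leP P%:R k) => [Pk|kP]; first by apply: triv; move: Pk C00; clear; lra.
  (* [rect_sum] requires [A >= 1]; for smaller conductors [P <= 3 C0] is bounded and the trivial
     estimate suffices. *)
  case: (ltP A 1) => [A1|A1].
    by apply: triv; apply: le_trans PC _; rewrite mulrC; move: k0 A1 C00; clear; nra.
  pose N : R := P%:R * Y%:R / 4.
  have PYn0 : P%:R * Y%:R != 0 :> R by rewrite -natrM pnatr_eq0 -lt0n muln_gt0 P0 Y0.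
  have PY0 : 0 < P%:R * Y%:R :> R by rewrite -natrM ltr0n muln_gt0 P0 Y0.
  have yN : complex.Im z <= N / 3000.
    have k3 : (4 * 3000 : R) != 0 by rewrite mulf_neq0 ?pnatr_eq0.
    have -> : N / 3000 = P%:R / k * Y%:R by rewrite kE /N invfM; ring.
    apply: le_trans yY _; rewrite ler_peMl // ler_pdivlMr ?mul1r ?ltW //.
    by rewrite lt_neqAle k0 kE eq_sym k3.
  have NA : N <= 2 * C0 * A * complex.Im z.
    apply: (@le_trans _ _ (C0 * (A + 2) * (9 / 4 * complex.Im z) / 4)).
      by rewrite /N ler_pM2r ?invr_gt0 //; apply: ler_pM.
    have q1 : C0 * complex.Im z * 1 <= C0 * complex.Im z * A by apply: ler_wpM2l => //; apply: mulr_ge0; exact: ltW.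
    by move: q1; have := mulr_gt0 C00 y0; clear; lra.
  have grid i l : (i <= m)%N -> (l <= L)%N -> N <= cmod (pt z (lpt z a b) i l) <= 24 * N.
    move=> im lL; have /andP[ou /andP[u1 u2]] := H i l im lL; rewrite -lpt_pt (lpt_ge zx zy yY Yy ou) /=.
    apply: le_trans (lpt_le zx zy yY u1 u2) _; rewrite natrD /N; clear; lra.
  have m24 : m%:R <= 24 * N / complex.Im z.
    rewrite ler_pdivlMr // /N.
    have : m%:R * complex.Im z <= (2 * P%:R) * Y%:R.
      by apply: ler_pM => //; rewrite -?natrM ?ler_nat ?(ltW y0).
    by move: PY0; clear; lra.
  have L24 : L%:R <= 24 * N.
    have : L%:R <= 4 * (P%:R * Y%:R) :> R by rewrite -!natrM ler_nat.
    by rewrite /N; move: PY0; clear; lra.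
  have := HK n z s (lpt z a b) e1 e2 N m L zx zy s12 A1 yN NA grid m24 L24 h1 h2.
  have -> : box (chiphi n z s e1 e2) a m b L =
      e1 ^ a * e2 ^ b * \sum_(i < m) \sum_(l < L) e1 ^+ i * e2 ^+ l * qchar n s (pt z (lpt z a b) i l).
    rewrite boxE mulr_sumr; apply: eq_bigr => i _; rewrite mulr_sumr; apply: eq_bigr => l _.
    rewrite chiphi_line // phi0E // -cmod_gt0.
    have /andP[g _] := grid i l (ltnW (ltn_ord i)) (ltnW (ltn_ord l)).
    by apply: lt_le_trans g; rewrite /N divr_gt0.
  set S := \sum_(i < m) _; rewrite !cmodM !cmod_expz h1 h2 !exp1rz !mul1r => HS.
  apply: (@le_trans _ _ (Num.sqrt K' * growth A)).
    rewrite /growth -sqrtrM ?(ltW K'0) // -(ger0_norm (cmod_ge0 S)) -sqrtr_sqr; apply: ler_wsqrtr.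
    apply: le_trans HS _; rewrite -/A; apply: ler_wpM2l (ltW K'0) _ _ _.
    by apply: ler_wpM2r; rewrite ?addr_ge0 ?ln_ge0 ?lerDl ?lerDr.
  apply: ler_wpM2r; first by apply: le_trans gA.
  by rewrite /K1; move: k0 C00; clear; lra.
rewrite sbox_split (addrC (sbox _ P _)) addrK.
have PY0 : (0 < P * Y)%N by rewrite muln_gt0 P0.
have B1 := rect (- (P + P)%N%:Z) (- (P * Y + P * Y)%N%:Z) P (P * Y + P * Y + (P * Y + P * Y))%N.
have B2 := rect P%:Z (- (P * Y + P * Y)%N%:Z) P (P * Y + P * Y + (P * Y + P * Y))%N.
have B3 := rect (- P%:Z) (- (P * Y + P * Y)%N%:Z) (P + P)%N (P * Y)%N.
have B4 := rect (- P%:Z) (P * Y)%N%:Z (P + P)%N (P * Y)%N.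
rewrite mulnDl in B1 B2 B3 B4.
move: (P * Y)%N PY0 B1 B2 B3 B4 => Q Q0 B1 B2 B3 B4.
have o1 i l : (i <= P)%N -> (l <= (Q + Q + (Q + Q)))%N ->
    ((P <= absz (- (P + P)%N%:Z + i%:Z)%R)%N || (Q <= absz (- (Q + Q)%N%:Z + l%:Z)%R)%N) &&
    ((absz (- (P + P)%N%:Z + i%:Z)%R <= P + P)%N && (absz (- (Q + Q)%N%:Z + l%:Z)%R <= Q + Q)%N).
  by clear=> im lL; apply/andP; split; [apply/orP; left; lia|apply/andP; split; lia].
have o2 i l : (i <= P)%N -> (l <= (Q + Q + (Q + Q)))%N ->
    ((P <= absz (P%:Z + i%:Z)%R)%N || (Q <= absz (- (Q + Q)%N%:Z + l%:Z)%R)%N) &&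
    ((absz (P%:Z + i%:Z)%R <= P + P)%N && (absz (- (Q + Q)%N%:Z + l%:Z)%R <= Q + Q)%N).
  by clear=> im lL; apply/andP; split; [apply/orP; left; lia|apply/andP; split; lia].
have o3 i l : (i <= (P + P))%N -> (l <= Q)%N ->
    ((P <= absz (- P%:Z + i%:Z)%R)%N || (Q <= absz (- (Q + Q)%N%:Z + l%:Z)%R)%N) &&
    ((absz (- P%:Z + i%:Z)%R <= P + P)%N && (absz (- (Q + Q)%N%:Z + l%:Z)%R <= Q + Q)%N).
  by clear=> im lL; apply/andP; split; [apply/orP; right; lia|apply/andP; split; lia].
have o4 i l : (i <= (P + P))%N -> (l <= Q)%N ->
    ((P <= absz (- P%:Z + i%:Z)%R)%N || (Q <= absz (Q%:Z + l%:Z)%R)%N) &&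
    ((absz (- P%:Z + i%:Z)%R <= P + P)%N && (absz (Q%:Z + l%:Z)%R <= Q + Q)%N).
  by clear=> im lL; apply/andP; split; [apply/orP; right; lia|apply/andP; split; lia].
have c1 : (P <= 2 * P)%N by clear; lia.
have c2 : (P + P <= 2 * P)%N by clear; lia.
have c3 : (Q + Q + (Q + Q) <= 4 * Q)%N by clear; lia.
have c4 : (Q <= 4 * Q)%N by clear; lia.
have := ler_cmod4 (B1 o1 c1 c3) (B2 o2 c1 c3) (B3 o3 c2 c4) (B4 o4 c2 c4).
by rewrite mulrA.
Qed.
End ShellBound.

(** * Shells beyond the conductor *)

Section Tail.
Variable R : realType.
Local Notation C := (R[i]).
Variables (z : C) (Y : nat).
Hypotheses (zx : `|complex.Re z| <= 2^-1) (zy : 4 / 5 <= complex.Im z).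
Local Notation y := (complex.Im z).
Hypotheses (yY : y <= Y%:R) (Yy : Y%:R <= 9 / 4 * y).
Variables (n : int) (s : C).
Hypothesis s2 : 2^-1 <= complex.Re s.
Local Notation A := (conductor n s).
Local Notation F := (chiphi n z s).
Local Notation sg := (complex.Re s).

Let y0 : 0 < y := im_gt0 zy.
Let Y0 : (0 < Y)%N.
Proof. by rewrite -(ltr_nat R) (lt_le_trans y0). Qed.
Let A0 : 0 <= A := conductor_ge0 n s.
Let sg0 : 0 <= sg.
Proof. by apply: le_trans s2; rewrite invr_ge0. Qed.

Definition scale (k : nat) : R := (2 ^ k)%:R * Y%:R / 4.

Lemma scale_pos k : 0 < scale k.
Proof. by rewrite /scale divr_gt0 // mulr_gt0 // ltr0n ?expn_gt0. Qed.

Lemma scale_mono k k' : (k <= k')%N -> scale k <= scale k'.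
Proof. by move=> kk'; rewrite /scale ler_pM2r ?invr_gt0 // ler_wpM2r // ler_nat leq_pexp2l. Qed.

(** The error density of [alternating_line] at [c z + d], with the step enlarged to [2 y] so as to
    serve both directions 1 and [z]. *)
Definition gline (c d : int) : R :=
  20 * A * (2 * y) ^+ 2 / cmod (lpt z c d) ^+ 2 * cmod (phi0 n s (lpt z c d)).

(** [20 * 4] from [20 (2 y)^2], 12 from the number of points of the annulus, and [64 = 4^3] from
    three powers of [scale], which carries a factor 1/4. *)
Definition tail_cst : R := 20 * 4 * 12 * 64.

Lemma tail_cst_ge0 : 0 <= tail_cst.
Proof. by rewrite /tail_cst; apply: mulr_ge0; [apply: mulr_ge0; [apply: mulr_ge0|]|]; exact: ler0n. Qed.

Local Notation B k := (scale k * wpow sg (scale k)).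

Lemma gline_shell k : sbox gline (2 ^ k.+1) (2 ^ k.+1 * Y) - sbox gline (2 ^ k) (2 ^ k * Y) <=
  tail_cst * A * (2 ^ k)%:R^-1 * B k.
Proof.
have p0 : (0 < 2 ^ k)%N by rewrite expn_gt0.
rewrite expnS mul2n -addnn mulnDl.
have sk := scale_pos k.
apply: le_trans (@annulus_le R gline (2 ^ k) (2 ^ k * Y) (20 * A * (2 * y) ^+ 2 / scale k ^+ 2 * wpow sg (scale k)) p0 _ _) _.
- by rewrite muln_gt0 p0.
- move=> c d o; have g : scale k <= cmod (lpt z c d) := lpt_ge zx zy yY Yy o.
  have g0 : 0 < cmod (lpt z c d) by exact: lt_le_trans g.
  apply: ler_pM => //; last exact: cmod_phi0_le.
    by rewrite divr_ge0 ?sqr_ge0 // !mulr_ge0 // ltW.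
  apply: ler_wpM2l; first by rewrite !mulr_ge0 // ltW.
  by rewrite lef_pV2 ?posrE ?exprn_gt0 //; apply: lerXn2r => //; rewrite nnegrE ltW.
rewrite natrM; set t : R := (2 ^ k)%:R; set Yr : R := Y%:R.
have t0 : 0 < t by rewrite ltr0n.
have Yr0 : 0 < Yr by rewrite ltr0n.
have w0 : 0 <= wpow sg (scale k) by rewrite expR_ge0.
have E : 12 * t * (t * Yr) * (20 * A * (2 * y) ^+ 2 / scale k ^+ 2 * wpow sg (scale k)) =
    tail_cst * A * t^-1 * B k * (y / Yr) ^+ 2.
  by rewrite /tail_cst /scale -/t -/Yr; move: (wpow _ _) => w; field; rewrite !gt_eqF.
rewrite E ler_piMr //.
  by rewrite !mulr_ge0 ?tail_cst_ge0 ?invr_ge0 ?(ltW sk) ?(ltW t0).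
rewrite expr_le1 ?divr_ge0 ?(ltW y0) ?(ltW Yr0) //.
by rewrite ler_pdivrMr // mul1r.
Qed.

(** A geometric series: from one shell to the next the factor [2^-k] halves, and [scale^(1 - 2 sg)]
    does not increase since [sg >= 1/2]. *)
Lemma gline_tail k j : sbox gline (2 ^ (k + j)) (2 ^ (k + j) * Y) - sbox gline (2 ^ k) (2 ^ k * Y) <=
  tail_cst * A * (2 ^ k)%:R^-1 * B k * (2 * (1 - (2 ^ j)%:R^-1)).
Proof.
set E := tail_cst * A * _ * _.
have E0 : 0 <= E.
  rewrite /E; apply: mulr_ge0; last exact: mulr_ge0 (ltW (scale_pos k)) (expR_ge0 _).
  by apply: mulr_ge0; [apply: mulr_ge0 => //; exact: tail_cst_ge0|rewrite invr_ge0].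
elim: j => [|j IH]; first by rewrite addn0 subrr expn0 invr1 subrr !mulr0.
rewrite addnS.
have := gline_shell (k + j); set S1 := sbox _ _ _; set S2 := sbox _ _ _ in IH *; set S3 := sbox _ _ _ in IH *.
have : tail_cst * A * (2 ^ (k + j))%:R^-1 * B (k + j) <= E * (2 ^ j)%:R^-1.
  have BB : B (k + j) <= B k by apply: wpow_le => //; [exact: scale_pos|apply: scale_mono; exact: leq_addr].
  have -> : E * (2 ^ j)%:R^-1 = tail_cst * A * (2 ^ (k + j))%:R^-1 * B k.
    by rewrite /E expnD natrM invfM; ring.
  by apply: ler_wpM2l => //; rewrite !mulr_ge0 ?tail_cst_ge0 ?invr_ge0.
have -> : (2 ^ j.+1)%:R^-1 = 2^-1 * (2 ^ j)%:R^-1 :> R by rewrite expnS natrM invfM.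
by move: IH; set x := (2 ^ j)%:R^-1; move: S1 S2 S3 => S1 S2 S3; move: (tail_cst * A * _ * _) => T; move: E {E0} x => E x; lra.
Qed.

Lemma line_bound (v : C) (L : nat) (u : nat -> C) (e : C) :
  cmod e = 1 -> cmod v <= 2 * y ->
  (forall l, (l <= L)%N -> u l = u 0%N + l%:R * v) ->
  (forall l, (l <= L)%N -> 40 * (A + 1) * y <= cmod (u l) /\ u l != 0) ->
  cmod (\sum_(l < L) e * (-1) ^+ l * phi0 n s (u l)) <=
  4 * cmod (phi0 n s (u 0%N)) + 4 * cmod (phi0 n s (u L)) +
  \sum_(l < L) 20 * A * (2 * y) ^+ 2 / cmod (u l) ^+ 2 * cmod (phi0 n s (u l)).
Proof.
move=> e1' vy uE H.
have vv : cmod v ^+ 2 <= (2 * y) ^+ 2 by apply: lerXn2r; rewrite ?nnegrE // mulr_ge0 // ltW.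
have H' l : (l <= L)%N -> 20 * (A + 1) * cmod v <= cmod (u 0%N + l%:R * v) /\ u 0%N + l%:R * v != 0.
  move=> lL; rewrite -uE //; have [h1 h2] := H l lL; split => //; apply: le_trans h1.
  have -> : 40 * (A + 1) * y = 20 * (A + 1) * (2 * y) by ring.
  by apply: ler_wpM2l => //; rewrite mulr_ge0 // addr_ge0.
have := alternating_line e1' H'; rewrite -uE // => HL.
have -> : \sum_(l < L) e * (-1) ^+ l * phi0 n s (u l) = \sum_(l < L) e * (-1) ^+ l * qchar n s (u 0%N + l%:R * v).
  by apply: eq_bigr => l _; have lL := ltnW (ltn_ord l); rewrite -uE // phi0E //; case: (H l lL).
rewrite (phi0E n s (proj2 (H _ (leqnn L)))) (phi0E n s (proj2 (H 0%N isT))).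
apply: le_trans HL _; apply: lerD => //; apply: ler_sum => l _; have lL := ltnW (ltn_ord l).
rewrite -uE // phi0E; last by case: (H l lL).
apply: ler_wpM2r => //; apply: ler_wpM2r; first by rewrite invr_ge0 sqr_ge0.
by apply: ler_wpM2l => //; rewrite mulr_ge0.
Qed.

(** Every nontrivial sign character alternates in at least one direction, along which the annulus is
    summed line by line. The bound does not depend on [j] and tends to 0 with [k] when [Re s > 1/2]:
    it yields the convergence of the sums as well as their size. The threshold [160 (A + 1)] makes
    the inner scale at least [20 (A + 1)] times the step [2 y]. *)
Lemma tail_bound e1 e2 k j : (e1, e2) \in [:: (-1, 1); (1, -1); (-1, -1)] -> 160 * (A + 1) <= (2 ^ k)%:R ->
  cmod (sbox (F e1 e2) (2 ^ (k + j)) (2 ^ (k + j) * Y) - sbox (F e1 e2) (2 ^ k) (2 ^ k * Y)) <=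
  (3 * 64 + 2 * tail_cst) * B k.
Proof.
move=> chi kA.
have sk := scale_pos k; have skj := scale_pos (k + j).
have yk : 40 * (A + 1) * y <= scale k.
  have : 160 * (A + 1) * y <= (2 ^ k)%:R * Y%:R 
    by apply: ler_pM; [apply: mulr_ge0 => //; apply: addr_ge0|exact: ltW y0|exact: kA|].
  rewrite /scale; lra.
have out (c d : int) : (2 ^ k <= absz c)%N || (2 ^ k * Y <= absz d)%N ->
    40 * (A + 1) * y <= cmod (lpt z c d) /\ lpt z c d != 0.
  move=> o; have g := lpt_ge zx zy yY Yy o; split; first exact: le_trans g.
  by rewrite -cmod_gt0; exact: lt_le_trans g.
have W1 (c d : int) : (2 ^ k <= absz c)%N || (2 ^ k * Y <= absz d)%N ->
    4 * cmod (phi0 n s (lpt z c d)) <= 4 * wpow sg (scale k).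
  by move=> o; rewrite ler_pM2l //; apply: cmod_phi0_le => //; exact: lpt_ge o.
have W2 (c d : int) : (2 ^ (k + j) <= absz c)%N || (2 ^ (k + j) * Y <= absz d)%N ->
    4 * cmod (phi0 n s (lpt z c d)) <= 4 * wpow sg (scale (k + j)).
  by move=> o; rewrite ler_pM2l //; apply: cmod_phi0_le => //; exact: lpt_ge o.
have BB : B (k + j) <= B k by apply: wpow_le => //; apply: scale_mono; exact: leq_addr.
have kj : (2 ^ k <= 2 ^ (k + j))%N by rewrite leq_pexp2l // leq_addr.
have kjY : (2 ^ k * Y <= 2 ^ (k + j) * Y)%N by rewrite leq_mul2r kj orbT.
have GT := gline_tail k j.
have tA : tail_cst * A * (2 ^ k)%:R^-1 * B k * (2 * (1 - (2 ^ j)%:R^-1)) <= 2 * tail_cst * B k.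
  have B0 : 0 <= B k by rewrite mulr_ge0 ?expR_ge0 // ltW.
  have i1 : 0 <= (2 ^ j)%:R^-1 :> R by rewrite invr_ge0.
  have a1 : A * (2 ^ k)%:R^-1 <= 1.
    by rewrite ler_pdivrMr ?mul1r ?ltr0n ?expn_gt0 //; move: kA A0; lra.
  have a0 : 0 <= A * (2 ^ k)%:R^-1 by rewrite mulr_ge0 ?invr_ge0.
  have t0 := tail_cst_ge0.
  have -> : tail_cst * A * (2 ^ k)%:R^-1 * B k * (2 * (1 - (2 ^ j)%:R^-1)) =
     (2 * tail_cst * B k) * (A * (2 ^ k)%:R^-1 * (1 - (2 ^ j)%:R^-1)) by ring.
  rewrite ler_piMr // ?mulr_ge0 ?expR_ge0 ?(ltW sk) //.
  have j1 : (2 ^ j)%:R^-1 <= 1 :> R by rewrite invf_le1 ?ler1n ?ltr0n expn_gt0.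
  by rewrite mulr_ile1 // ?subr_ge0 // lerBlDr lerDl.
have w1 : 0 <= wpow sg (scale k) by exact: expR_ge0.
have w2 : 0 <= wpow sg (scale (k + j)) by exact: expR_ge0.
have t4 (i : nat) : (2 ^ i * Y)%:R = 4 * scale i by rewrite /scale natrM; field.
have t1 (i : nat) : (2 ^ i)%:R <= 4 * scale i :> R by rewrite -t4 ler_nat leq_pmulr.
have n1 : cmod (-1 : C) = 1 by rewrite cmodN cmod1.
have e1u : cmod e1 = 1 by move: chi; rewrite !inE => /orP[/eqP[-> _]|/orP[/eqP[-> _]|/eqP[-> _]]]; rewrite ?cmod1.
have e2u : cmod e2 = 1 by move: chi; rewrite !inE => /orP[/eqP[_ ->]|/orP[/eqP[_ ->]|/eqP[_ ->]]]; rewrite ?cmod1.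
have e10 : e1 != 0 by rewrite -cmod_gt0 e1u.
have e20 : e2 != 0 by rewrite -cmod_gt0 e2u.
have [im1 im2 im3] := im_bounds zx zy.
have fin (p P : nat) (g1 g2 : R) : p%:R <= 4 * scale (k + j) -> P%:R <= 4 * scale k ->
    g1 - g2 <= 2 * tail_cst * B k ->
    4 * p%:R * (4 * wpow sg (scale (k + j))) + 8 * P%:R * (4 * wpow sg (scale k)) + (g1 - g2) <=
    (3 * 64 + 2 * tail_cst) * B k.
  move=> pk Pk g12.
  have h1 : p%:R * wpow sg (scale (k + j)) <= 4 * B k.
    by apply: le_trans (ler_wpM2r w2 pk) _; rewrite -mulrA ler_pM2l.
  have h2 : P%:R * wpow sg (scale k) <= 4 * B k by apply: le_trans (ler_wpM2r w1 Pk) _; rewrite -mulrA.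
  move: h1 h2 g12; move: (B k) (wpow sg (scale (k + j))) (wpow sg (scale k)) tail_cst => b v1 v2 t; lra.
(* With [e2 = -1] the lines run in the direction of [d]; otherwise [e1 = -1], and the box is
   transposed. *)
case: (altP (e2 =P -1)) => [e2E|e2n].
  have := @annulus_lines R (F e1 e2) gline (fun c d => 4 * cmod (phi0 n s (lpt z c d))) (2 ^ k) (2 ^ k * Y)
    (2 ^ (k + j) - 2 ^ k) (2 ^ (k + j) * Y - 2 ^ k * Y) (4 * wpow sg (scale k)) (4 * wpow sg (scale (k + j))) _ W1 _.
  rewrite !subnKC // => AL; apply: le_trans (AL _ _) _.
  - move=> r b L o.
    pose u l := lpt z r (b + l%:Z).
    have := @line_bound 1 L u (e1 ^ r * e2 ^ b); rewrite cmodM !cmod_expz e1u e2u !exp1rz mul1r.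
    rewrite /seg /gline -[b in lpt z r b]addr0 -/(u 0%N).
    have -> : \sum_(l < L) F e1 e2 r (b + l%:Z) = \sum_(l < L) e1 ^ r * e2 ^ b * (-1) ^+ l * phi0 n s (u l).
      by apply: eq_bigr => l _; rewrite /chiphi expfzDr // -exprnP -e2E; ring.
    apply => //; first by rewrite cmod1.
    + by move=> l _; rewrite /u /lpt addr0 mulr1 rmorphD /= addrA.
    + by move=> l lL; apply: out; exact: o.
  - by move=> r l o; apply: W2; rewrite o orbT.
  apply: fin => //; last exact: le_trans GT tA.
    by apply: le_trans (t1 _); rewrite ler_nat leq_subr.
have e1E : e1 = -1.
  by move: chi; rewrite !inE => /orP[/eqP[-> //]|/orP[/eqP[_ E]|/eqP[-> //]]]; rewrite E eqxx in e2n.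
have trE (V : zmodType) (G : int -> int -> V) P Q : sbox G P Q = sbox (fun d c => G c d) Q P by rewrite /sbox box_tr.
rewrite !(trE _ (F e1 e2)).
have := @annulus_lines R (fun d c => F e1 e2 c d) (fun d c => gline c d) (fun d c => 4 * cmod (phi0 n s (lpt z c d))) (2 ^ k * Y) (2 ^ k)
    (2 ^ (k + j) * Y - 2 ^ k * Y) (2 ^ (k + j) - 2 ^ k) (4 * wpow sg (scale k)) (4 * wpow sg (scale (k + j))).
rewrite !subnKC // => AL; apply: le_trans (AL _ _ _) _.
- move=> r b L o.
  pose u l := lpt z (b + l%:Z) r.
  have := @line_bound z L u (e1 ^ b * e2 ^ r); rewrite cmodM !cmod_expz e1u e2u !exp1rz mul1r.
  rewrite /seg /gline -[b in lpt z b r]addr0 -/(u 0%N).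
  have -> : \sum_(l < L) F e1 e2 (b + l%:Z) r = \sum_(l < L) e1 ^ b * e2 ^ r * (-1) ^+ l * phi0 n s (u l).
    by apply: eq_bigr => l _; rewrite /chiphi expfzDr // -exprnP -e1E; ring.
  apply => //.
  + by move=> l _; rewrite /u /lpt addr0 rmorphD /=; ring.
  + by move=> l lL; apply: out; rewrite orbC; exact: o.
- by move=> r l o; apply: W1; rewrite orbC.
- by move=> r l o; apply: W2; rewrite o.
rewrite -!(trE _ gline).
apply: fin => //; [|by rewrite t4|exact: le_trans GT tA].
by rewrite -t4 ler_nat leq_subr.
Qed.
End Tail.

(** * Entire functions and limits of sequences *)

Section Entire.
Variable R : realType.
Local Notation C := (R[i]).

Lemma cder_cexp_lin (a z : C) : cder (fun w => cexp (a * w)) z (a * cexp (a * z)).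
Proof.
move=> e e0; pose K := 4 * cmod (cexp (a * z)) * cmod a ^+ 2 + 1.
have p0 : 0 <= 4 * cmod (cexp (a * z)) * cmod a ^+ 2 by rewrite !mulr_ge0.
have K0 : 0 < K by rewrite /K ltr_wpDl.
have a0 : 0 < cmod a + 1 by rewrite ltr_wpDl.
exists (Num.min (2^-1 / (cmod a + 1)) (e / K)); first by rewrite lt_min !divr_gt0 // invr_gt0.
move=> h; rewrite lt_min => /andP[h1 h2].
have -> : cexp (a * (z + h)) - cexp (a * z) - a * cexp (a * z) * h =
    cexp (a * z) * (cexp (a * h) - 1 - a * h) by rewrite mulrDr cexpD; ring.
have ah : cmod (a * h) <= 2^-1.
  move: h1; rewrite ltr_pdivlMr // => h1; rewrite cmodM.
  by have := cmod_ge0 h; move: h1; clear; lra.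
have re : complex.Re (a * h) <= 2^-1 by apply: le_trans ah; apply: le_trans (ler_norm _) (ler_Re_cmod _).
have := ler_cexp_sub1_id re; rewrite (cmodM a h) (cmodM (cexp (a * z))) => H.
apply: (@le_trans _ _ (cmod (cexp (a * z)) * (4 * (cmod a * cmod h) ^+ 2))); first by apply: ler_wpM2l.
have -> : cmod (cexp (a * z)) * (4 * (cmod a * cmod h) ^+ 2) =
  4 * cmod (cexp (a * z)) * cmod a ^+ 2 * cmod h * cmod h by ring.
apply: ler_wpM2r => //; apply: (@le_trans _ _ (K * cmod h)); first by apply: ler_wpM2r; rewrite ?lerDl.
by move: h2; rewrite ltr_pdivlMr // mulrC => /ltW.
Qed.

Lemma centire_cst (c : C) : centire (fun _ => c).
Proof. by move=> z; exists 0; exact: cder_cst. Qed.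

Lemma centireD (f g : C -> C) : centire f -> centire g -> centire (fun z => f z + g z).
Proof. by move=> F G z; have [d D] := F z; have [d' D'] := G z; exists (d + d'); exact: cderD. Qed.

Lemma centireM (f g : C -> C) : centire f -> centire g -> centire (fun z => f z * g z).
Proof. by move=> F G z; have [d D] := F z; have [d' D'] := G z; exists (d * g z + f z * d'); exact: cderM. Qed.

Lemma centireN (f : C -> C) : centire f -> centire (fun z => - f z).
Proof.
move=> F; have := centireM (centire_cst (-1)) F; congr centire.
by apply/funext => z; rewrite mulN1r.
Qed.

Lemma centire_sum I (r : seq I) (f : I -> C -> C) : (forall i, centire (f i)) ->
  centire (fun z => \sum_(i <- r) f i z).
Proof.
move=> H; elim: r => [|i r IH].
  by have := centire_cst 0; congr centire; apply/funext => z; rewrite big_nil.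
by have := centireD (H i) IH; congr centire; apply/funext => z; rewrite big_cons.
Qed.

Lemma centire_cpow (x : R) (a : C) : centire (fun s => cpow x (a * s)).
Proof.
move=> z; exists (a * (ln x)%:C%C * cexp (a * (ln x)%:C%C * z)).
have -> : (fun s => cpow x (a * s)) = (fun w => cexp (a * (ln x)%:C%C * w)).
  by apply/funext => w; rewrite /cpow mulrAC.
exact: cder_cexp_lin.
Qed.

Lemma centire_qchar n (u : C) : centire (fun s => qchar n s u).
Proof.
have := centireM (centire_cpow (cmod u) (-2)) (centire_cst ((u / (cmod u)%:C%C) ^ n)).
by congr centire; apply/funext => s; rewrite /qchar mulNr.
Qed.

Lemma centire_phi0 n (u : C) : centire (fun s => phi0 n s u).
Proof. by rewrite /phi0; case: eqP => _; [exact: centire_cst|exact: centire_qchar]. Qed.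

Definition climit (u : nat -> C) (l : C) := forall e : R, 0 < e ->
  exists N, forall k, (N <= k)%N -> cmod (u k - l) <= e.

Lemma climit_cauchy (u : nat -> C) :
  (forall e : R, 0 < e -> exists N, forall k j, (N <= k)%N -> cmod (u (k + j)%N - u k) <= e) ->
  exists l, climit u l.
Proof.
move=> H.
have real_lim (f : C -> R) : (forall a b, `|f a - f b| <= cmod (a - b)) ->
    exists l, forall e : R, 0 < e -> exists N, forall k, (N <= k)%N -> `|f (u k) - l| <= e.
  move=> fL; have : cvgn (fun k => f (u k)).
    apply/cauchy_cvgP; apply: cauchy_exP => e e0.
    have [N HN] := H (e / 2) (divr_gt0 e0 (ltr0n _ 2)).
    exists (f (u N)); exists N => // k /= Nk; rewrite /ball /= distrC.
    apply: le_lt_trans (fL _ _) _; rewrite -(subnKC Nk).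
    by apply: le_lt_trans (HN N _ (leqnn N)) _; lra.
  move=> cv; exists (limn (fun k => f (u k))) => e e0.
  have /cvgrPdist_le /(_ e e0) [N _ HN] := cv.
  by exists N => k Nk; rewrite distrC; exact: HN.
have [a Ha] := real_lim (@complex.Re R) ltac:(by move=> x y'; rewrite -raddfB; exact: ler_Re_cmod).
have [b Hb] := real_lim (@complex.Im R) ltac:(by move=> x y'; rewrite -raddfB; exact: ler_Im_cmod).
exists (a +i* b)%C => e e0; have e2 : 0 < e / 2 by rewrite divr_gt0.
have [N1 H1] := Ha _ e2; have [N2 H2] := Hb _ e2; exists (maxn N1 N2) => k.
rewrite geq_max => /andP[k1 k2]; apply: le_trans (ler_cmod_ReIm _) _.
rewrite raddfB /= [complex.Im _]raddfB /=.
by have := H1 k k1; have := H2 k k2; lra.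
Qed.

Lemma climit_unique u l l' : climit u l -> climit u l' -> l = l'.
Proof.
move=> H H'; apply/eqP; rewrite -subr_eq0 -cmod_eq0 eq_le cmod_ge0 andbT.
apply/ler_addgt0Pl => e e0; rewrite addr0.
have e2 : 0 < e / 2 by rewrite divr_gt0.
have [N HN] := H _ e2; have [N' HN'] := H' _ e2.
have := HN _ (leq_maxl N N'); have := HN' _ (leq_maxr N N').
have := ler_cmodD (l - u (maxn N N')) (u (maxn N N') - l').
by rewrite addrA subrK (cmodB l); lra.
Qed.

Lemma climit_le u l (a : C) (B : R) N : climit u l -> (forall k, (N <= k)%N -> cmod (u k - a) <= B) -> cmod (l - a) <= B.
Proof.
move=> H HB; apply/ler_addgt0Pl => e e0.
have [N' HN'] := H _ e0.
have := HN' _ (leq_maxl N' N); have := HB _ (leq_maxr N' N).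
have := ler_cmodD (l - u (maxn N' N)) (u (maxn N' N) - a).
by rewrite addrA subrK (cmodB l); lra.
Qed.

Lemma climitD u v l l' : climit u l -> climit v l' -> climit (fun k => u k + v k) (l + l').
Proof.
move=> H H' e e0; have e2 : 0 < e / 2 by rewrite divr_gt0.
have [N HN] := H _ e2; have [N' HN'] := H' _ e2; exists (maxn N N') => k.
rewrite geq_max => /andP[k1 k2]; have := HN k k1; have := HN' k k2.
have := ler_cmodD (u k - l) (v k - l').
by rewrite opprD addrACA; lra.
Qed.

Lemma climitZ u l c : climit u l -> climit (fun k => c * u k) (c * l).
Proof.
move=> H e e0; have c0 : 0 < cmod c + 1 by rewrite ltr_wpDl.
have [N HN] := H (e / (cmod c + 1)) (divr_gt0 e0 c0); exists N => k Nk.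
rewrite -mulrBr cmodM; have := HN k Nk; rewrite ler_pdivlMr // => h.
by have := cmod_ge0 (u k - l); have := cmod_ge0 c; move: h; clear; nra.
Qed.

Lemma climit_shift u l m : climit u l -> climit (fun k => u (k + m)%N) l.
Proof.
by move=> H e e0; have [N HN] := H e e0; exists N => k Nk; apply: HN; exact: leq_trans Nk (leq_addr _ _).
Qed.
End Entire.

(** * Partial sums of Dirichlet series on Re w >= 1 *)

Section DirichletPartial.
Variable R : realType.
Local Notation C := (R[i]).
Implicit Types (w : C).

Definition dterm w (m : nat) : C := cpow (m%:R) (- w).

Lemma cmod_dterm w m : cmod (dterm w m) = expR (- complex.Re w * ln m%:R).
Proof. by rewrite cmod_cpow; case: w. Qed.

Lemma dtermM w a b : (0 < a)%N -> (0 < b)%N -> dterm w (a * b) = dterm w a * dterm w b.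
Proof. by move=> a0 b0; rewrite /dterm natrM cpowM // ltr0n. Qed.

Lemma cmod_dterm_le w m : 1 <= complex.Re w -> (0 < m)%N -> cmod (dterm w m) <= m%:R^-1.
Proof.
move=> w1 m0; have m0' : 0 < m%:R :> R by rewrite ltr0n.
rewrite cmod_dterm -[leRHS]lnK ?posrE ?invr_gt0 // ler_expR lnV ?posrE //.
have : 0 <= ln m%:R :> R by rewrite ln_ge0 // ler1n.
by move: w1; clear; nra.
Qed.

(** First order Euler-Maclaurin: [m^(-w)] is the increment of [- x^(1 - w) / (w - 1)] over
    [[m, m + 1]], up to second order terms in [|w| / m]. Dividing by [w - 1] is harmless because the
    quadratic error contains [|w - 1|^2]. *)
Lemma dterm_telescope w m : 1 <= complex.Re w -> w != 1 -> 4 * (1 + cmod w) <= m%:R ->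
  cmod (dterm w m - (dterm (w - 1) m - dterm (w - 1) m.+1) / (w - 1)) <= 18 * (1 + cmod w) / m%:R ^+ 2.
Proof.
move=> w1 wn1 mT; set T := 1 + cmod w in mT *.
have T1 : 1 <= T by rewrite /T lerDl.
have m4 : 4 <= m%:R :> R by move: mT T1; clear; lra.
have m0 : 0 < m%:R :> R by move: m4; clear; lra.
have mn0 : (0 < m)%N by rewrite -(ltr_nat R).
pose x : R := m%:R^-1; have x0 : 0 < x by rewrite invr_gt0.
have x4 : x <= 4^-1 by rewrite lef_pV2 ?posrE.
have xT : T * x <= 4^-1 by rewrite ler_pdivrMr //; move: mT; clear; lra.
pose L := ln (1 + x).
have L1 : `|L - x| <= 2 * x ^+ 2.
  have d2 : cmod (x%:C%C : C) <= 2^-1 by rewrite cmod_real gtr0_norm //; move: x4; clear; lra.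
  have := ln_cmod_1D d2; rewrite [cmod x%:C%C]cmod_real (gtr0_norm x0).
  have -> : 1 + x%:C%C = (1 + x)%:C%C :> C by rewrite rmorphD rmorph1.
  by rewrite cmod_real (gtr0_norm (addr_gt0 ltr01 x0)).
have L0 : 0 <= L by rewrite ln_ge0 // lerDl ltW.
have L2 : L <= 2 * x.
  have : x ^+ 2 <= 4^-1 * x by rewrite expr2 ler_wpM2r // ltW.
  by move: L1; rewrite ler_norml => /andP[_]; move: x0; clear; lra.
pose zeta := (1 - w) * L%:C%C.
have zc : cmod zeta = cmod (w - 1) * L by rewrite cmodM cmod_real ger0_norm // cmodB.
have wT : cmod (w - 1) <= T by apply: le_trans (ler_cmodB _ _) _; rewrite cmod1 /T addrC.
have zr : complex.Re zeta <= 2^-1.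
  apply: le_trans (le_trans (ler_norm _) (ler_Re_cmod _)) _; rewrite zc.
  apply: (@le_trans _ _ (T * (2 * x))); first by apply: ler_pM.
  by move: xT; clear; lra.
have E := ler_cexp_sub1_id zr; set ee := cexp zeta - 1 - zeta in E.
have w10 : w - 1 != 0 by rewrite subr_eq0.
have dS : dterm (w - 1) m.+1 = dterm (w - 1) m * cexp zeta.
  rewrite /dterm /cpow -cexpD; congr cexp; rewrite /zeta /L.
  have -> : m.+1%:R = m%:R * (1 + x) :> R by rewrite /x mulrDr mulr1 divff ?gt_eqF // -natr1.
  by rewrite lnM ?posrE ?addr_gt0 // rmorphD /=; ring.
have dm : dterm w m = dterm (w - 1) m * x%:C%C.
  rewrite /dterm /cpow; have -> : x%:C%C = cexp (- (ln m%:R)%:C%C) :> C.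
    by rewrite -rmorphN /= /cexp /= sin0 cos0 -lnV ?posrE // lnK ?posrE // -/x [(1 +i* 0)%C](_ : _ = 1) ?mulr1.
  by rewrite -cexpD; congr cexp; ring.
have -> : dterm w m - (dterm (w - 1) m - dterm (w - 1) m.+1) / (w - 1) =
    dterm (w - 1) m * ((x - L)%:C%C + ee / (w - 1)).
  have ce : cexp zeta = ee + 1 + zeta by rewrite /ee; ring.
  rewrite dm dS ce /zeta rmorphB /=; field.
  by [].
have d1 : cmod (dterm (w - 1) m) <= 1.
  rewrite cmod_dterm -[leRHS]expR0 ler_expR; have : 0 <= ln m%:R :> R by rewrite ln_ge0 // ler1n.
  have -> : complex.Re (w - 1) = complex.Re w - 1 by case: (w).
  by move: w1; clear; nra.
rewrite cmodM; apply: le_trans (ler_piMl (cmod_ge0 _) d1) _.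
apply: le_trans (ler_cmodD _ _) _; rewrite cmod_real distrC cmodM cmodV.
have e1 : cmod ee / cmod (w - 1) <= 16 * T * x ^+ 2.
  have w10' : 0 < cmod (w - 1) by rewrite cmod_gt0.
  rewrite ler_pdivrMr //; apply: le_trans E _; rewrite zc.
  have -> : 4 * (cmod (w - 1) * L) ^+ 2 = 4 * L ^+ 2 * cmod (w - 1) * cmod (w - 1) by ring.
  apply: ler_wpM2r => //; have LL : L ^+ 2 <= (2 * x) ^+ 2.
    by apply: lerXn2r; rewrite ?nnegrE // mulr_ge0 // ltW.
  apply: (@le_trans _ _ (4 * (2 * x) ^+ 2 * T)); last by rewrite le_eqVlt; apply/orP; left; apply/eqP; ring.
  by apply: ler_pM => //; [rewrite mulr_ge0 // sqr_ge0|rewrite ler_pM2l].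
have x2 : x ^+ 2 <= T * x ^+ 2 by rewrite ler_peMl // sqr_ge0.
rewrite -exprVn -/x; move: L1 e1 x2; clear; lra.
Qed.

Lemma sum_inv_sqr (M D : nat) : (0 < M)%N -> \sum_(M <= m < D) (m%:R ^+ 2)^-1 <= 2 / M%:R :> R.
Proof.
move=> M0; case: (leqP M D) => MD; last by rewrite big_geq ?divr_ge0 // ltnW.
apply: (@le_trans _ _ (2 / M%:R - 2 / D%:R)); last by rewrite lerBlDr lerDl divr_ge0.
rewrite -(subnKC MD); elim: (D - M)%N => [|j IH]; first by rewrite addn0 big_geq // subrr.
rewrite addnS big_nat_recr ?leq_addr //=.
have a0 : 1 <= (M + j)%:R :> R by rewrite ler1n ltn_addr.
have a0' : 0 < (M + j)%:R :> R by exact: lt_le_trans a0.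
have : ((M + j)%:R ^+ 2)^-1 <= 2 / (M + j)%:R - 2 / (M + j).+1%:R :> R.
  have -> : (M + j).+1%:R = (M + j)%:R + 1 :> R by rewrite natr1.
  move: a0 a0'; move: ((M + j)%:R : R) => a a0 a0'.
  have a1 : 0 < a + 1 by rewrite ltr_wpDl // ltW.
  have -> : 2 / a - 2 / (a + 1) = 2 / (a * (a + 1)) by field; rewrite !gt_eqF //.
  rewrite ler_pdivlMr ?mulr_gt0 // mulrC ler_pdivrMr ?exprn_gt0 //.
  by move: a0; clear; nra.
by move=> h; apply: le_trans (lerD IH h) _; rewrite addrA subrK.
Qed.

Lemma sum_inv_le (D : nat) : \sum_(1 <= m < D) m%:R^-1 <= 2 * ln (1 + D%:R) :> R.
Proof.
have := sum_harmonic_le D (@ltr01 R); rewrite mulr1 divr1; apply: le_trans.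
rewrite !big_nat; apply: ler_sum => m /andP[m1 _].
have m0 : 1 <= m%:R :> R by rewrite ler1n.
have m0' : 0 < m%:R :> R by exact: lt_le_trans m0.
rewrite ler_pdivlMr; last by rewrite ltr_wpDl // ltW.
by rewrite mulrC ler_pdivrMr //; move: m0; clear; lra.
Qed.

Lemma dirichlet_tail_telescope w (M D : nat) : 1 <= complex.Re w -> w != 1 -> 4 * (1 + cmod w) <= M%:R -> (M <= D)%N ->
  cmod (\sum_(M <= m < D) dterm w m - (dterm (w - 1) M - dterm (w - 1) D) / (w - 1)) <= 36 * (1 + cmod w) / M%:R.
Proof.
move=> w1 wn1 MT MD; set T := 1 + cmod w in MT.
have T1 : 1 <= T by rewrite /T lerDl.
have M0 : (0 < M)%N by rewrite -(ltr_nat R); move: MT T1; clear; lra.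
have -> : (dterm (w - 1) M - dterm (w - 1) D) / (w - 1) =
    \sum_(M <= m < D) (dterm (w - 1) m - dterm (w - 1) m.+1) / (w - 1).
  rewrite -mulr_suml; congr (_ / _); rewrite -[RHS]opprK -sumrN.
  under eq_bigr do rewrite opprB.
  by rewrite telescope_sumr // opprB.
rewrite -sumrB; apply: le_trans (ler_cmod_sum _ _ _) _.
apply: (@le_trans _ _ (\sum_(M <= m < D) 18 * T * (m%:R ^+ 2)^-1)).
  rewrite !big_nat; apply: ler_sum => m /andP[Mm _]; apply: dterm_telescope => //.
  by apply: le_trans MT _; rewrite ler_nat.
rewrite -mulr_sumr; apply: le_trans (ler_wpM2l _ (sum_inv_sqr D M0)) _; first by move: T1; clear; lra.
by rewrite mulrA -/T ler_pM2r ?invr_gt0 ?ltr0n //; move: T1; clear; lra.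
Qed.

Definition zbound w : R := 2 / cmod (w - 1) + 9 + 2 * ln (8 + 4 * cmod w).

Lemma zbound_ge0 w : 0 <= zbound w.
Proof.
rewrite /zbound !addr_ge0 ?divr_ge0 ?mulr_ge0 // ln_ge0 //.
by have := cmod_ge0 w; lra.
Qed.

(** The sum is cut at [M] just above [4 (1 + |w|)]: below, the harmonic sum gives the logarithm;
    above, telescoping gives the pole term [2 / |w - 1|] and an error [36 (1 + |w|) / M <= 9]. *)
Lemma dirichlet_partial w D : 1 <= complex.Re w -> w != 1 -> cmod (\sum_(1 <= m < D) dterm w m) <= zbound w.
Proof.
move=> w1 wn1; set T := 1 + cmod w.
have T1 : 1 <= T by rewrite /T lerDl.
pose M := (Num.truncn (4 * T)).+1.
have T4 : 0 <= 4 * T by move: T1; clear; lra.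
have /andP[M1 M2] : M.-1%:R <= 4 * T < M%:R := truncn_itv T4.
have MT : M%:R <= 4 * T + 1 by rewrite -[leLHS]/((M.-1).+1%:R) -[leLHS]natr1 lerD2r.
have head D' : (D' <= M)%N -> cmod (\sum_(1 <= m < D') dterm w m) <= 2 * ln (8 + 4 * cmod w).
  move=> DM; apply: le_trans (ler_cmod_sum _ _ _) _.
  apply: (@le_trans _ _ (\sum_(1 <= m < D') m%:R^-1)).
    by rewrite !big_nat; apply: ler_sum => m /andP[m1 _]; exact: cmod_dterm_le.
  apply: le_trans (sum_inv_le _) _; rewrite ler_pM2l // ler_ln ?posrE.
  - have : D'%:R <= M%:R :> R by rewrite ler_nat.
    by move: MT; rewrite /T; clear; lra.
  - by rewrite ltr_pwDl.
  - by have := cmod_ge0 w; clear; lra.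
have l0 : 0 <= 2 / cmod (w - 1) by rewrite divr_ge0.
rewrite /zbound; case: (leqP D M) => DM; first by have := head D DM; move: l0; clear; lra.
rewrite (big_cat_nat (n := M)) //=; last exact: ltnW.
have tl : cmod (\sum_(M <= m < D) dterm w m - (dterm (w - 1) M - dterm (w - 1) D) / (w - 1)) <= 9.
  apply: le_trans (dirichlet_tail_telescope w1 wn1 (ltW M2) (ltnW DM)) _.
  by rewrite ler_pdivrMr ?ltr0n //; move: M2; rewrite /T; clear; lra.
have d1 (m : nat) : (0 < m)%N -> cmod (dterm (w - 1) m) <= 1.
  move=> m0; rewrite cmod_dterm -[leRHS]expR0 ler_expR; have : 0 <= ln m%:R :> R by rewrite ln_ge0 // ler1n.
  have -> : complex.Re (w - 1) = complex.Re w - 1 by case: (w).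
  by move: w1; clear; nra.
have b2 : cmod ((dterm (w - 1) M - dterm (w - 1) D) / (w - 1)) <= 2 / cmod (w - 1).
  rewrite cmodM cmodV; apply: ler_wpM2r; first by rewrite invr_ge0.
  apply: le_trans (ler_cmodB _ _) _; have := d1 M isT; have := d1 D (leq_trans _ (ltnW DM)).
  by move/(_ isT); clear; lra.
move: tl b2; set S := \sum_(M <= m < D) _; set Q := (_ - _) / _ => tl b2.
have := ler_cmodD (S - Q) Q; rewrite subrK.
have := ler_cmodD (\sum_(1 <= m < M) dterm w m) S; have := head M (leqnn _).
move: tl b2; clear; lra.
Qed.

(** The alternating sum is twice its even part minus the full sum, and the even part is [2^(-w)]
    times a shorter full sum, with [|2 * 2^(-w)| <= 1]. *)
Lemma dirichlet_alternating w D : 1 <= complex.Re w -> w != 1 ->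
  cmod (\sum_(1 <= m < D) (-1) ^+ m * dterm w m) <= 2 * zbound w.
Proof.
move=> w1 wn1.
have -> : \sum_(1 <= m < D) (-1) ^+ m * dterm w m =
    2 * dterm w 2 * \sum_(1 <= m < uphalf D) dterm w m - \sum_(1 <= m < D) dterm w m.
  elim: D => [|D IH]; first by rewrite !big_geq // mulr0 subr0.
  case: (posnP D) => [->|D0]; first by rewrite !big_geq // mulr0 subr0.
  rewrite !(@big_nat_recr _ _ _ D 1) //= IH uphalf_half -signr_odd.
  case oD : (odd D) => /=; first by rewrite add1n expr1; ring.
  have h0 : (0 < D./2)%N by rewrite half_gt0; case: (D) oD D0 => [|[]].
  have DE : D = (2 * D./2)%N by rewrite mul2n -{1}(odd_double_half D) oD.
  have dD : dterm w D = dterm w 2 * dterm w D./2 by rewrite {1}DE dtermM.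
  by rewrite add0n expr0 mul1r (@big_nat_recr _ _ _ D./2 1) //= dD; ring.
have d2 : cmod (2 * dterm w 2) <= 1.
  have := cmod_dterm_le w1 (isT : (0 < 2)%N); rewrite cmodM (cmod_nat R 2); lra.
have := ler_cmodB (2 * dterm w 2 * \sum_(1 <= m < uphalf D) dterm w m) (\sum_(1 <= m < D) dterm w m).
rewrite [cmod (_ * _ * _)]cmodM; have := dirichlet_partial (uphalf D) w1 wn1; have := dirichlet_partial D w1 wn1.
have h3 : cmod (2 * dterm w 2) * cmod (\sum_(1 <= m < uphalf D) dterm w m) <= cmod (\sum_(1 <= m < uphalf D) dterm w m).
  by rewrite ler_piMl.
move: h3; clear; lra.
Qed.
End DirichletPartial.

(** * Continuation of full lattice sums to Re s > 1/2 *)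

Section LatticeContinuation.
Variable R : realType.
Local Notation C := (R[i]).

Definition bsum n (z : C) (Y k : nat) (s : C) : C :=
  sbox (fun c d => phi0 n s (lpt z c d)) (2 ^ k) (2 ^ k * Y).
Definition asum n (z : C) (Y k : nat) (s : C) : C :=
  sbox (chiphi n z s (-1) 1) (2 ^ k) (2 ^ k * Y) +
  (sbox (chiphi n z s 1 (-1)) (2 ^ k) (2 ^ k * Y) + sbox (chiphi n z s (-1) (-1)) (2 ^ k) (2 ^ k * Y)).

Lemma ler_cmod3B (x1 x2 x3 y1 y2 y3 : C) (B : R) : cmod (x1 - y1) <= B -> cmod (x2 - y2) <= B -> cmod (x3 - y3) <= B ->
  cmod (x1 + (x2 + x3) - (y1 + (y2 + y3))) <= 3 * B.
Proof.
have -> : x1 + (x2 + x3) - (y1 + (y2 + y3)) = (x1 - y1) + ((x2 - y2) + (x3 - y3)) by ring.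
have := ler_cmodD (x1 - y1) ((x2 - y2) + (x3 - y3)); have := ler_cmodD (x2 - y2) (x3 - y3); lra.
Qed.

Lemma sboxD (V : zmodType) (F G : int -> int -> V) P Q :
  sbox (fun c d => F c d + G c d) P Q = sbox F P Q + sbox G P Q.
Proof. by rewrite /sbox /box -segD; apply: eq_bigr => i _; rewrite -segD. Qed.

Lemma phi0_scale n s (a u : C) : a != 0 -> phi0 n s (a * u) = qchar n s a * phi0 n s u.
Proof.
move=> a0; rewrite /phi0 mulf_eq0 (negbTE a0) /=; case: eqP => [_|/eqP u0]; first by rewrite mulr0.
exact: qcharM.
Qed.

(* The even points of a box form the doubled box of half the size. *)
Lemma asum_bsum n z Y k s : (2 %| n)%Z ->
  asum n z Y k.+1 s = 4 * cpow 2 (- (2 * s)) * bsum n z Y k s - bsum n z Y k.+1 s.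
Proof.
move=> n2; set q := cpow 2 _.
pose G e1 e2 (c d : int) : C := e1 ^ c * e2 ^ d * phi0 n s (lpt z c d).
have b1 : bsum n z Y k.+1 s = sbox (G 1 1) (2 ^ k.+1) (2 ^ k.+1 * Y).
  by apply: eq_bigr => i _; apply: eq_bigr => l _; rewrite /G !exp1rz !mul1r.
rewrite /asum b1; apply/eqP; rewrite eq_sym subr_eq eq_sym; apply/eqP.
have twice (F : int -> C) (L : nat) : (forall x : int, F (x * 2 + 1) = 0) ->
    seg F (- (2 * L)%N%:Z) (2 * L + 2 * L) = seg (fun x => F (x * 2)) (- L%:Z) (L + L).
  move=> F0; have gen (K : nat) (a : int) : seg F (a * 2) (2 * K) = seg (fun x => F (x * 2)) a K.
    elim: K => [|K IH]; first by rewrite /seg muln0 !big_ord0.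
    rewrite mulnS addnC seg_cat IH -[K.+1]addn1 seg_cat; congr (_ + _).
    rewrite /seg !big_ord_recr !big_ord0 /= !add0r !addr0.
    have -> : a * 2 + (2 * K)%N%:Z + 1%N%:Z = (a + K%:Z) * 2 + 1 by lia.
    have -> : a * 2 + (2 * K)%N%:Z = (a + K%:Z) * 2 by lia.
    by rewrite F0 addr0.
  have -> : (- (2 * L)%N%:Z : int) = (- L%:Z) * 2 by lia.
  by rewrite -mulnDr gen.
have sgnE (c : int) : (-1 : C) ^ (c * 2) = 1 by rewrite mulrC -exprz_exp -[(-1) ^ 2]exprnP expr2 mulrNN mulr1 exp1rz.
have sgnO (c : int) : (-1 : C) ^ (c * 2 + 1) = -1.
  by rewrite expfzDr ?oppr_eq0 ?oner_eq0 // sgnE mul1r expr1z.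
(* The four sign characters sum to 4 at points with both coordinates even and to 0 elsewhere;
   homogeneity extracts [2^(-2 s)] from the surviving doubled points. *)
pose H c d := chiphi n z s (-1) 1 c d + (chiphi n z s 1 (-1) c d + chiphi n z s (-1) (-1) c d) + G 1 1 c d.
have HE c d : H c d = G (-1) 1 c d + (G 1 (-1) c d + G (-1) (-1) c d) + G 1 1 c d by [].
transitivity (sbox H (2 ^ k.+1) (2 ^ k.+1 * Y)); first by rewrite /H !sboxD.
rewrite /sbox /box expnS -mulnA.
rewrite (twice (fun c => seg (H c) _ _)); last first.
  move=> x; rewrite /seg big1 // => l _; rewrite HE /G sgnO !exp1rz; ring.
rewrite /bsum /sbox boxE mulr_sumr; apply: eq_bigr => i _; rewrite (twice (H _)); last first.
  by move=> x; rewrite HE /G sgnO !exp1rz !sgnE; ring.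
rewrite mulr_sumr; apply: eq_bigr => l _; rewrite HE /G !sgnE !exp1rz.
have -> : lpt z ((- (2 ^ k)%N%:Z + i%:Z) * 2) ((- (2 ^ k * Y)%N%:Z + l%:Z) * 2) =
    (2%:R)%:C%C * lpt z (- (2 ^ k)%N%:Z + i%:Z) (- (2 ^ k * Y)%N%:Z + l%:Z).
  rewrite /lpt !rmorphM /= (_ : (2%:R)%:C%C = 2) ?rmorph_nat //; ring.
rewrite phi0_scale ?rc_neq0 ?pnatr_eq0 // qchar_real ?pnatr_eq0 // ger0_norm // -/q; ring.
Qed.

Lemma centire_asum n z Y k : centire (asum n z Y k).
Proof.
have H e1 e2 P Q : centire (fun s => sbox (chiphi n z s e1 e2) P Q).
  apply: (@centire_sum R _ _ (fun i s => seg (chiphi n z s e1 e2 _) _ _)) => i.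
  apply: (@centire_sum R _ _ (fun l s => chiphi n z s e1 e2 _ _)) => l.
  by apply: centireM; [exact: centire_cst|exact: centire_phi0].
exact: centireD (H _ _ _ _) (centireD (H _ _ _ _) (H _ _ _ _)).
Qed.

Definition alim n z Y s : C := xget 0 [set l | climit (fun k => asum n z Y k s) l].

Definition limit_cst : R := 3 * (3 * 64 + 2 * tail_cst R).

Lemma limit_cst_gt0 : 0 < limit_cst.
Proof. by rewrite /limit_cst mulr_gt0 // ltr_pwDl ?mulr_gt0 // mulr_ge0 // tail_cst_ge0. Qed.

Definition tailw (Y : nat) (sg : R) k : R := expR ((1 - 2 * sg) * ln (scale R Y k)).

Variables (z : C) (Y : nat).
Hypotheses (zx : `|complex.Re z| <= 2^-1) (zy : 4 / 5 <= complex.Im z).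
Hypotheses (yY : complex.Im z <= Y%:R) (Yy : Y%:R <= 9 / 4 * complex.Im z).
Variable n : int.
Hypothesis n2 : (2 %| n)%Z.
Local Notation a := (asum n z Y).

Let Y0 : (0 < Y)%N.
Proof. by rewrite -(ltr_nat R) (lt_le_trans (im_gt0 zy)). Qed.

Lemma asum_tail s k j : 2^-1 <= complex.Re s -> 160 * (conductor n s + 1) <= (2 ^ k)%:R ->
  cmod (a (k + j)%N s - a k s) <= limit_cst * tailw Y (complex.Re s) k.
Proof.
move=> s2 kA.
have T e1 e2 : (e1, e2) \in [:: (-1, 1); (1, -1); (-1, -1)] ->
    cmod (sbox (chiphi n z s e1 e2) (2 ^ (k + j)) (2 ^ (k + j) * Y) -
      sbox (chiphi n z s e1 e2) (2 ^ k) (2 ^ k * Y)) <= (3 * 64 + 2 * tail_cst R) * tailw Y (complex.Re s) k.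
  by move=> he; rewrite /tailw -wpow_mul ?(scale_pos zy yY) //; exact: tail_bound.
have T1 := T (-1) 1 (mem_head _ _).
have T2 := T 1 (-1) ltac:(by rewrite !inE eqxx orbT).
have T3 := T (-1) (-1) ltac:(by rewrite !inE eqxx !orbT).
by have := ler_cmod3B T1 T2 T3; rewrite mulrA.
Qed.

Lemma tailw_small (r e : R) : 0 < r -> 0 < e -> exists N, forall k sg, (N <= k)%N -> 2^-1 + r <= sg -> tailw Y sg k <= e.
Proof.
move=> r0 e0.
pose X := expR (`|ln e| / (2 * r)).
have X0 : 1 <= X by rewrite -[leLHS]expR0 ler_expR divr_ge0 ?mulr_ge0 // ltW.
pose N := (Num.truncn (4 * X)).+1.
have X4 : 0 <= 4 * X by move: X0; lra.
have /andP[_ NX] := truncn_itv X4.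
exists N => k sg Nk sg1.
have sX : X <= scale R Y k.
  have h1 : (N <= 2 ^ k)%N by apply: leq_trans Nk _; rewrite ltnW // ltn_expl.
  have h2 : N%:R <= (2 ^ k)%:R :> R by rewrite ler_nat.
  have h3 : (2 ^ k)%:R * 1 <= (2 ^ k)%:R * Y%:R :> R by apply: ler_wpM2l => //; rewrite ler1n.
  have h4 := ltW (lt_le_trans NX h2).
  rewrite /scale; move: h3 h4; lra.
have sX' : 0 < scale R Y k by apply: lt_le_trans sX; exact: lt_le_trans X0.
have lX : `|ln e| / (2 * r) <= ln (scale R Y k) by rewrite -[leLHS]expRK ler_ln ?posrE // expR_gt0.
have lX' : `|ln e| <= ln (scale R Y k) * (2 * r) by rewrite -ler_pdivrMr // mulr_gt0.
have l0 : 0 <= ln (scale R Y k) by apply: le_trans lX; rewrite divr_ge0 // mulr_ge0 // ltW.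
rewrite /tailw -[leRHS]lnK ?posrE // ler_expR.
have le : - ln e <= `|ln e| by rewrite -normrN ler_norm.
have : (1 - 2 * sg) * ln (scale R Y k) <= - (2 * r) * ln (scale R Y k) by apply: ler_wpM2r => //; lra.
lra.
Qed.

Lemma pow2_ge (X : R) : exists k, X <= (2 ^ k)%:R.
Proof.
exists (Num.truncn `|X|).+1; have /andP[_ h] := truncn_itv (normr_ge0 X).
apply: le_trans (ler_norm _) _; apply: le_trans (ltW h) _; rewrite ler_nat; exact: ltnW (ltn_expl _ _).
Qed.

Lemma alimP s : 2^-1 < complex.Re s -> climit (fun k => a k s) (alim n z Y s).
Proof.
move=> s1; rewrite /alim; case: xgetP => [l _ //|H]; exfalso.
suff [l /H] : exists l, climit (fun k => a k s) l by [].
apply: climit_cauchy => e e0.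
have r0 : 0 < complex.Re s - 2^-1 by rewrite subr_gt0.
have [N HN] := tailw_small r0 (divr_gt0 e0 limit_cst_gt0).
have [M HM] := pow2_ge (160 * (conductor n s + 1)).
exists (maxn N M) => k j; rewrite geq_max => /andP[Nk Mk].
apply: le_trans (asum_tail j (ltW s1) _) _.
  by apply: le_trans HM _; rewrite ler_nat leq_pexp2l.
rewrite mulrC -ler_pdivlMr ?limit_cst_gt0 //; apply: HN => //.
by rewrite addrC subrK.
Qed.

Lemma alim_tail s k : 2^-1 < complex.Re s -> 160 * (conductor n s + 1) <= (2 ^ k)%:R ->
  cmod (a k s - alim n z Y s) <= limit_cst * tailw Y (complex.Re s) k.
Proof.
move=> s1 kA; rewrite cmodB; apply: (climit_le (N := k) (alimP s1)) => m km.
by rewrite -(subnKC km); apply: asum_tail => //; exact: ltW.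
Qed.

(** On a disc of radius half the distance to the line, the conductor is bounded and [Re s] stays
    away from 1/2, so one threshold for [k] serves the whole disc. *)
Lemma loc_unif_asum : loc_unif 2^-1 a (alim n z Y).
Proof.
move=> p p1; pose r := (complex.Re p - 2^-1) / 2.
have r0 : 0 < r by rewrite divr_gt0 // subr_gt0.
exists r => // e e0.
have [N HN] := tailw_small r0 (divr_gt0 e0 limit_cst_gt0).
have [M HM] := pow2_ge (160 * (`|n%:~R| + 2 * (cmod p + r) + 1)).
exists (maxn N M) => k s; rewrite geq_max => /andP[Nk Mk] sp.
have sr : 2^-1 + r <= complex.Re s.
  have := le_lt_trans (ler_Re_cmod _) sp; rewrite raddfB /= ltr_norml => /andP[h _].
  by move: h; rewrite /r; lra.
have s1 : 2^-1 < complex.Re s by apply: lt_le_trans sr; rewrite ltrDl.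
apply: le_trans (alim_tail s1 _) _.
  apply: (@le_trans _ _ (2 ^ M)%:R); last by rewrite ler_nat leq_pexp2l.
  apply: le_trans HM; rewrite /conductor.
  have : cmod s <= cmod p + r by have := ler_cmodD (s - p) p; rewrite subrK; move: sp; lra.
  by move: (cmod s) (cmod p + r) => x1 x2; lra.
by rewrite mulrC -ler_pdivlMr ?limit_cst_gt0 //; apply: HN.
Qed.

Lemma alim_bsum s v : 2^-1 < complex.Re s -> climit (fun k => bsum n z Y k s) v ->
  alim n z Y s = (4 * cpow 2 (- (2 * s)) - 1) * v.
Proof.
move=> s1 Hv; apply: (climit_unique (climit_shift 1 (alimP s1))).
have := climitD (climitZ (4 * cpow 2 (- (2 * s))) Hv) (climitZ (-1) (climit_shift 1 Hv)).
have -> : (4 * cpow 2 (- (2 * s)) - 1) * v = 4 * cpow 2 (- (2 * s)) * v + -1 * v by ring.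
move=> H e e0; have [N HN] := H e e0; exists N => k Nk; have := HN k Nk.
by rewrite addn1 (asum_bsum _ _ _ _ n2) !mulN1r.
Qed.
End LatticeContinuation.

(** * Size of the continued lattice sums near Re s = 1/2 *)

Section LatticeBound.
Variable R : realType.
Local Notation C := (R[i]).

Lemma cmod_im (t : R) : cmod (0 +i* t)%C = `|t|.
Proof. by rewrite /cmod /= expr0n add0r sqrtr_sqr. Qed.

Lemma seg_neg (V : zmodType) (f : int -> V) (Y : nat) : seg f (- Y%:Z) Y = \sum_(1 <= m < Y.+1) f (- m%:Z).
Proof.
elim: Y => [|Y IH]; first by rewrite /seg big_ord0 big_geq.
rewrite big_nat_recr //= -IH -[X in seg f _ X]add1n seg_cat addrC.
have -> : - Y.+1%:Z + 1%N%:Z = - Y%:Z :> int by lia.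
by congr (_ + _); rewrite /seg big_ord_recl big_ord0 !addr0.
Qed.

Lemma seg_pos (V : zmodType) (f : int -> V) (Y : nat) : f 0 = 0 -> seg f 0 Y = \sum_(1 <= m < Y) f m%:Z.
Proof.
move=> f0; rewrite /seg; under eq_bigr do rewrite add0r.
rewrite -(big_mkord xpredT (fun m => f m%:Z)); case: Y => [|Y]; first by rewrite !big_geq.
by rewrite big_ltn // f0 add0r.
Qed.

Lemma dirichlet_signed (w e : C) D : 1 <= complex.Re w -> w != 1 -> e = 1 \/ e = -1 ->
  cmod (\sum_(1 <= m < D) e ^+ m * dterm w m) <= 2 * zbound w.
Proof.
move=> w1 wn1 [->|->]; last exact: dirichlet_alternating.
under eq_bigr do rewrite expr1n mul1r.
apply: le_trans (dirichlet_partial D w1 wn1) _.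
by rewrite ler_peMl ?zbound_ge0 // ler1n.
Qed.

Lemma phi0_nat (n : int) (s : C) (d : int) : (2 %| n)%Z -> d != 0 -> phi0 n s d%:~R = dterm (2 * s) (absz d).
Proof.
move=> n2 d0; have -> : d%:~R = (d%:~R)%:C%C :> C by rewrite rmorph_int.
have d0' : d%:~R != 0 :> R by rewrite intr_eq0.
by rewrite phi0E ?rc_neq0 // qchar_real // /dterm -intr_norm -abszE.
Qed.

(** The box consists of the rows [c = -1] and [c = 0]. The first is bounded trivially; the second
    consists of two partial sums of a Dirichlet series in [2 s], one for each sign of [d], and is
    the source of the term [1 / |2 s - 1|]. *)
Lemma first_box (z : C) (Y : nat) (n : int) (s e1 e2 : C) :
  `|complex.Re z| <= 2^-1 -> 4 / 5 <= complex.Im z -> complex.Im z <= Y%:R -> Y%:R <= 9 / 4 * complex.Im z ->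
  (2 %| n)%Z -> 2^-1 < complex.Re s <= 1 -> cmod e1 = 1 -> e2 = 1 \/ e2 = -1 ->
  cmod (sbox (chiphi n z s e1 e2) 1 Y) <= 128 + 4 * zbound (2 * s).
Proof.
move=> zx zy yY Yy n2 /andP[s1 s2] h1 e2E.
have h2 : cmod e2 = 1 by case: e2E => ->; rewrite ?cmodN cmod1.
have Y0 : (0 < Y)%N by rewrite -(ltr_nat R) (lt_le_trans (im_gt0 zy)).
have s12 : 2^-1 <= complex.Re s <= 1 by rewrite ltW.
have -> : sbox (chiphi n z s e1 e2) 1 Y = box (chiphi n z s e1 e2) (- 1%N%:Z) 1 (- Y%:Z) (Y + Y) +
    seg (chiphi n z s e1 e2 0) (- Y%:Z) (Y + Y).
  rewrite /sbox /box seg_cat; congr (_ + _); rewrite /seg big_ord_recl big_ord0 addr0.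
  by have -> : - 1%N%:Z + 1%N%:Z + (@ord0 0)%:Z = 0 :> int by [].
have B1 : cmod (box (chiphi n z s e1 e2) (- 1%N%:Z) 1 (- Y%:Z) (Y + Y)) <= 128 * 1%N%:R.
  apply: (rect_trivial zx zy yY Yy) => //; last by lia.
  by move=> i l im lL; apply/orP; left; lia.
rewrite mulr1 in B1.
have w1 : 1 <= complex.Re (2 * s).
  by have -> : complex.Re (2 * s) = 2 * complex.Re s by [rewrite -[2]/(2%:R) mulr_natl raddfMn /= mulr_natl]; move: s1; clear; lra.
have wn1 : 2 * s != 1.
  apply/eqP => E; have : complex.Re (2 * s) = 1 by rewrite E.
  have -> : complex.Re (2 * s) = 2 * complex.Re s by rewrite -[2]/(2%:R) mulr_natl raddfMn /= mulr_natl.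
  by move: s1; clear; lra.
have term (d : int) : d != 0 -> chiphi n z s e1 e2 0 d = e2 ^+ absz d * dterm (2 * s) (absz d).
  move=> d0; rewrite /chiphi expr0z mul1r /lpt mul0r add0r phi0_nat //; congr (_ * _).
  case: d {d0} => m; first by [].
  have -> : e2 ^ Negz m = (e2 ^+ m.+1)^-1 by [].
  by rewrite -exprVn; case: e2E => ->; rewrite ?invrN invr1.
have -> : seg (chiphi n z s e1 e2 0) (- Y%:Z) (Y + Y) =
    \sum_(1 <= m < Y.+1) e2 ^+ m * dterm (2 * s) m + \sum_(1 <= m < Y) e2 ^+ m * dterm (2 * s) m.
  rewrite seg_cat addNr seg_neg seg_pos; last by rewrite /chiphi /lpt mul0r add0r /phi0 eqxx mulr0.
  congr (_ + _); rewrite !big_nat; apply: eq_bigr => m /andP[m1 _].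
    by rewrite term ?abszN // oppr_eq0 -lt0n.
  by rewrite term // -lt0n.
have D1 := dirichlet_signed Y.+1 w1 wn1 e2E; have D2 := dirichlet_signed Y w1 wn1 e2E.
move: B1 D1 D2; move: (box _ _ _ _ _) (\sum_(_ <= _ < _) _) (\sum_(_ <= _ < _) _) => b x1 x2.
have := ler_cmodD b (x2 + x1); have := ler_cmodD x2 x1; clear; lra.
Qed.

Lemma pow2_log (j : nat) (X : R) : (2 ^ j)%:R <= X -> j%:R <= 2 * ln X.
Proof.
move=> jX; have p0 : 0 < (2 ^ j)%:R :> R by rewrite ltr0n expn_gt0.
have X0 : 0 < X by exact: lt_le_trans jX.
have l2 : 2^-1 <= ln 2 :> R.
  have := @le_ln1Dx R (- 2^-1); have -> : 1 + - 2^-1 = 2^-1 :> R by lra.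
  by rewrite lnV ?posrE // => H; have := H ltac:(lra); lra.
have : j%:R * ln 2 <= ln X.
  by rewrite mulr_natl -lnXn // -natrX ler_ln ?posrE.
have : 0 <= j%:R :> R by []. 
move: l2; clear; nra.
Qed.

(** The dyadic boxes grow from the first one by shells: up to the conductor there are
    logarithmically many, each bounded by [growth A], and beyond it the tail is bounded. All
    constants are uniform in [Re s > 1/2], the pole term excepted. *)
Lemma alim_bound : exists2 K : R, 0 < K & forall (z : C) (Y : nat) (n : int) (s : C),
  let A := conductor n (0 +i* complex.Im s)%C in
  `|complex.Re z| <= 2^-1 -> 4 / 5 <= complex.Im z -> complex.Im z <= Y%:R -> Y%:R <= 9 / 4 * complex.Im z ->
  (2 %| n)%Z -> 2^-1 < complex.Re s <= 1 ->
  cmod (alim n z Y s) <= K * (growth A * (1 + ln (1 + A)) + (cmod (2 * s - 1))^-1).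
Proof.
(* Below the threshold, [2^j < 160 (conductor + 1) <= 160 (A + 3) <= 240 (A + 2)], since
   [conductor n s] is at most [A + 2]. *)
have [C0 C01 C0E] : exists2 c : R, 1 <= c & c = 240 by exists 240 => //; rewrite ler1n.
have [Ks Ks0 shell] := shell_bound C01.
have [l0 l00 l0E] : exists2 l : R, 0 <= l & l = ln (2 * C0) by exists (ln (2 * C0)) => //; rewrite ln_ge0 //; move: C01; clear; lra.
have [m0 m00 m0E] : exists2 l : R, 0 <= l & l = ln 16 by exists (ln 16) => //; rewrite ln_ge0 // ler1n.
pose K := 3 * 128 + 12 * 9 + 24 + 24 * m0 + 24 + 3 * (Ks * (3 + 2 * l0)) + limit_cst R.
have lc0 := limit_cst_gt0 R.
have Kl0 : 0 <= Ks * (3 + 2 * l0) by apply: mulr_ge0; [exact: ltW|move: l00; clear; lra].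
have K0 : 0 < K by rewrite /K; move: lc0 m00 Kl0; clear; lra.
exists K => // z Y n s A zx zy yY Yy n2 s12.
have /andP[s1 s2] := s12.
have A0 : 0 <= A := conductor_ge0 _ _.
have AE : A = `|n%:~R| + 2 * `|complex.Im s| by rewrite /A /conductor cmod_im.
have gA := growth_ge1 A0.
have lA : 0 <= ln (1 + A) by rewrite ln_ge0 // lerDl.
have csA : cmod s <= 1 + `|complex.Im s|.
  apply: le_trans (ler_cmod_ReIm _) _; rewrite lerD2r ger0_norm //; move: s1; clear; lra.
have AsA : conductor n s <= A + 2 by rewrite AE /conductor; move: csA; clear; lra.
have Y0 : (0 < Y)%N by rewrite -(ltr_nat R) (lt_le_trans (im_gt0 zy)).
pose P k := (160 * (conductor n s + 1) <= (2 ^ k)%:R :> R)%R.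
have exP : exists k, P k by have [k Hk] := pow2_ge (160 * (conductor n s + 1)); exists k.
(* The first dyadic size at which the alternating tail estimate applies; minimality bounds [k1] by a
   logarithm of the conductor. *)
pose k1 := ex_minn exP.
have Pk1 : P k1 by rewrite /k1; case: ex_minnP.
have below j : (j < k1)%N -> (2 ^ j)%:R <= C0 * (A + 2).
  rewrite /k1; case: ex_minnP => m _ mmin jm; rewrite leNgt; apply/negP => h.
  have : P j by rewrite /P C0E in h *; move: h AsA A0; clear; lra.
  by move/mmin; rewrite leqNgt jm.
have k1b : k1%:R <= (3 + 2 * l0) * (1 + ln (1 + A)).
  case E : k1 => [|j]; first by rewrite mulr_ge0 ?addr_ge0 ?mulr_ge0.
  have := pow2_log (below j ltac:(by rewrite E)).
  have : ln (C0 * (A + 2)) <= l0 + ln (1 + A).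
    have C00 : 0 < C0 by exact: lt_le_trans C01.
    have A1 : 0 < 1 + A by rewrite ltr_pwDl.
    rewrite l0E -lnM ?posrE ?mulr_gt0 // ler_ln ?posrE ?mulr_gt0 //; last by rewrite ltr_wpDl.
    have -> : 2 * C0 * (1 + A) = C0 * (A + 2 + A) by ring.
    by rewrite ler_pM2l // lerDl.
  have := mulr_ge0 l00 lA; rewrite -natr1; move: l00 lA; clear; lra.
have bx e1 e2 k : cmod e1 = 1 -> e2 = 1 \/ e2 = -1 -> (k <= k1)%N ->
    cmod (sbox (chiphi n z s e1 e2) (2 ^ k) (2 ^ k * Y)) <= 128 + 4 * zbound (2 * s) + k%:R * (Ks * growth A).
  move=> h1 e2E; have h2 : cmod e2 = 1 by case: e2E => ->; rewrite ?cmodN cmod1.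
  elim: k => [_|k IH kk]; first by rewrite expn0 mul1n mul0r addr0; exact: first_box.
  have s12' : 2^-1 <= complex.Re s <= 1 by rewrite ltW.
  have := shell z Y n s e1 e2 (2 ^ k)%N zx zy yY Yy s12' h1 h2 ltac:(by rewrite expn_gt0) (below _ kk).
  rewrite -/A -mulnDl addnn -mul2n -expnS.
  move: (IH (ltnW kk)); move: (sbox _ (2 ^ k) _) (sbox _ (2 ^ k.+1) _) => x1 x2.
  have := ler_cmodD (x2 - x1) x1; rewrite subrK -natr1; move: (Ks * growth A) (zbound _) => T Z.
  by clear; lra.
have n1 : cmod (-1 : C) = 1 by rewrite cmodN cmod1.
have B1 := bx (-1) 1 k1 n1 (or_introl erefl) (leqnn _).
have B2 := bx 1 (-1) k1 (@cmod1 R) (or_intror erefl) (leqnn _).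
have B3 := bx (-1) (-1) k1 n1 (or_intror erefl) (leqnn _).
have tl := alim_tail zx zy yY Yy s1 Pk1.
have tw : tailw Y (complex.Re s) k1 <= 1.
  rewrite /tailw -[leRHS]expR0 ler_expR.
  have : 0 <= ln (scale R Y k1).
    rewrite ln_ge0 // /scale.
    have h3 : (2 ^ k1)%:R * 1 <= (2 ^ k1)%:R * Y%:R :> R by apply: ler_wpM2l => //; rewrite ler1n.
    have h4 : 160 * (conductor n s + 1) <= (2 ^ k1)%:R :> R by [].
    move: h3 h4 (conductor_ge0 n s); clear; lra.
  by move: s1; clear; nra.
have al : cmod (alim n z Y s) <= cmod (asum n z Y k1 s) + limit_cst R.
  have := ler_cmodD (asum n z Y k1 s) (- (asum n z Y k1 s - alim n z Y s)).
  rewrite opprB addrC subrK -(cmodN (_ - _)) opprB => h; apply: le_trans h _.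
  rewrite lerD2l; apply: le_trans tl _; by rewrite ler_piMr // ltW.
have as3 : cmod (asum n z Y k1 s) <= 3 * (128 + 4 * zbound (2 * s) + k1%:R * (Ks * growth A)).
  have := @ler_cmod3B R _ _ _ 0 0 0 _ ltac:(by rewrite subr0; exact: B1) ltac:(by rewrite subr0; exact: B2) ltac:(by rewrite subr0; exact: B3).
  by rewrite !addr0 subr0.
have zb : zbound (2 * s) <= 2 * (cmod (2 * s - 1))^-1 + 9 + 2 * (m0 + ln (1 + A)).
  rewrite /zbound lerD2l ler_pM2l // m0E -lnM ?posrE // ?ltr_pwDl // ler_ln ?posrE.
  - rewrite cmodM (cmod_nat R 2) AE.
    have n0 : 0 <= `|n%:~R : R| by [].
    by move: csA n0 (normr_ge0 (complex.Im s)); clear; lra.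
  - by rewrite ltr_pwDl // mulr_ge0.
  - by rewrite mulr_gt0 // ltr_pwDl.
have k1K : k1%:R * (Ks * growth A) <= Ks * (3 + 2 * l0) * (growth A * (1 + ln (1 + A))).
  have -> : Ks * (3 + 2 * l0) * (growth A * (1 + ln (1 + A))) = (3 + 2 * l0) * (1 + ln (1 + A)) * (Ks * growth A) by ring.
  by apply: ler_wpM2r => //; rewrite mulr_ge0 ?ltW // (lt_le_trans ltr01).
have i0 : 0 <= (cmod (2 * s - 1))^-1 by rewrite invr_ge0.
set G := growth A * (1 + ln (1 + A)) in k1K *.
have G1 : 1 + ln (1 + A) <= G by rewrite /G ler_peMl // addr_ge0.
have G1' : 1 <= G by move: G1 lA; clear; lra.
have mG := ler_wpM2l m00 G1'; have lG := ler_wpM2l (ltW lc0) G1'.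
have mi := mulr_ge0 m00 i0; have li := mulr_ge0 (ltW lc0) i0; have ki := mulr_ge0 Kl0 i0.
move: al as3 zb k1K i0 G1 G1' mG lG mi li ki lA; rewrite /K.
move: (cmod (alim _ _ _ _)) (cmod (asum _ _ _ _ _)) (zbound _) (k1%:R * _) (Ks * (3 + 2 * l0)) ((cmod _)^-1) (limit_cst R) G (ln (1 + A)).
clear => a1 a2 zz kk T i lc g l; lra.
Qed.
End LatticeBound.

(** * Unordered sums and the zeta function *)

Section UnorderedSums.
Variable R : realType.
Local Notation C := (R[i]).

(** Unordered summation over duplicate-free lists on any [eqType]; [has_sum_usum] brings the
    set-based sums of the statement to this form. *)
Definition usum (I : eqType) (F : I -> C) (v : C) := forall e : R, 0 < e ->
  exists s0 : seq I, forall s, uniq s -> {subset s0 <= s} -> cmod (\sum_(i <- s) F i - v) <= e.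

Definition abs_bounded (I : eqType) (F : I -> C) (B : R) := forall s : seq I, uniq s -> \sum_(i <- s) cmod (F i) <= B.

Lemma usum_unique (I : eqType) (F : I -> C) v v' : usum F v -> usum F v' -> v = v'.
Proof.
move=> H H'; apply/eqP; rewrite -subr_eq0 -cmod_eq0 eq_le cmod_ge0 andbT.
apply/ler_addgt0Pl => e e0; rewrite addr0.
have e2 : 0 < e / 2 by rewrite divr_gt0.
have [s Hs] := H _ e2; have [s' Hs'] := H' _ e2.
have u : uniq (undup (s ++ s')) by exact: undup_uniq.
have h1 := Hs' _ u ltac:(by move=> x xs; rewrite mem_undup mem_cat xs orbT).
have h2 := Hs _ u ltac:(by move=> x xs; rewrite mem_undup mem_cat xs).
move: h1 h2; set S := \sum_(i <- _) _ => h1 h2.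
have := ler_cmodD (v - S) (S - v'); rewrite addrA subrK (cmodB v S) => h.
by move: h h1 h2; lra.
Qed.

Lemma usumD (I : eqType) (F G : I -> C) v w : usum F v -> usum G w -> usum (fun i => F i + G i) (v + w).
Proof.
move=> H H' e e0; have e2 : 0 < e / 2 by rewrite divr_gt0.
have [s Hs] := H _ e2; have [s' Hs'] := H' _ e2; exists (s ++ s') => t ut st.
have h1 := Hs t ut ltac:(by move=> x xs; apply: st; rewrite mem_cat xs).
have h2 := Hs' t ut ltac:(by move=> x xs; apply: st; rewrite mem_cat xs orbT).
rewrite big_split /= opprD addrACA; apply: le_trans (ler_cmodD _ _) _; move: h1 h2; lra.
Qed.

Lemma usumZ (I : eqType) (F : I -> C) v c : usum F v -> usum (fun i => c * F i) (c * v).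
Proof.
move=> H e e0; have c0 : 0 < cmod c + 1 by rewrite ltr_wpDl.
have [s Hs] := H _ (divr_gt0 e0 c0); exists s => t ut st.
rewrite -mulr_sumr -mulrBr cmodM; have := Hs t ut st; rewrite ler_pdivlMr // => h.
by have := cmod_ge0 (\sum_(i <- t) F i - v); have := cmod_ge0 c; move: h; clear; nra.
Qed.

Lemma usum_eq (I : eqType) (F G : I -> C) v : F =1 G -> usum F v -> usum G v.
Proof. by move/funext => ->. Qed.

Lemma sum_filter_supp (I : eqType) (F : I -> C) (s : seq I) :
  \sum_(i <- s) F i = \sum_(i <- [seq i <- s | F i != 0]) F i.
Proof. by rewrite big_filter [RHS]big_mkcond /=; apply: eq_bigr => i _; case: eqP. Qed.

(* Reindexing along [g] and [h], mutually inverse between the supports of [F] and [G]. *)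
Lemma usum_transfer (I J : eqType) (F : I -> C) (G : J -> C) (g : I -> J) (h : J -> I) v :
  (forall i, F i != 0 -> h (g i) = i /\ G (g i) = F i) ->
  (forall j, G j != 0 -> g (h j) = j /\ F (h j) = G j) -> usum G v -> usum F v.
Proof.
move=> Hg Hh H e e0; have [s0 Hs] := H e e0.
exists [seq h j | j <- s0 & G j != 0] => t ut st.
pose s := undup ([seq j <- s0 | G j == 0] ++ [seq g i | i <- t & F i != 0]).
have <- : \sum_(j <- s) G j = \sum_(i <- t) F i; last first.
  apply: Hs; first exact: undup_uniq.
  move=> j js; rewrite mem_undup mem_cat mem_filter js andbT; case: eqP => //= /eqP Gj.
  have [gh Fh] := Hh j Gj; apply/mapP; exists (h j) => //.
  by rewrite mem_filter Fh Gj /=; apply: st; apply/mapP; exists j => //; rewrite mem_filter Gj.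
rewrite sum_filter_supp [RHS]sum_filter_supp.
have inj : {in [seq i <- t | F i != 0] &, injective g}.
  move=> i i'; rewrite !mem_filter => /andP[Fi _] /andP[Fi' _] E.
  by have [<- _] := Hg i Fi; have [<- _] := Hg i' Fi'; rewrite E.
transitivity (\sum_(j <- [seq g i | i <- t & F i != 0]) G j).
  apply: perm_big; apply: uniq_perm; first by rewrite filter_uniq // undup_uniq.
    by rewrite map_inj_in_uniq // filter_uniq.
  move=> j; rewrite mem_filter mem_undup mem_cat mem_filter.
  apply/idP/idP => [/andP[Gj]|]; first by rewrite (negbTE Gj).
  move=> jt; rewrite jt orbT andbT; case/mapP: (jt) => i; rewrite mem_filter => /andP[Fi _] ->.
  by have [_ ->] := Hg i Fi.
rewrite big_map; apply: eq_big_seq => i; rewrite mem_filter => /andP[Fi _].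
by have [_ ->] := Hg i Fi.
Qed.

Lemma sum_subset_le (I : eqType) (f : I -> R) (s t : seq I) : (forall i, 0 <= f i) -> uniq s -> uniq t ->
  {subset s <= t} -> \sum_(i <- t) f i = \sum_(i <- s) f i + \sum_(i <- t | i \notin s) f i.
Proof.
move=> f0 us ut st; rewrite (bigID (mem s)) /=; congr (_ + _).
rewrite -big_filter; apply: perm_big; apply: uniq_perm; rewrite ?filter_uniq //.
by move=> i; rewrite mem_filter; apply/andP/idP => [[]//|si]; split=> //; exact: st.
Qed.

Lemma sum_subsetC (I : eqType) (f : I -> C) (s t : seq I) : uniq s -> uniq t ->
  {subset s <= t} -> \sum_(i <- t) f i = \sum_(i <- s) f i + \sum_(i <- t | i \notin s) f i.
Proof.
move=> us ut st; rewrite (bigID (mem s)) /=; congr (_ + _).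
rewrite -big_filter; apply: perm_big; apply: uniq_perm; rewrite ?filter_uniq //.
by move=> i; rewrite mem_filter; apply/andP/idP => [[]//|si]; split=> //; exact: st.
Qed.

(** Lists whose absolute sums approach the supremum have Cauchy sums, since enlarging such a list
    changes its sum by little. *)
Lemma usum_exists (I : eqType) (F : I -> C) B : abs_bounded F B -> exists v, usum F v.
Proof.
move=> HB.
pose E := [set x | exists2 s : seq I, uniq s & x = \sum_(i <- s) cmod (F i)].
have supE : has_sup E.
  split; first by exists 0; exists [::] => //; rewrite big_nil.
  by exists B => _ [s us ->]; exact: HB.
have near_sup (e : R) : 0 < e -> exists2 s : seq I, uniq s &
    forall t, uniq t -> {subset s <= t} -> cmod (\sum_(i <- t) F i - \sum_(i <- s) F i) <= e.
  move=> e0; have [_ [s us ->] hs] := sup_adherent e0 supE.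
  exists s => // t ut st; rewrite (sum_subsetC F us ut st) addrC addKr.
  apply: le_trans (ler_cmod_sum _ _ _) _.
  have := sum_subset_le (fun i => cmod_ge0 (F i)) us ut st.
  have : \sum_(i <- t) cmod (F i) <= sup E by apply: sup_upper_bound => //; exists t.
  by move: hs; lra.
pose e_ (k : nat) : R := k.+1%:R^-1.
have e_0 k : 0 < e_ k by rewrite invr_gt0.
have /choice[s_ Hs] : forall k, exists s : seq I, uniq s /\
    forall t, uniq t -> {subset s <= t} -> cmod (\sum_(i <- t) F i - \sum_(i <- s) F i) <= e_ k.
  by move=> k; have [s us h] := near_sup _ (e_0 k); exists s.
have pair k j : cmod (\sum_(i <- s_ k) F i - \sum_(i <- s_ j) F i) <= e_ k + e_ j.
  have [_ Hk] := Hs k; have [_ Hj] := Hs j.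
  have u := undup_uniq (s_ k ++ s_ j).
  have h1 := Hk _ u ltac:(by move=> x xs; rewrite mem_undup mem_cat xs).
  have h2 := Hj _ u ltac:(by move=> x xs; rewrite mem_undup mem_cat xs orbT).
  move: h1 h2; set S := \sum_(i <- undup _) _; set x := \sum_(i <- s_ k) _; set y := \sum_(i <- s_ j) _.
  by have := ler_cmodB (S - y) (S - x); rewrite opprB addrC addrA subrK; move: S x y => S x y; lra.
have small (e : R) : 0 < e -> exists N, forall k, (N <= k)%N -> e_ k <= e.
  move=> e0; exists (Num.truncn e^-1) => k Nk.
  have ei : 0 <= e^-1 by rewrite invr_ge0 ltW.
  have /andP[_ h] := truncn_itv ei.
  rewrite /e_ -[leRHS]invrK lef_pV2 ?posrE ?invr_gt0 //; apply: le_trans (ltW h) _.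
  by rewrite ler_nat ltnS.
have [v Hv] : exists v, climit (fun k => \sum_(i <- s_ k) F i) v.
  apply: climit_cauchy => e e0; have [N HN] := small (e / 2) (divr_gt0 e0 (ltr0n _ 2)).
  exists N => k j Nk; apply: le_trans (pair _ _) _.
  by have := HN k Nk; have := HN (k + j)%N (leq_trans Nk (leq_addr _ _)); lra.
exists v => e e0.
have e2 : 0 < e / 2 by rewrite divr_gt0.
have [N HN] := small _ e2; have [M HM] := Hv _ e2.
have [_ Hk] := Hs (maxn N M).
exists (s_ (maxn N M)) => t ut st.
have := Hk t ut st; have := HM _ (leq_maxr N M); have := HN _ (leq_maxl N M).
move: (\sum_(i <- t) F i) (\sum_(i <- s_ _) F i) => S x.
by have := ler_cmodD (S - x) (x - v); rewrite addrA subrK; lra.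
Qed.

Lemma usum_le (I : eqType) (F : I -> C) v B : usum F v -> (forall s, uniq s -> cmod (\sum_(i <- s) F i) <= B) -> cmod v <= B.
Proof.
move=> H HB; apply/ler_addgt0Pl => e e0; have [s Hs] := H e e0.
have u := undup_uniq s; have h := Hs _ u ltac:(by move=> x xs; rewrite mem_undup).
have := HB _ u; have := ler_cmodB (\sum_(i <- undup s) F i) (\sum_(i <- undup s) F i - v).
by rewrite subKr; move: h; lra.
Qed.

Lemma abs_bounded_sum (I : eqType) (F : I -> C) B s : abs_bounded F B -> uniq s -> cmod (\sum_(i <- s) F i) <= B.
Proof. by move=> H us; apply: le_trans (ler_cmod_sum _ _ _) (H s us). Qed.

Lemma abs_bounded_le (I : eqType) (F G : I -> C) B : abs_bounded F B -> (forall i, cmod (G i) <= cmod (F i)) -> abs_bounded G B.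
Proof. by move=> H GF s us; apply: le_trans (H s us); apply: ler_sum. Qed.

(** Absolute boundedness gives the double family a sum; products of two lists contain any finite
    list of pairs, and on them the double sum factors, which identifies the value. *)
Lemma usumM (I J : eqType) (F : I -> C) (G : J -> C) v w B D : abs_bounded F B -> abs_bounded G D ->
  usum F v -> usum G w -> usum (fun x : I * J => F x.1 * G x.2) (v * w).
Proof.
move=> HB HD Hv Hw.
have prodE (s : seq I) (t : seq J) (f : I -> C) (g : J -> C) :
    \sum_(x <- [seq (i, j) | i <- s, j <- t]) f x.1 * g x.2 = (\sum_(i <- s) f i) * (\sum_(j <- t) g j).
  rewrite big_allpairs mulr_suml; apply: eq_bigr => i _; by rewrite mulr_sumr.
have prodR (s : seq I) (t : seq J) (f : I -> R) (g : J -> R) :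
    \sum_(x <- [seq (i, j) | i <- s, j <- t]) f x.1 * g x.2 = (\sum_(i <- s) f i) * (\sum_(j <- t) g j).
  rewrite big_allpairs mulr_suml; apply: eq_bigr => i _; by rewrite mulr_sumr.
have u2 (s : seq I) (t : seq J) : uniq s -> uniq t -> uniq [seq (i, j) | i <- s, j <- t].
  by move=> us ut; apply: allpairs_uniq => // -[? ?] [? ?].
have cover (s : seq (I * J)) : {subset s <= [seq (i, j) | i <- undup [seq x.1 | x <- s], j <- undup [seq x.2 | x <- s]]}.
  move=> [i j] xs; apply/allpairsP; exists (i, j); split => //=; rewrite mem_undup; apply/mapP; by exists (i, j).
have BB : abs_bounded (fun x : I * J => F x.1 * G x.2) (B * D).
  move=> s us; pose s1 := undup [seq x.1 | x <- s]; pose s2 := undup [seq x.2 | x <- s].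
  have U := u2 s1 s2 (undup_uniq _) (undup_uniq _).
  have := sum_subset_le (fun x => cmod_ge0 (F x.1 * G x.2)) us U (@cover s).
  have : 0 <= \sum_(x <- [seq (i, j) | i <- s1, j <- s2] | x \notin s) cmod (F x.1 * G x.2) by apply: sumr_ge0.
  under [in X in _ -> X = _ -> _]eq_bigr do rewrite cmodM.
  rewrite (prodR s1 s2 (fun i => cmod (F i)) (fun j => cmod (G j))).
  have b1 : 0 <= \sum_(i <- s1) cmod (F i) by apply: sumr_ge0.
  have b2 : 0 <= \sum_(i <- s2) cmod (G i) by apply: sumr_ge0.
  have := ler_pM b1 b2 (HB _ (undup_uniq _)) (HD _ (undup_uniq _)).
  by rewrite -/s1 -/s2; lra.
have [u Hu] := usum_exists BB.
suff -> : v * w = u by [].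
apply/eqP; rewrite -subr_eq0 -cmod_eq0 eq_le cmod_ge0 andbT.
have D0 : 0 <= D by have := HD [::] isT; rewrite big_nil.
apply/ler_addgt0Pl => e e0; rewrite addr0.
have c0 : 0 < 1 + cmod v + D by rewrite -addrA ltr_pwDl // addr_ge0.
pose e' := e / 2 / (1 + cmod v + D).
have e'0 : 0 < e' by rewrite !divr_gt0.
have [s0 Hs] := Hu _ (divr_gt0 e0 (ltr0n _ 2)); have [s1 Hs1] := Hv _ e'0; have [s2 Hs2] := Hw _ e'0.
pose t1 := undup (s1 ++ [seq x.1 | x <- s0]); pose t2 := undup (s2 ++ [seq x.2 | x <- s0]).
have h0 := Hs _ (u2 t1 t2 (undup_uniq _) (undup_uniq _)) _.
have {}h0 : cmod ((\sum_(i <- t1) F i) * (\sum_(j <- t2) G j) - u) <= e / 2.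
  rewrite -prodE; apply: h0 => -[i j] xs; apply/allpairsP; exists (i, j); split => //=; rewrite mem_undup mem_cat.
    by apply/orP; right; apply/mapP; exists (i, j).
  by apply/orP; right; apply/mapP; exists (i, j).
have h1 := Hs1 t1 (undup_uniq _) ltac:(by move=> x xs; rewrite mem_undup mem_cat xs).
have h2 := Hs2 t2 (undup_uniq _) ltac:(by move=> x xs; rewrite mem_undup mem_cat xs).
have h3 := abs_bounded_sum HD (undup_uniq (s2 ++ [seq x.2 | x <- s0])).
rewrite -/t2 in h3; move: h0 h1 h2 h3.
move: (\sum_(i <- t1) F i) (\sum_(j <- t2) G j) => x y h0 h1 h2 h3.
have E : v * w - u = (x * y - u) - ((x - v) * y + v * (y - w)) by ring.
rewrite E; apply: le_trans (ler_cmodB _ _) _.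
have k1 : cmod ((x - v) * y + v * (y - w)) <= e' * D + cmod v * e'.
  apply: le_trans (ler_cmodD _ _) _; rewrite (cmodM (x - v)) (cmodM v).
  by apply: lerD; apply: ler_pM.
have k2 : e' * D + cmod v * e' <= e / 2.
  have -> : e / 2 = e' * (1 + cmod v + D) by rewrite /e' divfK // gt_eqF.
  by move: e'0; move: (cmod v) => V; clear; lra.
by move: h0 k1 k2; lra.
Qed.

Lemma has_sum_usum (I : choiceType) (A : set I) (f : I -> C) v : has_sum A f v ->
  usum (fun i => if i \in A then f i else 0) v.
Proof.
move=> H e e0; have [F0 [F0f F0A] HF] := H e e0.
have /finite_seqP[s0 F0E] := F0f.
exists s0 => s us sub.
pose s' := [seq i <- s | i \in A].
have us' : uniq s' by rewrite filter_uniq.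
have K := HF [set` s'].
rewrite -(fsbig_seq _ f us') in K.
rewrite -big_mkcond -big_filter -/s' -lecR -normc_cmod; apply: ltW; apply: K.
  by split=> [|i /=]; [exact: finite_seq|rewrite mem_filter => /andP[iA _]; exact: set_mem].
move=> i Fi /=; rewrite mem_filter; apply/andP; split; first by apply/mem_set; exact: F0A.
by apply: sub; rewrite F0E in Fi.
Qed.

Lemma usum_climit (I : eqType) (F : I -> C) v (s_ : nat -> seq I) : usum F v -> (forall k, uniq (s_ k)) ->
  (forall i, exists N, forall k, (N <= k)%N -> i \in s_ k) -> climit (fun k => \sum_(i <- s_ k) F i) v.
Proof.
move=> H us ex e e0; have [s0 Hs] := H e e0.
have [N HN] : exists N, forall k, (N <= k)%N -> {subset s0 <= s_ k}.
  elim: s0 {Hs} => [|i s [N IH]]; first by exists 0%N.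
  have [M HM] := ex i; exists (maxn N M) => k; rewrite geq_max => /andP[Nk Mk] j.
  by rewrite inE => /orP[/eqP ->|]; [exact: HM|exact: IH].
by exists N => k Nk; apply: Hs => //; exact: HN.
Qed.
End UnorderedSums.

(** * The zeta function on Re w > 1 and the 3-4-1 inequality *)

Section Zeta.
Variable R : realType.
Local Notation C := (R[i]).
Implicit Types (w : C).

Definition zterm w (m : nat) : C := if m == 0%N then 0 else dterm w m.
(** Meant for [Re w > 1]. At [w = 2 s] this is the half-plane [Re s > 1/2], where all the estimates
    take place. *)
Definition zeta w : C := xget 0 [set v | usum (zterm w) v].

Lemma sum_zterm w D : \sum_(m <- iota 0 D) zterm w m = \sum_(1 <= m < D) dterm w m.
Proof.
case: D => [|D]; first by rewrite big_nil big_geq.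
by rewrite /= big_cons /zterm eqxx add0r /index_iota subn1 big_seq [RHS]big_seq; apply: eq_bigr => m; rewrite mem_iota; case: m.
Qed.

Lemma dterm_real (x : R) m : dterm x%:C%C m = (expR (- x * ln m%:R))%:C%C.
Proof.
rewrite /dterm /cpow; have -> : - x%:C%C * (ln m%:R)%:C%C = (- x * ln m%:R)%:C%C :> C by rewrite !rmorphM rmorphN.
by rewrite /cexp /= sin0 cos0 [(1 +i* 0)%C](_ : _ = 1) // mulr1.
Qed.

Lemma sum_cmod_dterm w D : 1 < complex.Re w -> \sum_(1 <= m < D) cmod (dterm w m) <= zbound (complex.Re w)%:C%C.
Proof.
move=> w1; set r := (complex.Re w)%:C%C.
have rE m : dterm r m = (cmod (dterm w m))%:C%C by rewrite dterm_real cmod_dterm.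
have := @dirichlet_partial R r D (ltW w1) _.
under eq_bigr do rewrite rE; rewrite -rmorph_sum cmod_real ger0_norm ?sumr_ge0 //; apply.
by apply/eqP => /(congr1 (@complex.Re R)) /= E; move: w1; rewrite E ltxx.
Qed.

Lemma abs_bounded_zterm w : 1 < complex.Re w -> abs_bounded (zterm w) (zbound (complex.Re w)%:C%C).
Proof.
move=> w1 s us; pose D := (\max_(m <- s) m).+1.
apply: le_trans (sum_cmod_dterm D w1).
have sub : {subset s <= iota 0 D}.
  by move=> m ms; rewrite mem_iota /= add0n ltnS /D; exact: (@leq_bigmax_seq _ _ xpredT id).
have := sum_subset_le (fun m => cmod_ge0 (zterm w m)) us (iota_uniq 0 D) sub.
have -> : \sum_(m <- iota 0 D) cmod (zterm w m) = \sum_(1 <= m < D) cmod (dterm w m).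
  rewrite /= big_cons /zterm eqxx cmod0 add0r /index_iota subn1 big_seq [RHS]big_seq.
  by apply: eq_bigr => m; rewrite mem_iota; case: m.
by move=> ->; rewrite lerDl; apply: sumr_ge0.
Qed.

Lemma zetaP w : 1 < complex.Re w -> usum (zterm w) (zeta w).
Proof.
move=> w1; rewrite /zeta; case: xgetP => [v _ //|H]; exfalso.
by have [v /H] := usum_exists (abs_bounded_zterm w1).
Qed.

Lemma zeta_climit w : 1 < complex.Re w -> climit (fun D => \sum_(1 <= m < D) dterm w m) (zeta w).
Proof.
move=> w1; have := usum_climit (s_ := fun D => iota 0 D) (zetaP w1) (fun D => iota_uniq _ _) _.
under eq_fun do rewrite sum_zterm; apply => m; exists m.+1 => k mk.
by rewrite mem_iota.
Qed.

Lemma Re_neq1 w : 1 < complex.Re w -> w != 1.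
Proof. by move=> w1; apply/eqP => E; move: w1; rewrite E ltxx. Qed.

Lemma zeta_le w : 1 < complex.Re w -> cmod (zeta w) <= zbound w.
Proof.
move=> w1; have := climit_le (N := 0) (a := 0) (B := zbound w) (zeta_climit w1).
rewrite subr0; apply => k _; rewrite subr0; apply: dirichlet_partial; [exact: ltW|exact: Re_neq1].
Qed.

Lemma dterm_climit0 w : 0 < complex.Re w -> climit (fun D => dterm w D) 0.
Proof.
move=> w0 e e0; pose X := expR (`|ln e| / complex.Re w).
have X0 : 0 <= X by exact: expR_ge0.
have /andP[_ NX] := truncn_itv X0.
exists (Num.truncn X).+1 => k Nk; rewrite subr0 cmod_dterm -[leRHS]lnK ?posrE // ler_expR.
have kX : X <= k%:R by apply: le_trans (ltW NX) _; rewrite ler_nat.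
have Xp : 0 < X by exact: expR_gt0.
have : `|ln e| / complex.Re w <= ln k%:R by rewrite -[leLHS]expRK ler_ln ?posrE // (lt_le_trans Xp).
rewrite ler_pdivrMr // => h; have : - ln e <= `|ln e| by rewrite -normrN ler_norm.
by move: h; lra.
Qed.

Lemma zeta_tail w (M : nat) : 1 < complex.Re w -> 4 * (1 + cmod w) <= M%:R ->
  cmod (zeta w - (\sum_(1 <= m < M) dterm w m + dterm (w - 1) M / (w - 1))) <= 36 * (1 + cmod w) / M%:R.
Proof.
move=> w1 MT; have wn1 := Re_neq1 w1.
have M0 : (0 < M)%N by rewrite -(ltr_nat R); apply: lt_le_trans MT; rewrite mulr_gt0 // ltr_wpDr.
have l1 := climitD (zeta_climit w1) (climitZ ((w - 1)^-1) (@dterm_climit0 (w - 1) _)).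
have Rw : 0 < complex.Re (w - 1) by rewrite raddfB /= subr_gt0.
have {}l1 := l1 Rw; rewrite mulr0 addr0 in l1.
apply: (climit_le (N := M) l1) => D MD.
have := dirichlet_tail_telescope (ltW w1) wn1 MT MD.
have -> : \sum_(1 <= m < D) dterm w m = \sum_(1 <= m < M) dterm w m + \sum_(M <= m < D) dterm w m.
  by rewrite (big_cat_nat (n := M)).
set S1 := \sum_(1 <= i < M) _; set S2 := \sum_(M <= i < D) _.
by have -> : S2 - (dterm (w - 1) M - dterm (w - 1) D) / (w - 1) =
  S1 + S2 + (w - 1)^-1 * dterm (w - 1) D - (S1 + dterm (w - 1) M / (w - 1)) by ring.
Qed.

Definition sieved (ps : seq nat) w (m : nat) : C := if all (fun p => ~~ (p %| m)%N) ps then zterm w m else 0.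

(** One prime at a time: division by [p] matches the multiples of [p] in a sum sieved by the other
    primes with all its terms, so they contribute [p^(-w)] times that sum. *)
Lemma sieveP (ps : seq nat) w : 1 < complex.Re w -> uniq ps -> all prime ps ->
  usum (sieved ps w) (\prod_(p <- ps) (1 - dterm w p) * zeta w).
Proof.
move=> w1; elim: ps => [_ _|p ps IH /= /andP[pps ups] /andP[pp pr]].
  by rewrite big_nil mul1r; apply: usum_eq (zetaP w1).
have p0 := prime_gt0 pp.
have H := IH ups pr; rewrite big_cons.
have H2 : usum (fun m => if (p %| m)%N then sieved ps w m else 0) (dterm w p * (\prod_(p <- ps) (1 - dterm w p) * zeta w)).
  have allE j : all (fun r => ~~ (r %| p * j)%N) ps = all (fun r => ~~ (r %| j)%N) ps.
    apply: eq_in_all => r rps; have rp := allP pr r rps.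
    rewrite Euclid_dvdM // dvdn_prime2 //; case: eqP => [E|_] //=.
    by move: pps; rewrite -E rps.
  have mulE j : sieved ps w (p * j) = dterm w p * sieved ps w j.
    rewrite /sieved allE; case: ifP => _; last by rewrite mulr0.
    case: (posnP j) => [->|j0]; first by rewrite muln0 /zterm mulr0.
    by rewrite /zterm muln_eq0 !eqn0Ngt p0 j0 /= dtermM.
  apply: (usum_transfer (g := fun m => (m %/ p)%N) (h := fun j => (p * j)%N)) (usumZ (dterm w p) H).
  - move=> m; case: ifP => [pm _|]; last by rewrite eqxx.
    by rewrite mulnC divnK // -mulE mulnC divnK.
  - by move=> j _; rewrite mulKn // dvdn_mulr // mulE.
have := usumD H (usumZ (-1) H2).
have -> : (1 - dterm w p) * \prod_(j <- ps) (1 - dterm w j) * zeta w =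
    \prod_(p <- ps) (1 - dterm w p) * zeta w + -1 * (dterm w p * (\prod_(p <- ps) (1 - dterm w p) * zeta w)) by ring.
apply: usum_eq => m /=; rewrite /sieved /=; case: (p %| m)%N => /=; first by rewrite mulN1r subrr.
by rewrite mulr0 addr0.
Qed.

Definition primes_below (N : nat) := [seq p <- iota 0 N | prime p].

(** After sieving by all primes below [N] only 1 and integers at least [N] remain, and the latter
    form a tail of a convergent series. Finite products with this property stand in for the Euler
    product. *)
Lemma sieve_limit w (e : R) : 1 < complex.Re w -> 0 < e -> exists N0, forall N, (N0 <= N)%N ->
  cmod (\prod_(p <- primes_below N) (1 - dterm w p) * zeta w - 1) <= e.
Proof.
move=> w1 e0.
pose r := (complex.Re w)%:C%C : C.
have rw : complex.Re r = complex.Re w by [].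
have /(_ _ (divr_gt0 e0 (ltr0n _ 2))) [N0 HN] := zeta_climit (w := r) w1.
exists (maxn N0 2) => N; rewrite geq_max => /andP[N0N N2].
have rE m : dterm r m = (cmod (dterm w m))%:C%C by rewrite dterm_real cmod_dterm.
have tail D : (N <= D)%N -> \sum_(N <= m < D) cmod (dterm w m) <= e.
  move=> ND; have h1 := HN N N0N; have h2 := HN D (leq_trans N0N ND).
  have E : \sum_(1 <= m < D) dterm r m = \sum_(1 <= m < N) dterm r m + (\sum_(N <= m < D) cmod (dterm w m))%:C%C.
    rewrite (big_cat_nat (n := N)) //=; last exact: leq_trans N2.
    by congr (_ + _); rewrite rmorph_sum; apply: eq_bigr => m _; exact: rE.
  have S0 : 0 <= \sum_(N <= m < D) cmod (dterm w m) by apply: sumr_ge0.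
  move: h1 h2; rewrite E; move: (\sum_(1 <= m < N) _) (zeta r) (\sum_(N <= m < D) _) S0 => a Z S S0 h1 h2.
  have := ler_cmodB (a + S%:C%C - Z) (a - Z); have -> : a + S%:C%C - Z - (a - Z) = S%:C%C by ring.
  by rewrite cmod_real ger0_norm //; lra.
have up : uniq (primes_below N) by rewrite filter_uniq // iota_uniq.
have pp : all prime (primes_below N) by rewrite filter_all.
have H := sieveP w1 up pp.
have d1 : usum (fun m : nat => if m == 1%N then (1 : C) else 0) 1.
  move=> e' e'0; exists [:: 1%N] => s us s1.
  have m1 : 1%N \in s by exact: s1 (mem_head _ _).
  by rewrite -big_mkcond -big_filter filter_pred1_uniq // big_seq1 subrr cmod0 ltW.
have {}H := usumD H (usumZ (-1) d1); rewrite mulN1r in H.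
apply: (usum_le H) => s us.
have term m : cmod (sieved (primes_below N) w m + -1 * (if m == 1%N then 1 else 0)) <= if (N <= m)%N then cmod (dterm w m) else 0.
  rewrite /sieved; case: eqP => [->|/eqP m1].
    rewrite leqNgt N2 /=; have -> : all (fun p => ~~ (p %| 1)%N) (primes_below N).
      by apply/allP => p; rewrite mem_filter => /andP[/prime_gt1 p1 _]; rewrite dvdn1 neq_ltn p1 orbT.
    by rewrite /zterm /= /dterm cpow1 mulr1 subrr cmod0.
  rewrite mulr0 addr0; case: ifP => [al|_]; last by rewrite cmod0; case: ifP.
  rewrite /zterm; case: (posnP m) => [m0|m0]; first by rewrite cmod0; case: ifP.
  case: (leqP N m) => // mN; exfalso.
  have m2 : (1 < m)%N by case: (m) m1 m0 => [|[]].
  have := allP al (pdiv m); rewrite pdiv_dvd => /(_ _)/negP; apply => //.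
  rewrite mem_filter pdiv_prime // mem_iota /= add0n; exact: leq_ltn_trans (pdiv_leq m0) mN.
apply: le_trans (ler_cmod_sum _ _ _) _; apply: le_trans (ler_sum _ (fun m _ => term m)) _.
pose D := (N + (\max_(m <- s) m).+1)%N.
have sub : {subset s <= iota 0 D}.
  move=> m ms; rewrite mem_iota /= add0n /D ltn_addl // ltnS; exact: (@leq_bigmax_seq _ _ xpredT id).
have g0 m : 0 <= (if (N <= m)%N then cmod (dterm w m) else 0) by case: ifP.
have := sum_subset_le g0 us (iota_uniq 0 D) sub.
have -> : \sum_(m <- iota 0 D) (if (N <= m)%N then cmod (dterm w m) else 0) = \sum_(N <= m < D) cmod (dterm w m).
  have -> : iota 0 D = index_iota 0 D by rewrite /index_iota subn0.
  rewrite (big_cat_nat (n := N)) //=; last exact: leq_addr.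
  rewrite big_nat big1 ?add0r; last by move=> m /andP[_ mN]; rewrite leqNgt mN.
  by rewrite !big_nat; apply: eq_bigr => m /andP[-> _].
have := tail D (leq_addr _ _); have : 0 <= \sum_(m <- iota 0 D | m \notin s) (if (N <= m)%N then cmod (dterm w m) else 0).
  by apply: sumr_ge0.
by lra.
Qed.

(** By [1 + x <= exp x] the left side is at most the exponential of [5 r^2 - 4 r (1 + c)^2], where
    [2 (1 + c)^2 = 3 + 4 cos + cos 2] for [c = cos]. With [r = p^(-sg)] this is the square of the
    local factor of the 3-4-1 product. *)
Lemma euler_341 (r c : R) : 0 <= r <= 1 -> -1 <= c <= 1 ->
  (1 - r) ^+ 6 * (1 + r ^+ 2 - 2 * r * c) ^+ 4 * (1 + r ^+ 2 - 2 * r * (2 * c ^+ 2 - 1)) <= expR (5 * r ^+ 2).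
Proof.
move=> /andP[r0 r1] /andP[c0 c1].
have E (x : R) : 1 + x <= expR x by exact: expR_ge1Dx.
have e1 : (1 - r) ^+ 6 <= expR (- r) ^+ 6.
  by apply: lerXn2r; rewrite ?nnegrE ?expR_ge0 ?subr_ge0 //; exact: E.
have X0 : 0 <= 1 + r ^+ 2 - 2 * r * c by nra.
have e2 : (1 + r ^+ 2 - 2 * r * c) ^+ 4 <= expR (r ^+ 2 - 2 * r * c) ^+ 4.
  by apply: lerXn2r; rewrite ?nnegrE ?expR_ge0 //; have := E (r ^+ 2 - 2 * r * c); rewrite addrA.
have c2 : c ^+ 2 <= 1 by nra.
have Y0 : 0 <= 1 + r ^+ 2 - 2 * r * (2 * c ^+ 2 - 1) by have := sqr_ge0 c; nra.
have e3 : 1 + r ^+ 2 - 2 * r * (2 * c ^+ 2 - 1) <= expR (r ^+ 2 - 2 * r * (2 * c ^+ 2 - 1)).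
  by have := E (r ^+ 2 - 2 * r * (2 * c ^+ 2 - 1)); rewrite addrA.
have p1 : 0 <= (1 - r) ^+ 6 by rewrite exprn_ge0 // subr_ge0.
have p2 : 0 <= (1 + r ^+ 2 - 2 * r * c) ^+ 4 by exact: exprn_ge0.
apply: le_trans (ler_pM (mulr_ge0 p1 p2) Y0 (ler_pM p1 p2 e1 e2) e3) _.
rewrite -!expRM_natl -!expRD ler_expR.
have : 0 <= r * (1 + c) ^+ 2 by rewrite mulr_ge0 ?sqr_ge0.
by lra.
Qed.

Definition line (sg tau : R) : C := (sg +i* tau)%C.

Lemma dterm_line sg tau m : (0 < m)%N -> dterm (line sg tau) m = (expR (- sg * ln m%:R))%:C%C * cis (- tau * ln m%:R).
Proof. by move=> m0; rewrite /dterm /cpow /cexp /= mulr0 mulr0 subr0 add0r. Qed.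

(** For large [N] each sieved product times zeta is within 1/2 of 1, hence of modulus at least 1/2;
    eight such factors give [2^-8]. By [euler_341] the square of the combined sieving products is at
    most [exp (5 sum p^-2) <= exp 10]. *)
Lemma zeta_341 (sg tau : R) : 1 < sg ->
  (2 ^+ 8)^-1 * expR (- 5) <= cmod (zeta (line sg 0)) ^+ 3 * cmod (zeta (line sg tau)) ^+ 4 * cmod (zeta (line sg (2 * tau))).
Proof.
move=> s1.
have [N1 H1] := @sieve_limit (line sg 0) 2^-1 s1 ltac:(by rewrite invr_gt0).
have [N2 H2] := @sieve_limit (line sg tau) 2^-1 s1 ltac:(by rewrite invr_gt0).
have [N3 H3] := @sieve_limit (line sg (2 * tau)) 2^-1 s1 ltac:(by rewrite invr_gt0).
pose N := maxn N1 (maxn N2 N3).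
have {}H1 := H1 N (leq_maxl _ _).
have {}H2 := H2 N (leq_trans (leq_maxl _ _) (leq_maxr _ _)).
have {}H3 := H3 N (leq_trans (leq_maxr _ _) (leq_maxr _ _)).
have half (x : C) : cmod (x - 1) <= 2^-1 -> 2^-1 <= cmod x.
  by have := ler_cmod_dist 1 (1 - x); rewrite subKr cmod1 (cmodB 1); clear; lra.
have {}H1 := half _ H1; have {}H2 := half _ H2; have {}H3 := half _ H3.
rewrite cmodM in H1; rewrite cmodM in H2; rewrite cmodM in H3.
pose Q tau := \prod_(p <- primes_below N) (1 - dterm (line sg tau) p).
rewrite -/(Q 0) in H1; rewrite -/(Q tau) in H2; rewrite -/(Q (2 * tau)) in H3.
have QQ : (cmod (Q 0) ^+ 3 * cmod (Q tau) ^+ 4 * cmod (Q (2 * tau))) <= expR 5.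
  have cprod t : cmod (Q t) = \prod_(p <- primes_below N) cmod (1 - dterm (line sg t) p).
    by rewrite /Q; elim/big_rec2: _ => [|p x y _ <-]; rewrite ?cmod1 ?cmodM.
  rewrite -(ler_pXn2r (n := 2)) ?nnegrE ?expR_ge0 ?mulr_ge0 ?exprn_ge0 // !cprod -!prodrXl -!big_split -prodrXl /=.
  apply: (@le_trans _ _ (\prod_(p <- primes_below N) expR (5 * (p%:R ^+ 2)^-1))).
    rewrite !big_seq; apply: ler_prod => p; rewrite mem_filter => /andP[/prime_gt0 p0 _].
    rewrite sqr_ge0 /=.
    pose r := expR (- sg * ln p%:R); pose c := cos (- tau * ln p%:R).
    have lp : 0 <= ln p%:R :> R by rewrite ln_ge0 // ler1n.
    have r0 : 0 <= r by exact: expR_ge0.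
    have rp : r <= p%:R^-1.
      rewrite -[leRHS]lnK ?posrE ?invr_gt0 ?ltr0n // ler_expR lnV ?posrE ?ltr0n //; move: lp s1; clear; nra.
    have r1 : r <= 1 by apply: le_trans rp _; rewrite invf_le1 ?ltr0n // ler1n.
    have sq t : cmod (1 - dterm (line sg t) p) ^+ 2 = 1 + r ^+ 2 - 2 * r * cos (- t * ln p%:R).
      rewrite cmod_sqr dterm_line // -/r; move: (- t * ln p%:R) => th.
      have -> : complex.Re (1 - r%:C%C * cis th) = 1 - r * cos th by rewrite /cis /=; ring.
      have -> : complex.Im (1 - r%:C%C * cis th) = - (r * sin th) by rewrite /cis /=; ring.
      transitivity (1 - 2 * r * cos th + r ^+ 2 * (cos th ^+ 2 + sin th ^+ 2)); first by ring.
      by rewrite cos2Dsin2; ring.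
    have -> : (cmod (1 - dterm (line sg 0) p) ^+ 3 * cmod (1 - dterm (line sg tau) p) ^+ 4 * cmod (1 - dterm (line sg (2 * tau)) p)) ^+ 2 =
       (cmod (1 - dterm (line sg 0) p) ^+ 2) ^+ 3 * (cmod (1 - dterm (line sg tau) p) ^+ 2) ^+ 4 * cmod (1 - dterm (line sg (2 * tau)) p) ^+ 2 by ring.
    rewrite !sq oppr0 mul0r cos0 -/c.
    have -> : - (2 * tau) * ln p%:R = (- tau * ln p%:R) *+ 2 by rewrite mulr2n; ring.
    rewrite cos_mulr2n -/c.
    have c01 : -1 <= c <= 1 by rewrite cos_geN1 cos_le1.
    have -> : (1 + r ^+ 2 - 2 * r * 1) ^+ 3 = (1 - r) ^+ 6 by ring.
    have -> : c ^+ 2 *+ 2 - 1 = 2 * c ^+ 2 - 1 by rewrite mulr_natl.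
    apply: le_trans (euler_341 (r := r) _ c01) _; first by rewrite r0.
    by rewrite ler_expR ler_pM2l // -exprVn; apply: lerXn2r; rewrite ?nnegrE ?invr_ge0.
  rewrite -expR_sum -expRM_natl ler_expR -mulr_sumr.
  have : \sum_(p <- primes_below N) (p%:R ^+ 2)^-1 <= 2 :> R; last by clear; lra.
  apply: (@le_trans _ _ (\sum_(1 <= m < N) (m%:R ^+ 2)^-1)); last by have := @sum_inv_sqr R 1 N isT; rewrite divr1.
  rewrite big_filter /index_iota; case: N {H1 H2 H3 Q cprod} => [|N']; first by rewrite !big_nil.
  by rewrite /= big_cons /= subn1 /= big_mkcond /=; apply: ler_sum => m _; case: ifP => // _; rewrite invr_ge0 sqr_ge0.
have Qp : 0 <= cmod (Q 0) ^+ 3 * cmod (Q tau) ^+ 4 * cmod (Q (2 * tau)) by rewrite !mulr_ge0 ?exprn_ge0.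
set z0 := cmod (zeta _); set z1 := cmod (zeta (line sg tau)); set z2 := cmod (zeta (line sg (2 * tau))).
have z00 : 0 <= z0 := cmod_ge0 _.
have z10 : 0 <= z1 := cmod_ge0 _.
have z20 : 0 <= z2 := cmod_ge0 _.
have big : (2 ^+ 8)^-1 <= (cmod (Q 0) ^+ 3 * cmod (Q tau) ^+ 4 * cmod (Q (2 * tau))) * (z0 ^+ 3 * z1 ^+ 4 * z2).
  have -> : (cmod (Q 0) ^+ 3 * cmod (Q tau) ^+ 4 * cmod (Q (2 * tau))) * (z0 ^+ 3 * z1 ^+ 4 * z2) =
    (cmod (Q 0) * z0) ^+ 3 * (cmod (Q tau) * z1) ^+ 4 * (cmod (Q (2 * tau)) * z2) by ring.
  have -> : (2 ^+ 8)^-1 = 2^-1 ^+ 3 * 2^-1 ^+ 4 * 2^-1 :> R by rewrite -!exprVn -exprD -exprSr.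
  have h2 : 0 <= 2^-1 :> R by [].
  have a3 : 2^-1 ^+ 3 <= (cmod (Q 0) * z0) ^+ 3.
    by apply: lerXn2r; [rewrite nnegrE|rewrite nnegrE; exact: mulr_ge0 (cmod_ge0 _) z00|exact: H1].
  have a4 : 2^-1 ^+ 4 <= (cmod (Q tau) * z1) ^+ 4.
    by apply: lerXn2r; [rewrite nnegrE|rewrite nnegrE; exact: mulr_ge0 (cmod_ge0 _) z10|exact: H2].
  exact: ler_pM (mulr_ge0 (exprn_ge0 3 h2) (exprn_ge0 4 h2)) h2 (ler_pM (exprn_ge0 3 h2) (exprn_ge0 4 h2) a3 a4) H3.
have zz : 0 <= z0 ^+ 3 * z1 ^+ 4 * z2 := mulr_ge0 (mulr_ge0 (exprn_ge0 3 z00) (exprn_ge0 4 z10)) z20.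
rewrite expRN ler_pdivrMr ?expR_gt0 // mulrC; apply: le_trans big _.
by apply: ler_wpM2r.
Qed.
End Zeta.

(** * Lower bound for zeta near the line Re w = 1 *)

Section ZetaLowerBound.
Variable R : realType.
Local Notation C := (R[i]).

Definition loglen (tau : R) : R := 1 + ln (1 + `|tau|).

Lemma loglen_ge1 tau : 1 <= loglen tau.
Proof. by rewrite /loglen lerDl ln_ge0 // lerDl. Qed.

Lemma ln_le_sub1 (x : R) : 0 < x -> ln x <= x - 1.
Proof.
move=> x0; have := @le_ln1Dx R (x - 1); rewrite (addrC 1) subrK; apply.
by move: x0; lra.
Qed.

Lemma ln_le_id (x : R) : 0 < x -> ln x <= x.
Proof. by move=> x0; apply: le_trans (ln_le_sub1 x0) _; lra. Qed.

Lemma cmod_line_le (sg tau : R) : cmod (line sg tau) <= `|sg| + `|tau|.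
Proof. exact: ler_cmod_ReIm. Qed.

Lemma line_sub1 (d tau : R) : line (1 + d) tau - 1 = line d tau.
Proof. by apply/eqP; rewrite eq_complex /=; apply/andP; split; apply/eqP; ring. Qed.

Lemma expR_diff (d d1 L : R) : 0 <= d <= d1 -> 0 <= L -> `|expR (- d1 * L) - expR (- d * L)| <= d1 * L.
Proof.
move=> /andP[d0 dd] L0.
have h1 : expR (- d1 * L) <= expR (- d * L) by rewrite ler_expR; nra.
rewrite ler0_norm ?subr_le0 // opprB.
have h2 : expR (- d * L) <= 1 by rewrite -[leRHS]expR0 ler_expR; nra.
have := expR_ge1Dx (- d1 * L); lra.
Qed.

(* The dependence on the real part, for a Dirichlet polynomial together with its Euler-Maclaurin term. *)
Lemma main_part_diff (d d1 tau eta : R) (M : nat) : 0 < d -> d <= d1 -> d1 <= 1 -> 0 < eta <= 1 -> eta <= `|tau| -> (1 < M)%N ->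
  cmod ((\sum_(1 <= m < M) dterm (line (1 + d1) tau) m + dterm (line d1 tau) M / line d1 tau) -
        (\sum_(1 <= m < M) dterm (line (1 + d) tau) m + dterm (line d tau) M / line d tau)) <=
  d1 * (2 * ln (1 + M%:R) * ln M%:R + ln M%:R / eta + (eta ^+ 2)^-1).
Proof.
move=> d0 dd d11 /andP[eta0 eta1] teta M1; have M0 := ltnW M1.
have d10 : 0 < d1 by exact: lt_le_trans dd.
have dd' : 0 <= d <= d1 by rewrite ltW.
set LM := ln M%:R.
have LM0 : 0 <= LM by rewrite ln_ge0 // ler1n.
have dl (x y : R) m : (0 < m)%N -> dterm (line x tau) m - dterm (line y tau) m =
    (expR (- x * ln m%:R) - expR (- y * ln m%:R))%:C%C * cis (- tau * ln m%:R).
  by move=> m0; rewrite !dterm_line // rmorphB /= mulrBl.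
have S : cmod (\sum_(1 <= m < M) dterm (line (1 + d1) tau) m - \sum_(1 <= m < M) dterm (line (1 + d) tau) m) <= d1 * (2 * ln (1 + M%:R) * LM).
  rewrite -sumrB; apply: le_trans (ler_cmod_sum _ _ _) _.
  apply: (@le_trans _ _ (\sum_(1 <= m < M) d1 * LM * m%:R^-1)); last first.
    rewrite -mulr_sumr -!mulrA ler_pM2l // mulrC mulrA; apply: ler_wpM2r => //; exact: sum_inv_le.
  rewrite !big_nat; apply: ler_sum => m /andP[m1 mM].
  have m0 : 0 < m%:R :> R by rewrite ltr0n.
  have lm0 : 0 <= ln m%:R :> R by rewrite ln_ge0 // ler1n.
  rewrite dl // cmodM cmod_cis mulr1 cmod_real.
  have -> : expR (- (1 + d1) * ln m%:R) - expR (- (1 + d) * ln m%:R) = m%:R^-1 * (expR (- d1 * ln m%:R) - expR (- d * ln m%:R)).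
    have E (x : R) : expR (- (1 + x) * ln m%:R) = m%:R^-1 * expR (- x * ln m%:R).
      by rewrite mulNr mulrDl mul1r opprD expRD expRN lnK ?posrE // mulNr.
    by rewrite !E mulrBr.
  rewrite normrM (gtr0_norm (x := m%:R^-1)) ?invr_gt0 // mulrC; apply: ler_wpM2r; first by rewrite invr_ge0 ltW.
  apply: le_trans (expR_diff dd' lm0) _; rewrite ler_pM2l // ler_ln ?posrE ?ltr0n // ler_nat; exact: ltnW.
have lt (x : R) : eta <= cmod (line x tau) by apply: le_trans teta _; exact: (ler_Im_cmod (line x tau)).
have ltn0 x : line x tau != 0 by rewrite -cmod_gt0; exact: lt_le_trans (lt x).
have iv (x : R) : cmod ((line x tau)^-1) <= eta^-1 by rewrite cmodV lef_pV2 ?posrE ?(lt_le_trans eta0).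
set p1 := dterm (line d1 tau) M; set p := dterm (line d tau) M.
have pp : cmod (p1 - p) <= d1 * LM by rewrite /p1 /p dl // cmodM cmod_cis mulr1 cmod_real; exact: expR_diff.
have p_1 : cmod p <= 1.
  by rewrite /p dterm_line // cmodM cmod_cis mulr1 cmod_real gtr0_norm ?expR_gt0 // -[leRHS]expR0 ler_expR; have := mulr_ge0 (ltW d0) LM0; rewrite /LM; lra.
have T : cmod (p1 / line d1 tau - p / line d tau) <= d1 * (LM / eta + (eta ^+ 2)^-1).
  have -> : p1 / line d1 tau - p / line d tau = (p1 - p) / line d1 tau + p * ((d - d1)%:C%C / (line d1 tau * line d tau)).
    have -> : (d - d1)%:C%C = line d tau - line d1 tau :> C.
      by apply/eqP; rewrite eq_complex /=; apply/andP; split; apply/eqP; ring.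
    by field; rewrite !ltn0.
  apply: le_trans (ler_cmodD _ _) _; rewrite mulrDr; apply: lerD.
    by rewrite cmodM mulrA; apply: ler_pM.
  rewrite cmodM -[leRHS]mul1r; apply: ler_pM => //.
  rewrite (cmodM (d - d1)%:C%C) cmod_real cmodV cmodM; apply: ler_pM => //; first by rewrite invr_ge0 mulr_ge0.
    by rewrite ler0_norm; lra.
  rewrite lef_pV2 ?posrE ?exprn_gt0 ?mulr_gt0 ?(lt_le_trans eta0) // expr2.
  by apply: ler_pM => //; exact: ltW.
move: S T; rewrite -/LM -/p1 -/p.
set s1 := \sum_(1 <= m < M) _; set s := \sum_(1 <= m < M) _; set q1 := p1 / _; set q := p / _ => S T.
have -> : s1 + q1 - (s + q) = (s1 - s) + (q1 - q) by ring.
apply: le_trans (ler_cmodD _ _) _; move: S T; lra.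
Qed.

(** So close to 1 the pole term dominates: cutting at 12, which is at least [4 (1 + |w|)], it is at
    least [1 / (2 |w - 1|)], that is at least 50, against 11 for the partial sum and 9 for the
    error. *)
Lemma zeta_near_pole (d tau : R) : 0 < d -> d <= 1 / 400 -> `|tau| <= 1 / 200 ->
  (1 + (cmod (line d tau))^-1) / 8 <= cmod (zeta (line (1 + d) tau)).
Proof.
move=> d0 d1 t1; pose w := line (1 + d) tau.
have w1 : 1 < complex.Re w by rewrite /= ltrDl.
have cw : cmod w <= 2 by apply: le_trans (cmod_line_le _ _) _; rewrite ger0_norm; lra.
have MT : 4 * (1 + cmod w) <= 12%:R by lra.
have := zeta_tail w1 MT; rewrite /w line_sub1 -/w.
set u := line d tau.
have u0 : 0 < cmod u by rewrite cmod_gt0; apply/eqP => /(congr1 (@complex.Re R)) /= E; move: d0; rewrite E ltxx.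
have uu : cmod u <= 1 / 100 by apply: le_trans (cmod_line_le _ _) _; rewrite ger0_norm; lra.
have S : cmod (\sum_(1 <= m < 12) dterm w m) <= 11.
  apply: le_trans (ler_cmod_sum _ _ _) _; apply: (@le_trans _ _ (\sum_(1 <= m < 12) 1)); last by rewrite sumr_const_nat.
  rewrite !big_nat; apply: ler_sum => m /andP[m1 _]; apply: le_trans (cmod_dterm_le (ltW w1) m1) _.
  by rewrite invf_le1 ?ltr0n // ler1n.
have D : 2^-1 <= cmod (dterm u 12).
  rewrite /u dterm_line // cmodM cmod_cis mulr1 cmod_real gtr0_norm ?expR_gt0 //.
  have l12 : ln 12%:R <= 12%:R :> R by apply: ln_le_id; rewrite ltr0n.
  have := expR_ge1Dx (- d * ln 12%:R).
  have : d * ln 12%:R <= 1 / 400 * 12%:R by apply: ler_pM => //; [exact: ltW|rewrite ln_ge0 // ler1n].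
  lra.
have DU : 2^-1 * (cmod u)^-1 <= cmod (dterm u 12 / u) by rewrite cmodM cmodV ler_wpM2r // invr_ge0.
have iu : 100 <= (cmod u)^-1 by rewrite -[leLHS]invrK lef_pV2 ?posrE ?invr_gt0 //; lra.
have e9 : 36 * (1 + cmod w) / 12%:R <= 9 by lra.
move: S DU; set a := \sum_(1 <= m < 12) _; set b := dterm u 12 / u => S DU H.
have := ler_cmodD (b - (zeta w - (a + b)) * 0 + (zeta w - (a + b))) (- a - b) => _.
have := ler_cmodB (zeta w - (zeta w - (a + b))) a.
have -> : zeta w - (zeta w - (a + b)) - a = b by ring.
have := ler_cmodB (zeta w) (zeta w - (a + b)).
move: H S DU e9 iu; rewrite -/w; move: ((cmod u)^-1) (cmod b) (36 * _ / _) => iu cb ee; lra.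
Qed.

Lemma loglen_sub1 tau : loglen tau - 1 = ln (1 + `|tau|).
Proof. by rewrite /loglen addrC addKr. Qed.

Lemma zeta_real_le (d : R) : 0 < d -> d <= 1 -> cmod (zeta (line (1 + d) 0)) <= 43 / d.
Proof.
move=> d0 d1; have w1 : 1 < complex.Re (line (1 + d) 0) by rewrite /= ltrDl.
apply: le_trans (zeta_le w1) _; rewrite /zbound line_sub1.
have -> : cmod (line d 0) = d by rewrite -[line d 0]/(d%:C%C) cmod_real gtr0_norm.
have c2 : cmod (line (1 + d) 0) <= 2 by apply: le_trans (cmod_line_le _ _) _; rewrite normr0 ger0_norm; lra.
have c2' := cmod_ge0 (line (1 + d) 0).
have l16 : ln (8 + 4 * cmod (line (1 + d) 0)) <= 16 by apply: le_trans (ln_le_id _) _; lra.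
have i1 : 1 <= d^-1 by rewrite -[leLHS]invr1 lef_pV2 ?posrE.
lra.
Qed.

Lemma zeta_line_le (d tau : R) : 0 < d -> d <= 1 -> 1 / 200 <= `|tau| ->
  cmod (zeta (line (1 + d) (2 * tau))) <= (400 + 9 + 2 * (ln 24 + 1)) * loglen tau.
Proof.
move=> d0 d1 tb; have w1 : 1 < complex.Re (line (1 + d) (2 * tau)) by rewrite /= ltrDl.
have l1 := loglen_ge1 tau; have l24 : 0 <= ln 24 :> R by rewrite ln_ge0 // ler1n.
apply: le_trans (zeta_le w1) _; rewrite /zbound line_sub1.
have h1 : 1 / 200 <= cmod (line d (2 * tau)).
  apply: le_trans (ler_Im_cmod (line d (2 * tau))); rewrite /= normrM ger0_norm //.
  by apply: le_trans tb _; rewrite ler_peMl // ler1n.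
have h1' : 0 < cmod (line d (2 * tau)) by apply: lt_le_trans h1; lra.
have h2 : 2 / cmod (line d (2 * tau)) <= 400.
  by rewrite ler_pdivrMr //; move: h1; clear; lra.
have c2 : cmod (line (1 + d) (2 * tau)) <= 2 + 2 * `|tau|.
  apply: le_trans (cmod_line_le _ _) _.
  rewrite normrM (ger0_norm (ler0n _ 2)) (ger0_norm (x := 1 + d)) ?addr_ge0 ?(ltW d0) // lerD2r; move: d1; clear; lra.
have c2' := cmod_ge0 (line (1 + d) (2 * tau)).
have h3 : ln (8 + 4 * cmod (line (1 + d) (2 * tau))) <= ln 24 + (loglen tau - 1).
  have t1 : 0 < 1 + `|tau| by rewrite ltr_pwDl.
  have t2 : 0 < 8 + 4 * cmod (line (1 + d) (2 * tau)) by rewrite ltr_pwDl // mulr_ge0.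
  rewrite loglen_sub1 -lnM ?posrE // ler_ln ?posrE // ?mulr_gt0 //.
  by move: c2 (normr_ge0 tau); clear; lra.
have ll : ln 24 <= ln 24 * loglen tau by rewrite ler_peMr.
by move: h2 h3 ll l1; move: (2 / _) (ln (8 + _)) (ln 24) (loglen tau) => a1 a2 a3 a4; clear; lra.
Qed.

Lemma ln_scale_le (b tau : R) : 144 <= b ->
  ln (3 * (b ^+ 16 * (4 + `|tau|) * loglen tau ^+ 7)) <= 40 * (b * loglen tau).
Proof.
move=> b144; set l := loglen tau; have l1 : 1 <= l := loglen_ge1 tau.
have b0 : 0 < b by lra.
have l0 : 0 < l by lra.
have t1 : 0 < 1 + `|tau| by rewrite ltr_pwDl.
have T0 : 0 < 4 + `|tau| by rewrite ltr_pwDl.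
have B0 : 0 < b ^+ 16 by rewrite exprn_gt0.
have L0 : 0 < l ^+ 7 by rewrite exprn_gt0.
have BT : 0 < b ^+ 16 * (4 + `|tau|) by rewrite mulr_gt0.
have BTL : 0 < b ^+ 16 * (4 + `|tau|) * l ^+ 7 by rewrite mulr_gt0.
rewrite (@lnM _ 3) ?posrE // (@lnM _ (b ^+ 16 * (4 + `|tau|))) ?posrE // (@lnM _ (b ^+ 16)) ?posrE //.
rewrite (@lnXn _ 16) // (@lnXn _ 7) // -(mulr_natl (ln b)) -(mulr_natl (ln l)).
have h3 : ln 3 <= 3 :> R by exact: ln_le_id.
have h4 : ln 4 <= 4 :> R by exact: ln_le_id.
have hb : ln b <= b by exact: ln_le_id.
have hl : ln l <= l by exact: ln_le_id.
have hT : ln (4 + `|tau|) <= ln 4 + (l - 1).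
  rewrite /l loglen_sub1 -lnM ?posrE // ler_ln ?posrE // ?mulr_gt0 //.
  by move: (normr_ge0 tau); clear; lra.
have bl : b <= b * l by rewrite ler_peMr // ltW.
have bl' : 144 * l <= b * l by rewrite ler_pM2r.
move: h3 h4 hb hl hT bl bl' b144 l1; move: (ln 3) (ln 4) (ln b) (ln l) (ln (4 + _)) (b * l) => x3 x4 xb xl xT v.
by clear; lra.
Qed.

(** Near the pole see [zeta_near_pole]. Elsewhere, with [l = loglen tau], the 3-4-1 inequality at
    distance [d1 = (b l)^-9] from the line gives [|zeta| >= 4 Kd (b l)^-7], while passing from [d1]
    to a smaller [d] changes zeta by [Kd (b l)^2 d1 = Kd (b l)^-7] and a truncation error: the
    exponents 7 and 9 balance the two. The factor [1 + 1 / |line d tau|] on the left will absorb the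
    pole term of the lattice sums. *)
Lemma zeta_lower : exists2 c : R, 0 < c & forall tau : R, exists2 d0 : R, 0 < d0 & forall d, 0 < d -> d < d0 ->
  c * (1 + (cmod (line d tau))^-1) <= loglen tau ^+ 7 * cmod (zeta (line (1 + d) tau)).
Proof.
pose eta : R := 1 / 200.
have eta0 : 0 < eta by rewrite /eta; lra.
pose c0 : R := (2 ^+ 8)^-1 * expR (- 5).
have c00 : 0 < c0 by rewrite mulr_gt0 ?expR_gt0 ?invr_gt0 ?exprn_gt0.
(* [Ka] bounds zeta(1+d1) by Ka/d1, [Kb] bounds zeta(1+d1+2i tau) by Kb*l, and [Kd*b^2*l^2] is the Lipschitz constant. *)
pose Ka : R := 43.
pose Kb : R := 400 + 9 + 2 * (ln 24 + 1).
pose Kd : R := 2 * 40 * 40 + 40 * 200 + 200 ^+ 2.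
have l24 : 0 <= ln 24 :> R by rewrite ln_ge0 // ler1n.
have Ka0 : 0 < Ka by rewrite /Ka; lra.
have Kb0 : 0 < Kb by rewrite /Kb; lra.
have Kd0 : 0 < Kd by rewrite /Kd; lra.
pose c1 : R := c0 / (Ka ^+ 3 * Kb).
have c10 : 0 < c1 by rewrite divr_gt0 // mulr_gt0 // exprn_gt0.
(* Then [c1 b >= (4 Kd)^4], which gives the lower bound at [d1] a factor 4 over the Lipschitz term;
   144 keeps the truncation errors small. *)
pose b : R := Num.max (256 * Kd ^+ 4 / c1) 144.
have b144 : 144 <= b by rewrite le_max lexx orbT.
have b1 : 1 <= b by lra.
have b0 : 0 < b by lra.
have bK : 256 * Kd ^+ 4 <= c1 * b by rewrite [leRHS]mulrC -ler_pdivrMr // le_max lexx.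
pose c : R := 2 * Kd / b ^+ 7.
have cc0 : 0 < c by rewrite divr_gt0 ?exprn_gt0 // mulr_gt0.
exists (Num.min (8^-1) (c / 201)); first by rewrite lt_min; apply/andP; split; [rewrite invr_gt0|rewrite divr_gt0].
move=> tau; set l := loglen tau.
have l1 : 1 <= l := loglen_ge1 tau.
have l0 : 0 < l by lra.
case: (leP `|tau| eta) => [ts|tb].
  exists (1 / 400) => [|d d0 d1]; first by lra.
  apply: le_trans (_ : 8^-1 * (1 + (cmod (line d tau))^-1) <= _).
    by apply: ler_wpM2r; rewrite ?addr_ge0 ?invr_ge0 // ge_min lexx.
  rewrite mulrC; apply: le_trans (zeta_near_pole d0 (ltW d1) ts) _.
  by rewrite ler_peMl // exprn_ege1.
pose d1 : R := (b ^+ 9 * l ^+ 9)^-1.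
have bl0 : 0 < b ^+ 9 * l ^+ 9 by rewrite mulr_gt0 // exprn_gt0.
have d10 : 0 < d1 by rewrite invr_gt0.
have d11 : d1 <= 1 by rewrite invf_le1 // mulr_ege1 // exprn_ege1.
exists d1 => // d d0 dd1.
pose T : R := 4 + `|tau|.
have T4 : 4 <= T by rewrite /T lerDl.
(* Cutting at [M] just above [X] leaves an error [36 / (b^16 l^7)], smaller than the main terms
   [(b l)^-7], while [ln M] remains at most [40 b l]. *)
pose X : R := b ^+ 16 * T * l ^+ 7.
have b16 : 144 <= b ^+ 16 by apply: le_trans b144 _; rewrite -[leLHS]expr1 ler_weXn2l.
have l7 : 1 <= l ^+ 7 by rewrite exprn_ege1.
have bT : 0 < b ^+ 16 * T by rewrite mulr_gt0 ?exprn_gt0 //; lra.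
have X144 : 144 * T <= X.
  rewrite /X; apply: le_trans (_ : b ^+ 16 * T <= _); last by rewrite ler_peMr // ltW.
  by rewrite ler_wpM2r //; lra.
have X0 : 0 <= X by lra.
pose M := (Num.truncn X).+1.
have /andP[MX XM] : M.-1%:R <= X < M%:R := truncn_itv X0.
have MX1 : M%:R <= 2 * X by rewrite -[leLHS]/((M.-1).+1%:R) -[leLHS]natr1; move: X144 MX T4; clear; lra.
have M1 : (1 < M)%N by rewrite -(ltr_nat R); move: X144 XM T4; clear; lra.
have cw (x : R) : 0 < x -> x <= 1 -> 1 + cmod (line (1 + x) tau) <= T.
  by move=> x0 x1; have := cmod_line_le (1 + x) tau; rewrite ger0_norm /T; move: x0 x1; clear; lra.
have tail (x : R) : 0 < x -> x <= 1 -> cmod (zeta (line (1 + x) tau) -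
    (\sum_(1 <= m < M) dterm (line (1 + x) tau) m + dterm (line x tau) M / line x tau)) <= 36 / (b ^+ 16 * l ^+ 7).
  move=> x0 x1; have := cw x x0 x1 => cwx.
  have w1 : 1 < complex.Re (line (1 + x) tau) by rewrite /= ltrDl.
  have := zeta_tail (M := M) w1 ltac:(move: cwx X144 XM T4; clear; lra); rewrite line_sub1 => H; apply: le_trans H _.
  rewrite ler_pdivrMr ?ltr0n ?(ltnW M1) // mulrAC ler_pdivlMr ?mulr_gt0 ?exprn_gt0 // -mulrA ler_pM2l //.
  apply: le_trans (_ : T * (b ^+ 16 * l ^+ 7) <= _); first by rewrite ler_wpM2r // mulr_ge0 // exprn_ge0 // ltW.
  have -> : T * (b ^+ 16 * l ^+ 7) = X by rewrite /X; ring.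
  exact: ltW.
have lnM : ln (1 + M%:R) <= 40 * (b * l).
  apply: (@le_trans _ _ (ln (3 * X))).
    by rewrite ler_ln ?posrE; [move: MX1 X144 T4; clear; lra|rewrite ltr_pwDl|move: X144 T4; clear; lra].
  exact: ln_scale_le.
have lnM' : ln M%:R <= 40 * (b * l).
  by apply: le_trans lnM; rewrite ler_ln ?posrE ?ltr0n ?(ltnW M1) // ?ltr_pwDl // lerDr.
have lM0 : 0 <= ln M%:R :> R by rewrite ln_ge0 // ler1n; exact: ltnW M1.
have lM10 : 0 <= ln (1 + M%:R) :> R by rewrite ln_ge0 // lerDl.
have blp : 1 <= b * l by rewrite mulr_ege1.
have e01 : 0 < eta <= 1 by rewrite eta0 /eta; clear; lra.
have diff := main_part_diff d0 (ltW dd1) d11 e01 (ltW tb) M1.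
have diffK : cmod (zeta (line (1 + d1) tau) - zeta (line (1 + d) tau)) <= d1 * (Kd * (b * l) ^+ 2) + 72 / (b ^+ 16 * l ^+ 7).
  have t1 := tail d1 d10 d11; have t2 := tail d d0 (le_trans (ltW dd1) d11).
  have dd : d1 * (2 * ln (1 + M%:R) * ln M%:R + ln M%:R / eta + (eta ^+ 2)^-1) <= d1 * (Kd * (b * l) ^+ 2).
    rewrite ler_pM2l //.
    have ie : eta^-1 = 200 by rewrite /eta div1r invrK.
    rewrite -exprVn ie.
    have q1 : ln (1 + M%:R) * ln M%:R <= (40 * (b * l)) * (40 * (b * l)) by apply: ler_pM.
    have q2 : b * l <= (b * l) ^+ 2 by rewrite expr2 ler_peMr // (le_trans _ blp).
    have q3 : 1 <= (b * l) ^+ 2 by rewrite exprn_ege1.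
    rewrite /Kd; move: q1 q2 q3 lnM'; move: (b * l) (ln (1 + M%:R)) (ln M%:R) => v x1 x2; clear; lra.
  move: t1 t2 (le_trans diff dd).
  set z1 := zeta _; set z2 := zeta _; set m1 := _ + _ / line d1 tau; set m2 := _ + _ / line d tau => t1 t2 t3.
  have -> : z1 - z2 = (z1 - m1) - (z2 - m2) + (m1 - m2) by ring.
  have := ler_cmodD ((z1 - m1) - (z2 - m2)) (m1 - m2); have := ler_cmodB (z1 - m1) (z2 - m2).
  move: t1 t2 t3; set e36 := 36 / _; have -> : 72 / (b ^+ 16 * l ^+ 7) = e36 + e36 by rewrite /e36 -mulrDl; congr (_ / _); clear; lra.
  clear; lra.
have zd := zeta_341 tau (ltac:(rewrite ltrDl; exact: d10) : 1 < 1 + d1).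
have z0b : cmod (zeta (line (1 + d1) 0)) <= Ka / d1 := zeta_real_le d10 d11.
have z2b : cmod (zeta (line (1 + d1) (2 * tau))) <= Kb * l := zeta_line_le d10 d11 (ltW tb).
set Z := cmod (zeta (line (1 + d1) tau)) in zd *.
have Z0 : 0 <= Z := cmod_ge0 _.
have main : (4 * Kd) ^+ 4 <= (Z * l ^+ 7 * b ^+ 7) ^+ 4.
  have h : c0 <= (Ka / d1) ^+ 3 * Z ^+ 4 * (Kb * l).
    apply: le_trans zd _; apply: ler_pM; [by apply: mulr_ge0; exact: exprn_ge0|exact: cmod_ge0| |exact: z2b].
    by apply: ler_wpM2r; [exact: exprn_ge0|apply: lerXn2r; rewrite ?nnegrE // divr_ge0 ?ltW].
  have h' : c1 <= (b ^+ 9 * l ^+ 9) ^+ 3 * Z ^+ 4 * l.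
    rewrite /c1 ler_pdivrMr ?mulr_gt0 ?exprn_gt0 //; apply: le_trans h _.
    by rewrite /d1 invrK le_eqVlt; apply/orP; left; apply/eqP; ring.
  have -> : (Z * l ^+ 7 * b ^+ 7) ^+ 4 = ((b ^+ 9 * l ^+ 9) ^+ 3 * Z ^+ 4 * l) * b by ring.
  have -> : (4 * Kd) ^+ 4 = 256 * Kd ^+ 4 by ring.
  by apply: le_trans bK _; rewrite ler_pM2r.
have main' : 4 * Kd <= Z * l ^+ 7 * b ^+ 7.
  have n1 : 0 <= 4 * Kd by apply: mulr_ge0 => //; exact: ltW.
  have n2 : 0 <= Z * l ^+ 7 * b ^+ 7 by apply: mulr_ge0 (mulr_ge0 Z0 (exprn_ge0 7 (ltW l0))) (exprn_ge0 7 (ltW b0)).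
  by move: main; rewrite ler_pXn2r.
have zz : Z - (d1 * (Kd * (b * l) ^+ 2) + 72 / (b ^+ 16 * l ^+ 7)) <= cmod (zeta (line (1 + d) tau)).
  have := ler_cmod_dist (zeta (line (1 + d1) tau)) (zeta (line (1 + d1) tau) - zeta (line (1 + d) tau)).
  by rewrite subKr -/Z; move: diffK; clear; lra.
have fin : c <= l ^+ 7 * cmod (zeta (line (1 + d) tau)).
  apply: le_trans (ler_wpM2l (exprn_ge0 7 (ltW l0)) zz).
  rewrite /c ler_pdivrMr ?exprn_gt0 //.
  have b7 : 0 < b ^+ 7 by rewrite exprn_gt0.
  have l70 : 0 < l ^+ 7 by rewrite exprn_gt0.
  have -> : l ^+ 7 * (Z - (d1 * (Kd * (b * l) ^+ 2) + 72 / (b ^+ 16 * l ^+ 7))) * b ^+ 7 =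
     Z * l ^+ 7 * b ^+ 7 - Kd - 72 / b ^+ 9.
    by rewrite /d1; field; rewrite !gt_eqF.
  have : 72 / b ^+ 9 <= 1.
    rewrite ler_pdivrMr ?exprn_gt0 // mul1r; apply: le_trans (_ : b <= _); first by move: b144; clear; lra.
    by rewrite -[leLHS]expr1 ler_weXn2l.
  have : 1 <= Kd by rewrite /Kd; clear; lra.
  by move: main'; clear; lra.
apply: le_trans (_ : c / 201 * 201 <= _); last by rewrite divfK.
have h1 : eta <= cmod (line d tau) by apply: le_trans (ltW tb) _; exact: (ler_Im_cmod (line d tau)).
have h2 : (cmod (line d tau))^-1 <= eta^-1 by rewrite lef_pV2 ?posrE ?(lt_le_trans eta0).
have h3 : eta^-1 = 200 by rewrite /eta div1r invrK.
have m0 : 0 <= Num.min (8^-1) (c / 201).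
  by rewrite le_min; apply/andP; split; [rewrite invr_ge0|apply: divr_ge0 => //; exact: ltW].
have m1 : Num.min (8^-1) (c / 201) <= c / 201 by rewrite ge_min lexx orbT.
have p0 : 0 <= 1 + (cmod (line d tau))^-1 by rewrite addr_ge0 // invr_ge0.
have p1 : 1 + (cmod (line d tau))^-1 <= 201 by move: h2; rewrite h3; clear; lra.
exact: ler_pM.
Qed.
End ZetaLowerBound.

(** * Absolute convergence and reduction of plane lattices *)

Section LatticeFamilies.
Variable R : realType.
Local Notation C := (R[i]).

Definition boxseq (P Q : nat) : seq (int * int) :=
  [seq (- P%:Z + i%:Z, - Q%:Z + l%:Z) | i <- iota 0 (P + P), l <- iota 0 (Q + Q)].

Lemma sbox_seq (V : zmodType) (F : int -> int -> V) P Q : sbox F P Q = \sum_(x <- boxseq P Q) F x.1 x.2.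
Proof.
rewrite /boxseq big_allpairs_dep /sbox boxE -(big_mkord xpredT (fun i => \sum_(l < Q + Q) F (- P%:Z + i%:Z) (- Q%:Z + l%:Z))).
rewrite /index_iota subn0; apply: eq_bigr => i _.
by rewrite -(big_mkord xpredT (fun l => F (- P%:Z + i%:Z) (- Q%:Z + l%:Z))) /index_iota subn0.
Qed.

Lemma boxseq_uniq P Q : uniq (boxseq P Q).
Proof.
apply: allpairs_uniq; rewrite ?iota_uniq // => -[i l] [i' l'] _ _ /= [] h1 h2.
by congr pair; lia.
Qed.

Lemma mem_boxseq P Q (x : int * int) : (absz x.1 < P)%N -> (absz x.2 < Q)%N -> x \in boxseq P Q.
Proof.
case: x => c d /= cP dQ; apply/allpairsP; exists (absz (c + P%:Z), absz (d + Q%:Z)) => /=.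
by split; rewrite ?mem_iota /=; [lia|lia|congr pair; lia].
Qed.

Section ReducedSum.
Variables (z : C) (Y : nat).
Hypotheses (zx : `|complex.Re z| <= 2^-1) (zy : 4 / 5 <= complex.Im z).
Hypotheses (yY : complex.Im z <= Y%:R) (Yy : Y%:R <= 9 / 4 * complex.Im z).
Variables (n : int) (s : C).
Hypothesis s1 : 1 < complex.Re s.

Let Y0 : (0 < Y)%N.
Proof. by rewrite -(ltr_nat R) (lt_le_trans (im_gt0 zy)). Qed.

Definition lterm (x : int * int) : C := phi0 n s (lpt z x.1 x.2).

(** For [Re s > 1] the absolute sums over dyadic shells decrease geometrically with ratio
    [rho = 2^(2 - 2 Re s) < 1], and every finite set of pairs lies in a dyadic box. *)
Lemma lterm_bounded : exists B, abs_bounded lterm B.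
Proof.
pose g c d := cmod (phi0 n s (lpt z c d)).
have s0 : 0 <= complex.Re s by apply: ltW; apply: lt_trans s1.
pose rho : R := expR ((2 - 2 * complex.Re s) * ln 2).
have l2 : 0 < ln 2 :> R by rewrite ln_gt0 // ltr1n.
have rho1 : rho < 1.
  rewrite -[ltRHS]expR0 ltr_expR; have := mulr_gt0 l2 (ltac:(rewrite subr_gt0; exact: s1) : 0 < complex.Re s - 1).
  by lra.
have rho0 : 0 < rho by exact: expR_gt0.
pose E := 12 * Y%:R * wpow (complex.Re s) (scale R Y 0).
have E0 : 0 <= E by rewrite mulr_ge0 ?expR_ge0 // mulr_ge0.
have shell k : sbox g (2 ^ k.+1) (2 ^ k.+1 * Y) - sbox g (2 ^ k) (2 ^ k * Y) <= E * rho ^+ k.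
  have p0 : (0 < 2 ^ k)%N by rewrite expn_gt0.
  rewrite expnS mul2n -addnn mulnDl.
  have sk := scale_pos zy yY k.
  apply: le_trans (@annulus_le R g (2 ^ k) (2 ^ k * Y) (wpow (complex.Re s) (scale R Y k)) p0 _ _) _.
  - by rewrite muln_gt0 p0.
  - by move=> c d o; apply: cmod_phi0_le => //; exact: lpt_ge o.
  have -> : wpow (complex.Re s) (scale R Y k) = wpow (complex.Re s) (scale R Y 0) * expR (- 2 * complex.Re s * (k%:R * ln 2)).
    rewrite /wpow -expRD; congr expR; rewrite -mulrDr; congr (_ * _).
    rewrite mulr_natl -lnXn // -lnM ?posrE ?exprn_gt0 //; last exact: scale_pos zy yY 0%N.
    by congr ln; rewrite /scale expn0 natrX; ring.
  have -> : rho ^+ k = (2 ^ k)%:R * (2 ^ k)%:R * expR (- 2 * complex.Re s * (k%:R * ln 2)).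
    rewrite natrX -{1 2}(lnK (x := 2 ^+ k)) ?posrE ?exprn_gt0 // lnXn // -expRM_natl -!expRD.
    by congr expR; rewrite -mulr_natl; ring.
  by rewrite /E natrM le_eqVlt; apply/orP; left; apply/eqP; ring.
pose B := sbox g 1 Y + E / (1 - rho).
have boxB k : sbox g (2 ^ k) (2 ^ k * Y) <= B.
  have : sbox g (2 ^ k) (2 ^ k * Y) <= sbox g 1 Y + E * ((1 - rho ^+ k) / (1 - rho)).
    elim: k => [|k IH]; first by rewrite expn0 mul1n expr0 subrr mul0r mulr0 addr0.
    have := shell k; have -> : (1 - rho ^+ k.+1) / (1 - rho) = (1 - rho ^+ k) / (1 - rho) + rho ^+ k.
      by rewrite exprS; field; rewrite subr_eq0 gt_eqF.
    rewrite mulrDr; move: IH; lra.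
  move=> H; apply: le_trans H _; rewrite lerD2l; apply: ler_wpM2l => //.
  rewrite ler_pdivrMr ?subr_gt0 // mulVf ?subr_eq0 ?gt_eqF //.
  by have := exprn_ge0 k (ltW rho0); lra.
exists B => t ut; pose k := (\max_(x <- t) (absz x.1 + absz x.2)).+1.
apply: le_trans (boxB k); rewrite sbox_seq.
have sub : {subset t <= boxseq (2 ^ k) (2 ^ k * Y)}.
  move=> x xt; have h : (absz x.1 + absz x.2 < k)%N.
    by rewrite ltnS; exact: (@leq_bigmax_seq _ _ xpredT (fun x : int * int => absz x.1 + absz x.2)%N).
  have k2 : (k < 2 ^ k)%N by exact: ltn_expl.
  have h2 := ltn_trans h k2; apply: mem_boxseq; first exact: leq_ltn_trans (leq_addr _ _) h2.
  exact: leq_trans (leq_ltn_trans (leq_addl _ _) h2) (leq_pmulr _ Y0).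
rewrite (sum_subset_le (fun x => cmod_ge0 _) ut (boxseq_uniq _ _) sub) lerDl.
by apply: sumr_ge0.
Qed.

Lemma bsum_climit v : usum lterm v -> climit (fun k => bsum n z Y k s) v.
Proof.
move=> H; have := usum_climit (s_ := fun k => boxseq (2 ^ k) (2 ^ k * Y)) H (fun k => boxseq_uniq _ _) _.
rewrite (_ : (fun k => \sum_(i <- _) _) = (fun k => bsum n z Y k s)); last first.
  by apply/funext => k; rewrite /bsum sbox_seq.
apply=> x; exists (absz x.1 + absz x.2)%N => k xk.
have k2 : (k < 2 ^ k)%N by exact: ltn_expl.
have h2 := leq_ltn_trans xk k2; apply: mem_boxseq; first exact: leq_ltn_trans (leq_addr _ _) h2.
exact: leq_trans (leq_ltn_trans (leq_addl _ _) h2) (leq_pmulr _ Y0).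
Qed.
End ReducedSum.

Definition lam (w1 w2 : C) (x : int * int) : C := x.1%:~R * w1 + x.2%:~R * w2.
(** The oriented area of the parallelogram on [u], [v]; it is nonzero exactly when they generate a
    lattice. *)
Definition cdet (u v : C) : R := complex.Re u * complex.Im v - complex.Im u * complex.Re v.

Lemma cdet_le u v : `|cdet u v| <= 2 * (cmod u * cmod v).
Proof.
have h1 : `|complex.Re u * complex.Im v| <= cmod u * cmod v.
  by rewrite normrM; apply: ler_pM => //; [exact: ler_Re_cmod|exact: ler_Im_cmod].
have h2 : `|complex.Im u * complex.Re v| <= cmod u * cmod v.
  by rewrite normrM; apply: ler_pM => //; [exact: ler_Im_cmod|exact: ler_Re_cmod].
by apply: le_trans (ler_normB _ _) _; move: h1 h2; lra.
Qed.

Lemma cdet_lam w1 w2 x y : cdet (lam w1 w2 x) (lam w1 w2 y) = (x.1 * y.2 - x.2 * y.1)%:~R * cdet w1 w2.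
Proof.
case: w1 w2 x y => a b [c d] [x1 x2] [y1 y2]; rewrite /cdet /lam -!(rmorph_int (real_complex R)) /=.
by rewrite rmorphB !rmorphM /=; ring.
Qed.

Lemma exists_min_seq (T : eqType) (s : seq T) (f : T -> R) x : x \in s ->
  exists2 y, y \in s & forall t, t \in s -> f y <= f t.
Proof.
elim: s x => [//|a s IH] x _; case: s IH => [|b s] IH.
  by exists a; rewrite ?mem_head // => t; rewrite inE => /eqP ->.
have [y ys ymin] := IH b (mem_head _ _).
case: (leP (f a) (f y)) => h.
  exists a; rewrite ?mem_head // => t; rewrite inE => /orP[/eqP -> //|ts]; apply: le_trans h _; exact: ymin.
exists y; first by rewrite inE ys orbT.
by move=> t; rewrite inE => /orP[/eqP ->|ts]; [exact: ltW|exact: ymin].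
Qed.

(** By Cramer's rule a vector no longer than [w1] has bounded coordinates, so the minimum is taken
    over a finite box. *)
Lemma lam_min w1 w2 : cdet w1 w2 != 0 ->
  exists2 x : int * int, x != (0, 0) & forall y : int * int, y != (0, 0) -> cmod (lam w1 w2 x) <= cmod (lam w1 w2 y).
Proof.
move=> D0; have D0' : 0 < `|cdet w1 w2| by rewrite normr_gt0.
have w10 : w1 != 0 by apply: contraNneq D0 => ->; rewrite /cdet /= !mul0r subrr.
have small (x : int * int) : cmod (lam w1 w2 x) <= cmod w1 ->
    `|x.1%:~R| <= 2 * (cmod w1 * cmod w2) / `|cdet w1 w2| /\ `|x.2%:~R| <= 2 * (cmod w1 * cmod w1) / `|cdet w1 w2|.
  move=> xw; have l1 : lam w1 w2 (1, 0) = w1 by rewrite /lam /= mul1r mul0r addr0.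
  have l2 : lam w1 w2 (0, 1) = w2 by rewrite /lam /= mul1r mul0r add0r.
  split; rewrite ler_pdivlMr // -normrM.
    have := cdet_lam w1 w2 x (0, 1); rewrite l2 /= mulr1 mulr0 subr0 => <-.
    by apply: le_trans (cdet_le _ _) _; rewrite ler_pM2l // ler_wpM2r.
  have := cdet_lam w1 w2 (1, 0) x; rewrite l1 /= mul1r mul0r subr0 => <-.
  by apply: le_trans (cdet_le _ _) _; rewrite ler_pM2l // ler_wpM2l.
pose B := (Num.truncn (2 * (cmod w1 * cmod w2) / `|cdet w1 w2|) + Num.truncn (2 * (cmod w1 * cmod w1) / `|cdet w1 w2|)).+2.
have inB (x : int * int) : cmod (lam w1 w2 x) <= cmod w1 -> x \in boxseq B B.
  move=> /small[h1 h2].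
  have tr (X : R) (m : int) : 0 <= X -> `|m%:~R| <= X -> (absz m <= Num.truncn X)%N.
    move=> X0 h; rewrite truncn_ge_nat //; apply: le_trans h.
    by rewrite -intr_norm -abszE.
  have q1 : 0 <= 2 * (cmod w1 * cmod w2) / `|cdet w1 w2| by rewrite divr_ge0 ?mulr_ge0.
  have q2 : 0 <= 2 * (cmod w1 * cmod w1) / `|cdet w1 w2| by rewrite divr_ge0 ?mulr_ge0.
  have := tr _ _ q1 h1; have := tr _ _ q2 h2 => t1 t2.
  by apply: mem_boxseq; rewrite /B; lia.
have i0 : (1, 0) \in [seq x <- boxseq B B | x != (0, 0)].
  by rewrite mem_filter /= inB // /lam /= mul1r mul0r addr0.
have [x xs xmin] := exists_min_seq (fun x => cmod (lam w1 w2 x)) i0.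
have x1 : cmod (lam w1 w2 x) <= cmod w1.
  by have := xmin _ i0; rewrite /lam /= mul1r mul0r addr0.
exists x; first by move: xs; rewrite mem_filter => /andP[].
move=> y y0; case: (leP (cmod (lam w1 w2 y)) (cmod w1)) => h; last by apply: le_trans x1 (ltW h).
by apply: xmin; rewrite mem_filter y0 inB.
Qed.

(** Gauss reduction. The shortest vector [v] is completed to a basis by Bezout, and [z] is the
    quotient of the second vector by [v], shifted to [|Re z| <= 1/2]. Minimality gives [|z| >= 1],
    hence [(Im z)^2 >= 3/4 > (4/5)^2]. The mutually inverse maps [g] and [h] are the change of
    coordinates. *)
Lemma reduced_basis w1 w2 : cdet w1 w2 != 0 -> exists (v z : C) (g h : int * int -> int * int),
  [/\ exists2 x : int * int, x != (0, 0) & v = lam w1 w2 x,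
      `|complex.Re z| <= 2^-1, 4 / 5 <= complex.Im z, cancel g h /\ cancel h g &
      forall x, lam w1 w2 x = v * lpt z (g x).1 (g x).2].
Proof.
move=> D0; have [[c0 d0] x0 xmin] := lam_min D0.
set v := lam w1 w2 (c0, d0) in xmin *.
have lamz k (x : int * int) : lam w1 w2 (k * x.1, k * x.2) = k%:~R * lam w1 w2 x by rewrite /lam /= !rmorphM /=; ring.
have v0 : v != 0.
  have E := cdet_lam w1 w2 (c0, d0) (- d0, c0).
  apply/eqP => V; move: E; rewrite -/v V /cdet /= !mul0r subrr => /esym/eqP.
  rewrite mulf_eq0 (negbTE D0) orbF intr_eq0 mulrN opprK => /eqP E.
  have c00 : c0 * c0 = 0 by have := sqr_ge0 c0; have := sqr_ge0 d0; rewrite !expr2; lia.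
  have d00 : d0 * d0 = 0 by lia.
  move: c00 d00 => /eqP; rewrite mulf_eq0 orbb => /eqP c00 /eqP; rewrite mulf_eq0 orbb => /eqP d00.
  by move: x0; rewrite c00 d00 eqxx.
have vp : 0 < cmod v by rewrite cmod_gt0.
(* Dividing the shortest vector by the gcd of its coordinates would otherwise give a shorter one. *)
have gcd1 : gcdz c0 d0 = 1.
  have [e eE] : exists e : nat, gcdz c0 d0 = e%:Z by exists (gcdn (absz c0) (absz d0)).
  have /dvdzP[c1 c1E] := dvdz_gcdl c0 d0; have /dvdzP[d1 d1E] := dvdz_gcdr c0 d0.
  rewrite eE in c1E d1E *.
  have y0 : (c1, d1) != (0, 0).
    by apply: contraNneq x0 => -[c10 d10]; rewrite c1E d1E c10 d10 !mul0r.
  have e0 : (0 < e)%N by rewrite lt0n; apply: contraNneq x0 => e0; rewrite c1E d1E e0 !mulr0.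
  have vE : v = e%:~R * lam w1 w2 (c1, d1) by rewrite /v c1E d1E -lamz /= ![_ * e%:Z]mulrC.
  have := xmin _ y0; rewrite vE cmodM.
  have -> : cmod (e%:~R : C) = e%:R by rewrite -[LHS]/(cmod (e%:R : C)) cmod_nat.
  have l0 : 0 < cmod (lam w1 w2 (c1, d1)).
    by rewrite cmod_gt0; apply: contraNneq v0 => L; rewrite vE L mulr0.
  rewrite ger_pMl // -[1]/(1%:R) ler_nat => e1.
  by congr Posz; apply/eqP; rewrite eqn_leq e1 e0.
have [a [b ab]] := Bezoutz c0 d0; rewrite gcd1 in ab.
pose v2 := lam w1 w2 (- b, a); pose tau := v2 / v.
have dv : cdet v v2 = cdet w1 w2.
  rewrite cdet_lam /= mulrN opprK; have -> : c0 * a + d0 * b = 1 by rewrite -ab; ring.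
  by rewrite mul1r.
have imt : complex.Im tau * cmod v ^+ 2 = cdet v v2.
  have E : tau * v = v2 by rewrite /tau divfK.
  rewrite -E cmod_sqr /cdet; case: (tau) (v) => t1 t2 [p1 p2] /=; ring.
have imt0 : complex.Im tau != 0.
  by apply: contraNneq D0 => I0; rewrite -dv -imt I0 mul0r.
(* The sign [e] orients the basis so that [Im z > 0]; the integer [r] below centres the real
   part. *)
have [e [ee ep]] : exists e : int, e * e = 1 /\ 0 < e%:~R * complex.Im tau.
  case: (ltP 0 (complex.Im tau)) => h; first by exists 1; rewrite mulr1 rmorph1 mul1r.
  by exists (-1); rewrite mulrNN mul1r rmorphN rmorph1 mulN1r oppr_gt0 lt_neqAle imt0.
pose r := Num.floor (e%:~R * complex.Re tau + 2^-1).
have /andP[r1 r2] := real_floor_itv (num_real (e%:~R * complex.Re tau + 2^-1)).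
rewrite -/r rmorphD /= in r1 r2.
pose z := e%:~R * tau - r%:~R.
have zE : complex.Re z = e%:~R * complex.Re tau - r%:~R /\ complex.Im z = e%:~R * complex.Im tau.
  by rewrite /z; case: (tau) => t1 t2; rewrite -!(rmorph_int (real_complex R)) /=; split; ring.
pose g (x : int * int) := let m := c0 * x.2 - d0 * x.1 in let k := a * x.1 + b * x.2 in (e * m, e * m * r + k).
pose h (y : int * int) := let m := e * y.1 in let k := y.2 - y.1 * r in (k * c0 - m * b, k * d0 + m * a).
have gh : cancel g h.
  move=> [c d]; rewrite /g /h /=; congr pair.
    transitivity ((a * c + b * d) * c0 - (e * e) * (c0 * d - d0 * c) * b); first by ring.
    rewrite ee mul1r; transitivity (c * (a * c0 + b * d0)); first by ring.
    by rewrite ab mulr1.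
  transitivity ((a * c + b * d) * d0 + (e * e) * (c0 * d - d0 * c) * a); first by ring.
  rewrite ee mul1r; transitivity (d * (a * c0 + b * d0)); first by ring.
  by rewrite ab mulr1.
have hg : cancel h g.
  move=> [c d]; rewrite /g /h /=.
  have E1 : e * (c0 * ((d - c * r) * d0 + e * c * a) - d0 * ((d - c * r) * c0 - e * c * b)) = c.
    transitivity ((e * e) * c * (a * c0 + b * d0)); first by ring.
    by rewrite ee ab mul1r mulr1.
  congr pair => //; rewrite E1.
  transitivity (c * r + (d - c * r) * (a * c0 + b * d0)); first by ring.
  by rewrite ab; ring.
have ge x : lam w1 w2 x = v * lpt z (g x).1 (g x).2.
  case: x => c d; rewrite /lpt /z /=.
  have tE : v * tau = v2 by rewrite /tau mulrC divfK.
  transitivity ((a * c + b * d)%:~R * v + (c0 * d - d0 * c)%:~R * v2).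
    transitivity (((a * c + b * d) * c0 - (c0 * d - d0 * c) * b)%:~R * w1 + ((a * c + b * d) * d0 + (c0 * d - d0 * c) * a)%:~R * w2).
      rewrite /lam /=; congr (_%:~R * _ + _%:~R * _).
        transitivity (c * (a * c0 + b * d0)); first by rewrite ab mulr1.
        by ring.
      transitivity (d * (a * c0 + b * d0)); first by rewrite ab mulr1.
      by ring.
    by rewrite /v /v2 /lam /= !(intrD, rmorphN, intrM) /=; ring.
  rewrite -tE !(intrD, rmorphN, intrM) /= !intrM.
  have ee' : e%:~R * e%:~R = 1 :> C by rewrite -rmorphM /= ee.
  transitivity ((a%:~R * c%:~R + b%:~R * d%:~R) * v + (e%:~R * e%:~R) * (c0%:~R * d%:~R - d0%:~R * c%:~R) * (v * tau)); first by rewrite ee' mul1r.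
  by ring.
have [zr zi] := zE.
have zre : `|complex.Re z| <= 2^-1 by rewrite zr ler_norml; move: r1 r2; lra.
exists v, z, g, h; split => //; first by exists (c0, d0).
have zi0 : 0 < complex.Im z by rewrite zi.
have z1 : 1 <= cmod z.
  have gE := ge (h (1, 0)); rewrite hg /lpt /= mul1r addr0 in gE.
  have n0 : h (1, 0) != (0, 0).
    apply/eqP => H0; move: gE; rewrite H0 /lam /= !mul0r addr0 => /esym/eqP.
    rewrite mulf_eq0 (negbTE v0) /= => /eqP Z; move: zi0; rewrite Z /= ltxx //.
  by have := xmin _ n0; rewrite gE cmodM -[leLHS]mulr1 ler_pM2l.
have zs : 1 <= complex.Re z ^+ 2 + complex.Im z ^+ 2 by rewrite -cmod_sqr exprn_ege1.
have zr2 := ler_norm_sqr zre.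
rewrite leNgt; apply/negP => hz.
have : complex.Im z ^+ 2 <= (4 / 5) ^+ 2 by apply: lerXn2r; rewrite ?nnegrE ?(ltW zi0) ?(ltW hz).
by move: zs zr2; lra.
Qed.
End LatticeFamilies.

(** * Lattice sums sieved by congruence conditions *)

Section Families.
Variable R : realType.
Local Notation C := (R[i]).

(** Each prime is tagged by the coordinate that it must not divide: the first for [true], the second
    for [false]. *)
Definition avoids (ps : seq (nat * bool)) (x : int * int) : bool :=
  all (fun p => ~~ (p.1 %| absz (if p.2 then x.1 else x.2))%N) ps.
Definition fterm ps (n : int) (s w1 w2 : C) (x : int * int) : C :=
  if avoids ps x then phi0 n s (lam w1 w2 x) else 0.
Definition lattice_bound (s : C) (n : int) : R :=
  let A := conductor n (0 +i* complex.Im s)%C in growth A * (1 + ln (1 + A)) + (cmod (2 * s - 1))^-1.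
Definition doubling (s : C) : C := 4 * cpow 2 (- (2 * s)) - 1.

Lemma loc_unifM (s0 : R) (f : C -> C) A_ A : centire f -> loc_unif s0 A_ A ->
  loc_unif s0 (fun k s => f s * A_ k s) (fun s => f s * A s).
Proof.
move=> fe HA p sp; have [d /cder_cont/(_ 1 ltr01)[r r0 Hr]] := fe p.
have [r' r'0 H] := HA p sp.
exists (Num.min r r'); first by rewrite lt_min r0.
move=> e e0; have K0 : 0 < cmod (f p) + 1 by rewrite ltr_wpDl.
have [N HN] := H _ (divr_gt0 e0 K0); exists N => k z Nk; rewrite lt_min => /andP[zr zr'].
rewrite -mulrBr cmodM; have := HN k z Nk zr'; rewrite ler_pdivlMr // => h.
have := Hr _ zr; rewrite (addrC p) subrK => fz.
have fb : cmod (f z) <= cmod (f p) + 1 by have := ler_cmodD (f z - f p) (f p); rewrite subrK; move: fz; lra.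
by apply: le_trans (ler_wpM2r (cmod_ge0 _) fb) _; rewrite mulrC.
Qed.

Lemma loc_unifB (s0 : R) (A_ B_ : nat -> C -> C) (A B : C -> C) : loc_unif s0 A_ A -> loc_unif s0 B_ B ->
  loc_unif s0 (fun k s => A_ k s - B_ k s) (fun s => A s - B s).
Proof.
move=> HA HB p sp; have [r r0 H] := HA p sp; have [r' r'0 H'] := HB p sp.
exists (Num.min r r'); first by rewrite lt_min r0.
move=> e e0; have e2 : 0 < e / 2 by rewrite divr_gt0.
have [N HN] := H _ e2; have [N' HN'] := H' _ e2; exists (maxn N N') => k z.
rewrite geq_max lt_min => /andP[Nk Nk'] /andP[zr zr'].
have := HN k z Nk zr; have := HN' k z Nk' zr'.
have -> : A_ k z - B_ k z - (A z - B z) = (A_ k z - A z) - (B_ k z - B z) by ring.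
have := ler_cmodB (A_ k z - A z) (B_ k z - B z); lra.
Qed.

(** Dominated by the full sum over the lattice, transported to a reduced basis by the bijection
    [g]. *)
Lemma fterm_bounded ps n (s w1 w2 : C) : cdet w1 w2 != 0 -> 1 < complex.Re s -> exists B, abs_bounded (fterm ps n s w1 w2) B.
Proof.
move=> D0 s1; have [v [z [g [h [_ zx zy [gh hg] lamE]]]]] := reduced_basis D0.
have y0 := im_gt0 zy.
(* An integer with [y <= Y <= y + 1 <= 9 y / 4], the last step because [y >= 4/5]. *)
pose Y := Num.truncn (complex.Im z + 1).
have y1 : 0 <= complex.Im z + 1 by rewrite addr_ge0 // ltW.
have /andP[Y1 Y2] := truncn_itv y1; rewrite -/Y in Y1 Y2.
have yY : complex.Im z <= Y%:R by move: Y2; rewrite -natr1 ltrD2r => /ltW.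
have Yy : Y%:R <= 9 / 4 * complex.Im z by move: Y1 zy; lra.
have [B HB] := lterm_bounded zx zy yY Yy n s1.
exists (cmod (qchar n s v) * B) => t ut.
apply: (@le_trans _ _ (\sum_(x <- t) cmod (qchar n s v) * cmod (lterm z n s (g x)))).
  apply: ler_sum => x _; rewrite /fterm /lterm; case: ifP => _; last by rewrite cmod0 mulr_ge0.
  rewrite lamE; case: (eqVneq v 0) => [->|v0]; last by rewrite phi0_scale // cmodM.
  by rewrite mul0r /phi0 eqxx cmod0 mulr_ge0.
rewrite -mulr_sumr; apply: ler_wpM2l => //.
rewrite -(big_map g xpredT (fun y => cmod (lterm z n s y))); apply: HB.
by rewrite map_inj_uniq //; exact: can_inj gh.
Qed.

(** The lattice is [v] times a reduced one, and the character factors out [qchar n s v], of modulus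
    [|v|^(-2 Re s)]; since [v] is a nonzero lattice vector, this is at most the power of [lmin]. *)
Lemma lattice_good : exists2 K : R, 0 < K & forall (n : int) (w1 w2 : C) (lmin : R),
  (2 %| n)%Z -> cdet w1 w2 != 0 -> 0 < lmin -> (forall x : int * int, x != (0, 0) -> lmin <= cmod (lam w1 w2 x)) ->
  exists (A_ : nat -> C -> C) (A : C -> C), [/\ forall k, centire (A_ k), loc_unif 2^-1 A_ A,
    forall s v, 1 < complex.Re s -> usum (fterm [::] n s w1 w2) v -> A s = doubling s * v &
    forall s, 2^-1 < complex.Re s <= 1 -> cmod (A s) <= wpow (complex.Re s) lmin * (K * lattice_bound s n)].
Proof.
have [K K0 HK] := alim_bound R; exists K => // n w1 w2 lmin n2 D0 l0 Hl.
have [v [z [g [h [[x x0 vE] zx zy [gh hg] lamE]]]]] := reduced_basis D0.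
have y0 := im_gt0 zy.
pose Y := Num.truncn (complex.Im z + 1).
have y1 : 0 <= complex.Im z + 1 by rewrite addr_ge0 // ltW.
have /andP[Y1 Y2] := truncn_itv y1; rewrite -/Y in Y1 Y2.
have yY : complex.Im z <= Y%:R by move: Y2; rewrite -natr1 ltrD2r => /ltW.
have Yy : Y%:R <= 9 / 4 * complex.Im z by move: Y1 zy; lra.
have lv : lmin <= cmod v by rewrite vE; exact: Hl.
have v0 : v != 0 by rewrite -cmod_gt0 (lt_le_trans l0).
exists (fun k s => qchar n s v * asum n z Y k s), (fun s => qchar n s v * alim n z Y s); split.
- by move=> k; apply: centireM; [exact: centire_qchar|exact: centire_asum].
- by apply: loc_unifM; [exact: centire_qchar|exact: loc_unif_asum].
- move=> s u s1 Hu.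
  have Hu' : usum (fun y => qchar n s v * lterm z n s y) u.
    apply: (usum_transfer (g := h) (h := g)) Hu => y _.
      split; first exact: hg.
      by rewrite /fterm /= lamE hg /lterm phi0_scale.
    split; first exact: gh.
    by rewrite /fterm /= lamE /lterm phi0_scale.
  have Hl' : usum (lterm z n s) ((qchar n s v)^-1 * u).
    apply: usum_eq (usumZ (qchar n s v)^-1 Hu') => y.
    by rewrite mulrA mulVf ?mul1r // qchar_neq0.
  have s12 : 2^-1 < complex.Re s by apply: lt_trans s1; lra.
  have HB : climit (fun k => bsum n z Y k s) ((qchar n s v)^-1 * u) by apply: bsum_climit Hl' => //.
  rewrite (alim_bsum zx zy yY Yy n2 s12 HB) -/(doubling s).
  by rewrite mulrCA (mulrA (qchar n s v)) mulfV ?mul1r // qchar_neq0.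
move=> s /andP[s1 s2]; rewrite cmodM; apply: ler_pM => //.
  rewrite -phi0E //; apply: cmod_phi0_le => //; apply: ltW; apply: lt_trans s1; lra.
by apply: (HK z Y n s) => //; rewrite s1.
Qed.

(** Inclusion-exclusion. The terms violating the condition at [p] form the same family for the
    sublattice in which one basis vector is multiplied by [p]. A sublattice has no shorter vectors,
    so [lmin] still serves and the bound doubles with each prime. *)
Lemma family_good : exists2 K : R, 0 < K & forall (n : int) (ps : seq (nat * bool)) (w1 w2 : C) (lmin : R),
  uniq (map fst ps) -> all prime (map fst ps) ->
  (2 %| n)%Z -> cdet w1 w2 != 0 -> 0 < lmin -> (forall x : int * int, x != (0, 0) -> lmin <= cmod (lam w1 w2 x)) ->
  exists (A_ : nat -> C -> C) (A : C -> C), [/\ forall k, centire (A_ k), loc_unif 2^-1 A_ A,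
    forall s v, 1 < complex.Re s -> usum (fterm ps n s w1 w2) v -> A s = doubling s * v &
    forall s, 2^-1 < complex.Re s <= 1 ->
      cmod (A s) <= 2 ^+ size ps * (wpow (complex.Re s) lmin * (K * lattice_bound s n))].
Proof.
have [K K0 HK] := lattice_good; exists K => // n ps w1 w2 lmin ups pps n2.
elim: ps ups pps w1 w2 => [|[p b] ps IH] /= ups pps w1 w2 D0 l0 Hl.
  by have [A_ [A [H1 H2 H3 H4]]] := HK n w1 w2 lmin n2 D0 l0 Hl; exists A_, A; split => // s s1; rewrite expr0 mul1r; exact: H4.
have /andP[pn {}ups] := ups; have /andP[pp {}pps] := pps.
have p0 := prime_gt0 pp.
have pC : p%:R != 0 :> C by rewrite pnatr_eq0 -lt0n.
have pz : p%:Z != 0 by rewrite -[0]/(0%:Z) eqz_nat -lt0n.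
pose w1' : C := if b then p%:R * w1 else w1; pose w2' : C := if b then w2 else p%:R * w2.
pose up (x : int * int) : int * int := if b then (p%:Z * x.1, x.2) else (x.1, p%:Z * x.2).
pose dn (x : int * int) : int * int := if b then ((x.1 %/ p%:Z)%Z, x.2) else (x.1, (x.2 %/ p%:Z)%Z).
have lamup x : lam w1' w2' x = lam w1 w2 (up x).
  by rewrite /lam /w1' /w2' /up; case: (b) => /=; rewrite intrM mulrAC mulrC ?mulrA // -!mulrA ?(mulrC _ p%:R) //; ring.
have D0' : cdet w1' w2' != 0.
  have -> : cdet w1' w2' = p%:R * cdet w1 w2.
    rewrite /cdet /w1' /w2'; case: (b); have -> : p%:R = (p%:R)%:C%C :> C by rewrite rmorph_nat.
      by case: (w1) (w2) => ? ? [? ?] /=; ring.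
    by case: (w1) (w2) => ? ? [? ?] /=; ring.
  by rewrite mulf_neq0 // pnatr_eq0 -lt0n.
have upn x : x != (0, 0) -> up x != (0, 0).
  by case: x => c d; rewrite /up; case: (b) => /=; rewrite -!pair_eqE /= /pair_eq /= mulf_eq0 (negbTE pz).
have Hl' x : x != (0, 0) -> lmin <= cmod (lam w1' w2' x) by move=> x0; rewrite lamup; apply: Hl; exact: upn.
have [A_ [A [H1 H2 H3 H4]]] := IH ups pps w1 w2 D0 l0 Hl.
have [B_ [B [G1 G2 G3 G4]]] := IH ups pps w1' w2' D0' l0 Hl'.
exists (fun k s => A_ k s - B_ k s), (fun s => A s - B s); split.
- by move=> k; apply: centireD; [exact: H1|exact: centireN].
- exact: loc_unifB.
- move=> s v s1 Hv.
  have [a Ha] := @usum_exists R _ _ _ (projT2 (cid (fterm_bounded ps n D0 s1))).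
  have [a' Ha'] := @usum_exists R _ _ _ (projT2 (cid (fterm_bounded ps n D0' s1))).
  rewrite (H3 s a s1 Ha) (G3 s a' s1 Ha') -mulrBr; congr (_ * _).
  pose F x := if (p %| absz (if b then x.1 else x.2))%N then fterm ps n s w1 w2 x else 0.
  have avup x : avoids ps (up x) = avoids ps x.
    apply: eq_in_all => -[r c] rps /=; rewrite /up.
    have rp : prime r by apply: (allP pps); apply/mapP; exists (r, c).
    have rneq : r != p by apply: contraNneq pn => <-; apply/mapP; exists (r, c).
    by case: (b); case: c {rps} => //=; rewrite abszM absz_nat Euclid_dvdM // dvdn_prime2 // (negbTE rneq).
  have up1 x : (p %| absz (if b then (up x).1 else (up x).2))%N.
    by rewrite /up; case: (b) => /=; rewrite abszM absz_nat dvdn_mulr.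
  have HF : usum F a'.
    apply: (usum_transfer (g := dn) (h := up)) Ha'.
    - move=> x; rewrite /F; case: ifP => [px _|]; last by rewrite eqxx.
      have ud : up (dn x) = x.
        case: x px => c d; rewrite /up /dn; case: (b) => /= px; congr pair; rewrite mulrC divzK //; exact: px.
      by split => //; rewrite /fterm lamup -avup ud.
    - move=> x _; split; first by case: x => c d; rewrite /up /dn; case: (b) => /=; rewrite mulKz.
      by rewrite /F up1 /fterm avup lamup.
  apply: (usum_unique (F := fterm ((p, b) :: ps) n s w1 w2)) => //.
  have := usumD Ha (usumZ (-1) HF); rewrite mulN1r; apply: usum_eq => x.
  rewrite /F /fterm /=; case: (p %| _)%N => /=; first by rewrite mulN1r subrr.
  by rewrite mulr0 addr0.
move=> s s1; have h1 := H4 s s1; have h2 := G4 s s1.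
rewrite exprS -mulrA mulr2n mulrDl mul1r; apply: le_trans (ler_cmodB _ _) _; exact: lerD.
Qed.
End Families.

(** * Cusps of Gamma_0(q) *)

Section CuspArithmetic.
Variables (q : nat) (u v : int).
Hypothesis sq : squarefree q.
Hypothesis uv1 : coprimez u v.

Local Notation v0 := (gcdn (absz v) q).
Local Notation w0 := (q %/ v0)%N.

(** The row [(-v, u) h]. For the cusp [u / v] the bottom row of the inverse scaling matrix is a
    multiple of [(-v, u)], so this is, up to that factor, the bottom row on which the Eisenstein
    term depends. *)
Definition crow (h : 'M[int]_2) : int * int := (- v * h 0 0 + u * h 1 0, - v * h 0 1 + u * h 1 1).
Definition sgnrow (x y : int * int) : Prop := y = x \/ y = (- x.1, - x.2).
(** The rows that occur for the cusp: [crow_prim] and [crow_surj] show that they are exactly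
    these. *)
Definition prim (x : int * int) : bool := coprimez x.1 x.2 && (gcdn (absz x.1) q == v0).

Let q0 : (0 < q)%N := sq.1.
Lemma v0_gt0 : (0 < v0)%N. Proof. by rewrite gcdn_gt0 q0 orbT. Qed.
Lemma qE : q = (v0 * w0)%N. Proof. by rewrite mulnC divnK // dvdn_gcdr. Qed.

Lemma coprime_v0w : coprime v0 w0.
Proof.
rewrite /coprime; apply/eqP; apply: (proj2 sq); rewrite [X in (_ %| X)%N]qE expnS expn1.
by apply: dvdn_mul; [exact: dvdn_gcdl|exact: dvdn_gcdr].
Qed.

Lemma mx2E (T : comRingType) (h k : 'M[T]_2) (i j : 'I_2) : (h *m k) i j = h i 0 * k 0 j + h i 1 * k 1 j.
Proof. by rewrite mxE !big_ord_recl big_ord0 addr0; congr (_ * k _ j + h i _ * k _ j); apply/val_inj. Qed.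

Lemma det2 (T : comRingType) (h : 'M[T]_2) : \det h = h 0 0 * h 1 1 - h 0 1 * h 1 0.
Proof.
have e0 : widen_ord (leqnSn 1) ord_max = 0 :> 'I_2 by apply/val_inj.
have e1 : ord_max = 1 :> 'I_2 by apply/val_inj.
have l0 : lift (1 : 'I_2) (0 : 'I_1) = 0 by apply/val_inj.
have l1 : lift (0 : 'I_2) (0 : 'I_1) = 1 by apply/val_inj.
rewrite (expand_det_row _ 0) !big_ord_recr big_ord0 /= e0 e1 add0r /cofactor !det_mx11 !mxE /= l1 l0.
by rewrite expr0 expr1; ring.
Qed.

Lemma crowM h k : crow (h *m k) =
  ((crow h).1 * k 0 0 + (crow h).2 * k 1 0, (crow h).1 * k 0 1 + (crow h).2 * k 1 1).
Proof. by rewrite /crow !mx2E /=; congr pair; ring. Qed.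

Lemma bezout_uv : exists a b, a * u + b * v = 1.
Proof. by have [a [b E]] := Bezoutz u v; exists a, b; rewrite E; exact/eqP. Qed.

Lemma Gamma0M h k : Gamma0 q h -> Gamma0 q k -> Gamma0 q (h *m k).
Proof.
move=> [h1 h2] [k1 k2]; split; first by rewrite det_mulmx h1 k1 mulr1.
by rewrite mx2E; apply: rpredD; [apply: dvdz_mulr|apply: dvdz_mull].
Qed.

Definition adj2 (h : 'M[int]_2) : 'M[int]_2 := mx2 (h 1 1) (- h 0 1) (- h 1 0) (h 0 0).

Lemma Gamma0_adj h : Gamma0 q h -> Gamma0 q (adj2 h).
Proof.
move=> [h1 h2]; split; first by rewrite det2 !mxE /=; rewrite det2 in h1; rewrite -h1; ring.
by rewrite !mxE /= dvdzE abszN.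
Qed.

Lemma mx2P (T : Type) (h k : 'M[T]_2) : h 0 0 = k 0 0 -> h 0 1 = k 0 1 -> h 1 0 = k 1 0 -> h 1 1 = k 1 1 -> h = k.
Proof.
move=> e1 e2 e3 e4; apply/matrixP => i j.
have I (i' : 'I_2) : i' = 0 \/ i' = 1 by case: i' => -[|[|//]] p; [left|right]; apply/val_inj.
by case: (I i) => ->; case: (I j) => ->.
Qed.

Lemma adj2K (h k : 'M[int]_2) : \det h = 1 -> (k *m adj2 h) *m h = k.
Proof.
move=> h1; rewrite -mulmxA; have -> : adj2 h *m h = 1%:M; last by rewrite mulmx1.
by rewrite det2 in h1; apply: mx2P; rewrite mx2E !mxE /=; rewrite -?h1; ring.
Qed.

Lemma crow_prim h : Gamma0 q h -> prim (crow h).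
Proof.
move=> [h1 h2]; rewrite det2 in h1; have [a [b ab]] := bezout_uv.
apply/andP; split.
  apply/coprimezP; exists (- a * h 0 1 - b * h 1 1, a * h 0 0 + b * h 1 0) => /=.
  transitivity ((a * u + b * v) * (h 0 0 * h 1 1 - h 0 1 * h 1 0)); first by ring.
  by rewrite ab h1 mulr1.
have /dvdzP[k hk] := h2.
have cop : coprimez q%:Z (h 0 0).
  by apply/coprimezP; exists (- h 0 1 * k, h 1 1) => /=; rewrite -h1 hk; ring.
apply/eqP; suff : (gcdn `|(crow h).1| q)%:Z = v0%:Z by case.
rewrite -[LHS]/(gcdz (crow h).1 q%:Z) -[RHS]/(gcdz v q%:Z).
have -> : (crow h).1 = u * k * q%:Z + - (v * h 0 0) by rewrite /crow /= hk; ring.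
by rewrite gcdzC gcdzMDl gcdzN Gauss_gcdzl // gcdzC.
Qed.

Lemma orth_uv (x : int * int) : x.1 * u + x.2 * v = 0 -> exists t, x = (- (t * v), t * u).
Proof.
move=> e; have [a [b ab]] := bezout_uv; exists (a * x.2 - b * x.1).
rewrite [LHS]surjective_pairing; congr pair; rewrite -[LHS]mulr1 -ab.
  transitivity (a * (x.1 * u + x.2 * v) + (b * v * x.1 - a * v * x.2)); [by ring|by rewrite e; ring].
transitivity (b * (x.1 * u + x.2 * v) + (a * u * x.2 - b * u * x.1)); [by ring|by rewrite e; ring].
Qed.

Lemma crow_sgn h : Gamma0 q h ->
  (crow h).1 * u + (crow h).2 * v = 0 <-> sgnrow (- v, u) (crow h).
Proof.
move=> hG; split; last by case=> -> /=; ring.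
move=> /orth_uv[t E]; have /andP[/coprimezP[[a b] ab] _] := crow_prim hG.
rewrite E /= in ab.
have : (b * u - a * v) * t = 1 by rewrite -ab; ring.
move=> /intUnitRing.unitzPl /[!unfold_in] /orP[]/eqP e; [left|right]; rewrite E e /=; first by rewrite !mul1r.
by congr pair; ring.
Qed.

Definition cuspvec (a : option rat) : Prop := if a is Some r then u = numq r /\ v = denq r else u = 1 /\ v = 0.

Variable a : option rat.
Hypothesis auv : cuspvec a.

(** [h] fixes the line of [(u, v)] exactly when the row [(-v, u) h] is orthogonal to [(u, v)]; being
    primitive, that row is then [(-v, u)] up to sign. *)
Lemma crow_stab h : Gamma0 q h -> cusp_stabilizer q a h <-> sgnrow (- v, u) (crow h).
Proof.
move=> hG; rewrite -(crow_sgn hG) /cusp_stabilizer /mkset.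
suff E : mobius (map_mx intr h) a = a <-> (crow h).1 * u + (crow h).2 * v = 0 by rewrite -E; split=> [[]|].
have h1 : h 0 0 * h 1 1 - h 0 1 * h 1 0 = 1 by rewrite -det2; case: hG.
case: a auv => [r [uE vE]|[uE vE]]; rewrite /mobius !mxE /crow /=; last first.
  have -> : (- v * h 0 0 + u * h 1 0) * u + (- v * h 0 1 + u * h 1 1) * v = h 1 0 by rewrite uE vE; ring.
  case: ifP => [|/negbT]; rewrite intr_eq0; first by move/eqP=> ->.
  by move=> /eqP.
have v_neq0 : v%:~R != 0 :> rat by rewrite intr_eq0 vE denq_neq0.
have rE : r = u%:~R / v%:~R by rewrite uE vE divq_num_den.
set num := _ + (h 0 1)%:~R; set den := _ + (h 1 1)%:~R.
have cE : (((- v * h 0 0 + u * h 1 0) * u + (- v * h 0 1 + u * h 1 1) * v)%:~R : rat) = (v%:~R) ^+ 2 * (r * den - num).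
  by rewrite /num /den rE !(intrD, intrM, rmorphN) /=; field.
split.
  case: ifP => // /negbT d0 [] nd; apply/eqP; rewrite -(@intr_eq0 rat) cE -nd divfK // subrr mulr0 //.
move=> e0; have {cE} : r * den - num = 0.
  by apply: (mulfI (expf_neq0 2 v_neq0)); rewrite mulr0 -cE e0.
move=> /eqP; rewrite subr_eq0 => /eqP nE; case: ifP => [/eqP d0|/negbT d0]; last by rewrite -nE mulfK.
exfalso; have n0 : num = 0 by rewrite -nE d0 mulr0.
have /eqP := congr1 (fun z : int => z%:~R : rat) h1; rewrite rmorphB !rmorphM /=.
have -> : (h 1 1)%:~R = - ((h 1 0)%:~R * r) :> rat by apply/eqP; rewrite -addr_eq0 addrC; apply/eqP.
have -> : (h 0 1)%:~R = - ((h 0 0)%:~R * r) :> rat by apply/eqP; rewrite -addr_eq0 addrC; apply/eqP.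
have -> : (h 0 0)%:~R * - ((h 1 0)%:~R * r) - - ((h 0 0)%:~R * r) * (h 1 0)%:~R = 0 :> rat by ring.
by rewrite eq_sym oner_eq0.
Qed.

Lemma sgnrow_sym x y : sgnrow x y -> sgnrow y x.
Proof. by case=> ->; [left|right; rewrite /= !opprK -surjective_pairing]. Qed.

Lemma sgnrow_trans x y z : sgnrow x y -> sgnrow y z -> sgnrow x z.
Proof. by case=> -> [] ->; [left|right|right|left; rewrite /= !opprK -surjective_pairing]. Qed.

Lemma sgnrow_crowM h k k' : sgnrow (crow h) (crow k) -> sgnrow (crow (h *m k')) (crow (k *m k')).
Proof. by rewrite !crowM; case=> ->; [left|right => /=; congr pair; ring]. Qed.

Lemma crow1 : crow 1%:M = (- v, u).
Proof. by rewrite /crow !mxE /=; congr pair; ring. Qed.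

(** Multiplication by the inverse [adj2 gamma] reduces the question to the row of an element of the
    stabilizer. *)
Lemma mem_coset gamma gamma' : Gamma0 q gamma -> Gamma0 q gamma' ->
  [set h *m gamma | h in cusp_stabilizer q a] gamma' <-> sgnrow (crow gamma) (crow gamma').
Proof.
move=> hg hg'; split.
  move=> [h hs <-]; have [hG _] := hs; have /(crow_stab hG) := hs.
  by rewrite -crow1 => /(sgnrow_crowM gamma); rewrite mul1mx.
move=> s; exists (gamma' *m adj2 gamma); last by apply: adj2K; case: hg.
have hG := Gamma0M hg' (Gamma0_adj hg); apply/crow_stab => //.
have := sgnrow_crowM (adj2 gamma) s; apply: sgnrow_trans; left.
rewrite -[in RHS]crow1; congr crow.
have := adj2K 1%:M (proj1 (Gamma0_adj hg)); rewrite mul1mx.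
suff -> : adj2 (adj2 gamma) = gamma by [].
by apply: mx2P; rewrite !mxE /= ?opprK.
Qed.

Lemma coset_eq gamma gamma' : Gamma0 q gamma -> Gamma0 q gamma' -> sgnrow (crow gamma) (crow gamma') ->
  [set h *m gamma | h in cusp_stabilizer q a] = [set h *m gamma' | h in cusp_stabilizer q a].
Proof.
move=> hg hg' s; apply/seteqP; split=> k kc.
  have kG : Gamma0 q k by case: kc => h [hG _] <-; exact: Gamma0M.
  apply/mem_coset => //; move/(mem_coset hg kG): kc; exact: sgnrow_trans (sgnrow_sym s).
have kG : Gamma0 q k by case: kc => h [hG _] <-; exact: Gamma0M.
by apply/mem_coset => //; move/(mem_coset hg' kG): kc; exact: sgnrow_trans s.
Qed.

(** Completing [(-v, u)] and [(c, d)] to matrices of determinant 1 gives a solution with a free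
    parameter [t], whose lower left entry is [X + t v c]. It is divisible by [v0] because [v] and
    [c] are; modulo [w0] it can be made 0 since [v c] is invertible there, the squarefree [q] being
    the product of the coprime numbers [v0] and [w0]. *)
Lemma crow_surj x : prim x -> exists2 gamma, Gamma0 q gamma & crow gamma = x.
Proof.
case: x => c d /andP[/= cd /eqP cq]; have [al [be ab]] := bezout_uv.
have /coprimezP[[b' a'] /= cdE] := cd.
have vcw : coprimez (v * c) w0%:Z.
  have aux (z : int) : gcdn (absz z) q = v0 -> coprimez z w0%:Z.
    move=> e; rewrite /coprimez /gcdz /= -[_ == _]/(gcdn `|z| w0 == 1)%N -dvdn1.
    have := coprime_v0w; rewrite /coprime => /eqP <-; rewrite dvdn_gcd dvdn_gcdr andbT -[X in (_ %| X)%N]e.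
    by rewrite dvdn_gcd dvdn_gcdl /=; apply: dvdn_trans (dvdn_gcdr _ _) _; apply/dvdnP; exists v0; exact: qE.
  by rewrite coprimezMl !aux.
have /coprimezP[[s r] /= sr] := vcw.
(* With [s v c + r w0 = 1] this choice turns [X + t v c] into [X r w0]. *)
pose X := v * a' + al * c; pose t := - (X * s).
exists (mx2 (u * (a' + t * c) - be * c) (u * (- b' + t * d) - be * d)
            (v * (a' + t * c) + al * c) (v * (- b' + t * d) + al * d)); last first.
  rewrite /crow !mxE /=; congr pair.
    by transitivity (c * (al * u + be * v)); [ring|rewrite ab mulr1].
  by transitivity (d * (al * u + be * v)); [ring|rewrite ab mulr1].
split.
  rewrite det2 !mxE /=; transitivity ((al * u + be * v) * (b' * c + a' * d)); first by ring.
  by rewrite ab cdE.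
rewrite !mxE /= [X in (X%:Z %| _)%Z]qE PoszM Gauss_dvdz; last exact: coprime_v0w.
have dv (z : int) : gcdn (absz z) q = v0 -> (v0%:Z %| z)%Z by move=> <-; rewrite dvdzE /= dvdn_gcdl.
apply/andP; split; first by apply: rpredD; [apply: dvdz_mulr; exact: dv|apply: dvdz_mull; exact: dv].
apply/dvdzP; exists (X * r).
transitivity (X * (1 - s * (v * c))); first by rewrite /t /X; ring.
by rewrite -[in LHS]sr; ring.
Qed.
End CuspArithmetic.

(** * From cosets to sieved lattice sums *)

Section CuspSums.
Variable R : realType.
Local Notation C := (R[i]).

Definition neg2 (x : int * int) : int * int := (- x.1, - x.2).
(** Selects one vector from each pair of opposite nonzero vectors. *)
Definition pos2 (x : int * int) : bool := (0 < x.1) || ((x.1 == 0) && (0 < x.2)).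

Lemma neg2K x : neg2 (neg2 x) = x.
Proof. by rewrite /neg2 /= !opprK -surjective_pairing. Qed.

Lemma prim_neq0 q v x : prim q v x -> (x.1 == 0) && (x.2 == 0) = false.
Proof. by move=> /andP[c _]; apply/negP => /andP[/eqP e1 /eqP e2]; rewrite e1 e2 in c. Qed.

Lemma prim_neg2 q v x : prim q v (neg2 x) = prim q v x.
Proof. by rewrite /prim /coprimez /= gcdzN gcdNz abszN. Qed.

Lemma pos2_neg2 q v x : prim q v x -> pos2 (neg2 x) = ~~ pos2 x.
Proof. by move=> /prim_neq0; rewrite /pos2 /=; case: x => c d /=; lia. Qed.

(** A coset is a row up to sign, so the sum over all rows is twice the sum over cosets:
    [usum_transfer] matches the rows selected by [pos2] with the cosets, and negation accounts for
    the others. *)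
Lemma coset_usum q u v a (sq : squarefree q) (uv1 : coprimez u v) (auv : cuspvec u v a)
    (T : int * int -> C) (f : 'M[int]_2 -> C) val :
  (forall x, T (neg2 x) = T x) -> (forall gamma, Gamma0 q gamma -> f gamma = T (crow u v gamma)) ->
  has_sum (right_cosets q a) (fun K => f (xget 1%:M K)) val ->
  usum (fun x => if prim q v x then T x else 0) (2 * val).
Proof.
move=> Tn fT /has_sum_usum H.
pose coset gamma : set 'M[int]_2 := [set h *m gamma | h in cusp_stabilizer q a].
pose rep (K : set 'M[int]_2) := crow u v (xget 1%:M K).
pose posrep x := if pos2 x then x else neg2 x.
pose lift_row x := xget 1%:M [set gamma | Gamma0 q gamma /\ crow u v gamma = x].
have liftP x : prim q v x -> Gamma0 q (lift_row x) /\ crow u v (lift_row x) = x.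
  move=> px; rewrite /lift_row; case: xgetP => [g _ //|n].
  by have [g gG gx] := crow_surj sq uv1 px; case: (n g).
have repP gamma : Gamma0 q gamma -> Gamma0 q (xget 1%:M (coset gamma)) /\ sgnrow (crow u v gamma) (rep (coset gamma)).
  move=> gG; rewrite /rep; case: xgetP => [g _ gc|n]; last first.
    by case: (n gamma); apply/(mem_coset uv1 auv) => //; left.
  have gG' : Gamma0 q g by case: gc => h [hG _] <-; exact: Gamma0M.
  by split => //; exact: (iffLR (mem_coset uv1 auv gG gG') gc).
have sgnT x y : sgnrow x y -> T y = T x by case=> -> //; exact: Tn.
have sgnpos x y : prim q v y -> sgnrow x y -> pos2 x -> posrep y = x.
  rewrite /posrep => py [E|E] px; first by rewrite E px.
  have E' : y = neg2 x by [].
  by rewrite E' in py *; rewrite (pos2_neg2 (q:=q) (v:=v)) ?px ?neg2K // -prim_neg2.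
have sgnposrep x : sgnrow x (posrep x).
  by rewrite /posrep; case: ifP => _; [left|right].
have posposrep x : prim q v x -> pos2 (posrep x).
  by rewrite /posrep => px; case: ifP => // /negbT; rewrite -(pos2_neg2 px).
have primrep x : prim q v (posrep x) = prim q v x.
  by rewrite /posrep; case: ifP => _ //; exact: prim_neg2.
have h1 : usum (fun x => if prim q v x && pos2 x then T x else 0) val.
  apply: (usum_transfer (g := fun x => coset (lift_row x)) (h := fun K => posrep (rep K))) H.
    move=> x; case: ifP => [/andP[px xx] _|]; last by rewrite eqxx.
    have [lG lx] := liftP _ px; have [rG rs] := repP _ lG; rewrite lx in rs.
    have pr : prim q v (rep (coset (lift_row x))) by exact: crow_prim.
    rewrite (sgnpos _ _ pr rs xx); split=> //.
    rewrite mem_set; last by exists (lift_row x).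
    by rewrite fT // -/(rep _) (sgnT _ _ rs).
  move=> K; case: ifP => [/set_mem[gamma gG <-] _|]; last by rewrite eqxx.
  have [rG rs] := repP _ gG.
  have pr : prim q v (rep (coset gamma)) by exact: crow_prim.
  have pr' : prim q v (posrep (rep (coset gamma))) by rewrite primrep.
  have [lG lx] := liftP _ pr'; split.
    apply: (coset_eq uv1 auv) => //; rewrite lx.
    exact: sgnrow_trans (sgnrow_sym (sgnposrep _)) (sgnrow_sym rs).
  by rewrite primrep pr posposrep //= fT // (sgnT _ _ (sgnposrep _)).
have h2 : usum (fun x => if prim q v x && ~~ pos2 x then T x else 0) val.
  apply: (usum_transfer (g := neg2) (h := neg2)) h1 => x _; rewrite neg2K Tn prim_neg2;
    by case px: (prim q v x) => //=; rewrite (pos2_neg2 px) ?negbK.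
have -> : 2 * val = val + val by ring.
apply: usum_eq (usumD h1 h2) => x /=.
by case: (prim q v x); case: (pos2 x); rewrite /= ?addr0 ?add0r.
Qed.

Lemma coprime_all_primes m k : (0 < k)%N -> coprime m k = all (fun p => ~~ (p %| m)%N) (primes k).
Proof.
move=> k0; apply/idP/allP => [/eqP mk p|H].
  rewrite mem_primes => /and3P[pp _ pk]; apply/negP => pm.
  have : (p %| gcdn m k)%N by rewrite dvdn_gcd pm.
  by rewrite mk dvdn1 => /eqP p1; rewrite p1 in pp.
apply/eqP; case: (ltngtP (gcdn m k) 1) => // [|g1]; first by rewrite ltnNge gcdn_gt0 k0 orbT.
have := H (pdiv (gcdn m k)); rewrite mem_primes pdiv_prime // k0 (dvdn_trans (pdiv_dvd _) (dvdn_gcdr _ _)) => /(_ isT).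
by rewrite (dvdn_trans (pdiv_dvd _) (dvdn_gcdl _ _)).
Qed.

Section Fiber.
Variables (q : nat) (v : int).
Hypothesis sq : squarefree q.
Local Notation v0 := (gcdn (absz v) q).
Local Notation w0 := (q %/ v0)%N.

(** Once the first coordinate is written [v0 c], the gcd condition says that [c] is prime to [w0],
    and coprimality makes the second coordinate prime to [v0]. *)
Definition cusp_primes : seq (nat * bool) := [seq (p, true) | p <- primes w0] ++ [seq (p, false) | p <- primes v0].

Let q0 : (0 < q)%N := sq.1.
Let v00 : (0 < v0)%N := v0_gt0 v sq.
Lemma w0_gt0 : (0 < w0)%N.
Proof. by have := q0; rewrite [X in (0 < X)%N](qE q v) muln_gt0 => /andP[]. Qed.

Lemma fst_cusp_primes : map fst cusp_primes = primes w0 ++ primes v0.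
Proof. by rewrite /cusp_primes map_cat -!map_comp; congr cat; exact: map_id. Qed.

Lemma uniq_cusp_primes : uniq (map fst cusp_primes).
Proof.
rewrite fst_cusp_primes cat_uniq !primes_uniq /= andbT -coprime_has_primes ?w0_gt0 //.
by rewrite coprime_sym; exact: coprime_v0w.
Qed.

Lemma prime_cusp_primes : all prime (map fst cusp_primes).
Proof. by rewrite fst_cusp_primes all_cat; apply/andP; split; apply/allP => p; rewrite mem_primes => /and3P[]. Qed.

Lemma size_cusp_primes : (size cusp_primes <= size (primes q))%N.
Proof.
rewrite -(size_map fst); apply: uniq_leq_size; first exact: uniq_cusp_primes.
rewrite fst_cusp_primes => p; rewrite mem_cat !mem_primes q0 => /orP[] /and3P[-> _ d] /=.
  by rewrite (qE q v) dvdn_mull.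
by rewrite (qE q v) dvdn_mulr.
Qed.

Lemma avoids_cusp_primes x : avoids cusp_primes x = coprime (absz x.1) w0 && coprime (absz x.2) v0.
Proof.
rewrite /avoids all_cat [X in X && _]all_map [X in _ && X]all_map (coprime_all_primes _ w0_gt0) (coprime_all_primes _ v00).
by [].
Qed.

Lemma coprime_q m : coprime m q = coprime m w0 && coprime m v0.
Proof. by rewrite {1}(qE q v) coprimeMr andbC. Qed.

Lemma primP (x : int * int) : prim q v x <-> coprimez x.1 x.2 /\ exists2 c, x.1 = v0%:Z * c & coprime (absz c) w0.
Proof.
split.
  move=> /andP[c /eqP g]; split => //.
  have /dvdzP[c' E] : (v0%:Z %| x.1)%Z by rewrite dvdzE /= -g dvdn_gcdl.
  exists c'; first by rewrite E mulrC.
  move: g; rewrite E abszM {2}(qE q v) [absz v0%:Z]/= mulnC -muln_gcdr => /eqP.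
  by rewrite -[X in _ == X]muln1 eqn_pmul2l.
move=> [c [c' E /eqP g]]; rewrite /prim c /= E abszM {2}(qE q v) [absz v0%:Z]/= -muln_gcdr g muln1 //.
Qed.

(** A nonzero [(v0 y1, y2)] with [y1] prime to [w0] and [y2] prime to [v0] is uniquely [m x] with
    [m] prime to [q] and [x] a row of the cusp: [m] is its gcd. By homogeneity the term is
    [m^(-2 s)] times that of [x], and summing over [m] gives zeta without its Euler factors at [q].
    Coprimality is thereby traded for congruence conditions on single coordinates. *)
Lemma fiber_usum n (s w1 w2 V : C) : 1 < complex.Re s -> (2 %| n)%Z -> cdet w1 w2 != 0 ->
  usum (fun x => if prim q v x then phi0 n s (lam w1 w2 x) else 0) V ->
  usum (fterm cusp_primes n s (v0%:R * w1) w2)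
    (\prod_(p <- primes q) (1 - dterm (2 * s) p) * zeta (2 * s) * V).
Proof.
move=> s1 n2 ww HV.
have s2 : 1 < complex.Re (2 * s) by move: s1; case: (s) => a b /=; lra.
have pr : all prime (primes q) by apply/allP => p; rewrite mem_primes => /and3P[].
have H1 := sieveP s2 (primes_uniq q) pr.
have [B HB] := fterm_bounded [::] n ww s1.
have B1 : abs_bounded (sieved (primes q) (2 * s)) (zbound (complex.Re (2 * s))%:C%C).
  by apply: abs_bounded_le (abs_bounded_zterm s2) _ => m; rewrite /sieved; case: ifP => _ //; rewrite cmod0 cmod_ge0.
have B2 : abs_bounded (fun x => if prim q v x then phi0 n s (lam w1 w2 x) else 0) B.
  by apply: abs_bounded_le HB _ => x; rewrite /fterm /=; case: ifP => _ //; rewrite cmod0 cmod_ge0.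
have v0z : v0%:Z != 0 by rewrite eqz_nat -lt0n.
pose gm (y : int * int) := gcdn (absz (v0%:Z * y.1)) (absz y.2).
have scale m x : (0 < m)%N -> phi0 n s (m%:R * lam w1 w2 x) = dterm (2 * s) m * phi0 n s (lam w1 w2 x).
  move=> m0; have mr : m%:R != 0 :> R by rewrite pnatr_eq0 -lt0n.
  have -> : m%:R = (m%:R : R)%:C%C :> C by rewrite rmorph_nat.
  rewrite phi0_scale ?rc_neq0 // qchar_real // ger0_norm ?ler0n //.
apply: (usum_transfer (g := fun y => (gm y, ((v0%:Z * y.1 %/ (gm y)%:Z)%Z, (y.2 %/ (gm y)%:Z)%Z)))
   (h := fun z : nat * (int * int) => ((z.1%:Z * z.2.1 %/ v0%:Z)%Z, z.1%:Z * z.2.2))) (usumM B1 B2 H1 HV).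
  move=> y; rewrite /fterm avoids_cusp_primes; case: ifP => [/andP[y1 y2] F0|]; last by rewrite eqxx.
  have m0 : (0 < gm y)%N.
    rewrite gcdn_gt0 !absz_gt0 mulf_eq0 (negbTE v0z) /= -negb_and; apply/negP => /andP[/eqP e1 /eqP e2].
    by move: F0; rewrite /lam e1 e2 !mul0r addr0 /phi0 !eqxx.
  have mz : (gm y)%:Z != 0 by rewrite eqz_nat -lt0n.
  have /dvdzP[c cE] : ((gm y)%:Z %| v0%:Z * y.1)%Z by rewrite dvdzE /= dvdn_gcdl.
  have /dvdzP[d dE] : ((gm y)%:Z %| y.2)%Z by rewrite dvdzE /= dvdn_gcdr.
  rewrite /= cE dE !mulzK //.
  have cmv : coprime (gm y) v0 by apply: coprime_dvdl y2; exact: dvdn_gcdr.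
  have cmw : coprime (gm y) w0.
    by apply: (coprime_dvdl (dvdn_gcdl _ _)); rewrite abszM coprimeMl y1 [absz _]/= coprime_v0w.
  have cd : coprimez c d.
    have := mulz_gcdl c d (gm y)%:Z; rewrite -cE -dE -[gcdz (_ * y.1) _]/((gm y)%:Z) /=.
    by move=> e; apply/eqP; apply: (mulIf mz); rewrite e mul1r.
  have /dvdzP[c' cE'] : (v0%:Z %| c)%Z.
    have : (v0%:Z %| c * (gm y)%:Z)%Z by rewrite -cE dvdz_mulr.
    by rewrite Gauss_dvdzl // coprimez_sym.
  have yE : y.1 = c' * (gm y)%:Z.
    by apply: (mulfI v0z); rewrite cE cE'; ring.
  have px : prim q v (c, d).
    apply/primP; split => //; exists c'; first by rewrite cE' mulrC.
    by move: y1; rewrite yE abszM coprimeMl => /andP[].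
  split.
    rewrite [RHS]surjective_pairing; congr pair; last by rewrite dE mulrC.
    by rewrite mulrC -cE mulKz.
  rewrite px /sieved -(coprime_all_primes _ q0) coprime_q cmw cmv /= /zterm (gtn_eqF m0) -scale //.
  congr phi0; rewrite /lam yE dE cE' !rmorphM /= !pmulrn; ring.
move=> [m x] /=; rewrite /sieved -(coprime_all_primes _ q0); case: ifP => [cm|]; last by rewrite mul0r eqxx.
case: ifP => [px|]; last by rewrite mulr0 eqxx.
rewrite mulf_eq0 negb_or => /andP[zm _].
have m0 : (0 < m)%N by rewrite lt0n; apply: contraNneq zm => ->; rewrite /zterm.
have mz : m%:Z != 0 by rewrite eqz_nat -lt0n.
have [cx [c xE cc]] := (primP x).1 px.
have e1 : (m%:Z * x.1 %/ v0%:Z)%Z = m%:Z * c by rewrite xE mulrCA mulKz.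
have gE : gm (m%:Z * c, m%:Z * x.2) = m.
  rewrite /gm /=; have -> : v0%:Z * (m%:Z * c) = m%:Z * x.1 by rewrite xE; ring.
  by rewrite !abszM -muln_gcdr; move: cx; rewrite /coprimez /gcdz => /eqP[->]; rewrite muln1.
rewrite e1 gE; split.
  congr pair; have -> : v0%:Z * (m%:Z * c) = m%:Z * x.1 by rewrite xE; ring.
  by rewrite !mulKz // -surjective_pairing.
move: cm; rewrite coprime_q => /andP[cmw cmv].
rewrite /fterm avoids_cusp_primes /= !abszM !coprimeMl cmw cc cmv /=.
have -> : coprime (absz x.2) v0.
  rewrite coprime_sym; move: cx; rewrite /coprimez xE /gcdz abszM => /eqP[] /eqP cx; move: cx.
  by rewrite -/(coprime _ _) coprimeMl => /andP[].
rewrite /zterm (gtn_eqF m0) -scale //; congr phi0; rewrite /lam xE !rmorphM /= !pmulrn; ring.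
Qed.
End Fiber.
End CuspSums.

(** * Iwasawa coordinates, bottom rows and scaling matrices *)

Section Iwasawa.
Variable R : realType.
Local Notation C := (R[i]).
Implicit Types (h g sigma : 'M[R]_2).

Lemma angle_exists (a b : R) : a ^+ 2 + b ^+ 2 = 1 ->
  exists theta, [/\ 0 <= theta < 2 * pi, cos theta = a & sin theta = b].
Proof.
move=> ab.
have a1 : -1 <= a <= 1 by apply/andP; split; nra.
have p0 := pi_gt0 R.
have sa : sin (acos a) = `|b|.
  by rewrite sin_acos // -sqrtr_sqr; congr Num.sqrt; move: ab; lra.
have A0 := acos_ge0 a1; have A1 := acos_lepi a1.
case: (lerP 0 b) => b0.
  exists (acos a); split; [by apply/andP; split; lra| by rewrite acosK|by rewrite sa ger0_norm].
have al : -1 <= a < 1 by apply/andP; split; nra.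
have A2 := acos_gt0 al.
exists (- acos a + pi *+ 2); split; first by rewrite mulr2n; apply/andP; split; lra.
  by rewrite cosD cos2pi sin2pi mulr0 subr0 mulr1 cosN acosK.
by rewrite sinD cos2pi sin2pi mulr0 addr0 mulr1 sinN sa ltr0_norm // opprK.
Qed.

Lemma sqrt_expR (y : R) : 0 < y -> Num.sqrt y = expR (ln y / 2).
Proof.
move=> y0; have E : y = expR (ln y / 2) ^+ 2 by rewrite expr2 -expRD -splitr lnK.
by rewrite {1}E sqrtr_sqr gtr0_norm // expR_gt0.
Qed.

(** The bottom row [(c, d)] as [d + i c]. In Iwasawa coordinates it is [y^(-1/2) e^(i theta)], so
    [qchar n s] takes it to [y^s e^(i n theta)]. *)
Definition lowz h : C := (h 1 1 +i* h 1 0)%C.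

Lemma iwasawa_entries (x y t : R) :
  mx2 1 x 0 1 *m mx2 (Num.sqrt y) 0 0 (Num.sqrt y)^-1 *m mx2 (cos t) (- sin t) (sin t) (cos t) =
  mx2 (Num.sqrt y * cos t + x / Num.sqrt y * sin t) (- (Num.sqrt y * sin t) + x / Num.sqrt y * cos t)
      (sin t / Num.sqrt y) (cos t / Num.sqrt y).
Proof. by apply: mx2P; rewrite !mx2E !mxE /=; ring. Qed.

Lemma iwasawa_exists h : \det h = 1 -> exists x y t, iwasawa_coords h x y t.
Proof.
rewrite det2 => d1.
pose c := h 1 0; pose d := h 1 1; pose N := c ^+ 2 + d ^+ 2.
have N0 : 0 < N.
  rewrite lt_neqAle addr_ge0 ?sqr_ge0 // andbT eq_sym paddr_eq0 ?sqr_ge0 // !sqrf_eq0.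
  apply/negP => /andP[/eqP c0 /eqP d0]; move: d1; rewrite -/c -/d c0 d0 !mulr0 subrr => /esym/eqP.
  by rewrite oner_eq0.
have S0 : 0 < Num.sqrt N by rewrite sqrtr_gt0.
have S2 : Num.sqrt N ^+ 2 = N by rewrite sqr_sqrtr // ltW.
have Sn : Num.sqrt N != 0 by rewrite gt_eqF.
have [t [tb tc ts]] := @angle_exists (d / Num.sqrt N) (c / Num.sqrt N) ltac:(rewrite !expr_div_n -mulrDl S2 addrC divff ?gt_eqF //).
exists ((h 0 0 * c + h 0 1 * d) / N), N^-1, t; split; rewrite ?invr_gt0 //.
rewrite iwasawa_entries tc ts sqrtrV ?ltW // invrK.
have e1 : h 0 0 * d - h 0 1 * c = 1 by [].
have e3 : Num.sqrt N ^+ 2 = c ^+ 2 + d ^+ 2 by rewrite S2.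
move: S2 e3 Sn; move: (Num.sqrt N) => S S2 e3 Sn; rewrite -S2.
apply: mx2P; rewrite !mxE /= -/c -/d; [| |by field|by field];
  apply: (mulfI (expf_neq0 2 Sn)).
  transitivity (d * 1 + (h 0 0 * c + h 0 1 * d) * c); last by field.
  by rewrite -[in RHS]e1 e3; ring.
transitivity (- c * 1 + (h 0 0 * c + h 0 1 * d) * d); last by field.
by rewrite -[in RHS]e1 e3; ring.
Qed.

Lemma qchar_polar n (s : C) (L t : R) :
  qchar n s ((expR L)%:C%C * cis t) = cexp (- (2 * s) * L%:C%C) * cis (n%:~R * t).
Proof.
have cE : cmod ((expR L)%:C%C * cis t) = expR L.
  by rewrite cmodM cmod_cis mulr1 cmod_real ger0_norm // expR_ge0.
rewrite /qchar cE /cpow expRK; congr (_ * _).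
by rewrite mulrAC divff ?mul1r ?cis_expz // rc_neq0 // gt_eqF // expR_gt0.
Qed.

(** Existence of the coordinates is enough: whichever triple [iwasawa] selects, the character of the
    bottom row has the value prescribed by that triple. *)
Lemma eisenstein_termE sigma n g (s : C) (gamma : 'M[int]_2) :
  \det (invmx sigma *m map_mx intr gamma *m g) = 1 ->
  eisenstein_term sigma n g s gamma = qchar n s (lowz (invmx sigma *m map_mx intr gamma *m g)).
Proof.
rewrite /eisenstein_term; set h := _ *m g => h1.
have [x [y [t H]]] := iwasawa_exists h1.
have [y0 _ hE] : iwasawa_coords h (iwasawa h).1.1 (iwasawa_y h) (iwasawa_theta h).
  rewrite /iwasawa_y /iwasawa_theta /iwasawa.
  by apply: (@xgetPex _ (0, 1, 0) [set p | iwasawa_coords h p.1.1 p.1.2 p.2]); exists (x, y, t).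
set Y := iwasawa_y h in y0 hE *; set Th := iwasawa_theta h in hE *.
have -> : lowz h = (expR (- (ln Y / 2)))%:C%C * cis Th.
  rewrite /lowz hE iwasawa_entries !mxE /= sqrt_expR // expRN /cis.
  by apply/eqP; rewrite eq_complex /= !mul0r subr0 addr0 ![_^-1 * _]mulrC !eqxx.
rewrite qchar_polar /cpow cexp_im; congr (cexp _ * _).
by rewrite rmorphN rmorphM /= fmorphV rmorph_nat; field.
Qed.

Lemma row_norm_iwasawa g (x y t c d : R) : iwasawa_coords g x y t ->
  (c * g 0 1 + d * g 1 1) ^+ 2 + (c * g 0 0 + d * g 1 0) ^+ 2 = c ^+ 2 * y + (c * x + d) ^+ 2 / y.
Proof.
move=> [y0 _ ->]; rewrite iwasawa_entries !mxE /=.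
have S0 : 0 < Num.sqrt y by rewrite sqrtr_gt0.
have S2 : Num.sqrt y ^+ 2 = y by rewrite sqr_sqrtr // ltW.
have Sn : Num.sqrt y != 0 by rewrite gt_eqF.
have cs := cos2Dsin2 t; move: S2 Sn; move: (Num.sqrt y) => S S2 Sn; rewrite -S2.
transitivity ((c ^+ 2 * S ^+ 2 + (c * x + d) ^+ 2 / S ^+ 2) * (cos t ^+ 2 + sin t ^+ 2)); first by field.
by rewrite cs mulr1.
Qed.

(** The top row in the encoding of [lowz], so that [lam (low1 g) (lowz g) (c, d)] encodes the row
    [(c, d) g]. *)
Definition low1 g : C := (g 0 1 +i* g 0 0)%C.

Lemma cdet_low g : cdet (low1 g) (lowz g) = - \det g.
Proof. by rewrite det2 /cdet /=; ring. Qed.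

Lemma lam_low g (x : int * int) : lam (low1 g) (lowz g) x =
  ((x.1%:~R * g 0 1 + x.2%:~R * g 1 1) +i* (x.1%:~R * g 0 0 + x.2%:~R * g 1 0))%C.
Proof.
rewrite /lam -!(rmorph_int (real_complex R)) /=.
by apply/eqP; rewrite eq_complex /= !mul0r !subr0 !addr0 !eqxx.
Qed.

(** The squared length is [c^2 y + (c x + d)^2 / y]: at least [y] if [c] is nonzero, at least
    [1 / y] otherwise, and both are at least [1 / (y + 1/y)]. *)
Lemma lam_low_ge g (x y t : R) (k : int * int) : iwasawa_coords g x y t -> k != (0, 0) ->
  (Num.sqrt (y + y^-1))^-1 <= cmod (lam (low1 g) (lowz g) k).
Proof.
move=> H k0; have [y0 _ _] := H.
have z0 : 0 < y^-1 by rewrite invr_gt0.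
have yz : y * y^-1 = 1 by rewrite divff // gt_eqF.
rewrite -sqrtrV ?addr_ge0 ?(ltW y0) ?(ltW z0) // lam_low /cmod /= (row_norm_iwasawa _ _ H).
  apply: ler_wsqrtr.
have key : 1 <= (k.1%:~R ^+ 2 * y + (k.1%:~R * x + k.2%:~R) ^+ 2 / y) * (y + y^-1).
  have sq1 (m : int) : m != 0 -> 1 <= m%:~R ^+ 2 :> R.
    by move=> m0; rewrite -rmorphXn /= -[1]/(1%:~R) ler_int; move: m0; clear; nia.
  case: (eqVneq k.1 0) => k1.
    have k2 : k.2 != 0 by apply: contraNneq k0 => k2; rewrite [k]surjective_pairing k1 k2.
    have := sq1 _ k2; rewrite k1 mul0r add0r; set m := k.2%:~R ^+ 2 => m1.
    rewrite expr0n mul0r add0r -mulrA mulrDr [y^-1 * y]mulrC yz.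
    by have := sqr_ge0 y^-1; nra.
  have := sq1 _ k1; set m := k.1%:~R ^+ 2 => m1.
  have e0 : 0 <= (k.1%:~R * x + k.2%:~R) ^+ 2 / y by rewrite divr_ge0 ?sqr_ge0 // ltW.
  have h1 : 1 <= (m * y) * (y + y^-1) by rewrite -mulrA mulrDr yz; have := sqr_ge0 y; nra.
  apply: le_trans h1 _; apply: ler_wpM2r; [by rewrite addr_ge0 // ltW|by rewrite lerDl].
by rewrite -[leLHS]mul1r ler_pdivrMr // addr_gt0.
Qed.

Lemma invmx_det1 sigma : \det sigma = 1 ->
  invmx sigma = mx2 (sigma 1 1) (- sigma 0 1) (- sigma 1 0) (sigma 0 0).
Proof.
move=> s1; have su : sigma \in unitmx by rewrite unitmxE s1 unitr1.
set A := mx2 _ _ _ _; rewrite -[LHS]mulmx1 -[RHS](mulKmx su); congr (_ *m _).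
rewrite det2 in s1; apply: mx2P; rewrite mx2E !mxE /=; rewrite -?s1; ring.
Qed.

(** The first column of [sigma] is [rho (u, v)] for the primitive vector of the cusp. The unit
    translation conjugated by [sigma] is an integral matrix with entries built from [rho^2 u^2],
    [rho^2 u v] and [rho^2 v^2]; as [u], [v] are coprime, [rho^2] itself is a positive integer. *)
Lemma scaling_vector q a sigma : is_scaling_matrix q a sigma ->
  exists u v (rho : R), [/\ coprimez u v, cuspvec u v a, 1 <= `|rho|, sigma 0 0 = rho * u%:~R & sigma 1 0 = rho * v%:~R].
Proof.
move=> [s1 sa st].
have [u [v [rho [uv av r1 r2]]]] : exists u v (rho : R), [/\ coprimez u v, cuspvec u v a, sigma 0 0 = rho * u%:~R & sigma 1 0 = rho * v%:~R].
  move: sa; rewrite /mobius; case: a {st} => [r|] /=; case: ifP => [/eqP e|/negbT e] // E.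
    case: E => E; exists (numq r), (denq r), (sigma 1 0 / (denq r)%:~R).
    have d0 : (denq r)%:~R != 0 :> R by rewrite intr_eq0 denq_neq0.
    split=> //; [by apply/eqP; congr Posz; apply/eqP; exact: coprime_num_den| |by rewrite divfK].
    by rewrite -[LHS](divfK e) E /ratr; field.
  by exists 1, 0, (sigma 0 0); rewrite mulr1 mulr0; split.
exists u, v, rho; split=> //.
have : [set A | exists m : int, A = mx2 1 m%:~R 0 1 \/ A = - mx2 1 m%:~R 0 1] (mx2 1 1 0 1 : 'M[R]_2).
  by exists 1; left.
rewrite -st => -[h _ hE].
have su : sigma \in unitmx by rewrite unitmxE s1 unitr1.
have hs : map_mx intr h *m sigma = sigma *m mx2 1 1 0 1 by rewrite -hE !mulmxA mulmxV // mul1mx.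
have E i j := congr1 (fun M : 'M[R]_2 => M i j) hs.
have := E 0 0; have := E 0 1; have := E 1 0; have := E 1 1; rewrite !mx2E !mxE /= {E}.
rewrite det2 in s1; rewrite r1 r2 in s1 *.
set B := sigma 0 1 in s1 *; set D := sigma 1 1 in s1 *.
set h00 : R := (h 0 0)%:~R; set h01 : R := (h 0 1)%:~R; set h10 : R := (h 1 0)%:~R; set h11 : R := (h 1 1)%:~R.
set A := rho * u%:~R in s1 *; set K := rho * v%:~R in s1 *.
move=> e11 e10 e01 e00.
have f01 : h01 = A ^+ 2.
  transitivity (h01 * (A * D - B * K)); first by rewrite s1 mulr1.
  transitivity ((h00 * B + h01 * D) * A - (h00 * A + h01 * K) * B); first by ring.
  by rewrite e01 e00; ring.
have f10 : h10 = - K ^+ 2.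
  transitivity (h10 * (A * D - B * K)); first by rewrite s1 mulr1.
  transitivity ((h10 * A + h11 * K) * D - (h10 * B + h11 * D) * K); first by ring.
  by rewrite e11 e10; ring.
have f11 : h11 - 1 = A * K.
  transitivity (h11 * (A * D - B * K) - (A * D - B * K)); first by rewrite s1 mulr1.
  transitivity ((h10 * B + h11 * D) * A - (h10 * A + h11 * K) * B - (A * D - B * K)); first by ring.
  by rewrite e11 e10; ring.
have [al [be ab]] := bezout_uv uv.
(* With [al u + be v = 1], this integer is [rho^2 (al u + be v)^2 = rho^2]. *)
pose N := al ^+ 2 * h 0 1 + 2 * al * be * (h 1 1 - 1) - be ^+ 2 * h 1 0.
have NE : N%:~R = rho ^+ 2 :> R.
  have -> : N%:~R = al%:~R ^+ 2 * h01 + 2 * al%:~R * be%:~R * (h11 - 1) - be%:~R ^+ 2 * h10 :> R.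
    by rewrite /N /h01 /h11 /h10 !(rmorphB, rmorphD, rmorphM, rmorphXn) /=.
  rewrite f01 f10 f11 -[RHS]mulr1 -[X in _ = _ * X](expr1n _ 2).
  have e : 1 = al%:~R * u%:~R + be%:~R * v%:~R :> R by rewrite -!intrM -intrD ab.
  rewrite [X in _ = _ * X ^+ 2]e.
  by rewrite /A /K; ring.
have rho0 : rho != 0.
  apply/eqP => r0; move: s1; rewrite /A /K r0 !mul0r mulr0 subr0 => /esym/eqP; by rewrite oner_eq0.
have : 0 < N%:~R :> R by rewrite NE exprn_even_gt0.
rewrite ltr0z gtz0_ge1 -(@ler_int R) NE -real_normK ?num_real //.
by rewrite expr_ge1 // => ->.
Qed.

Lemma lowz_coset sigma (u v : int) (rho : R) g (gamma : 'M[int]_2) : \det sigma = 1 ->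
  sigma 0 0 = rho * u%:~R -> sigma 1 0 = rho * v%:~R ->
  lowz (invmx sigma *m map_mx intr gamma *m g) = rho%:C%C * lam (low1 g) (lowz g) (crow u v gamma).
Proof.
move=> s1 r1 r2; rewrite lam_low invmx_det1 // /lowz !mx2E !mxE /= r1 r2.
apply/eqP; rewrite eq_complex /= !mul0r subr0 addr0 /crow /= !(rmorphD, rmorphM, rmorphN) /=.
by apply/andP; split; apply/eqP; ring.
Qed.
End Iwasawa.

(** * The critical line *)

Section CriticalLine.
Variable R : realType.
Local Notation C := (R[i]).

Lemma centire_dterm2 m : centire (fun z : C => dterm (2 * z) m).
Proof. by have := centire_cpow (m%:R : R) (-2); congr centire; apply/funext => z; rewrite /dterm mulNr. Qed.

Lemma centire_doubling : centire (@doubling R).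
Proof.
have := centireD (centireM (centire_cst 4) (centire_cpow (2 : R) (-2))) (centire_cst (-1)).
by congr centire; apply/funext => z; rewrite /doubling mulNr.
Qed.

Lemma centire_euler (ps : seq nat) : centire (fun z : C => \prod_(p <- ps) (1 - dterm (2 * z) p)).
Proof.
elim: ps => [|p ps IH]; first by have := centire_cst (1 : C); congr centire; apply/funext => z; rewrite big_nil.
have := centireM (centireD (centire_cst 1) (centireN (centire_dterm2 p))) IH.
by congr centire; apply/funext => z; rewrite big_cons.
Qed.

(** Each factor has modulus at least [1 - 1/p >= 1/2]. This loss of [2^omega(q)] joins that of
    inclusion-exclusion in the final [4^omega(q)]. *)
Lemma euler_ge (ps : seq nat) (w : C) : 1 <= complex.Re w -> all prime ps ->
  2^-1 ^+ size ps <= cmod (\prod_(p <- ps) (1 - dterm w p)).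
Proof.
move=> w1; elim: ps => [|p ps IH /= /andP[pp pr]]; first by rewrite big_nil cmod1 expr0.
rewrite big_cons cmodM exprS; apply: ler_pM; rewrite ?exprn_ge0 ?invr_ge0 //; last exact: IH.
have := cmod_dterm_le w1 (prime_gt0 pp); have := ler_cmod_dist 1 (dterm w p); rewrite cmod1.
have : p%:R^-1 <= 2^-1 :> R by rewrite lef_pV2 ?posrE ?ltr0n ?ler_nat ?prime_gt1 ?prime_gt0.
by clear; lra.
Qed.

Lemma nat_above (x : R) : exists N, forall k, (N <= k)%N -> x <= k%:R.
Proof.
exists (Num.bound `|x|) => k Nk; apply: le_trans (ler_norm x) _; apply: ltW.
by apply: lt_le_trans (archi_boundP (normr_ge0 x)) _; rewrite ler_nat.
Qed.

(** On a disc of radius [dl], half the distance to the line, [Re z - 1 >= dl]; the Euler-Maclaurin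
    term is then at most [k^(-dl) / dl] and the remaining error is of order [1 / k]. *)
Lemma zeta_loc_unif : loc_unif 1 (fun k w => \sum_(1 <= m < k) dterm w m) (@zeta R).
Proof.
move=> p p1; pose dl := (complex.Re p - 1) / 2.
have dl0 : 0 < dl by rewrite divr_gt0 // subr_gt0.
exists dl => // e e0; pose T := cmod p + dl.
have T0 : 0 <= T by rewrite addr_ge0 // ltW.
have [N1 H1] := nat_above (4 * (1 + T)).
have [N2 H2] := nat_above (36 * (1 + T) * (2 / e)).
have [N3 H3] := nat_above (expR (- ln (dl * (e / 2)) / dl)).
exists (maxn 1 (maxn N1 (maxn N2 N3))) => k z; rewrite !geq_max => /and4P[k0 k1 k2 k3] zp.
have kp : 0 < k%:R :> R by rewrite ltr0n.
have Rz : 1 + dl <= complex.Re z.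
  have := ler_Re_cmod (z - p); rewrite raddfB /= ler_norml => /andP[h _].
  have : complex.Re p = 1 + 2 * dl by rewrite /dl; field.
  by move: h zp; clear; lra.
have z1 : 1 < complex.Re z by move: Rz dl0; lra.
have cz : cmod z <= T by have := ler_cmodD (z - p) p; rewrite subrK /T; move: zp; lra.
have h := zeta_tail z1 (le_trans (ler_wpM2l (ler0n _ 4) (lerD (lexx 1) cz)) (H1 _ k1)).
have cz1 : dl <= cmod (z - 1).
  by have := ler_Re_cmod (z - 1); rewrite raddfB /= ler_norml => /andP[_]; move: Rz; lra.
have a1 : 36 * (1 + cmod z) / k%:R <= e / 2.
  rewrite ler_pdivrMr //; have := H2 _ k2; have : 36 * (1 + cmod z) <= 36 * (1 + T) by move: cz; lra.
  move=> u1 u2; apply: le_trans u1 _.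
  have -> : 36 * (1 + T) = e / 2 * (36 * (1 + T) * (2 / e)) by field; rewrite gt_eqF.
  by apply: ler_wpM2l => //; rewrite divr_ge0 // ltW.
have a2 : cmod (dterm (z - 1) k / (z - 1)) <= e / 2.
  rewrite cmodM cmodV ler_pdivrMr; last exact: lt_le_trans dl0 cz1.
  apply: (@le_trans _ _ (dl * (e / 2))); last by rewrite mulrC; apply: ler_wpM2l => //; rewrite divr_ge0 // ltW.
  have x0 : 0 < dl * (e / 2) by rewrite mulr_gt0 // divr_gt0.
  rewrite cmod_dterm -[leRHS]lnK ?posrE // ler_expR.
  have lk : - ln (dl * (e / 2)) / dl <= ln k%:R.
    by rewrite -[leLHS]expRK; rewrite ler_ln ?posrE ?expR_gt0 //; exact: H3.
  have lk0 : 0 <= ln k%:R :> R by rewrite ln_ge0 // ler1n.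
  rewrite ler_pdivrMr // in lk; rewrite raddfB /=.
  have : dl * ln k%:R <= (complex.Re z - 1) * ln k%:R by apply: ler_wpM2r => //; move: Rz; lra.
  by move: lk; clear; lra.
rewrite cmodB; set S := \sum_(1 <= m < k) _ in h *; set D := dterm _ _ / _ in h a2.
have -> : zeta z - S = (zeta z - (S + D)) + D by rewrite opprD addrA subrK.
by apply: le_trans (ler_cmodD _ _) _; rewrite [leRHS]splitr; apply: lerD => //; exact: le_trans h a1.
Qed.

Lemma Re_2M (z : C) : complex.Re (2 * z) = 2 * complex.Re z.
Proof. by rewrite -[2]/(2%:R) mulr_natl raddfMn /= mulr_natl. Qed.

Lemma zeta2_loc_unif : loc_unif 2^-1 (fun k z => \sum_(1 <= m < k) dterm (2 * z) m) (fun z => zeta (2 * z) : C).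
Proof.
move=> p p1; have p2 : 1 < complex.Re (2 * p) by rewrite Re_2M; move: p1; lra.
have [r r0 H] := zeta_loc_unif p2; exists (r / 2); first by rewrite divr_gt0.
move=> e e0; have [N HN] := H e e0; exists N => k z Nk zp; apply: HN => //.
by rewrite -mulrBr cmodM (cmod_nat R 2); move: zp; lra.
Qed.

(** The number [4 * 2^(-2 z)] has modulus [2 * 2^(-d)], at least 3/2 for [d <= 1/4]. *)
Lemma doubling_ge (z : C) d : complex.Re z = 2^-1 + d / 2 -> 0 <= d -> d <= 4^-1 -> 2^-1 <= cmod (doubling z).
Proof.
move=> Rz d0 d1; have := ler_cmod_dist (4 * cpow 2 (- (2 * z))) 1.
rewrite -/(doubling z) cmod1 cmodM (cmod_nat R 4) cmod_cpow raddfN /= Re_2M Rz.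
have -> : - (2 * (2^-1 + d / 2)) * ln 2 = - ln 2 + - (d * ln 2) :> R by field.
rewrite expRD expRN lnK ?posrE //; have := expR_ge1Dx (- (d * ln 2)).
have : ln 2 <= 1 :> R by rewrite -[leRHS]expRK ler_ln ?posrE ?expR_gt0 //; have := expR_ge1Dx (1 : R); lra.
have : 0 <= ln 2 :> R by rewrite ln_ge0 // ler1n.
set E := expR _; set l := ln 2 => l0 l1 h; have : d * l <= 4^-1 by nra.
by move: h; clear; lra.
Qed.

Definition critical_bound (n : int) (t : R) : R :=
  let A := `|n%:~R| + 2 * `|t| in loglen (2 * t) ^+ 7 * (growth A * (1 + ln (1 + A))).

(** Division of the bound for [A] by the factors multiplying [f]. The unbounded quantity [1 + inv]
    occurs both in the upper bound for [a] and in the lower bound for zeta, and cancels; one [2^w]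
    comes from inclusion-exclusion, the other from the Euler factors. *)
Lemma critical_line_arith (fz D P Q zt a inv G W K c l e m : R) (w sz : nat) :
  0 <= fz -> 0 <= zt -> 0 <= inv -> 0 <= W -> 0 < K -> 0 < c -> 0 <= l -> 2^-1 <= D -> 2^-1 ^+ w <= P -> 2 <= Q ->
  fz * (D * (P * Q) * zt) = a -> a <= 2 ^+ sz * (W * (K * (G + inv))) -> c * (1 + inv) <= l * zt ->
  1 <= G -> (sz <= w)%N -> W <= m * e -> fz <= K / c * e * (4 ^+ w * (l * G) * m).
Proof.
move=> f0 z0 i0 W0 K0 c0 l0 D2 P2 Q2 E aB cz G1 sw We.
have p0 : 0 < 2 ^+ w :> R by rewrite exprn_gt0.
have pinv : 2 ^+ w * 2^-1 ^+ w = 1 :> R by rewrite exprVn divff // gt_eqF.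
have P1 : 1 <= 2 ^+ w * P by rewrite -[leLHS]pinv; apply: ler_wpM2l => //; exact: ltW.
have DQ : 1 <= D * Q by nra.
have h1 : fz * zt <= 2 ^+ w * a.
  rewrite -E; have -> : 2 ^+ w * (fz * (D * (P * Q) * zt)) = (fz * zt) * ((2 ^+ w * P) * (D * Q)) by ring.
  by rewrite -[leLHS]mulr1; apply: ler_wpM2l; [exact: mulr_ge0|nra].
have h2 : a <= 2 ^+ w * (m * e * (K * (G * (1 + inv)))).
  apply: le_trans aB _; apply: ler_pM; rewrite ?exprn_ge0 //.
  - by rewrite !mulr_ge0 // ?(ltW K0) //; lra.
  - by apply: ler_weXn2l => //; lra.
  apply: ler_pM => //; first by rewrite mulr_ge0 // ?(ltW K0) //; lra.
  by apply: ler_wpM2l; [exact: ltW|nra].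
have h3 : fz * (c * (1 + inv)) <= l * (2 ^+ w * (2 ^+ w * (m * e * (K * (G * (1 + inv)))))).
  apply: le_trans (ler_wpM2l f0 cz) _; rewrite mulrCA; apply: ler_wpM2l => //.
  by apply: le_trans h1 _; apply: ler_wpM2l => //; exact: ltW.
have i1 : 0 < 1 + inv by lra.
rewrite -(ler_pM2r (mulr_gt0 c0 i1)); apply: le_trans h3 _.
have -> : 4 ^+ w = 2 ^+ w * 2 ^+ w :> R by rewrite -exprMn; congr (_ ^+ _); ring.
by rewrite le_eqVlt; apply/orP; left; apply/eqP; field; rewrite gt_eqF.
Qed.

(** By [continuation_unique], [f F zeta = A] holds near every point with [Re > 1/2], up to isolated
    exceptions. A bound for [f] independent of [d] is obtained at a point [1/2 + d/2 + i t] with [d]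
    small, and continuity of [f] at the critical point transfers it; the same [B] serves as bound
    and as tolerance, whence the factor 2. *)
Lemma critical_line_bound : exists2 K : R, 0 < K & forall (q : nat) (v n : int) (rho lmin t : R) (w1 w2 : C) (f : C -> C),
  squarefree q -> (2 %| n)%Z -> 1 <= rho -> cdet w1 w2 != 0 -> 0 < lmin -> lmin <= 1 ->
  (forall x, x != (0, 0) -> lmin <= cmod (lam w1 w2 x)) ->
  meromorphic f -> holomorphic_at f (2^-1 +i* t)%C ->
  (forall z, 1 < complex.Re z -> usum (fterm (cusp_primes q v) n z w1 w2)
     (\prod_(p <- primes q) (1 - dterm (2 * z) p) * zeta (2 * z) * (cpow rho (2 * z) * (2 * f z)))) ->
  cmod (f (2^-1 +i* t)%C) <= K * (4 ^+ size (primes q) * critical_bound n t * lmin^-1).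
Proof.
have [K0 K00 HK] := family_good R; have [c c0 Hc] := zeta_lower R.
have e10 := expR_gt0 (1 : R).
exists (2 * (K0 / c * expR 1)); first by rewrite mulr_gt0 // mulr_gt0 // divr_gt0.
move=> q v n rho lmin t w1 w2 f sq n2 rho1 ww l0 l1 hl mf hf Hf.
have [A_ [A [Ae Al AH Ab]]] := HK n (cusp_primes q v) w1 w2 lmin (uniq_cusp_primes v sq) (prime_cusp_primes q v) n2 ww l0 hl.
pose F (z : C) := doubling z * (\prod_(p <- primes q) (1 - dterm (2 * z) p) * (2 * cpow rho (2 * z))).
have Fe : centire F.
  apply: centireM centire_doubling _; apply: centireM (centire_euler _) _.
  exact: centireM (centire_cst 2) (centire_cpow rho 2).
have CU := continuation_unique (s0 := 2^-1) (s1 := 1) mf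
  (fun k => centireM Fe (centire_sum (index_iota 1 k) (fun m => centire_dterm2 m))) Ae (loc_unifM Fe zeta2_loc_unif) Al.
have {CU} CU : forall p, 2^-1 < complex.Re p -> punctured_eq f (fun z => F z * zeta (2 * z)) A p.
  by apply: CU => z z1; rewrite (AH _ _ z1 (Hf _ z1)) /F; ring.
(* To the right of the line the lattice costs [lmin^(-1 - d) = exp (L + d L)]; keeping [d L <= 1]
   reduces this to [e / lmin]. *)
pose L := - ln lmin; have L0 : 0 <= L by rewrite oppr_ge0 ln_le0.
pose A0 := `|n%:~R| + 2 * `|t|; have A00 : 0 <= A0 by rewrite addr_ge0 // mulr_ge0.
pose G := growth A0 * (1 + ln (1 + A0)).
have G1 : 1 <= G.
  rewrite /G -[leLHS]mulr1; apply: ler_pM => //; first exact: growth_ge1.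
  by rewrite lerDl ln_ge0 // lerDl.
have ll1 := loglen_ge1 (2 * t); have l70 : 0 < loglen (2 * t) ^+ 7 by rewrite exprn_gt0 // (lt_le_trans ltr01).
pose B := K0 / c * expR 1 * (4 ^+ size (primes q) * (loglen (2 * t) ^+ 7 * G) * lmin^-1).
have G0 : 0 < G := lt_le_trans ltr01 G1.
have B0 : 0 < B.
  rewrite /B; apply: mulr_gt0; first by apply: mulr_gt0 => //; exact: divr_gt0.
  by apply: mulr_gt0; [apply: mulr_gt0; [rewrite exprn_gt0|exact: mulr_gt0]|rewrite invr_gt0].
suff : cmod (f (2^-1 +i* t)%C) <= 2 * B by rewrite /B !mulrA.
have [rh rh0 Hh] := (near_cball _ _).1 hf.
have [dr /cder_cont/(_ B B0)[r1 r10 Hr1]] : exists d, cder f (2^-1 +i* t)%C d.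
  by apply: derivable_cder; apply: Hh; rewrite subrr cmod0.
have [d0 d00 Hd] := Hc (2 * t).
pose m := Num.min (Num.min d0 r1) (Num.min 4^-1 (1 + L)^-1).
have L1 : 0 < 1 + L by rewrite ltr_pwDl.
have m0 : 0 < m by rewrite !lt_min d00 r10 !invr_gt0 L1 ltr0n.
have [md mr m4 mL] : [/\ m <= d0, m <= r1, m <= 4^-1 & m <= (1 + L)^-1].
  by split; rewrite /m !ge_min lexx ?orbT.
(* The identity is known only off the centre of a disc, so the disc is centred at an auxiliary point
   and [z] is taken at distance [e] from it. *)
have Rp : 2^-1 < complex.Re (line (2^-1 + m / 4) t) by rewrite /= ltrDl divr_gt0.
have [r2 r20 H2] := CU _ Rp.
pose e := Num.min (r2 / 2) (m / 8).
have e0 : 0 < e by rewrite lt_min !divr_gt0.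
have er : e <= r2 / 2 by rewrite ge_min lexx.
have em : e <= m / 8 by rewrite ge_min lexx orbT.
pose d := 2 * (m / 4 + e).
have dp : 0 < d by rewrite mulr_gt0 // addr_gt0 // divr_gt0.
have dm : d < m by rewrite /d; move: em m0; clear; lra.
pose z := line (2^-1 + d / 2) t.
have zpE : z - line (2^-1 + m / 4) t = e%:C%C.
  by rewrite /z /line /d; apply/eqP; rewrite eq_complex /= subrr eqxx andbT; apply/eqP; field.
have E : f z * (F z * zeta (2 * z)) = A z.
  by apply: H2; rewrite zpE cmod_real gtr0_norm //; move: er r20; clear; lra.
have fzB : cmod (f z) <= B.
  have z2 : 2 * z = line (1 + d) (2 * t).
    by rewrite [2 * z]mulr_natl mulr2n; apply/eqP; rewrite eq_complex /=; apply/andP; split; apply/eqP; field.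
  have Rz : complex.Re z = 2^-1 + d / 2 by [].
  have z21 : 2 * z - 1 = line d (2 * t).
    by rewrite z2; apply/eqP; rewrite eq_complex /= subr0 eqxx andbT; apply/eqP; ring.
  have Az := Ab z ltac:(rewrite Rz; apply/andP; split; move: dp dm m4; clear; lra).
  have lbE : lattice_bound z n = G + (cmod (line d (2 * t)))^-1 by rewrite /lattice_bound z21 /conductor /= cmod_im.
  have FE : cmod (F z) = cmod (doubling z) * (cmod (\prod_(p <- primes q) (1 - dterm (2 * z) p)) * (cmod 2 * cmod (cpow rho (2 * z)))).
    by rewrite /F cmodM; congr (_ * _); rewrite cmodM; congr (_ * _); exact: cmodM.
  rewrite lbE -E cmodM [cmod (F z * _)]cmodM FE in Az.
  apply: (critical_line_arith _ _ _ _ K00 c0 (ltW l70) _ _ _ erefl Az _ G1 (size_cusp_primes v sq));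
    rewrite ?cmod_ge0 ?invr_ge0 ?cmod_ge0 //.
  - by rewrite /wpow expR_ge0.
  - by apply: (doubling_ge Rz); move: dp dm m4; clear; lra.
  - apply: euler_ge; first by rewrite z2 /=; move: dp; clear; lra.
    by apply/allP => p; rewrite mem_primes => /and3P[].
  - rewrite (cmod_nat R 2) -[leLHS]mulr1; apply: ler_wpM2l => //.
    rewrite cmod_cpow -expR0 ler_expR mulr_ge0 ?ln_ge0 // z2 /=; move: dp; clear; lra.
  - by rewrite z2; apply: Hd => //; exact: lt_le_trans dm md.
  rewrite /wpow Rz; have -> : - 2 * (2^-1 + d / 2) * ln lmin = L + d * L by rewrite /L; field.
  rewrite expRD; have -> : expR L = lmin^-1 by rewrite /L expRN lnK.
  apply: ler_wpM2l; first by rewrite invr_ge0 ltW.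
  rewrite ler_expR; have := ltW dm; have : m * (1 + L) <= 1 by rewrite -ler_pdivlMr // mul1r.
  by move: L0 dp; clear; nra.
have hz : z = (2^-1 +i* t)%C + (d / 2)%:C%C.
  by apply/eqP; rewrite eq_complex /= addr0 !eqxx.
have := Hr1 (d / 2)%:C%C; rewrite cmod_real gtr0_norm ?divr_gt0 // -hz cmodB => h.
have := ler_cmodD (f (2^-1 +i* t)%C - f z) (f z); rewrite subrK.
have : cmod (f (2^-1 +i* t)%C - f z) <= B by apply: h; move: dm mr dp; clear; lra.
by move: fzB; set x1 := cmod _; set x2 := cmod _; set x3 := cmod _; clear; lra.
Qed.
End CriticalLine.

(** * Powers of q, n and t; the Eisenstein series as a lattice sum *)

Section FinalBounds.
Variable R : realType.
Local Notation C := (R[i]).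

Lemma powR_ge1 (x e : R) : 1 <= x -> 0 <= e -> 1 <= x `^ e.
Proof. by move=> x1 e0; rewrite -(powRr0 x); apply: ler_powR. Qed.

Lemma prod_primes_le q : (0 < q)%N -> (\prod_(p <- primes q) p <= q)%N.
Proof.
move=> q0; rewrite [leqRHS](prod_prime_decomp q0) prime_decompE big_map.
rewrite big_seq [leqRHS]big_seq; apply: leq_prod => p; rewrite -logn_gt0 /= => l0.
have pq : p \in primes q by rewrite -logn_gt0.
by rewrite -[leqLHS]expn1; apply: leq_pexp2l => //; move: pq; rewrite mem_primes => /and3P[/prime_gt0].
Qed.

(** Primes with [p >= P] satisfy [4 <= p^e] and multiply up to at most [q^e]; fewer than or equal to
    [P] primes are smaller, and they contribute at most the constant [4^P]. *)
Lemma omega_bound (e : R) : 0 < e ->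
  exists2 K : R, 0 < K & forall q, (0 < q)%N -> 4 ^+ size (primes q) <= K * q%:R `^ e.
Proof.
move=> e0; have [P HP] := nat_above (expR (ln 4 / e)).
exists (4 ^+ P); first by rewrite exprn_gt0.
move=> q q0.
have small : (count (fun p => (p < P)%N) (primes q) <= P)%N.
  rewrite -size_filter -[leqRHS](size_iota 0); apply: uniq_leq_size; first exact: filter_uniq (primes_uniq q).
  by move=> p; rewrite mem_filter mem_iota => /andP[].
rewrite -(count_predC (fun p => (p < P)%N)) exprD; apply: ler_pM; rewrite ?exprn_ge0 //.
  by apply: ler_weXn2l => //; lra.
apply: (@le_trans _ _ ((\prod_(p <- primes q) p)%N%:R `^ e)); last first.
  by apply: ge0_ler_powR; rewrite ?nnegrE ?ler0n ?ler_nat ?prod_primes_le // ltW.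
have : all prime (primes q) by apply/allP => p; rewrite mem_primes => /and3P[].
elim: (primes q) => [_|p s IH /= /andP[pp ps]]; first by rewrite big_nil expr0 powR1.
rewrite big_cons natrM powRM ?ler0n // exprD; apply: ler_pM; rewrite ?exprn_ge0 //; last exact: IH.
have p1 : 1 <= p%:R :> R by rewrite ler1n prime_gt0.
case: ltnP => [_|Pp] /=; first by rewrite expr0 powR_ge1 // ltW.
rewrite expr1 /powR gt_eqF ?ltr0n ?prime_gt0 // -[leLHS]lnK ?posrE // ler_expR.
rewrite -ler_pdivrMl // mulrC -[leLHS]expRK ler_ln ?posrE ?expR_gt0 ?ltr0n ?prime_gt0 //.
exact: HP.
Qed.

(** The sum is at most four times the largest of 1, [a], [b], so no convexity of the power is
    involved. *)
Lemma powR_sum3 (a b e : R) : 0 <= a -> 0 <= b -> 0 <= e ->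
  (1 + a + 2 * b) `^ e <= 4 `^ e * (1 + a `^ e + b `^ e).
Proof.
move=> a0 b0 e0; have pa := powR_ge0 a e; have pb := powR_ge0 b e.
have H m : 0 <= m -> 1 + a + 2 * b <= 4 * m -> m `^ e <= 1 + a `^ e + b `^ e ->
    (1 + a + 2 * b) `^ e <= 4 `^ e * (1 + a `^ e + b `^ e).
  move=> m0 h1 h2; apply: (@le_trans _ _ ((4 * m) `^ e)).
    by apply: ge0_ler_powR => //; rewrite nnegrE ?mulr_ge0 // !addr_ge0 // mulr_ge0.
  by rewrite powRM //; apply: ler_wpM2l => //; exact: powR_ge0.
case: (lerP a b) => ab.
  case: (lerP b 1) => b1; first by apply: (H 1) => //; rewrite ?powR1; lra.
  by apply: (H b) => //; lra.
case: (lerP a 1) => a1; first by apply: (H 1) => //; rewrite ?powR1; lra.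
by apply: (H a) => //; lra.
Qed.

(** With [X = 1 + |n| + 2 |t|], everything is at most [X^(1/2)] times nine logarithms: seven from
    the lower bound for zeta, one from [growth] and one from the number of shells. Each is at most a
    constant times [X^(e / 9)]. *)
Lemma critical_bound_le (e : R) : 0 < e ->
  exists2 K : R, 0 < K & forall (n : int) (t : R),
    0 <= critical_bound n t <= K * (1 + `|n%:~R| `^ (2^-1 + e) + `|t| `^ (2^-1 + e)).
Proof.
move=> e0; pose k := e / 9; have k0 : 0 < k by rewrite divr_gt0.
have k1 : 0 < 1 + k^-1 by rewrite addr_gt0 // invr_gt0.
exists ((1 + k^-1) ^+ 9 * 4 `^ (2^-1 + e)); first by rewrite mulr_gt0 ?exprn_gt0 // powR_gt0.
move=> n t; rewrite /critical_bound.
set N := `|n%:~R|; set T := `|t|; set A := N + 2 * T.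
have N0 : 0 <= N := normr_ge0 _.
have T0 : 0 <= T := normr_ge0 _.
have A0 : 0 <= A by rewrite addr_ge0 // mulr_ge0.
pose X := 1 + A; have X1 : 1 <= X by rewrite lerDl.
have X0 : 0 < X by apply: lt_le_trans X1.
pose l := 1 + ln X; have l1 : 1 <= l by rewrite lerDl ln_ge0.
have l0 : 0 <= l by apply: le_trans l1.
have lk : l <= (1 + k^-1) * X `^ k.
  have p1 := powR_ge1 X1 (ltW k0).
  have := ln_le_id (powR_gt0 k X0); rewrite ln_powR mulrC -ler_pdivlMr // => h.
  by rewrite mulrDl mul1r [k^-1 * _]mulrC; apply: lerD.
have ll : loglen (2 * t) <= l.
  rewrite /loglen /l lerD2l ler_ln ?posrE //.
  by rewrite lerD2l normrM ger0_norm // lerDr.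
have ll0 : 0 <= loglen (2 * t) by apply: le_trans (loglen_ge1 _).
have gE : growth A <= Num.sqrt X * l.
  rewrite /growth sqrtrM -/X -/l; last exact: ltW.
  apply: ler_wpM2l; first exact: sqrtr_ge0.
  rewrite -[leRHS]ger0_norm // -sqrtr_sqr; apply: ler_wsqrtr.
  by rewrite expr2 -[leLHS]mulr1; apply: ler_wpM2l.
have g0 : 0 <= growth A by exact: sqrtr_ge0.
apply/andP; split; first by rewrite !mulr_ge0 ?exprn_ge0.
apply: (@le_trans _ _ (l ^+ 7 * (Num.sqrt X * l * l))).
  apply: ler_pM; rewrite ?mulr_ge0 ?exprn_ge0 //; first by apply: lerXn2r; rewrite ?nnegrE.
  by apply: ler_wpM2r.
have -> : l ^+ 7 * (Num.sqrt X * l * l) = Num.sqrt X * l ^+ 9 by ring.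
apply: (@le_trans _ _ ((1 + k^-1) ^+ 9 * X `^ (2^-1 + e))); last first.
  rewrite -[leRHS]mulrA; apply: ler_wpM2l; first by rewrite exprn_ge0 // ltW.
  by rewrite /X /A addrA; apply: powR_sum3 => //; rewrite addr_ge0 // ltW.
rewrite powRD; last by rewrite (gt_eqF X0) implybT.
rewrite powR12_sqrt ?(ltW X0) // [leRHS]mulrCA; apply: ler_wpM2l; first exact: sqrtr_ge0.
have -> : e = k * 9%:R by rewrite /k divfK.
rewrite powRrM powR_mulrn ?powR_ge0 // -exprMn; apply: lerXn2r; rewrite ?nnegrE //.
by apply: mulr_ge0; [exact: ltW|exact: powR_ge0].
Qed.

(** The Eisenstein term is the character of [rho] times the row [crow gamma] applied to [g].
    Extracting [rho] gives the factor [|rho|^(2 z)], [coset_usum] the factor 2, and [fiber_usum] the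
    zeta and Euler factors. *)
Lemma eisenstein_usum q a sigma (u v n : int) (rho : R) g (z fz : C) :
  squarefree q -> coprimez u v -> cuspvec u v a -> \det sigma = 1 -> 1 <= `|rho| ->
  sigma 0 0 = rho * u%:~R -> sigma 1 0 = rho * v%:~R -> (2 %| n)%Z -> \det g = 1 ->
  1 < complex.Re z -> eisenstein_series q a sigma n g z fz ->
  usum (fterm (cusp_primes q v) n z ((gcdn `|v| q)%:R * low1 g) (lowz g))
     (\prod_(p <- primes q) (1 - dterm (2 * z) p) * zeta (2 * z) * (cpow `|rho| (2 * z) * (2 * fz))).
Proof.
move=> sq uv auv s1 rho1 r1 r2 n2 g1 z1 ser.
have rho0 : rho != 0 by rewrite -normr_gt0; apply: lt_le_trans rho1.
have rc0 : rho%:C%C != 0 :> C by rewrite rc_neq0.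
pose T x := phi0 n z (rho%:C%C * lam (low1 g) (lowz g) x).
have Tn x : T (neg2 x) = T x.
  rewrite /T; have -> : lam (low1 g) (lowz g) (neg2 x) = (-1) * lam (low1 g) (lowz g) x.
    by rewrite /lam /= !rmorphN /=; ring.
  have n10 : (-1 : C) != 0 by rewrite oppr_eq0 oner_eq0.
  have -> : rho%:C%C * (-1 * lam (low1 g) (lowz g) x) = (-1) * (rho%:C%C * lam (low1 g) (lowz g) x) by ring.
  by rewrite (@phi0_scale R n z (-1)) // qcharN // qchar1 mul1r.
have fT gamma : Gamma0 q gamma -> eisenstein_term sigma n g z gamma = T (crow u v gamma).
  move=> [gd _].
  have hd : \det (invmx sigma *m map_mx intr gamma *m g) = 1.
    by rewrite !det_mulmx det_inv s1 invr1 det_map_mx gd g1 rmorph1 !mulr1.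
  rewrite eisenstein_termE // /T -(lowz_coset g gamma s1 r1 r2) phi0E //.
  apply/eqP => /eqP; rewrite eq_complex /= => /andP[/eqP e1 /eqP e2].
  by move: hd; rewrite det2 e1 e2 !mulr0 subr0 => /eqP; rewrite eq_sym oner_eq0.
have ww : cdet (low1 g) (lowz g) != 0 by rewrite cdet_low g1 oppr_eq0 oner_eq0.
have H1 := usumZ (cpow `|rho| (2 * z)) (coset_usum sq uv auv Tn fT ser).
apply: (fiber_usum sq z1 n2 ww); apply: usum_eq H1 => x; case: ifP => _; last by rewrite mulr0.
rewrite /T phi0_scale // qchar_real // mulrA -[RHS]mul1r; congr (_ * _).
by rewrite /cpow -cexpD -mulrDl subrr mul0r cexp0.
Qed.
End FinalBounds.

Theorem theorem1p3 (R : realType) (eps : R) (heps : 0 < eps < 2^-1) :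
  exists2 C : R, 0 < C &
    forall (q : nat), squarefree q ->
    forall (a : option rat) (sigma : 'M[R]_2), is_scaling_matrix q a sigma ->
    forall (n : int), (2 %| n)%Z ->
    forall (t : R) (g : 'M[R]_2), \det g = 1 ->
    forall (x y theta : R), iwasawa_coords g x y theta ->
      `|eisenstein q a sigma n g (2^-1 +i* t)%C| <=
      (C * q%:R `^ eps
               * (1 + `|n%:~R| `^ (2^-1 + eps) + `|t| `^ (2^-1 + eps))
               * Num.sqrt (y + y^-1))%:C%C.
Proof.
have /andP[e0 _] := heps.
have [K K0 HK] := critical_line_bound R; have [K1 K10 HK1] := omega_bound e0.
have [K2 K20 HK2] := critical_bound_le e0.
exists (K * K1 * K2); first by rewrite mulr_gt0 // mulr_gt0.
move=> q sq a sigma sc n n2 t g g1 x y theta H; have [y0 _ _] := H.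
have Y0 : 0 < y^-1 by rewrite invr_gt0.
have S0 := sqrtr_ge0 (y + y^-1).
set S := 1 + _ + _; have S1 : 0 <= S by rewrite !addr_ge0 ?powR_ge0.
have Q0 := powR_ge0 (q%:R : R) eps.
(* If no continuation is regular at the point, the value is the default 0 and the bound is
   trivial. *)
rewrite normc_cmod lecR /eisenstein; case: xgetP => [w _ [f [mf Hf hf <-]]|_]; last first.
  by rewrite cmod0 !mulr_ge0 // ltW.
have [u [v [rho [uv auv rho1 r1 r2]]]] := scaling_vector sc; have [s1 _ _] := sc.
have ww : cdet (low1 g) (lowz g) != 0 by rewrite cdet_low g1 oppr_eq0 oner_eq0.
have v0 := v0_gt0 v sq.
have cE : cdet ((gcdn `|v| q)%:R * low1 g) (lowz g) = (gcdn `|v| q)%:R * cdet (low1 g) (lowz g).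
  have -> : (gcdn `|v| q)%:R = ((gcdn `|v| q)%:R : R)%:C%C :> R[i] by rewrite rmorph_nat.
  by rewrite /cdet /=; ring.
have Y1 : 1 <= y + y^-1.
  have yz : y * y^-1 = 1 by rewrite divff // gt_eqF.
  by move: yz y0 Y0; set z := y^-1; clear; nra.
have SY : 1 <= Num.sqrt (y + y^-1) by rewrite -[leLHS]sqrtr1; apply: ler_wsqrtr.
have SY0 : 0 < Num.sqrt (y + y^-1) by apply: lt_le_trans SY.
have B := HK q v n `|rho| (Num.sqrt (y + y^-1))^-1 t ((gcdn `|v| q)%:R * low1 g) (lowz g) f sq n2 rho1 _ _ _ _ mf hf _.
apply: le_trans (B _ _ _ _ _) _ => {B}.
- by rewrite cE mulf_neq0 // pnatr_eq0 -lt0n.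
- by rewrite invr_gt0.
- by rewrite invf_le1.
(* Multiplying one basis vector by an integer gives a sublattice, whose nonzero vectors are no
   shorter than those of the lattice of rows of [g]. *)
- move=> k k0; have -> : lam ((gcdn `|v| q)%:R * low1 g) (lowz g) k = lam (low1 g) (lowz g) ((gcdn `|v| q)%:Z * k.1, k.2).
    by rewrite /lam /= rmorphM /= -pmulrn; ring.
  apply: (lam_low_ge H); apply: contra_neq k0 => -[/eqP]; rewrite mulf_eq0 eqz_nat (gtn_eqF v0) /= => /eqP k1 k2.
  by rewrite [k]surjective_pairing k1 k2.
- by move=> z z1; apply: (eisenstein_usum sq uv auv s1 rho1 r1 r2 n2 g1 z1); exact: Hf.
rewrite invrK; have /andP[c0 c1] := HK2 n t; have w1 := HK1 q sq.1.
have -> : K * K1 * K2 * q%:R `^ eps * S * Num.sqrt (y + y^-1) = K * ((K1 * q%:R `^ eps) * (K2 * S) * Num.sqrt (y + y^-1)) by ring.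
apply: ler_wpM2l; first exact: ltW.
by apply: ler_wpM2r => //; apply: ler_pM => //; rewrite exprn_ge0.
Qed.
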